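(* Suppose that Assumptions 1, 2 and 3 (listed in the context) hold and that there exists an optimal control $(u,\alpha,\beta)\in\mathcal{U}\times\mathcal{A}\times\mathcal{B}$ attaining the minimum in the auxiliary optimal control problem $W(t,a,b)=\inf_{u\in\mathcal{U},\alpha\in\mathcal{A},\beta\in\mathcal{B}}\bar J(t,a,b;u,\alpha,\beta)$. Then: (i) The backward reachable set satisfies $$\mathcal{R}_t^\Gamma=\{(a,b)\in\mathbb{R}^n\times\mathbb{R}~|~W(t,a,b)=0\},\quad \forall t\in[0,T];$$ (ii) The value function $V$ of the state-constrained problem is characterized by the zero-level set of $W$: for $(t,a)\in[0,T]\times\mathbb{R}^n$, $$V(t,a)=\inf\{b\ge 0~|~(a,b)\in\mathcal{R}_t^\Gamma\}=\inf\{b\ge 0~|~W(t,a,b)=0\}.$$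
   Context: Probabilistic setting. $T>0$; $(\Omega,\mathcal{F},\mathbb{P})$ is a complete probability space with the natural filtration $\mathbb{F}=\{\mathcal{F}_s\}$, augmented by all $\mathbb{P}$-null sets, generated by two mutually independent processes on $[0,T]$: an $r$-dimensional standard Brownian motion $B$, and an $E$-marked right-continuous Poisson random measure $N$ on $E\times[0,T]$, where $E=\bar E\setminus\{0\}$, $\bar E\subset\mathbb{R}^l$, is a Borel subset of $\mathbb{R}^l$ with Borel $\sigma$-field $\mathcal{B}(E)$. The intensity measure of $N$ is $\pi(de)\,dt$, where $\pi$ is a $\sigma$-finite Lévy measure with $\pi(E)<\infty$ and $\int_E(1\wedge|e|^2)\pi(de)<\infty$; $\tilde N(de,dt)=N(de,dt)-\pi(de)dt$ is the compensated measure. For $k:E\to\mathbb{R}^n$, $\|k\|_{G^2}=(\int_E|k(e)|^2\pi(de))^{1/2}$. Controls. $U\subset\mathbb{R}^m$ is compact. $\mathcal{U}=\mathcal{U}_{t,T}$: $\mathbb{F}$-predictable $U$-valued processes on $[t,T]$ with $\mathbb{E}\int_t^T|u_s|^2ds<\infty$. $\mathcal{A}=\mathcal{A}_{t,T}$: $\mathbb{F}$-predictable $\mathbb{R}^r$-valued processes with $\mathbb{E}\int_t^T|\alpha_s|^2ds<\infty$. $\mathcal{B}=\mathcal{B}_{t,T}$: $\mathcal{P}\times\mathcal{B}(E)$-measurable $\mathbb{R}$-valued processes $\beta_s(e)$ ($\mathcal{P}$ the predictable $\sigma$-algebra) with $\mathbb{E}\int_t^T\int_E|\beta_s(e)|^2\pi(de)ds<\infty$.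 Dynamics. For $(t,a,b)\in[0,T]\times\mathbb{R}^n\times\mathbb{R}$, on $s\in(t,T]$, $dx_s^{t,a;u}=f(s,x_s^{t,a;u},u_s)ds+\sigma(s,x_s^{t,a;u},u_s)dB_s+\int_E\chi(s,x_{s-}^{t,a;u},u_s,e)\tilde N(de,ds)$, $x_t^{t,a;u}=a$; $dy_{s;t,a,b}^{u,\alpha,\beta}=-l(s,x_s^{t,a;u},u_s)ds+\alpha_s^\top dB_s+\int_E\beta_s(e)\tilde N(de,ds)$, $y_{t;t,a,b}^{u,\alpha,\beta}=b$. Assumption 1. $f:[0,T]\times\mathbb{R}^n\times U\to\mathbb{R}^n$, $\sigma:[0,T]\times\mathbb{R}^n\times U\to\mathbb{R}^{n\times r}$, $\chi:[0,T]\times\mathbb{R}^n\times U\times E\to\mathbb{R}^n$ are continuous in $(t,x,u)$ and for a constant $L>0$ and all $x,x'$: $|f(t,x,u)-f(t,x',u)|+|\sigma(t,x,u)-\sigma(t,x',u)|\le L|x-x'|$, $\|\chi(t,x,u,\cdot)-\chi(t,x',u,\cdot)\|_{G^2}\le L|x-x'|$, $|f(t,x,u)|+|\sigma(t,x,u)|+\|\chi(t,x,u,\cdot)\|_{G^2}\le L(1+|x|)$. Assumption 2. (i) $l:[0,T]\times\mathbb{R}^n\times U\to\mathbb{R}$ and $m:\mathbb{R}^n\to\mathbb{R}$ are continuous, with $|l(t,x,u)-l(t,x',u)|+|m(x)-m(x')|\le L|x-x'|$ and $|l(t,x,u)|+|m(x)|\le L(1+|x|)$. (ii) $l,m\ge0$.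 Constraint set and distance function. $\Gamma\subset\mathbb{R}^n$ is nonempty and closed; $d(\cdot,\Gamma):\mathbb{R}^n\to\mathbb{R}^+$ is a function with $d(x,\Gamma)=0$ if and only if $x\in\Gamma$. Assumption 3. $d(x,\Gamma)$ is Lipschitz continuous in $x$ with constant $L$ and has linear growth in $x$. State-constrained problem. $J(t,a;u)=\mathbb{E}[\int_t^Tl(s,x_s^{t,a;u},u_s)ds+m(x_T^{t,a;u})]$ and $V(t,a)=\inf_{u\in\mathcal{U}}\{J(t,a;u)~|~x_s^{t,a;u}\in\Gamma,\ \forall s\in[t,T],\ \mathbb{P}\text{-a.s.}\}$. Backward reachable set. With $\mathcal{E}(m)=\{(x,y)\in\mathbb{R}^n\times\mathbb{R}~|~y\ge m(x)\}$, $\mathcal{R}_t^\Gamma$ is the set of $(a,b)\in\mathbb{R}^n\times\mathbb{R}$ for which there exist $(u,\alpha,\beta)\in\mathcal{U}\times\mathcal{A}\times\mathcal{B}$ such that $(x_T^{t,a;u},y_{T;t,a,b}^{u,\alpha,\beta})\in\mathcal{E}(m)$, $\mathbb{P}$-a.s., and $x_s^{t,a;u}\in\Gamma$ for all $s\in[t,T]$, $\mathbb{P}$-a.s. Auxiliary (unconstrained) problem. $\bar J(t,a,b;u,\alpha,\beta)=\mathbb{E}[\max\{m(x_T^{t,a;u})-y_{T;t,a,b}^{u,\alpha,\beta},0\}+\int_t^Td(x_s^{t,a;u},\Gamma)ds]$ and $W(t,a,b)=\inf_{u\in\mathcal{U},\alpha\in\mathcal{A},\beta\in\mathcal{B}}\bar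 J(t,a,b;u,\alpha,\beta)$.
   Formalization: At t=T the distance integral vanishes, so (i) and the second equality in (ii) fail for a outside Γ; there (i) is proved as R_T^Γ={(a,b): a∈Γ, W(T,a,b)=0}, and the second equality in (ii) is proved for t<T or a∈Γ. *)

(* Defs.v *)
From HB Require Import structures.
From mathcomp Require Import all_boot all_order all_algebra.
From mathcomp Require Import all_classical all_reals all_analysis.
From mathcomp Require Import measurable_realfun.

Set Implicit Arguments.
Unset Strict Implicit.
Unset Printing Implicit Defensive.

Import Order.TTheory GRing.Theory Num.Theory.
Import numFieldNormedType.Exports.

Local Open Scope classical_set_scope.
Local Open Scope ring_scope.

(* Column vectors 'cV[R]_p model R^p.  The topology of 'M[R]_(p, q) is the
   usual one, but the library norm on matrices is the sup norm, so the
   Euclidean (Frobenius) norm is introduced here. *)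
Definition enorm {R : realType} {p q : nat} (A : 'M[R]_(p, q)) : R :=
  Num.sqrt (\sum_i \sum_j A i j ^+ 2).

Definition borel (S : topologicalType) : set (set S) := <<s @open S >>.

(* R^q with its Borel sigma-algebra, as a measurable type: the mark space. *)
Definition mark (R : realType) (q : nat) := g_sigma_algebraType (@open 'cV[R]_q).

Section Noise.
Context {R : realType} {dO : measure_display} {Omega : measurableType dO}.
Variables (P : probability Omega R) (r q : nat).

Local Notation leb := (@lebesgue_measure R).

(* [bm] is the Brownian motion B, [marks] the set E, [levy] the measure pi
   (only its values on subsets of [marks] matter), [prm] the random measure N
   (only its values on subsets of [marks] `*` `[0, horizon] matter). *)
Record noise := Noise {
  horizon : R ;
  bm : R -> Omega -> 'cV[R]_r ;
  marks : set (mark R q) ;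
  levy : {measure set (mark R q) -> \bar R} ;
  prm : Omega -> {measure set (mark R q * R) -> \bar R} }.

Variable S : noise.
Local Notation T := (horizon S).
Local Notation E := (marks S).

Definition sigma_bm (s : R) : set (set Omega) :=
  <<s [set A | exists v Y,
        [/\ 0 <= v <= s, borel Y & A = bm S v @^-1` Y]] >>.

Definition sigma_prm (s : R) : set (set Omega) :=
  <<s [set A | exists (D : set (mark R q * R)) (Y : set (\bar R)),
        [/\ measurable D, D `<=` E `*` `[0, s], measurable Y
          & A = (fun w => prm S w D) @^-1` Y]] >>.

Definition filt (s : R) : set (set Omega) :=
  <<s sigma_bm s `|` sigma_prm s `|` [set A | P.-negligible A] >>.

(* The last clause says at once that B_s' - B_s is independent of the past of
   B, that its coordinates are independent, and that each has law
   N(0, s' - s); [normal_prob] takes the standard deviation. *)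
Definition is_brownian_motion : Prop :=
  [/\ (forall (s : R) Y, 0 <= s <= T -> borel Y -> measurable (bm S s @^-1` Y)),
      {ae P, forall w, bm S 0 w = 0},
      {ae P, forall w, {within `[0, T], continuous (fun s => bm S s w)}}
    & forall (s s' : R) (A : 'I_r -> set R) C,
        0 <= s -> s < s' -> s' <= T ->
        (forall i, measurable (A i)) -> sigma_bm s C ->
        P ([set w | forall i, A i ((bm S s' w - bm S s w) i ord0)] `&` C) =
        ((\prod_(i < r) normal_prob 0%R (Num.sqrt (s' - s)%R) (A i)) * P C)%E].

(* Not [poisson_pmf], which is constantly 1 at rate 0. *)
Definition poisson_weight (lam : R) (k : nat) : R :=
  expR (- lam) * lam ^+ k / k`!%:R.

(* Joint law of N on finitely many disjoint sets: independent Poisson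
   variables, with parameters given by the intensity levy(de) dt. *)
Definition is_poisson_random_measure : Prop :=
  (forall D : set (mark R q * R), measurable D -> D `<=` E `*` `[0, T] ->
     measurable_fun setT (fun w => prm S w D)) /\
  (forall (k : nat) (D : 'I_k -> set (mark R q * R)) (c : 'I_k -> nat),
     (forall i, measurable (D i) /\ D i `<=` E `*` `[0, T]) ->
     trivIset setT D ->
     P [set w | forall i, prm S w (D i) = (c i)%:R%:E] =
     (\prod_(i < k) poisson_weight (fine ((levy S \x leb)%E (D i))) (c i))%:E).

Definition noise_axioms : Prop :=
  [/\ measure_is_complete P /\ 0 < T,
      [/\ measurable E, ~ E (0 : 'cV[R]_q), sigma_finite E (levy S),
          (levy S E < +oo)%E
        & (\int[levy S]_(e in E) (Num.min 1 (enorm (e : 'cV[R]_q) ^+ 2))%:E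
             < +oo)%E],
      is_brownian_motion,
      is_poisson_random_measure
    & forall C D, sigma_bm T C -> sigma_prm T D -> P (C `&` D) = (P C * P D)%E].

Definition adapted (V : topologicalType) (t : R) (X : R -> Omega -> V) : Prop :=
  forall (s : R) Y, t <= s <= T -> borel Y -> filt s (X s @^-1` Y).

Definition cadlag (V : ptopologicalType) (t : R) (X : R -> Omega -> V) : Prop :=
  forall w,
    (forall s, t <= s < T -> X v w @[v --> s^'+] --> X s w) /\
    (forall s, t < s <= T -> cvg (X v w @[v --> s^'-])).

Definition left_limit (V : ptopologicalType) (X : R -> Omega -> V)
    (s : R) (w : Omega) : V := lim (X v w @[v --> s^'-]).

Definition predictable_sets : set (set (R * Omega)) :=
  <<s `[0, T] `*` setT,
      [set C | exists A, filt 0 A /\ C = [set 0] `*` A] `|`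
      [set C | exists a b A, [/\ 0 <= a, a <= b <= T, filt a A
                               & C = `]a, b] `*` A]] >>.

Definition predictable (V : topologicalType) (t : R) (X : R -> Omega -> V) : Prop :=
  forall Y, borel Y ->
    predictable_sets [set z | t <= z.1 <= T /\ Y (X z.1 z.2)].

Definition predictable_field (t : R) (X : R -> mark R q -> Omega -> R) : Prop :=
  forall Y : set R, borel Y ->
    <<s (`[0, T] `*` setT) `*` E,
        [set C : set (R * Omega * mark R q) |
           exists D A, [/\ predictable_sets D, measurable A, A `<=` E
                         & C = D `*` A]] >>
    [set z | [/\ t <= z.1.1 <= T, E z.2 & Y (X z.1.1 z.2 z.1.2)]].

(* Stochastic integrals are defined on [t, T] as usual: explicitly on simple
   predictable integrands, then as L^2 limits.  [is_bint t Phi I] reads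
   I_s = \int_t^s Phi dB, and [is_pint t Phi J] reads
   J_s = \int_t^s \int_E Phi d(compensated N), for all s in [t, T]. *)
Record bsimple (p : nat) := BSimple {
  bs_len : nat ;
  bs_lo : 'I_bs_len -> R ;
  bs_hi : 'I_bs_len -> R ;
  bs_coef : 'I_bs_len -> Omega -> 'M[R]_(p, r) }.

Definition bs_ok p (t : R) (H : bsimple p) : Prop := forall i,
  [/\ t <= bs_lo i, bs_lo i <= bs_hi i <= T,
      (forall Y, borel Y -> filt (bs_lo i) (@bs_coef _ H i @^-1` Y))
    & exists K, forall w, enorm (@bs_coef _ H i w) <= K].

Definition bs_val p (H : bsimple p) (s : R) (w : Omega) : 'M[R]_(p, r) :=
  \sum_(i < bs_len H | bs_lo i < s <= bs_hi i) @bs_coef _ H i w.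

Definition bs_int p (H : bsimple p) (s : R) (w : Omega) : 'cV[R]_p :=
  \sum_(i < bs_len H) @bs_coef _ H i w *m
     (bm S (Num.min (bs_hi i) s) w - bm S (Num.min (bs_lo i) s) w).

Definition is_bint p (t : R) (Phi : R -> Omega -> 'M[R]_(p, r))
    (I : R -> Omega -> 'cV[R]_p) : Prop :=
  adapted t I /\
  exists H : nat -> bsimple p,
  [/\ (forall k, bs_ok t (H k)),
      (\int[P]_w \int[leb]_(s in `[t, T])
         (enorm (bs_val (H k) s w - Phi s w) ^+ 2)%:E)%E @[k --> \oo] --> 0%E
    & forall s, t <= s <= T ->
      (\int[P]_w (enorm (bs_int (H k) s w - I s w) ^+ 2)%:E)%E
        @[k --> \oo] --> 0%E].

Record psimple (p : nat) := PSimple {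
  ps_len : nat ;
  ps_lo : 'I_ps_len -> R ;
  ps_hi : 'I_ps_len -> R ;
  ps_set : 'I_ps_len -> set (mark R q) ;
  ps_coef : 'I_ps_len -> Omega -> 'cV[R]_p }.

Definition ps_ok p (t : R) (H : psimple p) : Prop := forall i,
  [/\ t <= ps_lo i, ps_lo i <= ps_hi i <= T,
      measurable (@ps_set _ H i) /\ @ps_set _ H i `<=` E,
      (forall Y, borel Y -> filt (ps_lo i) (@ps_coef _ H i @^-1` Y))
    & exists K, forall w, enorm (@ps_coef _ H i w) <= K].

Definition ps_val p (H : psimple p) (s : R) (e : mark R q) (w : Omega) : 'cV[R]_p :=
  \sum_(i < ps_len H | (ps_lo i < s <= ps_hi i) && (e \in @ps_set _ H i))
     @ps_coef _ H i w.

Definition compensated (w : Omega) (A : set (mark R q)) (a b : R) : R :=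
  fine (prm S w (A `*` `]a, b])) - fine (levy S A) * (b - a).

Definition ps_int p (H : psimple p) (s : R) (w : Omega) : 'cV[R]_p :=
  \sum_(i < ps_len H)
     compensated w (@ps_set _ H i) (Num.min (ps_lo i) s) (Num.min (ps_hi i) s)
       *: @ps_coef _ H i w.

Definition is_pint p (t : R) (Phi : R -> mark R q -> Omega -> 'cV[R]_p)
    (J : R -> Omega -> 'cV[R]_p) : Prop :=
  adapted t J /\
  exists H : nat -> psimple p,
  [/\ (forall k, ps_ok t (H k)),
      (\int[P]_w \int[leb]_(s in `[t, T]) \int[levy S]_(e in E)
         (enorm (ps_val (H k) s e w - Phi s e w) ^+ 2)%:E)%E
        @[k --> \oo] --> 0%E
    & forall s, t <= s <= T ->
      (\int[P]_w (enorm (ps_int (H k) s w - J s w) ^+ 2)%:E)%E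
        @[k --> \oo] --> 0%E].

Definition G2norm (p : nat) (k : mark R q -> 'cV[R]_p) : \bar R :=
  ((\int[levy S]_(e in E) (enorm (k e) ^+ 2)%:E) `^ 2^-1)%E.

End Noise.

Section Problem.
Context {R : realType} {dO : measure_display} {Omega : measurableType dO}.
Variables (P : probability Omega R) (r q n m : nat).
Variable S : noise (Omega := Omega) (R := R) r q.

Local Notation leb := (@lebesgue_measure R).
Local Notation T := (horizon S).
Local Notation E := (marks S).

(* [drift], [diffusion], [jump], [running], [terminal], [Gam], [dist] are
   f, sigma, chi, l, m, Gamma, d(., Gamma); all Lipschitz and growth
   conditions share the constant [lip], i.e. L. *)
Record problem := Problem {
  ctrl_set : set 'cV[R]_m ;
  drift : R -> 'cV[R]_n -> 'cV[R]_m -> 'cV[R]_n ;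
  diffusion : R -> 'cV[R]_n -> 'cV[R]_m -> 'M[R]_(n, r) ;
  jump : R -> 'cV[R]_n -> 'cV[R]_m -> mark R q -> 'cV[R]_n ;
  running : R -> 'cV[R]_n -> 'cV[R]_m -> R ;
  terminal : 'cV[R]_n -> R ;
  Gam : set 'cV[R]_n ;
  dist : 'cV[R]_n -> R ;
  lip : R }.

Variable C : problem.
Local Notation U := (ctrl_set C).
Local Notation f := (drift C).
Local Notation sigma := (diffusion C).
Local Notation chi := (jump C).
Local Notation l := (running C).
Local Notation mT := (terminal C).
Local Notation L := (lip C).

Definition problem_axioms : Prop :=
  [/\ compact U, Gam C !=set0, closed (Gam C), 0 < L
    & (forall x, 0 <= dist C x) /\ (forall x, dist C x = 0 <-> Gam C x)].

Definition txu_dom : set (R * 'cV[R]_n * 'cV[R]_m) :=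
  [set z | 0 <= z.1.1 <= T /\ U z.2].

(* Measurability of e |-> chi(t, x, u, e) is what makes the G^2 norm
   meaningful. *)
Definition assumption1 : Prop :=
  [/\ [/\ {within txu_dom, continuous (fun z => f z.1.1 z.1.2 z.2)},
          {within txu_dom, continuous (fun z => sigma z.1.1 z.1.2 z.2)},
          (forall e, E e ->
             {within txu_dom, continuous (fun z => chi z.1.1 z.1.2 z.2 e)})
        & forall (t : R) x u Y, 0 <= t <= T -> U u -> borel Y ->
             measurable (E `&` [set e | Y (chi t x u e)])],
      (forall (t : R) x x' u, 0 <= t <= T -> U u ->
         enorm (f t x u - f t x' u) + enorm (sigma t x u - sigma t x' u)
           <= L * enorm (x - x')),
      (forall (t : R) x x' u, 0 <= t <= T -> U u ->
         (G2norm S (fun e => (chi t x u e - chi t x' u e)%R)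
           <= (L * enorm (x - x'))%:E)%E)
    & (forall (t : R) x u, 0 <= t <= T -> U u ->
         ((enorm (f t x u) + enorm (sigma t x u))%:E + G2norm S (chi t x u)
           <= (L * (1 + enorm x))%:E)%E)].

Definition assumption2 : Prop :=
  [/\ {within txu_dom, continuous (fun z => l z.1.1 z.1.2 z.2)} /\
        continuous mT,
      (forall (t : R) x x' u, 0 <= t <= T -> U u ->
         `|l t x u - l t x' u| + `|mT x - mT x'| <= L * enorm (x - x')),
      (forall (t : R) x u, 0 <= t <= T -> U u ->
         `|l t x u| + `|mT x| <= L * (1 + enorm x)),
      (forall (t : R) x u, 0 <= t <= T -> U u -> 0 <= l t x u)
    & (forall x, 0 <= mT x)].

Definition assumption3 : Prop :=
  (forall x x', `|dist C x - dist C x'| <= L * enorm (x - x')) /\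
  (exists K, forall x, `|dist C x| <= K * (1 + enorm x)).

Definition ctrlU (t : R) (u : R -> Omega -> 'cV[R]_m) : Prop :=
  [/\ predictable P S t u,
      (forall s w, t <= s <= T -> U (u s w))
    & (\int[P]_w \int[leb]_(s in `[t, T]) (enorm (u s w) ^+ 2)%:E < +oo)%E].

Definition ctrlA (t : R) (alpha : R -> Omega -> 'cV[R]_r) : Prop :=
  predictable P S t alpha /\
  (\int[P]_w \int[leb]_(s in `[t, T]) (enorm (alpha s w) ^+ 2)%:E < +oo)%E.

Definition ctrlB (t : R) (beta : R -> mark R q -> Omega -> R) : Prop :=
  predictable_field P S t beta /\
  (\int[P]_w \int[leb]_(s in `[t, T]) \int[levy S]_(e in E)
     (`|beta s e w| ^+ 2)%:E < +oo)%E.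

(* [is_state t a u x] reads x = x^{t,a;u}, and [is_target t b u al be x y]
   reads y = y_{.;t,a,b}^{u,al,be} when x = x^{t,a;u}.  Both are unique up to
   indistinguishability, so that "the" solution is rendered relationally. *)
Definition is_state (t : R) (a : 'cV[R]_n) (u : R -> Omega -> 'cV[R]_m)
    (x : R -> Omega -> 'cV[R]_n) : Prop :=
  [/\ adapted P S t x, cadlag S t x
    & exists I J,
      [/\ is_bint P S t (fun s w => sigma s (x s w) (u s w)) I,
          is_pint P S t (fun s e w => chi s (left_limit x s w) (u s w) e) J
        & forall s, t <= s <= T -> {ae P, forall w,
            x s w = a + (\col_i (\int[leb]_(v in `[t, s])
                                   f v (x v w) (u v w) i ord0)%R)
                      + I s w + J s w}]].

Definition is_target (t b : R) (u : R -> Omega -> 'cV[R]_m)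
    (alpha : R -> Omega -> 'cV[R]_r) (beta : R -> mark R q -> Omega -> R)
    (x : R -> Omega -> 'cV[R]_n) (y : R -> Omega -> R) : Prop :=
  [/\ adapted P S t y, cadlag S t y
    & exists I J : R -> Omega -> 'cV[R]_1,
      [/\ is_bint P S t (fun s w => (alpha s w)^T) I,
          is_pint P S t (fun s e w => (beta s e w)%:M) J
        & forall s, t <= s <= T -> {ae P, forall w,
            y s w = b - (\int[leb]_(v in `[t, s]) l v (x v w) (u v w))%R
                      + I s w ord0 ord0 + J s w ord0 ord0}]].

Definition in_constraint (t : R) (x : R -> Omega -> 'cV[R]_n) : Prop :=
  {ae P, forall w, forall s, t <= s <= T -> Gam C (x s w)}.

Definition cost (t : R) (u : R -> Omega -> 'cV[R]_m)
    (x : R -> Omega -> 'cV[R]_n) : \bar R :=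
  (\int[P]_w (\int[leb]_(s in `[t, T]) (l s (x s w) (u s w))%:E
              + (mT (x T w))%:E))%E.

Definition value (t : R) (a : 'cV[R]_n) : \bar R :=
  ereal_inf [set c | exists u x,
    [/\ ctrlU t u, is_state t a u x, in_constraint t x & c = cost t u x]].

Definition epigraph (g : 'cV[R]_n -> R) : set ('cV[R]_n * R) :=
  [set z | g z.1 <= z.2].

Definition reachable (t : R) : set ('cV[R]_n * R) :=
  [set ab | exists u alpha beta x y,
    [/\ [/\ ctrlU t u, ctrlA t alpha & ctrlB t beta],
        is_state t ab.1 u x,
        is_target t ab.2 u alpha beta x y,
        {ae P, forall w, epigraph mT (x T w, y T w)}
      & in_constraint t x]].

Definition aux_cost (t : R) (x : R -> Omega -> 'cV[R]_n)
    (y : R -> Omega -> R) : \bar R :=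
  (\int[P]_w ((Num.max (mT (x T w) - y T w) 0)%:E
              + \int[leb]_(s in `[t, T]) (dist C (x s w))%:E))%E.

Definition aux_admissible (t : R) (a : 'cV[R]_n) (b : R)
    (x : R -> Omega -> 'cV[R]_n) (y : R -> Omega -> R) : Prop :=
  exists u alpha beta,
    [/\ [/\ ctrlU t u, ctrlA t alpha & ctrlB t beta],
        is_state t a u x & is_target t b u alpha beta x y].

Definition aux_value (t : R) (a : 'cV[R]_n) (b : R) : \bar R :=
  ereal_inf [set c | exists x y, aux_admissible t a b x y /\ c = aux_cost t x y].

Definition aux_attained (t : R) (a : 'cV[R]_n) (b : R) : Prop :=
  exists x y, aux_admissible t a b x y /\ aux_cost t x y = aux_value t a b.

End Problem.

(* Main.v *)
Require Import Defs.
From HB Require Import structures.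
From mathcomp Require Import all_boot all_order all_algebra.
From mathcomp Require Import all_classical all_reals all_analysis.
From mathcomp Require Import measurable_realfun ring lra.

(* The auxiliary cost of a control vanishes iff the target inequality and the
   vanishing of the distance integral hold almost surely, and the latter keeps
   the right-continuous state in Gamma; so optimal controls of cost 0 are exactly
   the reaching ones. Since y is b minus the running cost plus a martingale, the
   mean of m(x_T) <= y_T gives V(t, a) <= b for every reachable (a, b).
   Conversely let u be admissible with cost < b. As F_t is not trivial, the
   pathwise cost of u need not be a constant plus a stochastic integral; so u is
   written as a function of the past and the future of t, which are independent,
   and the past is frozen at a value for which the mean cost stays <= b. The cost
   is then a functional of the future, and such bounded functionals are L2-limits
   of constants plus simple stochastic integrals (by Taylor expansion along fine
   grids of products of bounded functions of the increments). Hence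
   W(t, a, b) = 0, and attainment turns this into reachability. *)

Set Implicit Arguments.
Unset Strict Implicit.
Unset Printing Implicit Defensive.

Import Order.TTheory GRing.Theory Num.Theory.
Import numFieldNormedType.Exports.

Local Open Scope classical_set_scope.
Local Open Scope ring_scope.

Local Notation mfun := measurable_fun.
Local Notation mfunT := (measurable_fun setT).
Local Notation sigT_of := g_sigma_algebraType.
Local Notation mfunM := measurable_funM.
Local Notation mfunB := measurable_funB.
Local Notation mfunD := measurable_funD.
Local Notation mfunX := measurable_funX.
Local Notation mfunTS := measurable_funTS.
Local Notation mfun_comp := measurableT_comp.

(** Stochastic integrals are available only as L2-limits of simple ones and do not make sense path
    by path, so freezing the past inside them is the main obstacle. No second probability space is
    built: past and future are two sigma-algebras on [Omega], both containing the null sets; the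
    identity into each gives two independent maps, and the original objects sit on the diagonal.
    Times are reduced to a countable grid, on which being the trace of a cadlag path is a measurable
    condition. The representation property is only approximate, which suffices because [aux_value]
    is an infimum, assumed attained; the independence of past and future is itself drawn from it. At
    the horizon the distance integral runs over one point and vanishes, so that a zero of
    [aux_value] says nothing about the constraint there; hence the separate treatment of the time
    [T]. *)

Lemma ereal_cvg0P (R : realType) (u : nat -> \bar R) : (forall k, 0 <= u k)%E ->
  u @ \oo --> 0%E <->
  (forall e : R, 0 < e -> exists N, forall k, (N <= k)%N -> (u k < e%:E)%E).
Proof.
move=> u0; split.
- move=> cu e e0. have [fu /cvgrPdist_lt/(_ e e0) cfu] := (fine_cvgP _ _).1 cu. have [N _ HN] := filterI fu cfu.
  exists N => k /HN /= [fk]; rewrite sub0r normrN ger0_norm ?fine_ge0//. by rewrite -lte_fin fineK.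
- move=> H. apply/fine_cvgP; split. have [N HN] := H 1 ltr01. exists N => // k /HN uk; rewrite ge0_fin_numE//.
    by rewrite (lt_trans uk)// ltry. apply/cvgrPdist_lt => e e0. have [N HN] := H e e0. exists N => // k /HN uk /=.
  have fk : u k \is a fin_num by rewrite ge0_fin_numE// (lt_trans uk)// ltry.
  rewrite sub0r normrN ger0_norm ?fine_ge0//. by rewrite -lte_fin fineK.
Qed.

Lemma sqr_abs (R : realDomainType) (x : R) : `|x| ^+ 2 = x ^+ 2.
Proof. by rewrite real_normK// num_real. Qed.

Lemma sqrD_le (R : realFieldType) (x y : R) :
  (x + y) ^+ 2 <= 2 * x ^+ 2 + 2 * y ^+ 2.
Proof. by have := sqr_ge0 (x - y); rewrite -subr_ge0; move=> h; rewrite -subr_ge0; lra. Qed.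

(** * Square-integrable random variables and inequalities for the squared norm *)

Section L2.
Context {R : realType} {d} {T : measurableType d}.
Variable P : probability T R.
Implicit Types f g c : T -> R.

Definition L2 f := mfunT f /\ (\int[P]_w ((f w) ^+ 2)%:E < +oo)%E.
Definition Ex f : R := \int[P]_w f w.
Definition L1 f := P.-integrable setT (EFin \o f).
(** The squared L2-norm. Estimates stay in this form to avoid square roots, and the triangle
    inequality then costs the factor 2 seen in [nrmD_le] and [nrm_tri]. *)
Definition nrm f : R := Ex (fun w => f w ^+ 2).

Lemma L1_meas f : L1 f -> mfunT f.
Proof. by move=> /measurable_int /measurable_EFinP. Qed.

Lemma ge0_L1P f : mfunT f -> (forall w, 0 <= f w) ->
  (\int[P]_w (f w)%:E < +oo)%E -> L1 f.
Proof.
move=> mf f0 h; apply/integrableP; split; first exact/measurable_EFinP.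
by under eq_integral do rewrite gee0_abs ?lee_fin//.
Qed.

Lemma ge0_ExE f : L1 f -> (Ex f)%:E = (\int[P]_w (f w)%:E)%E.
Proof. by move=> h; rewrite /Ex /Rintegral fineK//; exact: integrable_fin_num. Qed.

Lemma L1_le f g : mfunT f -> L1 g ->
  (forall w, `|f w| <= g w) -> L1 f.
Proof.
move=> mf ig h; apply: (le_integrable measurableT _ _ ig). exact/measurable_EFinP.
move=> w _; rewrite lee_fin (le_trans (h w))//.
exact: ler_norm.
Qed.

Lemma L1_cst (k : R) : L1 (cst k).
Proof. exact: finite_measure_integrable_cst. Qed.

Lemma L1D f g : L1 f -> L1 g -> L1 (fun w => f w + g w).
Proof. by move=> hf hg; have := integrableD measurableT hf hg. Qed.

Lemma L1B f g : L1 f -> L1 g -> L1 (fun w => f w - g w).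
Proof. by move=> hf hg; have := integrableB measurableT hf hg. Qed.

Lemma L1Z k f : L1 f -> L1 (fun w => k * f w).
Proof. by move=> hf; have := integrableZl measurableT k hf. Qed.

Lemma ExD f g : L1 f -> L1 g -> Ex (fun w => f w + g w) = Ex f + Ex g.
Proof. by move=> hf hg; rewrite /Ex RintegralD. Qed.

Lemma ExB f g : L1 f -> L1 g -> Ex (fun w => f w - g w) = Ex f - Ex g.
Proof. by move=> hf hg; rewrite /Ex RintegralB. Qed.

Lemma ExZ k f : L1 f -> Ex (fun w => k * f w) = k * Ex f.
Proof. by move=> hf; rewrite /Ex RintegralZl. Qed.

Lemma Ex_cst (k : R) : Ex (cst k) = k.
Proof.
rewrite /Ex Rintegral_cst//= probability_setT/=; exact: mulr1.
Qed.

Lemma Ex_ge0 f : (forall w, 0 <= f w) -> 0 <= Ex f.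
Proof. by move=> h; exact: Rintegral_ge0. Qed.

Lemma Ex_le f g : L1 f -> L1 g -> (forall w, f w <= g w) -> Ex f <= Ex g.
Proof. by move=> hf hg h; apply: le_Rintegral. Qed.

Lemma Ex_eq f g : f =1 g -> Ex f = Ex g.
Proof. by move=> h; apply: eq_Rintegral => w _. Qed.

Lemma Ex_ae f g : mfunT f -> mfunT g ->
  {ae P, forall w, f w = g w} -> Ex f = Ex g.
Proof.
move=> mf mg h; congr fine; apply: ae_eq_integral => //.
- exact/measurable_EFinP.
- exact/measurable_EFinP.
- by apply: filterS h => w -> _.
Qed.

Lemma Ex_sum (I : Type) (s : seq I) (F : I -> T -> R) :
  (forall i, L1 (F i)) ->
  L1 (fun w => \sum_(i <- s) F i w) /\
  Ex (fun w => \sum_(i <- s) F i w) = \sum_(i <- s) Ex (F i).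
Proof.
move=> h; elim: s => [|i s [IH1 IH2]].
  by under eq_fun do rewrite big_nil; rewrite big_nil; split; [exact: L1_cst|exact: Ex_cst].
under eq_fun do rewrite big_cons; rewrite big_cons -IH2 -ExD//; split => //; exact: L1D.
Qed.

Lemma L2_meas f : L2 f -> mfunT f. Proof. by case. Qed.

Lemma L2_sqr f : L2 f -> L1 (fun w => f w ^+ 2).
Proof.
case=> mf h; apply: ge0_L1P => //; first exact: mfunX.
by move=> w; exact: sqr_ge0.
Qed.

Lemma L2P f : mfunT f -> L1 (fun w => f w ^+ 2) -> L2 f.
Proof.
move=> mf /integrableP[_ h]; split => //.
by under eq_integral do rewrite -[X in X%:E]ger0_norm ?sqr_ge0//.
Qed.

Lemma L2_mul f g : L2 f -> L2 g -> L1 (fun w => f w * g w).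
Proof.
move=> hf hg.
apply: (@L1_le _ (fun w => f w ^+ 2 + g w ^+ 2)).
- by apply: mfunM; [case: hf|case: hg].
- by apply: L1D; exact: L2_sqr.
by move=> w; rewrite ler_norml; apply/andP; split; nra.
Qed.

Lemma L2_cst (k : R) : L2 (cst k).
Proof. by apply: L2P => //; exact: (L1_cst (k ^+ 2)). Qed.

Lemma L2D f g : L2 f -> L2 g -> L2 (fun w => f w + g w).
Proof.
move=> hf hg; apply: L2P. by apply: mfunD; [case: hf|case: hg].
apply: (@L1_le _ (fun w => 2 * f w ^+ 2 + 2 * g w ^+ 2)).
- by apply: mfunX; apply: mfunD; [case: hf|case: hg].
- by apply: L1D; apply: L1Z; exact: L2_sqr.
by move=> w; rewrite ger0_norm ?sqr_ge0// sqrD_le.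
Qed.

Lemma L2Z k f : L2 f -> L2 (fun w => k * f w).
Proof.
move=> hf; apply: L2P; first by apply: mfunM; case: hf.
under [X in L1 X]funext do rewrite exprMn.
by apply: L1Z; exact: L2_sqr.
Qed.

Lemma L2N f : L2 f -> L2 (fun w => - f w).
Proof.
by move=> hf; under [X in L2 X]funext do rewrite -mulN1r; exact: L2Z.
Qed.

Lemma L2B f g : L2 f -> L2 g -> L2 (fun w => f w - g w).
Proof. by move=> hf hg; apply: L2D => //; exact: L2N. Qed.

Lemma L2_sum (I : Type) (s : seq I) (F : I -> T -> R) :
  (forall i, L2 (F i)) -> L2 (fun w => \sum_(i <- s) F i w).
Proof.
move=> h; elim: s => [|i s IH]. under [X in L2 X]funext do rewrite big_nil. exact: L2_cst.
under [X in L2 X]funext do rewrite big_cons.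
exact: L2D.
Qed.

Lemma L2_L1 f : L2 f -> L1 f.
Proof.
move=> hf; have := L2_mul hf (L2_cst 1).
by under [X in L1 X]funext do rewrite /cst mulr1.
Qed.

Lemma L2M_bounded c f k : mfunT c -> (forall w, `|c w| <= k) ->
  L2 f -> L2 (fun w => c w * f w).
Proof.
move=> mc ck hf; apply: L2P; first by apply: mfunM; case: hf.
apply: (@L1_le _ (fun w => k ^+ 2 * f w ^+ 2)).
- by apply: mfunX; apply: mfunM; case: hf.
- by apply: L1Z; exact: L2_sqr.
move=> w; rewrite exprMn ger0_norm; last by rewrite mulr_ge0 ?sqr_ge0.
rewrite ler_wpM2r ?sqr_ge0//.
by rewrite -[X in X <= _]sqr_abs lerXn2r ?nnegrE// (le_trans _ (ck w)).
Qed.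

Lemma L2_bounded c k : mfunT c -> (forall w, `|c w| <= k) -> L2 c.
Proof.
move=> mc ck; have := L2M_bounded mc ck (L2_cst 1).
by under [X in L2 X]funext do rewrite /cst mulr1.
Qed.

Lemma L1M_bounded c f k : mfunT c -> (forall w, `|c w| <= k) ->
  L1 f -> L1 (fun w => c w * f w).
Proof.
move=> mc ck hf; have k0 : 0 <= k by rewrite (le_trans _ (ck point)).
apply: (@L1_le _ (fun w => k * `|f w|)).
- by apply: mfunM => //; exact: L1_meas.
- by apply: L1Z; exact: (integrable_abse hf).
by move=> w; rewrite normrM ler_wpM2r.
Qed.

Lemma nrm_ge0 f : 0 <= nrm f.
Proof. by apply: Ex_ge0 => w; exact: sqr_ge0. Qed.

Lemma nrmE f : L2 f -> (nrm f)%:E = (\int[P]_w ((f w) ^+ 2)%:E)%E.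
Proof. by move=> hf; rewrite /nrm ge0_ExE//; exact: L2_sqr. Qed.

Lemma nrmD_le f g : L2 f -> L2 g ->
  nrm (fun w => f w + g w) <= 2 * nrm f + 2 * nrm g.
Proof.
move=> hf hg; rewrite /nrm -!ExZ; try exact: L2_sqr.
rewrite -ExD; try (apply: L1Z; exact: L2_sqr).
apply: Ex_le.
- by apply: L2_sqr; exact: L2D.
- by apply: L1D; apply: L1Z; exact: L2_sqr.
by move=> w; exact: sqrD_le.
Qed.

Lemma nrmZ k f : L2 f -> nrm (fun w => k * f w) = k ^+ 2 * nrm f.
Proof.
move=> hf; rewrite /nrm -ExZ; last exact: L2_sqr.
by apply: Ex_eq => w; rewrite exprMn.
Qed.

Lemma nrmN f : nrm (fun w => - f w) = nrm f.
Proof. by apply: Ex_eq => w; rewrite sqrrN. Qed.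

Lemma nrmB_le f g : L2 f -> L2 g ->
  nrm (fun w => f w - g w) <= 2 * nrm f + 2 * nrm g.
Proof.
move=> hf hg; rewrite -[X in _ <= _ + 2 * X]nrmN.
by apply: nrmD_le => //; exact: L2N.
Qed.

Lemma nrmBC f g : nrm (fun w => f w - g w) = nrm (fun w => g w - f w).
Proof. by rewrite -nrmN; apply: Ex_eq => w; rewrite opprB. Qed.

Lemma nrm_tri f g h : L2 f -> L2 g -> L2 h ->
  nrm (fun w => f w - h w) <=
  2 * nrm (fun w => f w - g w) + 2 * nrm (fun w => g w - h w).
Proof.
move=> hf hg hh.
rewrite (_ : (fun w => f w - h w) = (fun w => (f w - g w) + (g w - h w))); last by apply/funext => w; ring.
by apply: nrmD_le; exact: L2B.
Qed.

Lemma nrm_le f g : mfunT f -> L2 g ->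
  (forall w, `|f w| <= `|g w|) -> nrm f <= nrm g.
Proof.
move=> mf hg h; have h2 w : f w ^+ 2 <= g w ^+ 2. by rewrite -(sqr_abs (f w)) -(sqr_abs (g w)) lerXn2r.
have hf : L2 f. apply: L2P => //; apply: (@L1_le _ (fun w => g w ^+ 2)).
  - exact: mfunX.
  - exact: L2_sqr. by move=> w; rewrite ger0_norm ?sqr_ge0.
by apply: Ex_le => //; exact: L2_sqr.
Qed.

Lemma nrm_ae f g : mfunT f -> mfunT g ->
  {ae P, forall w, f w = g w} -> nrm f = nrm g.
Proof.
move=> mf mg h; apply: Ex_ae; try exact: mfunX.
by apply: filterS h => w ->.
Qed.

Lemma L2_ae f g : mfunT f -> L2 g ->
  {ae P, forall w, f w = g w} -> L2 f.
Proof.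
move=> mf [mg hg] h; split => //.
rewrite (_ : (\int[P]_w ((f w) ^+ 2)%:E = \int[P]_w ((g w) ^+ 2)%:E)%E)//.
apply: ae_eq_integral => //.
- by apply/measurable_EFinP; exact: mfunX.
- by apply/measurable_EFinP; exact: mfunX.
by apply: filterS h => w -> _.
Qed.

(** Young's inequality, from the square of [x - k * e^-1 * y] with a sign [k]. With the weight [e]
    free it plays the role of Cauchy-Schwarz. *)
Lemma Ex_mul_le (e : R) f g : 0 < e -> L2 f -> L2 g ->
  `|Ex (fun w => f w * g w)| <= e * nrm f + e^-1 * nrm g.
Proof.
move=> e0 hf hg.
have h k : k = 1 \/ k = -1 -> k * Ex (fun w => f w * g w) <= e * nrm f + e^-1 * nrm g.
  move=> hk; rewrite /nrm -!ExZ; try exact: L2_sqr; last exact: L2_mul. rewrite -ExD; try (apply: L1Z; exact: L2_sqr).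
  apply: Ex_le.
  - by apply: L1Z; exact: L2_mul.
  - by apply: L1D; apply: L1Z; exact: L2_sqr. move=> w; set x := f w; set y := g w.
  have [ei ei0] : exists ei : R, e^-1 = ei /\ e * ei = 1. by exists e^-1; split => //; rewrite divff// gt_eqF.
  have -> : e^-1 = ei by case: ei0. case: ei0 => _ ei0 || idtac.

  have : 0 <= e * (x - k * ei * y) ^+ 2 by rewrite mulr_ge0 ?sqr_ge0// ltW. have -> : e * (x - k * ei * y) ^+ 2 =
     e * x ^+ 2 - 2 * k * (e * ei) * (x * y) + k ^+ 2 * (e * ei) * ei * y ^+ 2 by ring. rewrite ei0 !mulr1.
  have := sqr_ge0 x; have := sqr_ge0 y. by case: hk => -> ; rewrite ?expr1n; nra.
rewrite ler_norml -lerNl; apply/andP; split. by have := h (-1) (or_intror erefl); rewrite mulN1r.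
by have := h 1 (or_introl erefl); rewrite mul1r.
Qed.

(** Young's inequality against the constant 1. Once [nrm f] is at most [e ^+ 2], the mean of the
    absolute value is at most [2 * e]. *)
Lemma Ex_abs_le (e : R) f : 0 < e -> L2 f -> Ex (fun w => `|f w|) <= e + e^-1 * nrm f.
Proof.
move=> e0 hf.
have := @Ex_mul_le e (cst 1) (fun w => `|f w|) e0 (L2_cst 1).
have ha : L2 (fun w => `|f w|). apply: L2P; first by apply: mfun_comp; case: hf.
  under [X in L1 X]funext do rewrite sqr_abs. exact: L2_sqr.
move=> /(_ ha); rewrite (_ : Ex (fun w => cst 1 w * `|f w|) = Ex (fun w => `|f w|)); last first.
  by apply: Ex_eq => w; rewrite /cst mul1r.
rewrite (_ : nrm (fun w => `|f w|) = nrm f); last first. by apply: Ex_eq => w; rewrite sqr_abs.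
rewrite (_ : nrm (cst 1) = 1) ?mulr1; last first. by rewrite -[RHS](Ex_cst 1); apply: Ex_eq => w; rewrite /cst expr1n.
by rewrite ger0_norm//; apply: Ex_ge0.
Qed.

Lemma nrm_eq0 f : L2 f -> nrm f = 0 -> {ae P, forall w, f w = 0}.
Proof.
move=> hf h0.
have : (\int[P]_w `| ((f w) ^+ 2)%:E | = 0)%E. under eq_integral do rewrite gee0_abs ?lee_fin ?sqr_ge0//.
  by rewrite -nrmE// h0.
move=> H0.
have /(ae_eq_integral_abs P measurableT)[/(_ H0)] : mfunT (EFin \o (fun w => f w ^+ 2)).
  by apply/measurable_EFinP; apply: mfunX; case: hf.
by move=> + _; apply: filterS => w /(_ I) [/eqP]; rewrite sqrf_eq0 => /eqP.
Qed.

Lemma nrm_le_eps_eq0 (x : R) : 0 <= x -> (forall e, 0 < e -> x <= e) -> x = 0.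
Proof.
move=> x0 h; apply/eqP; rewrite eq_le x0 andbT.
by apply/ler_addgt0Pr => e e0; rewrite add0r h.
Qed.

End L2.

(** * Independent maps: Tonelli, null sets and product formulas *)

Section Indep.
Context {R : realType} {d d1 d2} {T : measurableType d}
  {T1 : measurableType d1} {T2 : measurableType d2}.
Variable P : probability T R.
Variables (X : T -> T1) (Y : T -> T2).

Definition indep_maps := forall A B, measurable A -> measurable B ->
  P (X @^-1` A `&` Y @^-1` B) = (P (X @^-1` A) * P (Y @^-1` B))%E.

Hypotheses (mX : mfunT X) (mY : mfunT Y).
Let mX_mixin := isMeasurableFun.Build _ _ _ _ _ mX.
Let mX_pack : {mfun _ >-> _} := HB.pack X mX_mixin.
Let mY_mixin := isMeasurableFun.Build _ _ _ _ _ mY.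
Let mY_pack : {mfun _ >-> _} := HB.pack Y mY_mixin.
Let XY := fun w => (X w, Y w).
Let mXY : mfunT XY.
Proof. exact: measurable_fun_pair. Qed.
Let mXY_mixin := isMeasurableFun.Build _ _ _ _ _ mXY.
Let mXY_pack : {mfun _ >-> _} := HB.pack XY mXY_mixin.

Let m1 : probability T1 R := distribution P mX_pack.
Let m2 : probability T2 R := distribution P mY_pack.
Let m12 : probability (T1 * T2)%type R := distribution P mXY_pack.

Lemma measurable_Ex_snd (phi : T1 * T2 -> \bar R) : mfunT phi ->
  (forall z, 0 <= phi z)%E ->
  mfunT (fun x => \int[P]_w phi (x, Y w))%E.
Proof.
move=> mphi phi0.
have -> : (fun x => \int[P]_w phi (x, Y w))%E = fubini_F m2 phi. apply/funext => x; rewrite /fubini_F.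
  rewrite ge0_integral_pushforward//. exact: mfun_comp => //; exact: pair1_measurable.
exact: measurable_fun_fubini_tonelli_F.
Qed.

Hypothesis ind : indep_maps.

Lemma m12E : forall Z, measurable Z -> (m1 \x m2)%E Z = m12 Z.
Proof.
apply: product_measure_unique => A B mA mB.
by rewrite -ind.
Qed.

(** Independence makes the joint law of [X] and [Y] agree with the product of the marginals on
    rectangles, hence everywhere, so the second argument may be resampled independently. [X] and [Y]
    live on one space: later both are the identity, into two different sigma-algebras. *)
Lemma indep_tonelli (phi : T1 * T2 -> \bar R) : mfunT phi ->
  (forall z, 0 <= phi z)%E ->
  (\int[P]_w phi (X w, Y w) = \int[P]_w \int[P]_v phi (X w, Y v))%E.
Proof.
move=> mphi phi0.
transitivity (\int[m12]_z phi z)%E. by rewrite ge0_integral_pushforward.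
transitivity (\int[(m1 \x m2)%E]_z phi z)%E. by apply: eq_measure_integral => A mA _; exact/esym/m12E.
rewrite fubini_tonelli1// ge0_integral_pushforward//; first last.
- by move=> y _; apply: integral_ge0.
- exact: measurable_fun_fubini_tonelli_F.
apply: eq_integral => w _ /=.
rewrite /fubini_F ge0_integral_pushforward//.
exact: mfun_comp => //; exact: pair1_measurable.
Qed.

(** Tonelli for the indicator of the complement of [Q]: a set that is null for the product law has
    null sections at almost every first argument. In this way almost sure properties on the diagonal
    pass to processes with a frozen past. *)
Lemma indep_ae (Q : set (T1 * T2)) : measurable Q ->
  {ae P, forall w, Q (X w, Y w)} ->
  {ae P, forall w, {ae P, forall v, Q (X w, Y v)}}.
Proof.
move=> mQ aeQ.
pose phi z := (\1_(~` Q) z : R)%:E.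
have mphi : mfunT phi. by apply/measurable_EFinP; apply: measurable_indic; exact: measurableC.
have phi0 z : (0 <= phi z)%E by rewrite lee_fin.
have := indep_tonelli mphi phi0.
rewrite [X in X = _](_ : _ = 0)%E; last first. rewrite -(integral0 P setT); apply: ae_eq_integral => //.
  - exact: mfun_comp. apply: filterS aeQ => w Qw _; rewrite /phi indicE. by rewrite memNset//= => /(_ Qw).
move=> /esym H.
have {}H : (\int[P]_w `|\int[P]_v phi (X w, Y v)| = 0)%E. rewrite -[RHS]H; apply: eq_integral => w _.
  by rewrite gee0_abs// integral_ge0.
have mF : mfunT (fun w => \int[P]_v phi (X w, Y v))%E. exact: (mfun_comp (measurable_Ex_snd mphi phi0)).
have := (ae_eq_integral_abs P measurableT mF).1 H.
apply: filterS => w /(_ Logic.I) /= Hw.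
have {}Hw : (\int[P]_v `|phi (X w, Y v)| = 0)%E. rewrite -[RHS]Hw; apply: eq_integral => v _. by rewrite gee0_abs.
have mG : mfunT (fun v => phi (X w, Y v)). by apply: mfun_comp => //; apply: mfun_comp.
have := (ae_eq_integral_abs P measurableT mG).1 Hw.
apply: filterS => v /(_ Logic.I) [].
rewrite indicE; case: (pselect (Q (X w, Y v))) => // nQ.
by rewrite mem_set//= => /eqP; rewrite oner_eq0.
Qed.

Lemma indep_mul_ge0 (f : T1 -> R) (g : T2 -> R) :
  mfunT f -> mfunT g ->
  (forall x, 0 <= f x) -> (forall x, 0 <= g x) ->
  L1 P (f \o X) -> L1 P (g \o Y) ->
  L1 P (fun w => f (X w) * g (Y w)) /\
  Ex P (fun w => f (X w) * g (Y w)) = Ex P (f \o X) * Ex P (g \o Y).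
Proof.
move=> mf mg f0 g0 hf hg.
have m : mfunT (fun z : T1 * T2 => (f z.1 * g z.2)%:E). apply/measurable_EFinP; apply: mfunM.
    exact: mfun_comp. exact: mfun_comp.
have H : (\int[P]_w (f (X w) * g (Y w))%:E = (Ex P (f \o X) * Ex P (g \o Y))%:E)%E.
  have := indep_tonelli m (fun z => mulr_ge0 (f0 z.1) (g0 z.2)). move=> /= ->.
  rewrite (eq_integral (fun w => (f (X w))%:E * (Ex P (g \o Y))%:E))%E; last first.
    move=> w _; under eq_integral do rewrite EFinM. rewrite ge0_integralZl//; first by rewrite ge0_ExE.
    - by apply/measurable_EFinP; exact: mfun_comp.
    - by move=> v _; rewrite lee_fin.
    - by rewrite lee_fin. rewrite ge0_integralZr//; first by rewrite EFinM (ge0_ExE hf).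
  - by apply/measurable_EFinP; exact: mfun_comp.
  - by move=> w _; rewrite lee_fin.
  - by rewrite lee_fin; apply: Ex_ge0 => w; exact: g0.
have h : L1 P (fun w => f (X w) * g (Y w)). apply: ge0_L1P; [|by move=> w; rewrite mulr_ge0|by rewrite H ltry].
  by apply: mfunM; exact: mfun_comp.
split => //.
by apply: EFin_inj; rewrite ge0_ExE.
Qed.

Lemma indep_mul (f : T1 -> R) (g : T2 -> R) :
  mfunT f -> mfunT g ->
  L1 P (f \o X) -> L1 P (g \o Y) ->
  L1 P (fun w => f (X w) * g (Y w)) /\
  Ex P (fun w => f (X w) * g (Y w)) = Ex P (f \o X) * Ex P (g \o Y).
Proof.
move=> mf mg hf hg.
pose p := fun x : R => Num.max x 0.
have p0 x : 0 <= p x by rewrite le_max lexx orbT.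
have pE x : x = p x - p (- x). by rewrite /p /Num.max; case: ltP => ?; case: ltP => ?; lra.
have pn x : `|p x| <= `|x|. by rewrite ger0_norm// /p ge_max normr_ge0 ler_norm.
have mp d' (T' : measurableType d') (h : T' -> R) : mfunT h -> mfunT (p \o h). by move=> mh; exact: measurable_maxr.
have mo d' (T' : measurableType d') (h : T' -> R) : mfunT h -> mfunT (fun x => - h x). by move=> mh; exact: mfun_comp.
have lp (h : T -> R) : L1 P h -> L1 P (p \o h). move=> hh; apply: (L1_le (g := fun w => `|h w|)).
  - by apply: mp; exact: L1_meas hh.
  - exact: (integrable_abse hh).
  - by move=> w; exact: pn.
have lo (h : T -> R) : L1 P h -> L1 P (fun w => p (- h w)). move=> hh; apply: (L1_le (g := fun w => `|h w|)).
  - by apply: (mp _ _ (fun w => - h w)); apply: mo; exact: L1_meas hh.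
  - exact: (integrable_abse hh).
  - by move=> w; rewrite -(normrN (h w)); exact: pn.
have [a1 b1] := indep_mul_ge0 (mp _ _ _ mf) (mp _ _ _ mg) (fun x => p0 _) (fun x => p0 _) (lp _ hf) (lp _ hg).
have [a2 b2] := indep_mul_ge0 (mp _ _ _ mf) (mp _ _ _ (mo _ _ _ mg)) (fun x => p0 _) (fun x => p0 _) (lp _ hf) (lo _ hg).
have [a3 b3] := indep_mul_ge0 (mp _ _ _ (mo _ _ _ mf)) (mp _ _ _ mg) (fun x => p0 _) (fun x => p0 _) (lo _ hf) (lp _ hg).
have [a4 b4] := indep_mul_ge0 (mp _ _ _ (mo _ _ _ mf)) (mp _ _ _ (mo _ _ _ mg)) (fun x => p0 _) (fun x => p0 _) (lo _ hf) (lo _ hg).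
have E w : f (X w) * g (Y w) = (p (f (X w)) * p (g (Y w)) - p (f (X w)) * p (- g (Y w)))
   - (p (- f (X w)) * p (g (Y w)) - p (- f (X w)) * p (- g (Y w))). by rewrite {1}(pE (f (X w))) {1}(pE (g (Y w))); ring.
have eE : (fun w => f (X w) * g (Y w)) = fun w => (p (f (X w)) * p (g (Y w)) - p (f (X w)) * p (- g (Y w)))
   - (p (- f (X w)) * p (g (Y w)) - p (- f (X w)) * p (- g (Y w))). exact/funext.
rewrite eE; split. by apply: L1B; apply: L1B.
have ef : Ex P (f \o X) = Ex P (p \o f \o X) - Ex P (fun w => p (- f (X w))).
  rewrite -ExB; [|exact: (lp _ hf)|exact: (lo _ hf)]. exact: Ex_eq => w; rewrite /= {1}(pE (f (X w))).
have eg : Ex P (g \o Y) = Ex P (p \o g \o Y) - Ex P (fun w => p (- g (Y w))).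
  rewrite -ExB; [|exact: (lp _ hg)|exact: (lo _ hg)]. exact: Ex_eq => w; rewrite /= {1}(pE (g (Y w))).
rewrite ExB; [|exact: L1B|exact: L1B].
rewrite ExB// ExB// ef eg.
move: b1 b2 b3 b4; rewrite /comp => -> -> -> ->; ring.
Qed.

End Indep.

(** * Measurability from countably many conditions and from coordinates *)

Section Borel.
Context {R : realType}.

Lemma meas_exists d (T : measurableType d) (I : countType) (F : I -> set T) :
  (forall i, measurable (F i)) -> measurable [set w | exists i, F i w].
Proof.
move=> mF.
have -> : [set w | exists i, F i w] = \bigcup_n (if unpickle n is Some i then F i else set0).
  apply/seteqP; split=> w /= []. by move=> i Fi; exists (pickle i) => //; rewrite pickleK.
  by move=> n _; case: (unpickle n) => // i Fi; exists i.
by apply: bigcupT_measurable => n; case: (unpickle n).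
Qed.

Lemma meas_forall d (T : measurableType d) (I : countType) (F : I -> set T) :
  (forall i, measurable (F i)) -> measurable [set w | forall i, F i w].
Proof.
move=> mF.
have -> : [set w | forall i, F i w] = ~` [set w | exists i, (~` F i) w]. apply/seteqP; split=> w /=.
    by move=> h [i]; apply. by move=> h i; apply: contrapT => nF; apply: h; exists i.
by apply: measurableC; apply: meas_exists => i; exact: measurableC.
Qed.

Lemma meas_lt d (T : measurableType d) (f g : T -> R) :
  mfunT f -> mfunT g ->
  measurable [set w | f w < g w].
Proof.
move=> mf mg.
rewrite (_ : [set w | f w < g w] = (fun w => f w - g w) @^-1` `]-oo, 0[%classic).
  by rewrite -[X in measurable X]setTI; apply: mfunB.
by apply/seteqP; split => w /=; rewrite in_itv/= subr_lt0.
Qed.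

Lemma meas_le d (T : measurableType d) (f g : T -> R) :
  mfunT f -> mfunT g ->
  measurable [set w | f w <= g w].
Proof.
move=> mf mg.
rewrite (_ : [set w | f w <= g w] = ~` [set w | g w < f w]). by apply: measurableC; exact: meas_lt.
by apply/seteqP; split => w /=; rewrite leNgt => /negP.
Qed.

Lemma meas_eq d (T : measurableType d) (f g : T -> R) :
  mfunT f -> mfunT g ->
  measurable [set w | f w = g w].
Proof.
move=> mf mg.
rewrite (_ : [set w | f w = g w] = [set w | f w <= g w] `&` [set w | g w <= f w]). by apply: measurableI; exact: meas_le.
apply/seteqP; split => w /=; first by move=> ->.
by move=> [h1 h2]; apply/eqP; rewrite eq_le h1.
Qed.

Lemma borelRE : @borel R = @measurable _ R.
Proof.
apply/seteqP; split. apply: smallest_sub; last by move=> A oA; exact: open_measurable. exact: sigma_algebra_measurable.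
have -> : @measurable _ R = (@RGenOpens.G R).-sigma.-measurable. exact: RGenOpens.measurableE.
apply: smallest_sub; last first. by move=> B [x [y ->]]; apply: sub_sigma_algebra; exact: interval_open.
exact: smallest_sigma_algebra.
Qed.

Lemma mx_ballP p q (x y : 'M[R]_(p, q)) (e : R) : 0 < e ->
  ball x e y <-> forall i j, `|x i j - y i j| < e.
Proof.
by move=> e0; split => [[_ h] i j|h]; [exact: h|split => // i j; exact: h].
Qed.

(** An open set of matrices is the union of the rational balls that it contains, and a ball is a
    finite intersection of coordinate conditions; so coordinatewise measurability suffices.
    Conversely the coordinates are continuous. *)
Lemma mx_measP d (T : measurableType d) p q (f : T -> 'M[R]_(p, q)) :
  (forall Y, borel Y -> measurable (f @^-1` Y)) <->
  (forall i j, mfunT (fun w => f w i j)).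
Proof.
split. move=> h i j _ Y mY; rewrite setTI. apply: (h ((fun M : 'M[R]_(p, q) => M i j) @^-1` Y)).
  move: Y mY; rewrite -borelRE => Y. pose S := [set Y : set R | borel ((fun M : 'M[R]_(p, q) => M i j) @^-1` Y)].
  apply: (@smallest_sub _ _ _ S). split => /=.
    - by rewrite /S/= preimage_set0; exact: sigma_algebra0.
    - move=> A SA; rewrite /S/= setTD preimage_setC; exact: sigma_algebraC.
    - by move=> F SF; rewrite /S/= preimage_bigcup; exact: sigma_algebra_bigcup.
  move=> A oA; apply: sub_sigma_algebra; move: oA; apply: open_comp. by move=> x _; exact: coord_continuous.
move=> h Y bY.
pose S := [set Y : set 'M[R]_(p, q) | measurable (f @^-1` Y)].
apply: (@smallest_sub _ _ (@open 'M[R]_(p, q)) S) bY. split => /=.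
  - by rewrite /S/= preimage_set0.
  - by move=> A SA; rewrite /S/= setTD preimage_setC; exact: measurableC.
  - by move=> F SF; rewrite /S/= preimage_bigcup; exact: bigcupT_measurable.
move=> A oA; rewrite /S/=.
pose c (z : 'M[rat]_(p, q)) : 'M[R]_(p, q) := map_mx ratr z.
have -> : f @^-1` A = [set w | exists z : 'M[rat]_(p, q) * nat,
    ball (c z.1) z.2.+1%:R^-1 `<=` A /\ forall ij : 'I_p * 'I_q, `|c z.1 ij.1 ij.2 - f w ij.1 ij.2| < z.2.+1%:R^-1].
  apply/seteqP; split=> w /=; last first. move=> [[z k] [h1 h2]]; apply: h1; apply/mx_ballP => // i j.
    exact: (h2 (i, j)). move=> Afw; have /nbhs_ballP[e/= e0 he] := open_nbhs_nbhs (conj oA Afw).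
  (* A radius below [e / 2]: the ball of that radius around a rational matrix equally close to [f w]
     stays inside the ball of radius [e] around [f w]. *)
  have [k hk] : exists k : nat, 2 * k.+1%:R^-1 < e.
    have [k _ hk] := near_infty_natSinv_lt (PosNum (divr_gt0 e0 (ltr0n R 2))).
    by exists k; have := hk k (leqnn _) => h2; rewrite mulrC -ltr_pdivlMr. have k0 : 0 < (k.+1%:R^-1 : R) by [].
  have : exists z : 'M[rat]_(p, q), forall i j, `|c z i j - f w i j| < k.+1%:R^-1.
    have H (ij : 'I_p * 'I_q) : exists r : rat, `|ratr r - f w ij.1 ij.2| < k.+1%:R^-1.
      have /rat_in_itvoo[r] : f w ij.1 ij.2 - k.+1%:R^-1 < f w ij.1 ij.2 + k.+1%:R^-1. by rewrite ltrD2l gt0_cp.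
      by rewrite in_itv/= => hr; exists r; rewrite ltr_distl. have [g hg] := choice H.
    by exists (\matrix_(i, j) g (i, j)) => i j; rewrite !mxE; exact: (hg (i, j)).
  move=> [z hz]; exists (z, k); split => [y|ij] /=; last exact: hz.
  move=> /(mx_ballP _ _ k0) hy; apply: he; apply/mx_ballP => // i j. have := ler_distD (c z i j) (f w i j) (y i j).
  move=> /le_lt_trans; apply; rewrite (lt_trans _ hk)// mulr2n mulrDl !mul1r. by rewrite ltrD// distrC.
apply: meas_exists => -[z k] /=.
case: (pselect (ball (c z) k.+1%:R^-1 `<=` A)) => hb; last first.
  rewrite [X in measurable X](_ : _ = set0)//; apply/seteqP; split =>  w /= []. by move=> /hb.
rewrite [X in measurable X](_ : _ = [set w | forall ij : 'I_p * 'I_q, `|c z ij.1 ij.2 - f w ij.1 ij.2| < k.+1%:R^-1]); last first.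
  by apply/seteqP; split => w; [case|].
apply: meas_forall => ij.
apply: meas_lt => //.
by apply: mfun_comp => //; apply: mfunB.
Qed.
End Borel.

Lemma sigma_ae {R : realType} d (T : measurableType d) (P : probability T R)
    (G : set (set T)) (A B : set T) : (forall N, P.-negligible N -> <<s G >> N) ->
  <<s G >> A -> {ae P, forall w, A w <-> B w} -> <<s G >> B.
Proof.
move=> hG GA nAB; pose GT := sigT_of G.
pose N := [set w | ~ (A w <-> B w)].
have hN : P.-negligible N by [].
have -> : B = (A `\` N) `|` (B `&` N). apply/seteqP; split => w.
    move=> Bw; case: (pselect (N w)) => Nw; [by right|left; split => //]. by have [_] := contrapT Nw; apply.
  by move=> [[Aw Nw]|[]//]; have [h _] := contrapT Nw; apply: h.
apply: (@measurableU _ GT). by apply: (@measurableD _ GT) => //; exact: hG.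
by apply: hG; apply: negligibleS hN; exact: subIsetr.
Qed.

Lemma sigma_fun_ae {R : realType} d (T : measurableType d) (P : probability T R)
    (G : set (set T)) d' (U : measurableType d') (X Y : T -> U) :
  (forall N, P.-negligible N -> <<s G >> N) ->
  mfun [set: sigT_of G] (X : sigT_of G -> U) ->
  {ae P, forall w, X w = Y w} ->
  mfun [set: sigT_of G] (Y : sigT_of G -> U).
Proof.
move=> hG mX h _ B mB.
apply: (@sigma_ae _ _ _ P _ ([set: T] `&` X @^-1` B)) => //; first exact: mX.
by apply: filterS h => w; rewrite /= => ->.
Qed.

(** * The augmented filtration of the noise *)

Section Filtration.
Context {R : realType} {dO} {Omega : measurableType dO} (P : probability Omega R)
  {r q} (S : @noise R dO Omega r q).

Local Notation T := (horizon S).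
Local Notation E := (marks S).

(** The generators of [filt], named so that each sigma-algebra of the filtration becomes a
    measurable type [Fil s] with carrier [Omega]. Adaptedness is then measurability from another
    source, and the closure properties of measurable functions apply to it as they are. *)
Definition Fgen (s : R) : set (set Omega) :=
  sigma_bm S s `|` sigma_prm S s `|` [set A | P.-negligible A].

Local Notation Fil s := (sigT_of (Fgen s)).

Definition fm (s : R) (X : Omega -> R) := mfun [set: Fil s] (X : Fil s -> R).

Lemma sigma_bm_mono s s' : s <= s' -> sigma_bm S s `<=` sigma_bm S s'.
Proof.
move=> ss'; apply: sub_sigma_algebra2 => A [v [Y [/andP[v0 vs] bY AE]]].
by exists v, Y; split => //; rewrite v0 (le_trans vs).
Qed.

Lemma sigma_prm_mono s s' : s <= s' -> sigma_prm S s `<=` sigma_prm S s'.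
Proof.
move=> ss'; apply: sub_sigma_algebra2 => A [D [Y [mD DE mY AE]]].
exists D, Y; split => // z /DE [Ez zs]; split => //.
by move: zs; rewrite /= !in_itv/= => /andP[-> /le_trans->].
Qed.

Lemma Fgen_mono s s' : s <= s' -> Fgen s `<=` Fgen s'.
Proof.
move=> ss' A [[]|]; [left; left|left; right|by right]. exact: (sigma_bm_mono ss').
exact: (sigma_prm_mono ss').
Qed.

Lemma filt_mono s s' : s <= s' -> filt P S s `<=` filt P S s'.
Proof. by move=> ss'; apply: sub_sigma_algebra2; exact: Fgen_mono. Qed.

Lemma fm_mono s s' X : s <= s' -> fm s X -> fm s' X.
Proof. by move=> ss' mX _ Y mY; apply: (filt_mono ss'); exact: mX. Qed.

Lemma filt_negl s A : P.-negligible A -> filt P S s A.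
Proof. by move=> nA; apply: sub_sigma_algebra; right. Qed.

Lemma fm_ae s X Y : fm s X -> {ae P, forall w, X w = Y w} -> fm s Y.
Proof. exact: (sigma_fun_ae (@filt_negl s)). Qed.

Lemma mx_adaptedP t p p' (X : R -> Omega -> 'M[R]_(p, p')) :
  adapted P S t X <->
  forall s i j, t <= s <= T -> fm s (fun w => X s w i j).
Proof.
split. move=> aX s i j ts. have := (@mx_measP R _ (Fil s) p p' (X s)).1; apply. by move=> Y bY; exact: aX.
move=> h s Y ts bY.
have := (@mx_measP R _ (Fil s) p p' (X s)).2; apply => //.
by move=> i j; exact: h.
Qed.

Lemma real_adaptedP t (X : R -> Omega -> R) :
  adapted P S t X <-> forall s, t <= s <= T -> fm s (X s).
Proof.
split => [aX s ts _ Y mY|h s Y ts bY]. by rewrite setTI; apply: aX => //; rewrite borelRE.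
by have := h s ts measurableT Y; rewrite setTI; apply; rewrite -borelRE.
Qed.

Hypothesis hN : noise_axioms P S.

Lemma T_gt0 : 0 < T. Proof. by case: hN => -[]. Qed.

Lemma bm_meas v i j : 0 <= v <= T -> mfunT (fun w => bm S v w i j).
Proof.
move=> hv; have := (@mx_measP R _ Omega r 1 (bm S v)).1; apply => Y bY.
by case: hN => _ _ [h _ _ _] _ _; exact: h.
Qed.

Lemma prm_meas D : measurable D -> D `<=` E `*` `[0, T] ->
  mfunT (fun w => prm S w D).
Proof. by case: hN => _ _ _ [h _] _; exact: h. Qed.

Lemma negl_meas A : P.-negligible A -> measurable A.
Proof. by case: hN => -[h _] _ _ _ _; exact: h. Qed.

Lemma sigma_bm_meas s : s <= T -> sigma_bm S s `<=` measurable.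
Proof.
move=> sT; apply: smallest_sub; first exact: sigma_algebra_measurable.
move=> A [v [Y [/andP[v0 vs] bY ->]]].
by case: hN => _ _ [h _ _ _] _ _; apply: h => //; rewrite v0 (le_trans vs).
Qed.

Lemma sigma_prm_meas s : s <= T -> sigma_prm S s `<=` measurable.
Proof.
move=> sT; apply: smallest_sub; first exact: sigma_algebra_measurable.
move=> A [D [Y [mD DE mY ->]]].
rewrite -[X in measurable X]setTI; apply: prm_meas => // z /DE [Ez zs].
by split => //; move: zs; rewrite /= !in_itv/= => /andP[-> /le_trans->].
Qed.

Lemma filt_meas s : s <= T -> filt P S s `<=` measurable.
Proof.
move=> sT; apply: smallest_sub; first exact: sigma_algebra_measurable.
move=> A [[]|].
- exact: sigma_bm_meas.
- exact: sigma_prm_meas.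
- exact: negl_meas.
Qed.

Lemma fm_meas s X : s <= T -> fm s X -> mfunT X.
Proof. by move=> sT mX _ Y mY; apply: (filt_meas sT); exact: mX. Qed.

Lemma fm_bm s v i : 0 <= v <= s -> fm s (fun w => bm S v w i ord0).
Proof.
move=> vs; apply: (@mx_measP R _ (Fil s) r 1 (bm S v)).1 => Y bY.
by apply: sub_sigma_algebra; left; left; apply: sub_sigma_algebra; exists v, Y.
Qed.

Lemma fm_prm (s : R) (D : set (mark R q * R)) : measurable D -> D `<=` E `*` `[0, s] ->
  mfun [set: Fil s] ((fun w => prm S w D) : Fil s -> \bar R).
Proof.
move=> mD DE _ Y mY; rewrite setTI; apply: sub_sigma_algebra; left; right.
by apply: sub_sigma_algebra; exists D, Y.
Qed.

End Filtration.

(** * Gaussian and Poisson moments *)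

Section Density.
Context {R : realType} {d} {T : measurableType d}.
Variables (mu m : {measure set T -> \bar R}) (g : T -> R).
Hypotheses (mg : mfunT g) (g0 : forall x, 0 <= g x).
Hypothesis mE : forall A, measurable A -> (m A = \int[mu]_(x in A) (g x)%:E)%E.

Import HBNNSimple.

Lemma ge0_integral_density (f : T -> \bar R) : mfunT f ->
  (forall x, 0 <= f x)%E ->
  (\int[m]_x f x = \int[mu]_x (f x * (g x)%:E))%E.
Proof.
move=> mf f0.
have ind A : measurable A -> (\int[m]_x (\1_A x)%:E = \int[mu]_x ((\1_A x)%:E * (g x)%:E))%E.
  move=> mA; rewrite integral_indic// setIT mE// integral_mkcond. apply: eq_integral => x _; rewrite patchE indicE.
  by case: ifPn; rewrite ?mul1e ?mul0e.
have mge A : measurable A -> mfunT (fun x => (\1_A x)%:E * (g x)%:E)%E.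
  by move=> mA; apply: emeasurable_funM; apply/measurable_EFinP => //; exact: measurable_indic.
have nn (h : {nnsfun T >-> R}) : (\int[m]_x (h x)%:E = \int[mu]_x ((h x)%:E * (g x)%:E))%E.
  under eq_integral do rewrite fimfunE -fsumEFin//. rewrite [RHS](eq_integral (fun x => \sum_(r \in range h)
      ((r * \1_(h @^-1` [set r]) x)%:E * (g x)%:E))%E); last first.
    move=> x _; rewrite fimfunE -fsumEFin// ge0_mule_fsuml// => y. by have := nnfun_muleindic_ge0 h y x; rewrite -EFinM.
  rewrite ge0_integral_fsum//; last 2 first.
  - by move=> r; apply/measurable_EFinP; apply: mfunM.
  - by move=> r x _; rewrite EFinM nnfun_muleindic_ge0. rewrite ge0_integral_fsum//; last 2 first.
  - move=> r; under eq_fun do rewrite EFinM -muleA. by apply: emeasurable_funM => //; exact: mge.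
  - move=> r x _; rewrite mule_ge0 ?lee_fin//. by rewrite -lee_fin EFinM nnfun_muleindic_ge0. apply: eq_fsbigr => r _.
  case: (ltP r 0) => r0. rewrite preimage_nnfun0//.
    by rewrite !integral0_eq// => x _; rewrite indicE in_set0 mulr0 ?mul0e. under eq_integral do rewrite EFinM.
  under [RHS]eq_integral do rewrite EFinM -muleA. rewrite ge0_integralZl//; last first. by apply/measurable_EFinP.
  rewrite ge0_integralZl//; last 2 first.
  - exact: mge.
  - by move=> x _; rewrite mule_ge0 ?lee_fin. by rewrite ind.
pose h := nnsfun_approx measurableT mf.
have hc x : (EFin \o h^~ x) n @[n --> \oo] --> f x. exact: cvg_nnsfun_approx.
transitivity (limn (fun n => \int[m]_x (h n x)%:E))%E. rewrite -monotone_convergence//.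
  - by apply: eq_integral => x _; apply/esym/cvg_lim => //; exact: hc.
  - by move=> n; apply/measurable_EFinP.
  - by move=> n x _; rewrite lee_fin.
  - by move=> x _ a b ab; rewrite lee_fin; exact/lefP/nd_nnsfun_approx.
transitivity (limn (fun n => \int[mu]_x ((h n x)%:E * (g x)%:E)))%E. by congr (limn _); apply/funext => n; rewrite nn.
rewrite -monotone_convergence//; first last.
- by move=> x _ a b ab; rewrite lee_wpmul2r ?lee_fin//; exact/lefP/nd_nnsfun_approx.
- by move=> n x _; rewrite mule_ge0 ?lee_fin.
- by move=> n; apply: emeasurable_funM; apply/measurable_EFinP.
apply: eq_integral => x _; apply/cvg_lim => //.
apply: cvgeZr => //; exact: hc.
Qed.
End Density.

Section Gauss.
Context {R : realType}.
Local Notation leb := (@lebesgue_measure R).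
Variable s : R.
Hypothesis s0 : 0 < s.

Lemma normal_prob_integral (f : R -> \bar R) : mfunT f ->
  (forall x, 0 <= f x)%E ->
  (\int[normal_prob 0 s]_x f x = \int[leb]_x (f x * (normal_pdf 0 s x)%:E))%E.
Proof.
move=> mf f0; apply: ge0_integral_density => //.
- exact: measurable_normal_pdf.
- by move=> x; exact: normal_pdf_ge0.
Qed.

Lemma normal_prob_sym (A : set R) : measurable A ->
  normal_prob 0 s (-%R @^-1` A) = normal_prob 0 s A.
Proof.
move=> mA; rewrite /normal_prob.
transitivity (\int[pushforward leb (-%R : _ -> measurableTypeR R)]_(x in A) (normal_pdf 0 s x)%:E)%E; last first.
  by apply: eq_measure_integral => B mB BA; exact: lebesgue_measureN.

rewrite ge0_integral_pushforward; [|by []|by []| |].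
- apply: eq_integral => x _; congr EFin. by rewrite !normal_pdfE ?gt_eqF// /normal_fun !subr0 sqrrN.
- apply/measurable_EFinP; apply: mfunTS; exact: measurable_normal_pdf.
- by move=> x _; rewrite lee_fin normal_pdf_ge0.
Qed.

Lemma sqr_le_4expR (z : R) : 0 <= z -> z ^+ 2 <= 4 * expR z.
Proof.
move=> z0; have -> : expR z = expR (z / 2) ^+ 2. by rewrite -expRM_natl; congr expR; rewrite mulrC divfK.
have := expR_ge1Dx (z / 2); set e := expR _ => h.
have h2 : z / 2 <= e by lra.
have e0 : 0 <= e by rewrite (le_trans _ h2)// divr_ge0.
have : (z / 2) ^+ 2 <= e ^+ 2 by rewrite lerXn2r ?nnegrE ?divr_ge0.
rewrite expr_div_n; lra.
Qed.

(** No Gaussian moment is computed: the integrand is compared with the normal density of standard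
    deviation [2 * s]. With [y = x ^+ 2 / (2 s ^+ 2)] the quotient of the densities is twice
    [exp (- 3 y / 4)], the fourth power of [x] is [4 s ^+ 4 y ^+ 2], and [y ^+ 2] is at most
    [8 exp (3 y / 4)]; this yields 64 as 4 times 2 times 8. *)
Lemma normal_fourth_moment :
  (\int[normal_prob 0 s]_x (x ^+ 4)%:E <= (64 * s ^+ 4)%:E)%E.
Proof.
have s2 : 0 < 2 * s by rewrite mulr_gt0.
rewrite normal_prob_integral; first last.
- by move=> x; rewrite lee_fin exprn_even_ge0.
- by apply/measurable_EFinP; exact: mfunX.
apply: (@le_trans _ _ (\int[leb]_x ((64 * s ^+ 4)%:E * (normal_pdf 0 (2 * s) x)%:E))%E); last first.
  rewrite ge0_integralZl_EFin//.
  - by rewrite integral_normal_pdf mule1.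
  - by move=> x _; rewrite lee_fin normal_pdf_ge0.
  - by apply/measurable_EFinP; exact: measurable_normal_pdf.
  - by rewrite mulr_ge0// exprn_ge0// ltW.
apply: ge0_le_integral => //.
- by move=> x _; rewrite mule_ge0// lee_fin ?normal_pdf_ge0// exprn_even_ge0.
- apply: emeasurable_funM; apply/measurable_EFinP; [exact: mfunX|exact: measurable_normal_pdf].
- by apply: emeasurable_funM => //; apply/measurable_EFinP; exact: measurable_normal_pdf.
move=> x _; rewrite -!EFinM lee_fin.
rewrite !normal_pdfE ?gt_eqF// /normal_fun !subr0.
have pk : normal_peak s = 2 * normal_peak (2 * s). rewrite /normal_peak.
  rewrite (_ : (2 * s) ^+ 2 * pi *+ 2 = 2 ^+ 2 * (s ^+ 2 * pi *+ 2)); last first. by rewrite exprMn -mulrA mulrnAr.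
  by rewrite sqrtrM// sqrtr_sqr ger0_norm// invfM mulrA divff// mul1r.
rewrite pk.
have p0 := normal_peak_ge0 (2 * s); set p := normal_peak _ in p0 *.
set y := x ^+ 2 / (s ^+ 2 *+ 2).

have y0 : 0 <= y by rewrite divr_ge0 ?sqr_ge0// mulrn_wge0// sqr_ge0.
have -> : - x ^+ 2 / (s ^+ 2 *+ 2) = - (y / 4) + - (3 * y / 4). by rewrite mulNr -/y; lra.
have -> : - x ^+ 2 / ((2 * s) ^+ 2 *+ 2) = - (y / 4). rewrite /y; field; by rewrite gt_eqF.
have -> : x ^+ 4 = 4 * s ^+ 4 * y ^+ 2. rewrite /y; field; by rewrite gt_eqF.
rewrite expRD expRN [expR (- (3 * y / 4))]expRN.
have y34 : 0 <= 3 * y / 4 by lra.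
have hz := sqr_le_4expR y34.
set e := expR (3 * y / 4) in hz *; set u := (expR (y / 4))^-1.
have e0 : 0 < e by exact: expR_gt0.
have u0 : 0 <= u by rewrite invr_ge0 expR_ge0.
have hy : y ^+ 2 * e^-1 <= 8. by rewrite ler_pdivrMr; nra.
have : (8 * s ^+ 4 * p * u) * (y ^+ 2 * e^-1) <= (8 * s ^+ 4 * p * u) * 8.
  have s4 : 0 <= s ^+ 4 by rewrite exprn_ge0// ltW. apply: ler_wpM2l => //; apply: mulr_ge0 => //; apply: mulr_ge0; lra.
set ei := e^-1; lra.
Qed.

Lemma normal_mean_sym (f : R -> R) : (forall x, f (- x) = - f x) ->
  mfunT f ->
  (normal_prob 0 s).-integrable setT (EFin \o f) ->
  (\int[normal_prob 0 s]_x f x = 0).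
Proof.
move=> fN mf fi.
have H : (\int[normal_prob 0 s]_x (f x)%:E = \int[normal_prob 0 s]_x (f (- x))%:E)%E.
  transitivity (\int[pushforward (normal_prob 0 s) (-%R : _ -> measurableTypeR R)]_x (f x)%:E)%E.
    by apply: eq_measure_integral => B mB BA; exact/esym/normal_prob_sym. rewrite integral_pushforward//=.
  - exact/measurable_EFinP.
  - rewrite preimage_setT (_ : _ \o _ = (fun x => - (f x)%:E)%E). exact: (integrableN fi).
    by apply/funext => x /=; rewrite fN.
have : \int[normal_prob 0 s]_x f x = - \int[normal_prob 0 s]_x f x. rewrite {1}/Rintegral H -mulN1r -RintegralZl//.
  by congr fine; apply: eq_integral => x _; rewrite fN mulN1r.
lra.
Qed.
End Gauss.

Section Poisson.
Context {R : realType} {d} {T : measurableType d}.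
Variables (P : probability T R) (lam : R) (X : T -> \bar R).
Hypotheses (lam0 : 0 <= lam) (mX : mfunT X).
Hypothesis hX : forall k : nat,
  P [set w | X w = k%:R%:E] = (poisson_weight lam k)%:E.

Lemma poisson_weight_ge0 k : 0 <= poisson_weight lam k.
Proof. by rewrite divr_ge0// mulr_ge0// exprn_ge0. Qed.

(** Factorial moments of the Poisson law: the falling factorial cancels against the factorial in the
    weight and shifts the exponential series by [j]. *)
Lemma nneseries_ffact j :
  (\sum_(k <oo) ((k ^_ j)%:R * poisson_weight lam k)%:E = (lam ^+ j)%:E)%E.
Proof.
have p0 k : (0 <= ((k ^_ j)%:R * poisson_weight lam k)%:E)%E. by rewrite lee_fin mulr_ge0// poisson_weight_ge0.
rewrite (@nneseries_split R _ 0 j)//.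
rewrite add0n big_nat_cond big1 ?add0e; last first. by move=> i /andP[/andP[_ ij] _]; rewrite ffact_small// mul0r.
rewrite -nneseries_addn//.
have E i : ((((i + j) ^_ j)%:R * poisson_weight lam (i + j))%:E = (lam ^+ j * expR (- lam))%:E * (exp_coeff lam i)%:E)%E.
  rewrite -EFinM; congr EFin; rewrite /poisson_weight /exp_coeff/=.
  have := @ffact_fact (i + j) j (leq_addl _ _); rewrite addnK => <-.
  have n1 : (i`!%:R : R) != 0 by rewrite pnatr_eq0 -lt0n fact_gt0.
  have n2 : ((i + j) ^_ j)%:R != 0 :> R by rewrite pnatr_eq0 -lt0n ffact_gt0 leq_addl.
  rewrite exprD natrM; field; by rewrite n1 n2.
rewrite (eq_eseriesr (fun i _ => E i)) nneseriesZl; last first. by move=> n _; rewrite lee_fin exp_coeff_ge0.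
rewrite -[RHS](_ : (lam ^+ j * expR (- lam))%:E * (expR lam)%:E = _)%E; last first.
  by rewrite -EFinM -mulrA -expRD addNr expR0 mulr1.
congr *%E; rewrite -EFin_lim; last exact: is_cvg_series_exp_coeff.
by apply/congr_lim/funext => n/=; rewrite /series/= -sumEFin.
Qed.

(** The masses at the natural numbers sum to 1, by the case [j = 0] of the factorial moments, so [X]
    is almost surely natural and the integral splits over the events [X = k]. *)
Lemma poisson_integral (h : R -> R) : mfunT h ->
  (forall x, 0 <= h x) ->
  (\int[P]_w (h (fine (X w)))%:E =
   \sum_(k <oo) (h k%:R * poisson_weight lam k)%:E)%E
  /\ {ae P, forall w, exists k : nat, X w = k%:R%:E}.
Proof.
move=> mh h0.
pose F k := [set w | X w = k%:R%:E].
have mF k : measurable (F k). rewrite (_ : F k = X @^-1` [set k%:R%:E]); last by [].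
  by rewrite -[X in measurable X]setTI; apply: mX => //; exact: emeasurable_set1.
have tF : trivIset setT F. apply/trivIsetP => i j _ _ ij; apply/seteqP; split => // w [/= h1].
  rewrite /F/= h1 => -[/eqP]; by rewrite eqr_nat (negbTE ij).
have mUF : measurable (\bigcup_k F k) by exact: bigcupT_measurable.
have PUF : P (\bigcup_k F k) = 1%E. rewrite measure_semi_bigcup//. rewrite -[RHS](nneseries_ffact 0).
  by apply: eq_eseriesr => k _; rewrite ffactn0 mul1r; exact: hX.
have PN : P (~` \bigcup_k F k) = 0%E by rewrite probability_setC// PUF subee.
have ae : {ae P, forall w, exists k : nat, X w = k%:R%:E}.
  exists (~` \bigcup_k F k); split => //; first exact: measurableC. by move=> w nw [k _ Fk]; apply: nw; exists k.
split => //.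
have mhX : mfunT (fun w => (h (fine (X w)))%:E). apply/measurable_EFinP; apply: mfun_comp => //. exact: mfun_comp.
rewrite (ge0_negligible_integral (measurableC mUF))//; last by move=> w _; rewrite lee_fin.
rewrite setDE setTI setCK ge0_integral_bigcup//; last 2 first.
- exact: mfunTS.
- by move=> w _; rewrite lee_fin.
apply: eq_eseriesr => k _.
rewrite (eq_integral (cst (h k%:R)%:E)); last by move=> w /set_mem ->.
by rewrite integral_cst//= EFinM -hX.
Qed.

End Poisson.

(** * Independence of events: pi-lambda arguments and countable partitions *)

Section IndepSets.
Context {R : realType} {d} {T : measurableType d}.
Variable P : probability T R.
Implicit Types A B : set T.

Definition indepS A B := P (A `&` B) = (P A * P B)%E.

Lemma indepSC A B : indepS A B -> indepS B A.
Proof. by rewrite /indepS setIC muleC. Qed.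

Lemma P_ae A B : measurable A -> measurable B ->
  {ae P, forall w, A w <-> B w} -> P A = P B.
Proof.
move=> mA mB h; rewrite -(setIT A) -(setIT B) -!integral_indic//.
apply: ae_eq_integral => //.
- by apply/measurable_EFinP; exact: measurable_indic.
- by apply/measurable_EFinP; exact: measurable_indic.
apply: filterS h => w h _; congr EFin; rewrite !indicE; congr ((_ : bool)%:R).
by apply/idP/idP; rewrite !inE; case: h.
Qed.

Lemma indepS_lambda B : measurable B ->
  lambda_system setT [set A | measurable A /\ indepS A B].
Proof.
move=> mB; split => /=.
- by move=> A _; exact: subsetT.
- by split => //; rewrite /indepS setTI probability_setT mul1e.
- move=> A C CA [mA iA] [mC iC]; split; first exact: measurableD. rewrite /indepS setDE setIAC -setDE.
  have fC : P C \is a fin_num by exact: fin_num_measure.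

  have -> : A `&` B `\` C = (A `&` B) `\` (C `&` B).
    apply/seteqP; split => w /= [[Aw Bw] nC]; split => //; first by case. by move=> Cw; apply: nC.
  have lty X : measurable X -> (P X < +oo)%E by move=> mX; rewrite -ge0_fin_numE// fin_num_measure.
  have mAB : measurable (A `&` B) by exact: measurableI. have mCB : measurable (C `&` B) by exact: measurableI.
  rewrite (measureD mAB mCB (lty _ mAB)) (measureD mA mC (lty _ mA)).
  rewrite (_ : A `&` B `&` (C `&` B) = C `&` B); last first.
    by apply/seteqP; split => w; [case|move=> [Cw Bw]; split; split => //; exact: CA].
  rewrite (_ : A `&` C = C); last first. by apply/seteqP; split => w; [case|move=> Cw; split => //; exact: CA].
  transitivity (P A * P B - P C * P B)%E; first by congr (_ - _)%E.
  apply/esym; apply: muleBl; first exact: fin_num_measure. by apply: fin_num_adde_defl; rewrite fin_numN.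
- move=> F ndF FP; split; first by apply: bigcupT_measurable => n; have [] := FP n. rewrite /indepS setI_bigcupl.
  have mF n : measurable (F n) by have [] := FP n. have c1 : P (F n `&` B) @[n --> \oo] --> P (\bigcup_n (F n `&` B)).
    apply: nondecreasing_cvg_mu.
    - by move=> n; exact: measurableI.
    - by apply: bigcupT_measurable => n; exact: measurableI.
    - by move=> a b ab; apply/subsetPset; apply: setSI; exact/subsetPset/ndF.
  have c2 : P (F n) @[n --> \oo] --> P (\bigcup_n F n). apply: nondecreasing_cvg_mu => //. exact: bigcupT_measurable.
  have fB : P B \is a fin_num by exact: fin_num_measure. have c3 := cvgeZr fB c2.
  apply: (cvg_unique _ c1); first exact: ereal_hausdorff. apply: cvg_trans c3; apply: near_eq_cvg; near=> n.
  by have [_ ->] := FP n.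
Unshelve. all: by end_near. Qed.

Lemma indep_sigma_l (G : set (set T)) B : setI_closed G -> G `<=` measurable ->
  measurable B -> (forall A, G A -> indepS A B) ->
  forall A, <<s G >> A -> indepS A B.
Proof.
move=> GI Gm mB h A sA.
suff [] : [set A | measurable A /\ indepS A B] A by [].
apply: (lambda_system_subset GI (indepS_lambda mB)) => //.
by move=> C GC; split; [exact: Gm|exact: h].
Qed.

Lemma indep_sigma (G H : set (set T)) : setI_closed G -> G `<=` measurable ->
  setI_closed H -> H `<=` measurable ->
  (forall A B, G A -> H B -> indepS A B) ->
  forall A B, <<s G >> A -> <<s H >> B -> indepS A B.
Proof.
move=> GI Gm HI Hm h A B sA sB.
have mB : measurable B. by apply: (smallest_sub _ Hm sB); exact: sigma_algebra_measurable.
apply: (@indep_sigma_l G) => // {A sA}A GA.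
apply: indepSC; apply: (@indep_sigma_l H) => //; first exact: Gm.
by move=> C HC; apply: indepSC; exact: h.
Qed.

(** Independence from each of the disjoint atoms [F j] adds up over a countable union. The union is
    only required up to a null set, because counts of the Poisson measure are natural numbers only
    almost surely. *)
Lemma indep_countable (J : countType) (F : J -> set T) (U : set J) A B :
  (forall j, measurable (F j)) -> (forall i j w, F i w -> F j w -> i = j) ->
  measurable A -> measurable B ->
  {ae P, forall w, A w <-> exists2 j, U j & F j w} ->
  (forall j, indepS (F j) B) -> indepS A B.
Proof.
move=> mF dF mA mB AE iF.
pose G n := if pickle_inv n is Some j then [set w | U j /\ F j w] else set0.
have mG n : measurable (G n). rewrite /G; case: (pickle_inv n) => // j. case: (pselect (U j)) => Uj.
    by rewrite (_ : [set w | _] = F j)//; apply/seteqP; split => w; [case|].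
  by rewrite (_ : [set w | _] = set0)//; apply/seteqP; split => w [].
have iG n : indepS (G n) B. rewrite /G; case: (pickle_inv n) => [j|]; last by rewrite /indepS set0I measure0 mul0e.
  case: (pselect (U j)) => Uj. by rewrite (_ : [set w | _] = F j)//; apply/seteqP; split => w; [case|].
  rewrite (_ : [set w | _] = set0); last by apply/seteqP; split => w []. by rewrite /indepS set0I measure0 mul0e.
have tG : trivIset setT G. apply/trivIsetP => i j _ _ ij; apply/seteqP; split =>  w [].
  rewrite /G; case ei: (pickle_inv i) => [a|//]; case ej: (pickle_inv j) => [b|//] /= [_ Fa] [_ Fb].
  move/eqP: ij; apply. have := @pickle_invK J i; have := @pickle_invK J j; rewrite ei ej /= => <- <-.
  by rewrite (dF _ _ _ Fa Fb).
have AEG : {ae P, forall w, A w <-> (\bigcup_n G n) w}. apply: filterS AE => w ->; split.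
    by move=> [j Uj Fj]; exists (pickle j) => //; rewrite /G pickleK_inv.
  by move=> [n _]; rewrite /G; case: (pickle_inv n) => // j [Uj Fj]; exists j.
have mUG : measurable (\bigcup_n G n) by exact: bigcupT_measurable.
have E1 : P A = P (\bigcup_n G n) by apply: P_ae.
have E2 : P (A `&` B) = P (\bigcup_n G n `&` B). apply: P_ae; [exact: measurableI|exact: measurableI|].
  by apply: filterS AEG => w /= ->.
have tGB : trivIset setT (fun n => G n `&` B). exact: trivIset_setIr.
rewrite /indepS E1 E2 setI_bigcupl measure_semi_bigcup//; last 2 first.
- by move=> n; exact: measurableI.
- by apply: bigcupT_measurable => n; exact: measurableI.
rewrite measure_semi_bigcup// muleC.
have fB : P B \is a fin_num by exact: fin_num_measure.
rewrite -(fineK fB) -nneseriesZl//.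
by apply: eq_eseriesr => n _; rewrite fineK// muleC; exact: iG.
Qed.

Lemma indep_negl A A' B : measurable A -> measurable A' -> measurable B ->
  {ae P, forall w, A w <-> A' w} -> indepS A B -> indepS A' B.
Proof.
move=> mA mA' mB h; rewrite /indepS (P_ae mA mA' h) => <-.
apply: P_ae; [exact: measurableI|exact: measurableI|].
by apply: filterS h => w /= ->.
Qed.

End IndepSets.

Section Enorm.
Context {R : realType}.

Lemma enormE p q (A : 'M[R]_(p, q)) : enorm A ^+ 2 = \sum_i \sum_j A i j ^+ 2.
Proof.
rewrite /enorm sqr_sqrtr// sumr_ge0// => i _; apply: sumr_ge0 => j _; exact: sqr_ge0.
Qed.

Lemma enorm_ge0 p q (A : 'M[R]_(p, q)) : 0 <= enorm A.
Proof. exact: sqrtr_ge0. Qed.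

Lemma coord_le_enorm2 p q (A : 'M[R]_(p, q)) i j : A i j ^+ 2 <= enorm A ^+ 2.
Proof.
rewrite enormE (bigD1 i)//= (bigD1 j)//= -addrA lerDl addr_ge0//. by apply: sumr_ge0 => k _; exact: sqr_ge0.
by apply: sumr_ge0 => k _; apply: sumr_ge0 => l _; exact: sqr_ge0.
Qed.

Lemma coord_le_enorm p q (A : 'M[R]_(p, q)) i j : `|A i j| <= enorm A.
Proof.
rewrite -(@ler_pXn2r _ 2) ?nnegrE ?enorm_ge0//.
by rewrite sqr_abs coord_le_enorm2.
Qed.

Lemma enorm_bounded p q (A : 'M[R]_(p, q)) (k : R) : (forall i j, `|A i j| <= k) ->
  enorm A <= Num.sqrt (\sum_(i < p) \sum_(j < q) k ^+ 2).
Proof.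
move=> h; apply: ler_wsqrtr; apply: ler_sum => i _; apply: ler_sum => j _.
have k0 : 0 <= k by exact: le_trans (h i j).
by rewrite -sqr_abs lerXn2r.
Qed.

Lemma meas_enorm2 d (T : measurableType d) p q (f : T -> 'M[R]_(p, q)) :
  (forall i j, mfunT (fun w => f w i j)) ->
  mfunT (fun w => enorm (f w) ^+ 2).
Proof.
move=> h; under [X in mfun _ X]funext do rewrite enormE.
by apply: measurable_sum => i; apply: measurable_sum => j; exact: mfunX.
Qed.
End Enorm.

(** * Joint measurability in time and chance: cadlag paths and Caratheodory functions *)

Section JointMeas.
Context {R : realType}.

Lemma meas_index d (T : measurableType d) (K : countType) (A : set T)
    (N : T -> K) (F : K -> T -> R) :
  measurable A -> (forall k, measurable [set w | N w = k]) ->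
  (forall k, mfun A (F k)) ->
  mfun A (fun w => F (N w) w).
Proof.
move=> mA mN mF _ Y mY.
rewrite (_ : A `&` _ = [set w | exists k, ([set w | N w = k] `&` (A `&` F k @^-1` Y)) w]).
  apply: meas_exists => k; apply: measurableI => //; exact: mF.
apply/seteqP; split => w /=; first by move=> [Aw h]; exists (N w).
by move=> [k [/= <-]].
Qed.

Lemma meas_nat_index d (T : measurableType d) (N : T -> nat) (F : nat -> T -> R) :
  (forall n, measurable [set w | N w = n]) ->
  (forall n, mfunT (F n)) ->
  mfunT (fun w => F (N w) w).
Proof. by move=> mN mF; exact: meas_index. Qed.

Lemma truncn_meas d (T : measurableType d) (f : T -> R) n : mfunT f ->
  measurable [set w | Num.truncn (f w) = n].
Proof.
move=> mf.
pose Z := [set x : R | Num.truncn x = n].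
rewrite (_ : [set w | _] = f @^-1` Z)//.
rewrite -[X in measurable X]setTI; apply: mf => //.
have lt01 (x : R) : x < 0 -> ~~ (1 <= x) by move=> x0; rewrite -ltNge (lt_trans x0).
have -> : Z = ([set x | n%:R <= x] `&` [set x | x < n.+1%:R]) `|` ([set x | x < 0] `&` [set x | n = 0%N]).
  apply/seteqP; split => x; rewrite /Z/=. case: (ltP x 0) => x0. by rewrite (truncn0Pn _ (lt01 x x0)) => <-; right.
    by move=> <-; left; have /andP[] := truncn_itv x0. move=> [[h1 h2]|[h1 ->]]; last exact/truncn0Pn/lt01.
  by apply/truncn_def; rewrite h1.
apply: measurableU; apply: measurableI.
- exact: (@meas_le R _ _ (cst n%:R) id).
- exact: (@meas_lt R _ _ id (cst n.+1%:R)).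
- exact: (@meas_lt R _ _ id (cst 0)).
- case: (eqVneq n 0%N) => h. by rewrite [X in measurable X](_ : _ = setT)//; apply/seteqP; split.
  by rewrite [X in measurable X](_ : _ = set0)//; apply/seteqP; split => // x /eqP; rewrite (negbTE h).
Qed.

Lemma meas_cont_mx d (T : measurableType d) p q (f : T -> 'M[R]_(p, q)) (g : 'M[R]_(p, q) -> R) :
  continuous g -> (forall i j, mfunT (fun w => f w i j)) ->
  mfunT (fun w => g (f w)).
Proof.
move=> cg /mx_measP mf _ Y mY; rewrite setTI.
apply: (mf (g @^-1` Y)).
move: Y mY; rewrite -borelRE => Y.
pose B := [set Y : set R | borel (g @^-1` Y)].
apply: (@smallest_sub _ _ _ B). split => /=.
  - by rewrite /B/= preimage_set0; exact: sigma_algebra0.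
  - by move=> A SA; rewrite /B/= setTD preimage_setC; exact: sigma_algebraC.
  - by move=> F SF; rewrite /B/= preimage_bigcup; exact: sigma_algebra_bigcup.
move=> A oA; apply: sub_sigma_algebra; move: oA; apply: open_comp => x _.
exact: cg.
Qed.

Section Cadlag.
Context {d} {T' : measurableType d}.
Variables (t T : R) (X : R -> T' -> R).
Hypothesis tT : t <= T.
Hypothesis mX : forall s, t <= s <= T -> mfunT (X s).

(** The approximants see the time only through the countably many values [g j n], hence are jointly
    measurable, and a pointwise limit keeps this. *)
Lemma grid_joint (N : nat -> R -> nat) (g : nat -> nat -> R) (Y : R -> T' -> R) :
  (forall j n, measurable [set s | N j s = n]) ->
  (forall j n, t <= g j n <= T) ->
  (forall s w, X (g j (N j s)) w @[j --> \oo] --> Y s w) ->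
  mfunT (fun z : R * T' => Y z.1 z.2).
Proof.
move=> mN gT cv.
apply: (@measurable_fun_cvg _ _ _ _ (fun j (z : R * T') => X (g j (N j z.1)) z.2)).
  move=> j; apply: (@meas_nat_index _ _ (fun z : R * T' => N j z.1) (fun n z => X (g j n) z.2)).
    move=> n; rewrite (_ : [set _ | _] = [set s | N j s = n] `*` setT). exact: measurableX.
    by apply/seteqP; split => z []. by move=> n; apply: mfun_comp => //; apply: mX.
by move=> z _; exact: cv.
Qed.

Definition clamp (s : R) := Num.max t (Num.min s T).

Lemma clampP s : t <= clamp s <= T.
Proof. by rewrite /clamp le_max lexx/= ge_max tT ge_min lexx orbT. Qed.

Lemma clamp_id s : t <= s <= T -> clamp s = s.
Proof. by move=> /andP[ts sT]; rewrite /clamp (min_l sT) (max_r ts). Qed.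

(** With the shift [n.+1], the index [truncn ((s - t) * j.+1)] yields a grid point strictly to the
    right of [s], as a right limit requires, at distance at most [1 / j.+1]; the cut keeps it in
    [[t, T]]. [downg] is the mirror image counted from [T], for left limits. *)
Definition upg (j n : nat) : R := Num.min T (t + n.+1%:R / j.+1%:R).

Lemma upgP j n : t <= upg j n <= T.
Proof. by rewrite /upg le_min tT ge_min lexx/= lerDl divr_ge0. Qed.

Lemma upg_gt j s : t <= s < T -> s < upg j (Num.truncn ((s - t) * j.+1%:R)) <= s + j.+1%:R^-1.
Proof.
move=> /andP[ts sT]; rewrite /upg.

have x0 : 0 <= (s - t) * j.+1%:R by rewrite mulr_ge0// subr_ge0.
have /andP[h1 h2] := truncn_itv x0.
set n := Num.truncn _ in h1 h2 *.
rewrite lt_min sT/= ge_min; apply/andP; split. by rewrite -ltrBlDl ltr_pdivlMr.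
apply/orP; right; rewrite -natr1 mulrDl mul1r addrA lerD2r -lerBrDl.
by rewrite ler_pdivrMr.
Qed.

Lemma upg_cvg s : t <= s < T -> upg j (Num.truncn ((s - t) * j.+1%:R)) @[j --> \oo] --> s.
Proof.
move=> ts.
apply: (@squeeze_cvgr _ _ _ _ (fun _ => s) (fun j => s + j.+1%:R^-1)).
- near=> j; have /andP[h1 h2] := upg_gt j ts; by rewrite (ltW h1).
- exact: cvg_cst.
- rewrite -[X in _ --> X]addr0; apply: cvgD; first exact: cvg_cst. exact: cvg_harmonic.
Unshelve. all: by end_near. Qed.

Lemma cvg_at_right_seq (f : R -> R) (s l : R) (u : nat -> R) :
  f v @[v --> s^'+] --> l -> (forall j, s < u j) -> u j @[j --> \oo] --> s ->
  f (u j) @[j --> \oo] --> l.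
Proof.
move=> cf su cu; apply: (cvg_comp _ f) cf.
move=> A /= [e e0 he].
have /cvgrPdist_lt/(_ e e0) := cu.
apply: filterS => j hj; apply: he => //=.
Qed.

Lemma cvg_at_left_seq (f : R -> R) (s l : R) (u : nat -> R) :
  f v @[v --> s^'-] --> l -> (forall j, u j < s) -> u j @[j --> \oo] --> s ->
  f (u j) @[j --> \oo] --> l.
Proof.
move=> cf su cu; apply: (cvg_comp _ f) cf.
move=> A /= [e e0 he].
have /cvgrPdist_lt/(_ e e0) := cu.
apply: filterS => j hj; apply: he => //=.
Qed.

Definition downg (j n : nat) : R := Num.max t (T - n.+1%:R / j.+1%:R).

Lemma downgP j n : t <= downg j n <= T.
Proof. by rewrite /downg ge_max tT le_max lexx/= lerBlDr lerDl divr_ge0. Qed.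

Lemma downg_lt j s : t < s <= T ->
  s - j.+1%:R^-1 <= downg j (Num.truncn ((T - s) * j.+1%:R)) < s.
Proof.
move=> /andP[ts sT]; rewrite /downg.

have x0 : 0 <= (T - s) * j.+1%:R by rewrite mulr_ge0// subr_ge0.
have /andP[h1 h2] := truncn_itv x0.
set n := Num.truncn _ in h1 h2 *.
rewrite gt_max ts/= le_max; apply/andP; split.
  apply/orP; right; rewrite -[n.+1%:R]natr1 mulrDl mul1r opprD addrA lerD2r. by rewrite lerBrDl -lerBrDr ler_pdivrMr.
by rewrite ltrBlDl -ltrBlDr ltr_pdivlMr.
Qed.

Lemma downg_cvg s : t < s <= T -> downg j (Num.truncn ((T - s) * j.+1%:R)) @[j --> \oo] --> s.
Proof.
move=> ts.
apply: (@squeeze_cvgr _ _ _ _ (fun j => s - j.+1%:R^-1) (fun _ => s)).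
- near=> j; have /andP[h1 h2] := downg_lt j ts; by rewrite h1 ltW.
- rewrite -[X in _ --> X]subr0; apply: cvgB; first exact: cvg_cst. exact: cvg_harmonic.
- exact: cvg_cst.
Unshelve. all: by end_near. Qed.

Lemma clamp_meas : mfunT clamp.
Proof. by apply: measurable_maxr => //; apply: measurable_minr. Qed.

Lemma right_cont_joint :
  (forall s w, t <= s < T -> X v w @[v --> s^'+] --> X s w) ->
  mfunT (fun z : R * T' => X (clamp z.1) z.2).
Proof.
move=> rc.
(* Index 0 is reserved for the time [T], which has no grid point to its right; the true indices are
   shifted by one. *)
pose N j s := if clamp s < T then (Num.truncn ((clamp s - t) * j.+1%:R)).+1 else 0%N.
pose g j n := if n is n'.+1 then upg j n' else T.
apply: (@grid_joint N g (fun s w => X (clamp s) w)).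
- move=> j n. have mlt : measurable [set s : R | clamp s < T] by apply: meas_lt => //; exact: clamp_meas.
  case: n => [|n]. rewrite (_ : [set s | _] = ~` [set s : R | clamp s < T]); first exact: measurableC.
    apply/seteqP; split => s; rewrite /N/=; first by case: ifP => // ->. by case: ifP => // _ /(_ isT).
  rewrite (_ : [set s | _] = [set s : R | clamp s < T] `&` [set s | Num.truncn ((clamp s - t) * j.+1%:R) = n]).
    apply: measurableI => //; apply: truncn_meas; apply: mfunM => //. by apply: mfunB => //; exact: clamp_meas.
  apply/seteqP; split => s; rewrite /N/=; first by case: ifP =>  _ []. by move=> [-> ->].
- by move=> j [|n]; [rewrite tT lexx|exact: upgP].
- move=> s w; rewrite /N /g; have /andP[h1 h2] := clampP s; case: (ltP (clamp s) T) => sT.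
    have ts : t <= clamp s < T by rewrite h1. apply: (cvg_at_right_seq (rc (clamp s) w ts)).
      by move=> j; have /andP[] := upg_gt j ts. exact: upg_cvg. have -> : clamp s = T by apply/eqP; rewrite eq_le h2.
  exact: cvg_cst.
Qed.

Lemma left_lim_joint :
  (forall s w, t < s <= T -> cvg (X v w @[v --> s^'-])) ->
  mfunT (fun z : R * T' =>
    if t < clamp z.1 then lim (X v z.2 @[v --> (clamp z.1)^'-]) else X t z.2).
Proof.
move=> ll.
pose N j s := if t < clamp s then (Num.truncn ((T - clamp s) * j.+1%:R)).+1 else 0%N.
pose g j n := if n is n'.+1 then downg j n' else t.
apply: (@grid_joint N g (fun s w => if t < clamp s then lim (X v w @[v --> (clamp s)^'-]) else X t w)).
- move=> j n. have mlt : measurable [set s : R | t < clamp s] by apply: meas_lt => //; exact: clamp_meas.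
  case: n => [|n]. rewrite (_ : [set s | _] = ~` [set s : R | t < clamp s]); first exact: measurableC.
    apply/seteqP; split => s; rewrite /N/=; first by case: ifP => // ->. by case: ifP => // _ /(_ isT).
  rewrite (_ : [set s | _] = [set s : R | t < clamp s] `&` [set s | Num.truncn ((T - clamp s) * j.+1%:R) = n]).
    apply: measurableI => //; apply: truncn_meas; apply: mfunM => //. by apply: mfunB => //; exact: clamp_meas.
  apply/seteqP; split => s; rewrite /N/=; first by case: ifP =>  _ []. by move=> [-> ->].
- by move=> j [|n]; [rewrite tT lexx|exact: downgP].
- move=> s w; rewrite /N /g; have /andP[h1 h2] := clampP s; case: (ltP t (clamp s)) => sT.
    have ts : t < clamp s <= T by rewrite sT. apply: (cvg_at_left_seq (ll (clamp s) w ts)).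
      by move=> j; have /andP[] := downg_lt j ts. exact: downg_cvg. exact: cvg_cst.
Qed.

End Cadlag.
End JointMeas.

Section Caratheodory.
Context {R : realType}.

Lemma floor_meas d (T : measurableType d) (f : T -> R) (n : int) : mfunT f ->
  measurable [set w | Num.floor (f w) = n].
Proof.
move=> mf.
rewrite (_ : [set w | _] = [set w | n%:~R <= f w] `&` [set w | f w < (n + 1)%:~R]).
  by apply: measurableI; [exact: meas_le|exact: meas_lt].
apply/seteqP; split => w /=. by move=> <-; have /andP[] := floor_itv (f w).
by move=> [h1 h2]; apply: floor_def; rewrite h1.
Qed.

Context {n m : nat} {de : measure_display} {M : measurableType de}.
Local Notation Z := (R * 'cV[R]_n * 'cV[R]_m)%type.
Variables (D : set Z) (Ee : set M) (F : Z -> M -> R).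
Hypothesis Fc : forall e z, Ee e -> D z -> F^~ e @ within D (nbhs z) --> F z e.
Hypothesis Fm : forall z, D z -> mfun Ee (F z).
Hypothesis mEe : measurable Ee.

Local Notation K := (int * {ffun 'I_n -> int} * {ffun 'I_m -> int})%type.

Definition cell (j : nat) (z : Z) : K :=
  (Num.floor (z.1.1 * j.+1%:R),
   [ffun i => Num.floor (z.1.2 i ord0 * j.+1%:R)],
   [ffun i => Num.floor (z.2 i ord0 * j.+1%:R)]).

Lemma floor_close (j : nat) (x y : R) : Num.floor (x * j.+1%:R) = Num.floor (y * j.+1%:R) ->
  `|x - y| < j.+1%:R^-1.
Proof.
move=> h; have j0 : 0 < (j.+1%:R : R) by [].
have /andP[a1 a2] := floor_itv (x * j.+1%:R); have /andP[b1 b2] := floor_itv (y * j.+1%:R).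
rewrite -h in b1 b2; rewrite intrD in a2 b2.
rewrite -(@ltr_pM2r _ j.+1%:R)// mulVf//.
rewrite -[X in `|_| * X]gtr0_norm// -normrM mulrBl ltr_norml; lra.
Qed.

(** The argument [z w] is discretised into countably many cells of mesh [1 / j.+1]. Each cell that
    meets [D] has a chosen representative in [D], as [F] is continuous only within [D]; the
    discretised function depends on [w] through a countable index and [e w], and converges as [j]
    grows. *)
Lemma caratheodory d (T : measurableType d) (A : set T) (z : T -> Z) (e : T -> M) :
  measurable A ->
  mfunT (fun w => (z w).1.1) ->
  (forall i, mfunT (fun w => (z w).1.2 i ord0)) ->
  (forall i, mfunT (fun w => (z w).2 i ord0)) ->
  mfunT e ->
  (forall w, A w -> D (z w) /\ Ee (e w)) ->
  mfun A (fun w => F (z w) (e w)).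
Proof.
move=> mA m1 m2 m3 me AD.
pose rep j (k : K) : option Z := if pselect (exists y, D y /\ cell j y = k) is left h then Some (projT1 (cid h)) else None.
have repP j k y : rep j k = Some y -> D y /\ cell j y = k. by rewrite /rep; case: pselect => // h [<-]; case: (cid h).
have repE j w : A w -> exists y, [/\ rep j (cell j (z w)) = Some y, D y & cell j y = cell j (z w)].
  move=> Aw; have [Dz _] := AD w Aw. case E : (rep j (cell j (z w))) => [y|]. by exists y; have [] := repP _ _ _ E.
  move: E; rewrite /rep; case: pselect => // h; exfalso; apply: h. by exists (z w).
pose G j (k : K) (w : T) : R := if rep j k is Some y then F y (e w) else 0.
apply: (@measurable_fun_cvg _ _ _ _ (fun j w => G j (cell j (z w)) w)). move=> j; apply: meas_index => //. move=> k.
    rewrite (_ : [set w | _] = [set w | Num.floor ((z w).1.1 * j.+1%:R) = k.1.1] `&`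
      ([set w | forall i, Num.floor ((z w).1.2 i ord0 * j.+1%:R) = k.1.2 i] `&`
       [set w | forall i, Num.floor ((z w).2 i ord0 * j.+1%:R) = k.2 i])). apply: measurableI; last apply: measurableI.
      - by apply: floor_meas; exact: mfunM.
      - apply: (@meas_forall _ _ 'I_n) => i; apply: floor_meas; exact: mfunM.
      - apply: (@meas_forall _ _ 'I_m) => i; apply: floor_meas; exact: mfunM.
    apply/seteqP; split => w /=. by move=> <-; split; split => i; rewrite ffunE.
    move=> [h1 [h2 h3]]; case: k h1 h2 h3 => [[k1 k2] k3] /= h1 h2 h3. rewrite /cell h1; congr (_, _, _).
      by apply/ffunP => i; rewrite ffunE. by apply/ffunP => i; rewrite ffunE.
  move=> k; rewrite /G; case E : (rep j k) => [y|]; last exact: measurable_cst. have [Dy _] := repP _ _ _ E.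
  move=> _ Y mY. rewrite (_ : A `&` _ = A `&` e @^-1` (Ee `&` F y @^-1` Y)).
    apply: measurableI => //; rewrite -[X in measurable X]setTI; apply: me => //. exact: Fm.
  apply/seteqP; split => w /=; last by move=> [Aw [_ h]]. by move=> [Aw h]; split => //; split; have [] := AD w Aw.
move=> w Aw; have [Dz Ew] := AD w Aw.
have [y hy] := choice (fun j => repE j w Aw).
have -> : (fun j => G j (cell j (z w)) w) = (fun j => F (y j) (e w)).
  by apply/funext => j; rewrite /G; have [-> _ _] := hy j.
apply: (cvg_comp y (F^~ (e w))) (Fc Ew Dz).
have near0 (ee : R) : 0 < ee -> \forall j \near \oo, j.+1%:R^-1 < ee.
  by move=> ee0; exact: near_infty_natSinv_lt (PosNum ee0).
have c1 : (y j).1.1 @[j --> \oo] --> (z w).1.1. apply/cvgrPdist_lt => ee ee0; apply: filterS (near0 _ ee0) => j hj.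
  apply: lt_trans hj; apply: floor_close; have [_ _] := hy j. by move=> /(congr1 (fun k => k.1.1)).
have c2 : (y j).1.2 @[j --> \oo] --> (z w).1.2. apply/cvg_ballP => ee ee0; apply: filterS (near0 _ ee0) => j hj.
  apply/mx_ballP => // i i'; rewrite (ord1 i'). apply: lt_trans hj; apply: floor_close; have [_ _] := hy j.
  by move=> -[_ /ffunP /(_ i) + _]; rewrite !ffunE.
have c3 : (y j).2 @[j --> \oo] --> (z w).2. apply/cvg_ballP => ee ee0; apply: filterS (near0 _ ee0) => j hj.
  apply/mx_ballP => // i i'; rewrite (ord1 i'). apply: lt_trans hj; apply: floor_close; have [_ _] := hy j.
  by move=> -[_ _ /ffunP /(_ i)]; rewrite !ffunE.
have c : y j @[j --> \oo] --> z w. have -> : y = (fun j => ((y j).1.1, (y j).1.2, (y j).2)).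
    by apply/funext => j; case: (y j) => -[]. have -> : z w = ((z w).1.1, (z w).1.2, (z w).2) by case: (z w) => -[].
  exact: (cvg_pair (cvg_pair c1 c2) c3).
move=> B /= wB.
have h : \forall j \near \oo, D (y j) -> B (y j) := c _ wB.
by apply: filterS h => j; apply; have [] := hy j.
Qed.
End Caratheodory.

(** * Second-order expansions in increments and counts *)

Section Expansion.
Context {R : realType}.

(** A once differentiable function, equal to 1 on the negative half-line and decreasing to 0, for
    which [ramp (n x)] tends to the indicator of [x <= 0]. [dramp] is its derivative. *)
Definition ramp (x : R) : R := (1 + (Num.max x 0) ^+ 2)^-1.
Definition dramp (x : R) : R := - (2 * Num.max x 0) * ramp x ^+ 2.

Lemma ramp_bound x : 0 < ramp x <= 1.
Proof.
have h : 0 <= (Num.max x 0) ^+ 2 by exact: sqr_ge0.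
rewrite /ramp invr_gt0; apply/andP; split; first lra.
by rewrite invf_le1; lra.
Qed.

Lemma ramp_pos (x : R) : 0 < 1 + (Num.max x 0) ^+ 2.
Proof. have h := sqr_ge0 (Num.max x 0); lra. Qed.

Lemma ramp_lip x d : `|ramp (x + d) - ramp x| <= `|d|.
Proof.
rewrite /ramp; set y : R := Num.max x 0; set y' : R := Num.max (x + d) 0.
have hp := ramp_pos x; have hp' := ramp_pos (x + d); rewrite -/y -/y' in hp hp'.
have yd : `|y' - y| <= `|d|. rewrite /y' /y; rewrite ler_norml; have := ler_norm d; have := ler_norm (- d); rewrite normrN.
  by rewrite /Num.max; case: ltP => ?; case: ltP => ?; lra.
have -> : (1 + y' ^+ 2)^-1 - (1 + y ^+ 2)^-1 =
  (y - y') * ((y + y') / ((1 + y ^+ 2) * (1 + y' ^+ 2))) by field; apply/andP; split; exact: lt0r_neq0.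
rewrite normrM distrC -[leRHS]mulr1; apply: ler_pM => //.
have y0 : 0 <= y by rewrite /y le_max lexx orbT.
have y0' : 0 <= y' by rewrite /y' le_max lexx orbT.
rewrite ger0_norm; last by apply: divr_ge0; [lra|apply: mulr_ge0; lra].
rewrite ler_pdivrMr ?mulr_gt0// mul1r.
have := sqr_ge0 (y - 1); have := sqr_ge0 (y' - 1); have := sqr_ge0 (y * y').
rewrite !expr2; nra.
Qed.

Lemma dramp_bound x : `|dramp x| <= 1.
Proof.
rewrite /dramp normrM normrN /ramp; set y : R := Num.max x 0.
have hp := ramp_pos x; rewrite -/y in hp.
have y0 : 0 <= y by rewrite /y le_max lexx orbT.
rewrite !ger0_norm ?exprn_ge0 ?invr_ge0; try lra.
rewrite exprVn ler_pdivrMr ?exprn_gt0// mul1r.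
have := sqr_ge0 (y - 1); have := sqr_ge0 y; rewrite !expr2; nra.
Qed.

(** The squared positive part has a first-order remainder [rho] between 0 and [d ^+ 2]. The error is
    minus [rho] times a factor in [0, 1], plus the square of the increment of the positive part
    times a factor in [0, 2]. *)
Lemma ramp_expand x d : `|ramp (x + d) - ramp x - dramp x * d| <= 3 * d ^+ 2.
Proof.
rewrite /dramp /ramp; set y : R := Num.max x 0; set y' : R := Num.max (x + d) 0.
have hp := ramp_pos x; have hp' := ramp_pos (x + d); rewrite -/y -/y' in hp hp'.

pose rho := y' ^+ 2 - y ^+ 2 - 2 * y * d.
have rho0 : 0 <= rho <= d ^+ 2. rewrite /rho /y' /y /Num.max !expr2; case: ltP => ?; case: ltP => ?; nra.
have yd : (y' - y) ^+ 2 <= d ^+ 2. rewrite -sqr_abs -[d ^+ 2]sqr_abs; apply: lerXn2r; rewrite//.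
  rewrite /y' /y; rewrite ler_norml; have := ler_norm d; have := ler_norm (- d); rewrite normrN.
  by rewrite /Num.max; case: ltP => ?; case: ltP => ?; lra.
have -> : (1 + y' ^+ 2)^-1 - (1 + y ^+ 2)^-1 - - (2 * y) * (1 + y ^+ 2)^-1 ^+ 2 * d =
  - (rho / (1 + y ^+ 2) ^+ 2) + (y' - y) ^+ 2 * ((y' + y) ^+ 2 / ((1 + y ^+ 2) ^+ 2 * (1 + y' ^+ 2))).
  by rewrite /rho; field; apply/andP; split; exact: lt0r_neq0.
have h1 : 0 <= rho / (1 + y ^+ 2) ^+ 2 <= d ^+ 2. case/andP: rho0 => r1 r2; rewrite divr_ge0 ?exprn_ge0 ?(ltW hp)//=.
  rewrite ler_pdivrMr ?exprn_gt0//; apply: le_trans r2 _. rewrite ler_peMr//; have := sqr_ge0 y; rewrite !expr2; nra.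
have h2 : 0 <= (y' + y) ^+ 2 / ((1 + y ^+ 2) ^+ 2 * (1 + y' ^+ 2)) <= 2.
  have p2 : 0 < (1 + y ^+ 2) ^+ 2 * (1 + y' ^+ 2) by rewrite mulr_gt0// exprn_gt0.
  rewrite divr_ge0 ?sqr_ge0 ?(ltW p2)//= ler_pdivrMr// {p2}. have a0 := sqr_ge0 y; have b0 := sqr_ge0 y'.
  have : (y' + y) ^+ 2 <= 2 * y' ^+ 2 + 2 * y ^+ 2 by exact: sqrD_le.
  rewrite [(1 + _) ^+ 2]expr2; move: a0 b0; set a := y ^+ 2; set b := y' ^+ 2.
  move=> a0 b0; have ab := mulr_ge0 a0 b0; have aa := mulr_ge0 a0 a0; have aab := mulr_ge0 aa b0. by nra.
have h3 : 0 <= (y' - y) ^+ 2 * ((y' + y) ^+ 2 / ((1 + y ^+ 2) ^+ 2 * (1 + y' ^+ 2))) <= d ^+ 2 * 2.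
  case/andP: h2 => h21 h22; rewrite mulr_ge0 ?sqr_ge0//=. by apply: ler_pM => //; exact: sqr_ge0.
by rewrite ler_norml; case/andP: h1 => ? ?; case/andP: h3 => ? ?; lra.
Qed.

Lemma ramp_meas : mfunT ramp.
Proof.
rewrite (_ : ramp = (fun x => expR (- ln (1 + (Num.max x 0) ^+ 2)))); last first.
  by apply/funext => x; rewrite expRN lnK// posrE ramp_pos.
apply: mfun_comp => //; apply: mfun_comp => //; apply: mfun_comp => //.
apply: mfunD => //; apply: mfunX; exact: measurable_maxr.
Qed.

Lemma dramp_meas : mfunT dramp.
Proof.
apply: mfunM; last by apply: mfunX; exact: ramp_meas.
by apply: mfun_comp => //; apply: mfunM => //; exact: measurable_maxr.
Qed.

Lemma ramp_cvg (x : R) : ramp (n%:R * x) @[n --> \oo] --> ((x <= 0)%R%:R : R).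
Proof.
case: (lerP x 0) => x0 /=. have -> : (fun n : nat => ramp (n%:R * x)) = cst 1.
    apply/funext => n; rewrite /ramp /cst max_r; last by rewrite mulr_ge0_le0. by rewrite expr2 mulr0 addr0 invr1.
  exact: cvg_cst.
apply/cvgrPdist_lt => e e0.
near=> n.
rewrite sub0r normrN /ramp max_l; last by rewrite mulr_ge0 ?(ltW x0).
rewrite ger0_norm ?invr_ge0; last by have := sqr_ge0 (n%:R * x); lra.
have n1 : 1 < n%:R :> R by near: n; exact: nbhs_infty_gtr.
have n2 : (x ^+ 2 * e)^-1 < n%:R :> R by near: n; exact: nbhs_infty_gtr.
have xe : 0 < x ^+ 2 * e by rewrite mulr_gt0 ?exprn_gt0.
rewrite invf_plt ?posrE//; last by have := sqr_ge0 (n%:R * x); lra.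
have h : e^-1 < n%:R * x ^+ 2. rewrite -(@ltr_pM2r _ (x ^+ 2 * e)) // mulVf ?gt_eqF// in n2.
  by rewrite -(@ltr_pM2r _ e)// mulVf ?gt_eqF// -mulrA.
rewrite exprMn; have x2 : 0 < x ^+ 2 by rewrite exprn_gt0.
apply: lt_le_trans h _; rewrite [n%:R ^+ 2]expr2.

rewrite -[leLHS]mul1r -mulrA -[leLHS]add0r lerD// ler_pM2r ?ltW// mulr_gt0//; lra.
Unshelve. all: by end_near.
Qed.

Section Product.
Context {I : finType}.
Variables (F F' a d : I -> R) (B : R).
Hypotheses (F1 : forall i, `|F i| <= 1) (F1' : forall i, `|F' i| <= 1).
Hypothesis Fl : forall i, `|F' i - F i| <= `|d i|.
Hypothesis Fe : forall i, `|F' i - F i - a i * d i| <= 3 * d i ^+ 2.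
Hypothesis dB : forall i j, `|d i| * `|d j| <= B.

(** By the product rule, the coefficient of [d i] in the first-order expansion of the product of the
    [F k] over the list, when [a i] is the derivative of factor [i]. *)
Fixpoint prodcf (F a : I -> R) (l : seq I) (i : I) : R :=
  if l is j :: l' then (i == j)%:R * a j * \prod_(k <- l') F k + F j * prodcf F a l' i else 0.

Lemma prod_le1 (G : I -> R) (l : seq I) : (forall i, `|G i| <= 1) -> `|\prod_(k <- l) G k| <= 1.
Proof.
move=> h; elim: l => [|j l ih]; first by rewrite big_nil normr1.
by rewrite big_cons normrM; apply: mulr_ile1.
Qed.

Lemma prodcf_bound (G b : I -> R) (l : seq I) i : (forall i, `|G i| <= 1) -> (forall i, `|b i| <= 1) ->
  `|prodcf G b l i| <= (size l)%:R.
Proof.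
move=> h hb; elim: l => [|j l ih] /=; first by rewrite normr0.
rewrite -[(size l).+1]addn1 natrD [leRHS]addrC; apply: le_trans (ler_normD _ _) _; apply: lerD.
  rewrite normrM mulr_ile1//; last exact: prod_le1. by rewrite normrM mulr_ile1//; case: (_ == _); rewrite ?normr1 ?normr0.
by rewrite normrM -[leRHS]mul1r; apply: ler_pM.
Qed.

Lemma prod_lip (l : seq I) : `|\prod_(k <- l) F' k - \prod_(k <- l) F k| <= \sum_(k <- l) `|d k|.
Proof.
elim: l => [|j l ih]; first by rewrite !big_nil subrr normr0.
rewrite !big_cons.
have -> : F' j * \prod_(k <- l) F' k - F j * \prod_(k <- l) F k =
  (F' j - F j) * \prod_(k <- l) F' k + F j * (\prod_(k <- l) F' k - \prod_(k <- l) F k) by ring.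
apply: le_trans (ler_normD _ _) _; rewrite !normrM; apply: lerD.
  by rewrite -[leRHS]mulr1; apply: ler_pM => //; exact: prod_le1.
by rewrite -[leRHS]mul1r; apply: ler_pM.
Qed.

(** Each new factor contributes [3 * B] from its own remainder and, as a cross term, its increment
    times the Lipschitz bound of the remaining product, at most the length of the list times [B]. *)
Lemma prod_expand (l : seq I) :
  `|\prod_(k <- l) F' k - \prod_(k <- l) F k - \sum_i prodcf F a l i * d i| <=
  (size l)%:R * (3 + (size l)%:R) * B.
Proof.
elim: l => [|j l ih]. by rewrite !big_nil subrr sub0r normrN mul0r mul0r big1 ?normr0// => i _; rewrite mul0r.
have B0 : 0 <= B by apply: le_trans (dB j j); rewrite mulr_ge0.
rewrite !big_cons.
have -> : \sum_i prodcf F a (j :: l) i * d i = a j * d j * \prod_(k <- l) F k + F j * \sum_i prodcf F a l i * d i.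
  rewrite mulr_sumr; transitivity (\sum_i ((i == j)%:R * a j * \prod_(k <- l) F k * d i
     + F j * (prodcf F a l i * d i))). by apply: eq_bigr => i _ /=; ring. rewrite big_split/=; congr (_ + _).
  rewrite (bigD1 j)//= eqxx [X in _ + X]big1 ?addr0; last by move=> i ij; rewrite (negPf ij) !mul0r. by rewrite mulr1n; ring.
have -> : forall x y : R, F' j * x - F j * y - (a j * d j * y + F j * \sum_i prodcf F a l i * d i) =
  F j * (x - y - \sum_i prodcf F a l i * d i) + (F' j - F j - a j * d j) * y + (F' j - F j) * (x - y). by move=> x y; ring.
have h1 : `|F j * (\prod_(k <- l) F' k - \prod_(k <- l) F k - \sum_i prodcf F a l i * d i)| <=
   (size l)%:R * (3 + (size l)%:R) * B. by rewrite normrM -[leRHS]mul1r; apply: ler_pM.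
have h2 : `|(F' j - F j - a j * d j) * \prod_(k <- l) F k| <= 3 * B.
  rewrite normrM -[leRHS]mulr1; apply: ler_pM => //; last exact: prod_le1. apply: le_trans (Fe j) _; rewrite ler_pM2l//.
  by rewrite -sqr_abs expr2.
have h3 : `|(F' j - F j) * (\prod_(k <- l) F' k - \prod_(k <- l) F k)| <= (size l)%:R * B.
  rewrite normrM; apply: le_trans (_ : `|d j| * \sum_(k <- l) `|d k| <= _). by apply: ler_pM => //; exact: prod_lip.
  rewrite mulr_sumr; elim: (l) => [|k l' ih'] /=; first by rewrite big_nil mul0r.
  by rewrite big_cons -[(size l').+1]addn1 natrD mulrDl mul1r [leRHS]addrC; apply: lerD.
apply: le_trans (ler_normD _ _) _; apply: le_trans (lerD (ler_normD _ _) h3) _.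
apply: le_trans (lerD (lerD h1 h2) (lexx _)) _.
rewrite /= -[(size l).+1]addn1 natrD; have := ler0n R (size l); nra.
Qed.
End Product.

Section Count.
Context {K : finType}.
Variable Psi : (K -> R) -> R.
Hypothesis Psi01 : forall c, 0 <= Psi c <= 1.

(** A vector of natural numbers is zero, a unit vector, or has total at least 2. In the first two
    cases the expansion is exact; in the third [N ^+ 2 - N] absorbs the crude bound [1 + N]. This
    second factorial power is the right error: over a short interval its mean square is of second
    order in the length, whereas that of [N ^+ 2] is only of first order. *)
Lemma count_expand (c : K -> R) (v : K -> nat) :
  let N := (\sum_k (v k)%:R : R) in
  `|Psi (fun k => c k + (v k)%:R) - Psi c| <= N /\
  `|Psi (fun k => c k + (v k)%:R) - Psi c
     - \sum_k (Psi (fun j => c j + (j == k)%:R) - Psi c) * (v k)%:R| <= 2 * (N ^+ 2 - N).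
Proof.
move=> N; set D := Psi _ - Psi c.
have Dle c1 c2 : `|Psi c1 - Psi c2| <= 1.
  by have := Psi01 c1; have := Psi01 c2; rewrite ler_norml => /andP[? ?] /andP[? ?]; lra.
pose n := (\sum_k v k)%N.
have Nn : N = n%:R by rewrite /N /n natr_sum.
have [n0|[n1|n2]] : n = 0%N \/ n = 1%N \/ (2 <= n)%N by move: (n) => [|[|k]]; auto.
- have v0 k : v k = 0%N. by apply/eqP; move: n0 => /eqP; rewrite /n sum_nat_eq0 => /forallP /(_ k). have -> : D = 0.
    by rewrite /D (_ : (fun k => _) = c) ?subrr//; apply/funext => k; rewrite v0 addr0.
  rewrite Nn n0 big1; last by move=> k _; rewrite v0 mulr0. by rewrite subrr normr0 expr2 mulr0 subrr mulr0.
- have [k0 [vk0 vk]] : exists k0, v k0 = 1%N /\ forall k, k != k0 -> v k = 0%N. have : exists k0, v k0 != 0%N.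
      apply/existsP; apply: contra_eqT n1; rewrite negb_exists => /forallP h.
      by rewrite /n big1// => k _; apply/eqP; move: (h k); rewrite negbK.
    move=> [k0 hk0]; exists k0; move: n1; rewrite /n (bigD1 k0)//=. case: (v k0) hk0 => [//|[|j]] _.
      move=> /eqP; rewrite eqSS => /eqP /eqP; rewrite -/(nat_of_bool _).
      rewrite sum_nat_eq0 => /forallP h; split => // k kk; apply/eqP. by have /implyP := h k; apply.
    by move=> /eqP; rewrite addSn eqSS addSn. have E : (fun k => c k + (v k)%:R) = (fun j => c j + (j == k0)%:R).
    apply/funext => k; have [->|kk] := eqVneq k k0; first by rewrite vk0. by rewrite vk.
  rewrite Nn n1; split; first exact: Dle. rewrite (bigD1 k0)//= big1; last by move=> k kk; rewrite vk// mulr0.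
  by rewrite addr0 vk0 mulr1 /D E subrr normr0 expr1n subrr mulr0.
have N2 : 2 <= N by rewrite Nn ler_nat.
split; first by apply: le_trans (Dle _ _) _; lra.
have h : `|\sum_k (Psi (fun j => c j + (j == k)%:R) - Psi c) * (v k)%:R| <= N.
  apply: le_trans (ler_norm_sum _ _ _) _; apply: ler_sum => k _. by rewrite normrM normr_nat ler_piMl.
have h' := Dle (fun k => c k + (v k)%:R) c; rewrite -/D in h'.
apply: le_trans (ler_normB _ _) _; rewrite expr2; nra.
Qed.
End Count.

End Expansion.

(** * Averaging out an independent argument *)

Section CondIndep.
Context {R : realType} {d d1 d2} {T : measurableType d}
  {T1 : measurableType d1} {T2 : measurableType d2}.
Variable P : probability T R.

Lemma Ex_snd_bounded (Y : T -> T2) (phi : T1 * T2 -> R) (k : R) :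
  mfunT Y -> mfunT phi ->
  (forall z, `|phi z| <= k) ->
  mfunT (fun x => Ex P (fun v => phi (x, Y v))).
Proof.
move=> mY mphi phik.
have phik0 z : (0 <= (phi z + k)%:E)%E. by rewrite lee_fin; have := phik z; rewrite ler_norml => /andP[]; lra.
have L1w x : L1 P (fun v => phi (x, Y v)). apply: (L1_le _ (L1_cst P k)) => //. by apply: mfun_comp; apply: mfun_comp.
have -> : (fun x => Ex P (fun v => phi (x, Y v))) = (fun x => fine (\int[P]_v (phi (x, Y v) + k)%:E)%E - k).
  apply/funext => x; have := ge0_ExE (L1D (L1w x) (L1_cst P k)). by move=> <-; rewrite ExD ?Ex_cst ?addrK//; exact: L1_cst.
apply: mfunB => //; apply: mfun_comp => //.
apply: (measurable_Ex_snd _ mY (phi := fun z => (phi z + k)%:E)) => //.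
by apply/measurable_EFinP; apply: mfunD.
Qed.

(** The conditional expectation of [phi (X, Y)] given [X] is the average over [Y] alone, tested here
    against functions of [X]; signs of [Z] are handled by its positive and negative parts. *)
Lemma indep_bounded_mul (X : T -> T1) (Y : T -> T2) (phi : T1 * T2 -> R) (Z : T1 -> R) :
  mfunT X -> mfunT Y -> indep_maps P X Y ->
  mfunT phi -> (forall z, 0 <= phi z <= 1) ->
  mfunT Z -> L1 P (Z \o X) ->
  Ex P (fun w => phi (X w, Y w) * Z (X w)) =
  Ex P (fun w => Ex P (fun v => phi (X w, Y v)) * Z (X w)).
Proof.
move=> mX mY ind mphi phi01 mZ LZ.
have phi1 z : `|phi z| <= 1 by have /andP[h1 h2] := phi01 z; rewrite ger0_norm.
have mphiw x : mfunT (fun v => phi (x, Y v)). by apply: mfun_comp; apply: mfun_comp.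
have Lphi x : L1 P (fun v => phi (x, Y v)). exact: (L1_le _ (L1_cst P 1)).
have mV := Ex_snd_bounded mY mphi phi1.
have mphid : mfunT (fun w => phi (X w, Y w)). by apply: mfun_comp => //; exact: measurable_fun_pair.
have V01 x : 0 <= Ex P (fun v => phi (x, Y v)) <= 1.
  apply/andP; split; first by apply: Ex_ge0 => v; have /andP[] := phi01 (x, Y v).
  rewrite -[leRHS](Ex_cst P); apply: Ex_le => //; first exact: L1_cst. by move=> v; have /andP[] := phi01 (x, Y v).
have V1 x : `|Ex P (fun v => phi (x, Y v))| <= 1 by have /andP[h1 h2] := V01 x; rewrite ger0_norm.
have mVX : mfunT (fun w => Ex P (fun v => phi (X w, Y v))). exact: (mfun_comp mV mX).
have main (F : T1 -> R) : mfunT F -> L1 P (F \o X) -> (forall x, 0 <= F x) ->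
  Ex P (fun w => phi (X w, Y w) * F (X w)) = Ex P (fun w => Ex P (fun v => phi (X w, Y v)) * F (X w)). move=> mF LF F0.
  have l1 : L1 P (fun w => phi (X w, Y w) * F (X w)). exact: (L1M_bounded mphid _ LF) => w; exact: phi1.
  have l2 : L1 P (fun w => Ex P (fun v => phi (X w, Y v)) * F (X w)). exact: (L1M_bounded mVX _ LF) => w; exact: V1.
  apply: EFin_inj; rewrite !ge0_ExE//. have -> : (fun w => (phi (X w, Y w) * F (X w))%:E) =
            (fun w => (fun z => (phi z * F z.1)%:E) (X w, Y w)) by [].
  rewrite (indep_tonelli mX mY ind (phi := fun z => (phi z * F z.1)%:E)).
  - apply: eq_integral => w _ /=; rewrite -ge0_ExE. by congr EFin; rewrite mulrC -ExZ//; apply: Ex_eq => v; rewrite mulrC.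
    by apply: (L1_le _ (L1Z (F (X w)) (Lphi (X w)))) => [|v];
      [exact: mfunM|rewrite ger0_norm ?mulr_ge0 1?mulrC; have /andP[] := phi01 (X w, Y v)].
  - apply/measurable_EFinP; apply: mfunM => //. exact: mfun_comp.
  - by move=> z; rewrite lee_fin mulr_ge0; have /andP[] := phi01 z.
pose Zp x := Num.max (Z x) 0; pose Zn x := Num.max (- Z x) 0.
have mp : mfunT Zp by exact: measurable_maxr.
have mn : mfunT Zn. by apply: measurable_maxr => //; exact: mfun_comp.
have Zpn x : Z x = Zp x - Zn x. by rewrite /Zp /Zn /Num.max; case: ltP => ?; case: ltP => ?; lra.
have labs : L1 P (fun w => `|Z (X w)|). by move: LZ => /integrable_norm.
have lp : L1 P (Zp \o X). apply: (L1_le _ labs) => [|w] /=; first exact: mfun_comp.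
  rewrite /Zp ger0_norm ?le_max ?lexx ?orbT// ge_max normr_ge0 andbT; exact: ler_norm.
have ln : L1 P (Zn \o X). apply: (L1_le _ labs) => [|w] /=; first exact: mfun_comp.
  rewrite /Zn ger0_norm ?le_max ?lexx ?orbT// ge_max normr_ge0 andbT -normrN; exact: ler_norm.
transitivity (Ex P (fun w => phi (X w, Y w) * Zp (X w)) - Ex P (fun w => phi (X w, Y w) * Zn (X w))).
  rewrite -ExB; last 2 first. exact: (L1M_bounded mphid _ lp) => w; exact: phi1.
    exact: (L1M_bounded mphid _ ln) => w; exact: phi1. by apply: Ex_eq => w; rewrite -mulrBr -Zpn.
rewrite !main//; last 2 first. by move=> x; rewrite /Zn le_max lexx orbT. by move=> x; rewrite /Zp le_max lexx orbT.
rewrite -ExB; last 2 first. exact: (L1M_bounded mVX _ lp) => w; exact: V1. exact: (L1M_bounded mVX _ ln) => w; exact: V1.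
by apply: Ex_eq => w; rewrite -mulrBr -Zpn.
Qed.
End CondIndep.

Lemma meas_if_set d d' (T : measurableType d) (U : measurableType d') (Q : set T) (f g : T -> U) :
  measurable Q -> mfunT f -> mfunT g ->
  mfunT (fun y => if y \in Q then f y else g y).
Proof.
move=> mQ mf mg _ B mB; rewrite setTI.
rewrite (_ : _ @^-1` _ = (Q `&` f @^-1` B) `|` (~` Q `&` g @^-1` B)).
  apply: measurableU; apply: measurableI => //; first by rewrite -[X in measurable X]setTI; exact: mf.
    exact: measurableC. by rewrite -[X in measurable X]setTI; exact: mg.
apply/seteqP; split => y /=.
  by case: ifPn => [/set_mem h1 h2|/negP h1 h2]; [left|right; split => // h; apply: h1; exact/mem_set].
by move=> [[h1 h2]|[h1 h2]]; [rewrite mem_set|rewrite memNset].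
Qed.

(** * Lifting sets and functions along the diagonal *)

Section LiftAbstract.
Context {R : realType} {d} {T : measurableType d}.
Variable P : probability T R.
Context {I X : Type} {dY} {Y : measurableType dY}.
Variables (VP : set I) (phi : I -> T -> X) (psi : I -> T -> Y).

(** [psi v w] will be the diagonal point over [phi v w]. The parameter [v] is a time (or trivial),
    and the null set of [w] must serve all [v] at once, since it is later used for whole paths. *)
Definition lifts (A : set X) (B : set Y) :=
  measurable B /\ {ae P, forall w, forall v, VP v -> (A (phi v w) <-> B (psi v w))}.

(** Countable operations merge countably many null sets into one, so the sets that lift form a
    sigma-algebra on [D]. *)
Lemma lifts_sigma (D : set X) (G : set (set X)) :
  (exists B, lifts D B) -> (forall A, G A -> exists B, lifts A B) ->
  forall A, <<s D, G >> A -> exists B, lifts A B.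
Proof.
move=> [BD [mBD lBD]] hG; apply: smallest_sub; last exact: hG.
split.
- by exists set0; split => //; exact: aeW.
- move=> A [B [mB lB]]; exists (BD `\` B); split; first exact: measurableD.
  apply: filterS2 lBD lB => w h1 h2 v Vv; have e1 := h1 v Vv; have e2 := h2 v Vv.
  by split => -[a1 a2]; split; [exact/e1|move=> /e2|exact/e1|move=> /e2].
move=> F /choice[B hB]; exists (\bigcup_n B n); split. by apply: bigcupT_measurable => n; have [] := hB n.
have : {ae P, forall w, forall n v, VP v -> (F n (phi v w) <-> B n (psi v w))}. by apply/ae_foralln => n; have [] := hB n.
apply: filterS => w h v Vv; split => -[n _ hn]; exists n => //; exact/(h n v Vv).
Qed.

(** The lift is the infimum of the rationals [q] whose lifted sublevel set contains the point, the
    value being [+oo] for the others; only countably many sets are lifted, so one null set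
    suffices. *)
Lemma lifts_fun (D : set X) (f : X -> R) :
  (forall c : R, exists B, lifts [set x | D x /\ f x < c] B) ->
  exists f' : Y -> R, mfunT f' /\
   {ae P, forall w, forall v, VP v -> D (phi v w) -> f (phi v w) = f' (psi v w)}.
Proof.
move=> h.
have [Q hQ] := choice (fun q : rat => h (ratr q)).
pose F (n : nat) (y : Y) : \bar R := if @unpickle rat n is Some q then (if y \in Q q then (ratr q)%:E else +oo%E) else +oo%E.
pose f' y := fine (einfs (F^~ y) 0%N).
exists f'; split. apply: mfun_comp => //; apply: measurable_fun_einfs => n.
  rewrite /F; case: (unpickle n) => [q|]; last exact: measurable_cst. by apply: meas_if_set; have [] := hQ q.
have : {ae P, forall w, forall n, forall v, VP v -> if @unpickle rat n is Some q then
   ((D (phi v w) /\ f (phi v w) < ratr q) <-> Q q (psi v w)) else True}.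
  apply/ae_foralln => n; case: (unpickle n) => [q|]; last exact: aeW. by have [] := hQ q.
move: h => _ H; apply: filterS H => w hw v Vv Dv.
have h q : (f (phi v w) < ratr q) <-> Q q (psi v w).
  have := hw (pickle q) v Vv; rewrite pickleK => hh; split => [a|b]; first exact/hh. by have [] := hh.2 b.
suff -> : f' (psi v w) = fine ((f (phi v w))%:E) by [].
congr fine; rewrite /einfs /=; apply/eqP; rewrite eq_le; apply/andP; split. apply/lee_addgt0Pr => e e0.
  have [q] : exists q : rat, ratr q \in `](f (phi v w)), (f (phi v w) + e)[. by apply: rat_in_itvoo; rewrite ltrDl.
  rewrite in_itv/= => /andP[q1 q2]. apply: (@le_trans _ _ (ratr q)%:E); last by rewrite -EFinD lee_fin ltW.
  apply: ereal_inf_lbound; exists (pickle q) => //=. by rewrite /F pickleK mem_set//; exact/h.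
apply: le_ereal_inf_tmp => _ [n _ <-]; rewrite /F; case: (unpickle n) => [q|]; last exact: leey.
case: ifPn => [/set_mem /h|_]; last exact: leey.
by rewrite lee_fin => /ltW.
Qed.
End LiftAbstract.

Section SigmaD.
Context {X : Type}.
Variables (D : set X) (G : set (set X)).

Lemma sigma_diff A B : A `<=` D -> <<s D, G >> A -> <<s D, G >> B -> <<s D, G >> (A `\` B).
Proof.
move=> AD sA sB.
have [h0 hC hU] := smallest_sigma_algebra D G.
rewrite (_ : A `\` B = D `\` \bigcup_n (if n is 0%N then D `\` A else B)).
  by apply: (hC); apply: (hU) => -[|n]; [exact: (hC)|].
apply/seteqP; split => x. move=> [Ax nB]; split; first exact: AD. by move=> [[|n] _] //= [_ /(_ Ax)].
move=> [Dx h]; split. by apply: contrapT => nA; apply: h; exists 0%N.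
by move=> Bx; apply: h; exists 1%N.
Qed.

Lemma sigma_union A B : <<s D, G >> A -> <<s D, G >> B -> <<s D, G >> (A `|` B).
Proof.
move=> sA sB; have [h0 hC hU] := smallest_sigma_algebra D G.
rewrite (_ : A `|` B = \bigcup_n (if n is 0%N then A else B)). by apply: (hU) => -[|n].
apply/seteqP; split => x; first by move=> [h|h]; [exists 0%N|exists 1%N].
by move=> [[|n] _ h]; [left|right].
Qed.
End SigmaD.

(** * Cadlag paths recovered from a countable grid *)

Section Path.
Context {R : realType}.

Definition einv (n : nat) : R := n.+1%:R^-1.

Lemma einv_gt0 n : 0 < einv n.
Proof. by rewrite /einv. Qed.

Lemma osc_cvg (I : Type) (F : set_system I) (FF : ProperFilter F) (f : I -> R) :
  (forall e, 0 < e -> exists2 A, F A & forall x y, A x -> A y -> `|f x - f y| <= e) ->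
  cvg (f @ F).
Proof.
move=> h; apply/cauchy_cvgP/cauchy_ballP => e e0.
have [|A FA hA] := h (e / 2); first by rewrite divr_gt0.
have FA' : F (f @^-1` (f @` A)) by apply: filterS FA => i Ai; exists i.
exists (f @` A, f @` A) => //.
move=> [_ _] [[x Ax <-] [y Ay <-]].
by rewrite /ball /= (le_lt_trans (hA x y Ax Ay))// ltr_pdivrMr// mulr_natr mulr2n ltrDl.
Qed.

Variables t T : R.
Hypothesis tT : t < T.

Local Notation K := (nat * nat)%type.
Definition pnt (k : K) : R := upg t T k.1 k.2.
(** An index whose grid point is [T]: at mesh 1 the point following [T - t] is cut off at the
    horizon. *)
Definition kT : K := (0%N, Num.truncn (T - t)).

Lemma pntP k : t <= pnt k <= T. Proof. exact: upgP (ltW tT) _ _. Qed.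

Lemma pnt_kT : pnt kT = T.
Proof.
rewrite /pnt /upg min_l// divr1 addrC -lerBlDr; exact: ltW (truncnS_gt _).
Qed.

(** Countably many conditions on values at grid points, which hold exactly for traces of cadlag
    paths: among three close points one of the two consecutive increments is small (the Skorokhod
    modulus that allows one jump), right-continuity at grid points, and consistency when two indices
    name the same time. Being countable, they define a measurable event. *)
Definition good (g : K -> R) :=
  [/\ forall e, exists m, forall k1 k2 k3, pnt k1 < pnt k2 -> pnt k2 < pnt k3 ->
        pnt k3 < pnt k1 + einv m ->
        `|g k2 - g k1| <= einv e \/ `|g k3 - g k2| <= einv e,
      forall k e, pnt k < T -> exists m, forall k', pnt k <= pnt k' ->
        pnt k' < pnt k + einv m -> `|g k' - g k| <= einv e &
      forall k k', pnt k = pnt k' -> g k = g k'].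

Definition cadl (x : R -> R) :=
  (forall s, t <= s < T -> x v @[v --> s^'+] --> x s) /\
  (forall s, t < s <= T -> cvg (x v @[v --> s^'-])).

Lemma inv_lt (d : R) : 0 < d -> exists m : nat, einv m < d.
Proof.
move=> d0; have [n _ /(_ n (leqnn n)) /= hn] := near_infty_natSinv_lt (PosNum d0).
by exists n.
Qed.

Lemma cadl_right x s e : cadl x -> t <= s < T -> 0 < e ->
  exists2 d, 0 < d & forall v, s <= v < s + d -> `|x v - x s| <= e.
Proof.
move=> [rc _] sT e0; have /cvgrPdist_le /(_ e e0) := rc s sT.
move=> [d /= d0 h]; exists d => // v; rewrite le_eqVlt => /andP[/predU1P[<-|sv] vd]. by rewrite subrr normr0 ltW.
rewrite distrC; apply: h => //=; rewrite distrC ger0_norm ?(ltW sv); lra.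
Qed.

Lemma cadl_osc x s e : cadl x -> t <= s <= T -> 0 < e -> exists2 d, 0 < d &
  (forall v v', s <= v < s + d -> s <= v' < s + d -> v <= T -> v' <= T -> `|x v - x v'| <= e) /\
  (forall v v', s - d < v < s -> s - d < v' < s -> t <= v -> t <= v' -> `|x v - x v'| <= e).
Proof.
move=> cx /andP[ts sT] e0.
have e2 : 0 < e / 2 by rewrite divr_gt0.
have tri (a b c : R) : `|a - c| <= e / 2 -> `|b - c| <= e / 2 -> `|a - b| <= e.
  move=> h1 h2; have -> : a - b = (a - c) - (b - c) by ring. by apply: le_trans (ler_normB _ _) _; lra.
have [d1 d10 h1] : exists2 d, 0 < d & forall v v', s <= v < s + d -> s <= v' < s + d -> v <= T -> v' <= T -> `|x v - x v'| <= e.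
  move: sT; rewrite le_eqVlt => /predU1P[->|sT]. exists 1 => // v v' /andP[a1 _] /andP[a2 _] a3 a4.
    have -> : v = v' by apply: le_anti; apply/andP; split; [apply: le_trans a2|apply: le_trans a1].
    by rewrite subrr normr0 ltW. have sT' : t <= s < T by rewrite ts sT. have [d d0 h] := cadl_right cx sT' e2.
  by exists d => // v v' a1 a2 _ _; apply: (tri _ _ (x s)); exact: h.
have [d2 d20 h2] : exists2 d, 0 < d & forall v v', s - d < v < s -> s - d < v' < s -> t <= v -> t <= v' -> `|x v - x v'| <= e.
  move: ts; rewrite le_eqVlt => /predU1P[<-|ts]. by exists 1 => // v v' /andP[_ a1] _ a2; move: a1; rewrite ltNge a2.
  have sT' : t < s <= T by rewrite ts sT. have /cvgrPdist_le /(_ _ e2) [d /= d0 h] := cx.2 s sT'.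
  exists d => // v v' /andP[a1 a2] /andP[a3 a4] _ _.
  apply: (tri _ _ (lim (x v @[v --> s^'-]))); rewrite distrC; apply: h => //=; rewrite ger0_norm ?subr_ge0 ?ltW//; lra.
exists (Num.min d1 d2); first by rewrite lt_min d10 d20.
split => v v' /andP[a1 a2] /andP[a3 a4] a5 a6.
  by apply: h1 => //; rewrite ?a1 ?a3/=; [apply: lt_le_trans a2 _|apply: lt_le_trans a4 _]; rewrite lerD2l ge_min lexx.
by apply: h2 => //; rewrite ?a2 ?a4 andbT; [apply: le_lt_trans a1|apply: le_lt_trans a3];
  rewrite lerD2l lerN2 ge_min lexx orbT.
Qed.

Lemma cadl_bounded x : cadl x -> exists M, forall v, t <= v <= T -> `|x v| <= M.
Proof.
move=> cx.
have cpt := (compact_near_coveringP `[t, T]).1 (@segment_compact R t T).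
have h : \forall M \near +oo, `[t, T] `<=` (fun v => t <= v <= T -> `|x v| <= M).
  apply: (cpt R _ (fun M v => t <= v <= T -> `|x v| <= M)) => s /=.
  rewrite in_itv /= => st; have [d d0 [h1 h2]] := cadl_osc cx st ltr01. pose p0 := Num.max t (s - d / 2).
  pose B := `|x s| + `|x p0| + 1. exists ([set v | `|s - v| < d / 2], [set M | B < M]) => /=.
    split; first by exists (d / 2) => //=; rewrite divr_gt0. by exists B; split => //; exact: num_real.
  move=> [v M] /= [vs BM] /andP[tv vT]. move: vs; rewrite ltr_norml => /andP[v1 v2].
  have nx := normr_ge0 (x p0); have ns := normr_ge0 (x s). case/andP: st => ts sT; case: (leP s v) => sv.
    have hh : `|x v - x s| <= 1 by apply: h1 => //; rewrite ?sv; lra.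
    have := ler_normD (x v - x s) (x s); rewrite subrK; move: BM; rewrite /B; lra.
  have tp0 : t <= p0 by rewrite le_max lexx. have p0s : s - d < p0 < s.
    apply/andP; split; first by rewrite lt_max; apply/orP; right; lra. by rewrite gt_max (le_lt_trans tv sv); lra.
  have hh : `|x v - x p0| <= 1 by apply: h2 => //; apply/andP; split; lra.
  have := ler_normD (x v - x p0) (x p0); rewrite subrK; move: BM; rewrite /B; lra.
have : \forall M \near +oo, `[t, T] `<=` (fun v => t <= v <= T -> `|x v| <= M) by [].
move=> /filter_ex[M hM]; exists M => v vtT; apply: hM => //=; by rewrite in_itv.
Qed.

(** Each time has a neighbourhood where the path oscillates little on either side separately, and
    compactness makes its size uniform. Of three increasing points in it, the first two or the last
    two lie on one side. *)
Lemma cadl_good x : cadl x -> good (x \o pnt).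
Proof.
move=> cx; split; last by move=> k k' /= ->.
- move=> e; have e0 := einv_gt0 e. have cpt := (compact_near_coveringP `[t, T]).1 (@segment_compact R t T).
  pose Q (d v1 : R) := forall v2 v3, v1 < v2 -> v2 < v3 -> v3 < v1 + d -> t <= v1 -> v3 <= T ->
     `|x v2 - x v1| <= einv e \/ `|x v3 - x v2| <= einv e. have h : \forall d \near 0^'+, `[t, T] `<=` Q d.
    apply: (cpt R _ Q) => s /=. rewrite in_itv /= => st; have [d d0 [h1 h2]] := cadl_osc cx st e0.
    exists ([set v | `|s - v| < d / 2], [set d' | d' < d / 2]) => /=.
      split; first by exists (d / 2) => //=; rewrite divr_gt0. by apply: nbhs_right_lt; rewrite divr_gt0.
    move=> [v1 d'] /= [vs dd] v2 v3 v12 v23 v31 tv vT. move: vs; rewrite ltr_norml => /andP[u1 u2].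
    case: (ltP v2 s) => sv. left; apply: h2; lra. right; apply: h1; lra.
  have : \forall d \near 0^'+, 0 < d /\ `[t, T] `<=` Q d. by near=> d; split; [near: d; exact: nbhs_right_gt|near: d].
  move=> /filter_ex[d [d0 hd]]; have [m md] := inv_lt d0. exists m => k1 k2 k3 k12 k23 k31; apply: (hd (pnt k1)) => //.
  + by rewrite /= in_itv/= pntP.
  + by apply: lt_trans k31 _; rewrite ltrD2l.
  + by have /andP[] := pntP k1.
  + by have /andP[] := pntP k3.
- move=> k e kT'; have e0 := einv_gt0 e. have sT' : t <= pnt k < T by have /andP[-> _] := pntP k.
  have [d d0 h] := cadl_right cx sT' e0. have [m md] := inv_lt d0; exists m => k' kk kk'; apply: h.
  by rewrite kk (lt_trans kk')// ltrD2l.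
Unshelve. all: by end_near. Qed.

Variable g : K -> R.
Hypothesis gg : good g.

(** If the oscillation to the right of [s] did not vanish, every grid point right of [s] would have
    another one, closer to [s], with a value more than [einv e] away. Applied twice this gives three
    close points with two large increments, against the first condition of [good]. *)
Lemma good_right s e : t <= s < T -> exists2 d, 0 < d & forall k k', s < pnt k < s + d ->
  s < pnt k' < s + d -> `|g k - g k'| <= 2 * einv e.
Proof.
move=> sT; apply: contrapT => hn.
have hn' d : 0 < d -> exists k k', [/\ s < pnt k < s + d, s < pnt k' < s + d & 2 * einv e < `|g k - g k'|].
  move=> d0; apply: contrapT => h; apply: hn; exists d => // k k' h1 h2.
  by rewrite leNgt; apply/negP => h3; apply: h; exists k, k'.
have [W _ _] := gg; have [m hm] := W e.
have next k : s < pnt k -> exists k', s < pnt k' < pnt k /\ einv e < `|g k - g k'|.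
  move=> sk; have [|k1 [k2 [a1 a2 a3]]] := hn' (pnt k - s); first by rewrite subr_gt0.
  have E : s + (pnt k - s) = pnt k by ring. rewrite E in a1 a2.
  case: (ltP (einv e) (`|g k - g k1|)) => h; first by exists k1.
  exists k2; split => //; rewrite ltNge; apply/negP => h'. have : `|g k1 - g k2| <= `|g k - g k1| + `|g k - g k2|.
    have -> : g k1 - g k2 = (g k - g k2) - (g k - g k1) by ring. by rewrite [leRHS]addrC; exact: ler_normB. lra.
have m0 := einv_gt0 m.
have [k3 [_ [/andP[b1 b2] _ _]]] := hn' _ m0.
have [k2 [/andP[c1 c2] c3]] := next k3 b1.
have [k1 [/andP[d1 d2] d3]] := next k2 c1.
have [|h|h] := hm k1 k2 k3 d2 c2; first lra. by move: d3; rewrite ltNge h.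
by move: c3; rewrite ltNge h.
Qed.

Lemma good_left s e : t < s <= T -> exists2 d, 0 < d & forall k k', s - d < pnt k < s ->
  s - d < pnt k' < s -> `|g k - g k'| <= 2 * einv e.
Proof.
move=> sT; apply: contrapT => hn.
have hn' d : 0 < d -> exists k k', [/\ s - d < pnt k < s, s - d < pnt k' < s & 2 * einv e < `|g k - g k'|].
  move=> d0; apply: contrapT => h; apply: hn; exists d => // k k' h1 h2.
  by rewrite leNgt; apply/negP => h3; apply: h; exists k, k'.
have [W _ _] := gg; have [m hm] := W e.
have next k : pnt k < s -> exists k', pnt k < pnt k' < s /\ einv e < `|g k' - g k|.
  move=> sk; have [|k1 [k2 [a1 a2 a3]]] := hn' (s - pnt k); first by rewrite subr_gt0.
  have E : s - (s - pnt k) = pnt k by ring. rewrite E in a1 a2.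
  case: (ltP (einv e) (`|g k1 - g k|)) => h; first by exists k1.
  exists k2; split => //; rewrite ltNge; apply/negP => h'. have : `|g k1 - g k2| <= `|g k1 - g k| + `|g k2 - g k|.
    have -> : g k1 - g k2 = (g k1 - g k) - (g k2 - g k) by ring. exact: ler_normB. lra.
have m0 := einv_gt0 m.
have [k1 [_ [/andP[b1 b2] _ _]]] := hn' _ m0.
have [k2 [/andP[c1 c2] c3]] := next k1 b2.
have [k3 [/andP[d1 d2] d3]] := next k2 c2.
have [|h|h] := hm k1 k2 k3 c1 d1; first lra. by move: c3; rewrite ltNge h.
by move: d3; rewrite ltNge h.
Qed.

Definition near_idx (s : R) (j : nat) : K := (j, Num.truncn ((s - t) * j.+1%:R)).

Definition ext (s : R) : R := if s < T then lim (g (near_idx s j) @[j --> \oo]) else g kT.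

Lemma near_idxP s j : t <= s < T -> s < pnt (near_idx s j) <= s + einv j.
Proof. by move=> sT; exact: upg_gt. Qed.

Lemma near_idx_near s d : t <= s < T -> 0 < d -> \forall j \near \oo, s < pnt (near_idx s j) < s + d.
Proof.
move=> sT d0; have := near_infty_natSinv_lt (PosNum d0); apply: filterS => j /= hj.
by have /andP[-> h2] := near_idxP j sT; apply: le_lt_trans h2 _; rewrite ltrD2l.
Qed.

Lemma ext_cvg s : t <= s < T -> g (near_idx s j) @[j --> \oo] --> ext s.
Proof.
move=> sT; rewrite /ext; case/andP: (sT) => _ ->.
apply: osc_cvg => e e0; have [m hm] := inv_lt (divr_gt0 e0 (ltr0Sn _ 1)).
have [d d0 hd] := good_right m sT.
exists [set j | s < pnt (near_idx s j) < s + d]; first exact: near_idx_near.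
move=> i j hi hj; apply: le_trans (hd _ _ hi hj) _; lra.
Qed.

Lemma ext_right s e : t <= s < T -> 0 < e -> exists2 d, 0 < d & forall k, s < pnt k < s + d -> `|g k - ext s| <= e.
Proof.
move=> sT e0; have [m hm] := inv_lt (divr_gt0 e0 (ltr0Sn _ 1)).
have [d d0 hd] := good_right m sT; exists d => // k hk.
have c : `|g k - g (near_idx s j)| @[j --> \oo] --> `|g k - ext s|.
  by apply: cvg_norm; apply: cvgB; [exact: cvg_cst|exact: ext_cvg].
rewrite -(cvg_lim _ c)//; apply: limr_le; first by apply/cvg_ex; eexists; exact: c.
have := near_idx_near sT d0; apply: filterS => j hj.
apply: le_trans (hd _ _ hk hj) _; lra.
Qed.

Lemma ext_pnt k : ext (pnt k) = g k.
Proof.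
have [_ rc cst] := gg; have /andP[h1] := pntP k; rewrite le_eqVlt => /predU1P[kT'|kT'].
  by rewrite /ext kT' ltxx; apply: cst; rewrite pnt_kT kT'.
have sT : t <= pnt k < T by rewrite h1.
apply/eqP; rewrite -subr_eq0 -normr_le0; apply/ler_addgt0Pl => e e0; rewrite addr0.
have [m hm] := inv_lt (divr_gt0 e0 (ltr0Sn _ 1)).
have [m' hm'] := rc k m kT'.
have [|d d0 hd] := ext_right sT (e := e / 2); first by rewrite divr_gt0.
have d1 : 0 < Num.min d (einv m') by rewrite lt_min d0 einv_gt0.
have /filter_ex[j /andP[j1 j2]] := near_idx_near sT d1.
have a1 := hd (near_idx (pnt k) j); have a2 := hm' (near_idx (pnt k) j).
have {}a1 : `|g (near_idx (pnt k) j) - ext (pnt k)| <= e / 2. by apply: a1; rewrite j1 (lt_le_trans j2)// lerD2l ge_min lexx.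
have {}a2 : `|g (near_idx (pnt k) j) - g k| <= einv m.
  by apply: a2; rewrite ?(ltW j1)// (lt_le_trans j2)// lerD2l ge_min lexx orbT.
have -> : ext (pnt k) - g k = (g (near_idx (pnt k) j) - g k) - (g (near_idx (pnt k) j) - ext (pnt k)) by ring.
apply: le_trans (ler_normB _ _) _; lra.
Qed.

Lemma ext_cadl : cadl ext.
Proof.
split => s sT. apply/cvgrPdist_le => e e0; have [d d0 hd] := ext_right sT (divr_gt0 e0 (ltr0Sn _ 1)).
  case/andP: (sT) => ts s_T. exists (Num.min d (T - s)) => /=; first by rewrite lt_min d0 subr_gt0.
  move=> v /=; rewrite distrC => + sv; rewrite ger0_norm ?subr_ge0 ?(ltW sv)// lt_min => /andP[v1 v2].
  have vT : t <= v < T by apply/andP; split; [exact: le_trans (ltW sv)|lra].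
  have [|d' d'0 hd'] := ext_right vT (e := e / 2); first by rewrite divr_gt0.
  have dd : 0 < Num.min d' (s + d - v) by rewrite lt_min d'0; lra.
  have /filter_ex[j /andP[j1 j2]] := near_idx_near vT dd. have b1 : `|g (near_idx v j) - ext v| <= e / 2.
    by apply: hd'; rewrite j1 (lt_le_trans j2)// lerD2l ge_min lexx. have b2 : `|g (near_idx v j) - ext s| <= e / 2.
    apply: hd; rewrite (lt_trans sv j1) /=.
    apply: lt_le_trans j2 _; apply: le_trans (_ : v + (s + d - v) <= _); last lra. by rewrite lerD2l ge_min lexx orbT.
  have -> : ext s - ext v = (g (near_idx v j) - ext v) - (g (near_idx v j) - ext s) by ring.
  apply: le_trans (ler_normB _ _) _; lra.
apply: osc_cvg => e e0; have [m hm] := inv_lt (divr_gt0 e0 (ltr0Sn _ 3)).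
have [d d0 hd] := good_left m sT; case/andP: (sT) => ts s_T.
have key v : [/\ t <= v, s - d < v & v < s] -> exists k, s - d < pnt k < s /\ `|g k - ext v| <= e / 4.
  move=> [tv dv vs]; have vT : t <= v < T by rewrite tv (lt_le_trans vs).
  have [d' d'0 hd'] := ext_right vT (divr_gt0 e0 (ltr0Sn _ 3)).
  have dd : 0 < Num.min d' (s - v) by rewrite lt_min d'0 subr_gt0.
  have /filter_ex[j /andP[j1 j2]] := near_idx_near vT dd. exists (near_idx v j); split.
    rewrite (lt_trans dv j1); apply: lt_le_trans j2 _. apply: le_trans (_ : v + (s - v) <= _); last lra.
    by rewrite lerD2l ge_min lexx orbT. by apply: hd'; rewrite j1 (lt_le_trans j2)// lerD2l ge_min lexx.
exists [set v | [/\ t <= v, s - d < v & v < s]]. exists (Num.min d (s - t)) => /=; first by rewrite lt_min d0 subr_gt0.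
  move=> v /=; rewrite lt_min => /andP[+ +] vs. by rewrite ger0_norm ?subr_ge0 ?(ltW vs)// => v1 v2; split; lra.
move=> v v' /key[k [hk gk]] /key[k' [hk' gk']].
have := hd k k' hk hk'.
have -> : ext v - ext v' = (g k' - ext v') - (g k - ext v) + (g k - g k') by ring.
move=> h; apply: le_trans (ler_normD _ _) _.
have := ler_normB (g k' - ext v') (g k - ext v); lra.
Qed.
End Path.

(** * Vector-valued cadlag paths, coordinate by coordinate *)

Section MxCvg.
Context {R : realType} {n : nat}.

Lemma mx_cvgP (I : Type) (F : set_system I) (FF : Filter F) (f : I -> 'cV[R]_n) (l : 'cV[R]_n) :
  (f @ F --> l) <-> (forall i, (fun v => f v i ord0) @ F --> l i ord0).
Proof.
split => [h i|h]. apply/cvgrPdist_lt => e e0; have /cvg_ballP /(_ e e0) := h.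
  by apply: filterS => v /(mx_ballP _ _ e0) /(_ i ord0).
apply/cvg_ballP => e e0.
have : \forall v \near F, forall i, `|l i ord0 - f v i ord0| < e.
  by apply: filter_forall => i; have /cvgrPdist_lt /(_ e e0) := h i.
by apply: filterS => v hv; apply/mx_ballP => // i j; rewrite (ord1 j).
Qed.

Lemma mx_lim (I : Type) (F : set_system I) (FF : ProperFilter F) (f : I -> 'cV[R]_n) :
  (forall i, cvg ((fun v => f v i ord0) @ F)) ->
  f @ F --> (\col_i lim ((fun v => f v i ord0) @ F) : 'cV[R]_n).
Proof. by move=> h; apply/mx_cvgP => i; rewrite mxE; exact: h. Qed.

Context {dO : measure_display} {Omega : measurableType dO} {r q : nat}.
Variable S : noise (R := R) (Omega := Omega) r q.
Local Notation T := (horizon S).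

Lemma cadlag_mxP t (X : R -> Omega -> 'cV[R]_n) :
  cadlag S t X <-> forall w i, cadl t T (fun s => X s w i ord0).
Proof.
split => [h w i|h w]. have [h1 h2] := h w; split => s st; first by have /mx_cvgP := h1 s st; exact.
  have /mx_cvgP /(_ i) c : X v w @[v --> s^'-] --> lim (X v w @[v --> s^'-]) by exact: h2.
  by apply/cvg_ex; eexists; exact: c.
split => s st; first by apply/mx_cvgP => i; have [+ _] := h w i; exact.
apply/cvg_ex; eexists; apply: mx_lim => i; have [_] := h w i; exact.
Qed.

Lemma left_limitE t (X : R -> Omega -> 'cV[R]_n) s w i : cadlag S t X -> t < s <= T ->
  left_limit X s w i ord0 = lim (X v w i ord0 @[v --> s^'-]).
Proof.
move=> cX st; have [_ h2] := cX w; apply/esym/cvg_lim => //.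
have /mx_cvgP := h2 s st; exact.
Qed.
End MxCvg.

(** * Measurability of coefficients and of partial integrals *)

Section CoefMeas.
Context {R : realType}.

Lemma meas_patch d d' (T : measurableType d) (U : measurableType d') (A : set T) (f : T -> U) (c : U) :
  measurable A -> mfun A f -> mfunT (fun w => if w \in A then f w else c).
Proof.
move=> mA mf _ Y mY; rewrite setTI.
rewrite (_ : _ @^-1` Y = (A `&` f @^-1` Y) `|` (~` A `&` [set _ | Y c])); last first. apply/seteqP; split => w /=.
    by case: ifPn => [/set_mem ? ?|/negP h ?]; [left|right; split => // Aw; exact: h (mem_set Aw)].
  by case=> [[h1 h2]|[h1 h2]]; [rewrite mem_set|rewrite memNset].
apply: measurableU; first exact: mf.
apply: measurableI; first exact: measurableC.
by have := (@measurable_cst _ _ T U setT c) measurableT _ mY; rewrite setTI.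
Qed.

Lemma caratheodoryW n m de (M : measurableType de) (D : set (R * 'cV[R]_n * 'cV[R]_m)) (Ee : set M)
    (F : R * 'cV[R]_n * 'cV[R]_m -> M -> R) :
  (forall e z, Ee e -> D z -> F^~ e @ within D (nbhs z) --> F z e) ->
  (forall z, D z -> mfun Ee (F z)) -> measurable Ee ->
  forall d (T : measurableType d) (A : set T) (z : T -> R * 'cV[R]_n * 'cV[R]_m) (e : T -> M),
  measurable A -> mfun A (fun w => (z w).1.1) ->
  (forall i, mfun A (fun w => (z w).1.2 i ord0)) ->
  (forall i, mfun A (fun w => (z w).2 i ord0)) ->
  mfun A e -> (forall w, A w -> D (z w) /\ Ee (e w)) ->
  mfun A (fun w => F (z w) (e w)).
Proof.
move=> Fc Fm mE d T A z e mA m1 m2 m3 m4 h.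
have [->|/set0P[w0 Aw0]] := eqVneq A set0. by move=> _ Y _; rewrite set0I.
pose z' w := if w \in A then z w else z w0.
pose e' w := if w \in A then e w else e w0.
apply: (eq_measurable_fun (fun w => F (z' w) (e' w))). by move=> w wA; rewrite /z' /e' wA.
apply: (caratheodory Fc Fm mE) => //.
- rewrite (_ : (fun w => _) = (fun w => if w \in A then (z w).1.1 else (z w0).1.1)); first exact: meas_patch.
  by apply/funext => w; rewrite /z'; case: ifP.
- move=> i; rewrite (_ : (fun w => _) = (fun w => if w \in A then (z w).1.2 i ord0 else (z w0).1.2 i ord0)); first exact: meas_patch.
  by apply/funext => w; rewrite /z'; case: ifP.
- move=> i; rewrite (_ : (fun w => _) = (fun w => if w \in A then (z w).2 i ord0 else (z w0).2 i ord0)); first exact: meas_patch.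
  by apply/funext => w; rewrite /z'; case: ifP.
- exact: meas_patch.
- by move=> w Aw; rewrite /z' /e' mem_set//; exact: h.
Qed.

Lemma meas_int_snd d1 d2 (T1 : measurableType d1) (T2 : measurableType d2)
    (mu : {sigma_finite_measure set T2 -> \bar R}) (B : set T1) (D : set T2) (f : T1 * T2 -> \bar R) :
  measurable B -> measurable D -> mfun (B `*` D) f -> (forall z, (B `*` D) z -> 0 <= f z)%E ->
  mfun B (fun x => \int[mu]_(y in D) f (x, y))%E.
Proof.
move=> mB mD mf f0.
have mBD : measurable (B `*` D) by exact: measurableX.
apply: (eq_measurable_fun (fun x => \int[mu]_y ((f \_ (B `*` D)) (x, y)))%E).
  move=> x /set_mem xB; rewrite [RHS]integral_mkcond; apply: eq_integral => y _.
  rewrite !patchE; case: (pselect (D y)) => yD; first by rewrite !mem_set. by rewrite !memNset// => -[].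
apply: mfunTS.
apply: (@measurable_fun_fubini_tonelli_F _ _ T1 T2 R mu (f \_ (B `*` D))). by apply/(measurable_restrictT _ _).1.
by move=> z; rewrite patchE; case: ifPn => // /set_mem; exact: f0.
Qed.

Lemma meas_int_fst d1 d2 (T1 : measurableType d1) (T2 : measurableType d2)
    (mu : {sigma_finite_measure set T1 -> \bar R}) (D : set T1) (B : set T2) (f : T1 * T2 -> \bar R) :
  measurable D -> measurable B -> mfun (D `*` B) f -> (forall z, (D `*` B) z -> 0 <= f z)%E ->
  mfun B (fun y => \int[mu]_(x in D) f (x, y))%E.
Proof.
move=> mD mB mf f0.
apply: (@meas_int_snd _ _ _ _ mu B D (fun z => f (z.2, z.1))) => //; last by move=> [x y] [h1 h2]; exact: f0.
apply: (measurable_comp (F := D `*` B) _ _ mf); first exact: measurableX. by move=> _ [[y x] [h1 h2] <-].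
by apply: mfunTS; exact: measurable_swap.
Qed.

Lemma meas_Rint_fst d2 (T2 : measurableType d2) (D : set R) (B : set T2) (f : R * T2 -> R) :
  measurable D -> measurable B -> mfun (D `*` B) f ->
  mfun B (fun y => \int[@lebesgue_measure R]_(x in D) f (x, y)).
Proof.
move=> mD mB mf; rewrite /Rintegral.
have mfine : mfun [set: \bar R] fine by [].
apply: (mfun_comp mfine).
apply: (eq_measurable_fun (fun y => \int[@lebesgue_measure R]_(x in D) (EFin \o f)^\+ (x, y) -
   \int[@lebesgue_measure R]_(x in D) (EFin \o f)^\- (x, y))%E). move=> y _ /=; rewrite [in RHS]integralE.
  by congr (_ - _)%E; apply: eq_integral => x _; rewrite ?funeposE ?funenegE.
have me : mfun (D `*` B) (EFin \o f) by apply/measurable_EFinP.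
apply: emeasurable_funB.
  exact: (@meas_int_fst _ _ _ _ (@lebesgue_measure R) D B ((EFin \o f)^\+)%E mD mB (measurable_funepos me)) => z _; exact: funepos_ge0.
exact: (@meas_int_fst _ _ _ _ (@lebesgue_measure R) D B ((EFin \o f)^\-)%E mD mB (measurable_funeneg me)) => z _; exact: funeneg_ge0.
Qed.

Context {r q n m : nat} {dO : measure_display} {Omega : measurableType dO}.
Variables (S : noise (R := R) (Omega := Omega) r q) (C : problem (R := R) r q n m).
Local Notation dom := (txu_dom S C).

Lemma coef_meas d (T : measurableType d) (A : set T) (g : R -> 'cV[R]_n -> 'cV[R]_m -> R)
    (tm : T -> R) (x : T -> 'cV[R]_n) (u : T -> 'cV[R]_m) :
  {within dom, continuous (fun z => g z.1.1 z.1.2 z.2)} ->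
  measurable A -> mfun A tm -> (forall i, mfun A (fun w => x w i ord0)) ->
  (forall i, mfun A (fun w => u w i ord0)) ->
  (forall w, A w -> dom (tm w, x w, u w)) ->
  mfun A (fun w => g (tm w) (x w) (u w)).
Proof.
move=> /subspace_continuousP gc mA m1 m2 m3 h.
apply: (@caratheodoryW n m _ R dom setT (fun z _ => g z.1.1 z.1.2 z.2) _ _ _ _ T A (fun w => (tm w, x w, u w)) (fun=> 0)) => //.
  by move=> _ z _ Dz; exact: gc.
by move=> w Aw; split; [exact: h|].
Qed.

Lemma coef_measE d (T : measurableType d) (A : set T) (g : R -> 'cV[R]_n -> 'cV[R]_m -> mark R q -> R)
    (tm : T -> R) (x : T -> 'cV[R]_n) (u : T -> 'cV[R]_m) (e : T -> mark R q) :
  (forall e, marks S e -> {within dom, continuous (fun z => g z.1.1 z.1.2 z.2 e)}) ->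
  (forall z, dom z -> mfun (marks S) (g z.1.1 z.1.2 z.2)) -> measurable (marks S) ->
  measurable A -> mfun A tm -> (forall i, mfun A (fun w => x w i ord0)) ->
  (forall i, mfun A (fun w => u w i ord0)) -> mfun A e ->
  (forall w, A w -> dom (tm w, x w, u w) /\ marks S (e w)) ->
  mfun A (fun w => g (tm w) (x w) (u w) (e w)).
Proof.
move=> gc gm mE mA m1 m2 m3 m4 h.
apply: (@caratheodoryW n m _ (mark R q) dom (marks S) (fun z e => g z.1.1 z.1.2 z.2 e) _ _ _ _ T A (fun w => (tm w, x w, u w)) e) => //.
by move=> e' z Ee; move: z; apply/subspace_continuousP; exact: gc.
Qed.
End CoefMeas.

(** * Almost sure statements from L2 bounds and geometric rates *)

Section Fast.
Context {R : realType} {d} {T : measurableType d}.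
Variable P : probability T R.

Lemma L2_fatou (X : nat -> T -> R) (Y : T -> R) (c : R) : (forall k, L2 P (X k)) -> (forall k, nrm P (X k) <= c) ->
  mfunT Y -> {ae P, forall w, X k w @[k --> \oo] --> Y w} -> L2 P Y /\ nrm P Y <= c.
Proof.
move=> LX Xc mY XY.
have mX k : mfunT (fun w => (X k w ^+ 2)%:E). by apply/measurable_EFinP; apply: mfunX; have [] := LX k.
have mY2 : mfunT (fun w => (Y w ^+ 2)%:E). by apply/measurable_EFinP; apply: mfunX.
have le : (\int[P]_w (Y w ^+ 2)%:E <= c%:E)%E.
  rewrite (@ge0_ae_eq_integral _ _ _ P setT _ (fun w => limn_einf (fun k => (X k w ^+ 2)%:E))) //.
  - apply: le_trans (@fatou _ _ _ P setT measurableT _ mX _) _; first by move=> k w _; rewrite lee_fin sqr_ge0.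
    rewrite limn_einf_lim; apply: lime_le; first exact: is_cvg_einfs.
    apply: nearW => n; apply: le_trans (ereal_inf_lbound _) _; first by exists n => /=. by rewrite -nrmE// lee_fin.
  - rewrite /limn_einf; apply: mfun_comp => //. by apply: measurable_fun_limn_esup => k; apply: mfun_comp.
  - by move=> w _; rewrite lee_fin sqr_ge0.
  - move=> w _; rewrite limn_einf_lim; apply: lime_ge; first exact: is_cvg_einfs.
    by apply: nearW => n; apply: le_ereal_inf_tmp => _ [k _ <-]; rewrite lee_fin sqr_ge0.
  - apply: filterS XY => w h _; apply/esym. have h2 : (fun k => (X k w ^+ 2)%:E) @ \oo --> (Y w ^+ 2)%:E.
      by apply: cvg_EFin; [exact: nearW|]; rewrite /comp; under eq_fun do rewrite expr2; rewrite expr2; exact: cvgM.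
    by have [-> _] := cvg_limn_einf_sup h2.
have L : L2 P Y by split => //; apply: le_lt_trans le (ltry _).
by split => //; rewrite -lee_fin nrmE.
Qed.

(** Fatou along the tails of [X k - Z] bounds the squared norm of [Y - Z] by every positive number,
    so the almost sure limit and the L2-limit agree. *)
Lemma ae_lim_unique (X : nat -> T -> R) (Y Z : T -> R) : (forall k, L2 P (fun w => X k w - Z w)) ->
  (forall e, 0 < e -> exists N, forall k, (N <= k)%N -> nrm P (fun w => X k w - Z w) <= e) ->
  mfunT Y -> mfunT Z ->
  {ae P, forall w, X k w @[k --> \oo] --> Y w} -> {ae P, forall w, Y w = Z w}.
Proof.
move=> LX h mY mZ XY.
have key e : 0 < e -> L2 P (fun w => Y w - Z w) /\ nrm P (fun w => Y w - Z w) <= e. move=> e0; have [N hN] := h e e0.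
  apply: (@L2_fatou (fun k w => X (k + N)%N w - Z w)) => //.
  - by move=> k; apply: hN; exact: leq_addl.
  - exact: mfunB.
  - by apply: filterS XY => w hw; apply: cvgB (cvg_cst _); rewrite (cvg_shiftn N (X^~ w)).
have [L _] := key 1 ltr01.
have n0 : nrm P (fun w => Y w - Z w) = 0. by apply: nrm_le_eps_eq0 => [|e e0]; [exact: nrm_ge0|have [] := key e e0].
by apply: filterS (nrm_eq0 L n0) => w /eqP; rewrite subr_eq0 => /eqP.
Qed.

(** Weighted by [b ^+ j], the integrals sum to at most [2 * C], so the weighted series is almost
    surely finite and its sum bounds every term. A factor 2 in the rate is traded for an almost sure
    bound. *)
Lemma fast_ae (G : nat -> T -> \bar R) (C b : R) : 0 <= C -> 0 < b -> (forall j, mfunT (G j)) ->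
  (forall j w, 0 <= G j w)%E -> (forall j, \int[P]_w G j w <= (C / (2 * b) ^+ j)%:E)%E ->
  {ae P, forall w, exists c : R, forall j, (G j w <= (c / b ^+ j)%:E)%E}.
Proof.
move=> C0 b0 mG G0 hG.
have bj j : 0 < b ^+ j by exact: exprn_gt0.
pose H j w := ((b ^+ j)%:E * G j w)%E.
have H0 j w : (0 <= H j w)%E by apply: mule_ge0 => //; rewrite lee_fin ltW.
have mH j : mfunT (H j) by exact: measurable_funeM.
have mS : mfunT (fun w => \sum_(j <oo) H j w)%E. exact: ge0_emeasurable_sum.
have S0 w : (0 <= \sum_(j <oo) H j w)%E by exact: nneseries_ge0.
have iH : (\int[P]_w (\sum_(j <oo) H j w) < +oo)%E. rewrite integral_nneseries//; apply: le_lt_trans (ltry (2 * C)).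
  have C2 : 0 <= 2 * C by rewrite mulr_ge0. apply: le_trans (epsilon_trick0 xpredT C2).
  apply: lee_nneseries => [j _ _|j _]; first exact: integral_ge0. rewrite /H ge0_integralZl//; last by rewrite lee_fin ltW.
  apply: le_trans (lee_wpmul2l _ (hG j)) _; first by rewrite lee_fin ltW.
  rewrite -EFinM lee_fin exprMn natrX exprS le_eqVlt; apply/orP; left; apply/eqP. by field; rewrite !expf_neq0// gt_eqF.
have iS : P.-integrable setT (fun w => \sum_(j <oo) H j w)%E.
  by apply/integrableP; split => //; under eq_integral do rewrite gee0_abs//.
apply: filterS (integrable_ae measurableT iS) => w /(_ Logic.I) wf.
exists (fine (\sum_(j <oo) H j w)%E) => j.
have : (H j w <= \sum_(j <oo) H j w)%E. apply: le_trans (nneseries_lim_ge j.+1 _) => //.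
  by rewrite big_nat_recr//= leeDr// sume_ge0.
rewrite -(fineK wf) /H => h.
rewrite EFinM muleC; apply: le_trans (lee_wpmul2l _ h); last by rewrite lee_fin invr_ge0 ltW.
by rewrite muleA -EFinM mulVf ?gt_eqF// mul1e.
Qed.
End Fast.

(** * Coefficients along a path: joint measurability and time integrals *)

Section Coef.
Context {R : realType} {dO} {Omega : measurableType dO}.
Variables (r q n m : nat).
Variables (S : noise (R := R) (Omega := Omega) r q) (C : problem (R := R) r q n m).
Local Notation T := (horizon S).
Local Notation leb := (@lebesgue_measure R).
Local Notation dom := (txu_dom S C).
Context {d} {W : measurableType d}.
Variables (t s : R) (x : R -> W -> 'cV[R]_n) (u : R -> W -> 'cV[R]_m).
Hypotheses (t0 : 0 <= t) (ts : t <= s) (sT : s <= T).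
Hypothesis cx : forall w i, cadl t s (fun v => x v w i ord0).
Hypothesis mx : forall v i, t <= v <= s -> mfunT (fun w => x v w i ord0).
Hypothesis mu : forall i, mfun ((`[t, s] `*` setT) : set (R * W)) (fun z => u z.1 z.2 i ord0).
Hypothesis hu : forall v w, t <= v <= s -> ctrl_set C (u v w).
Local Notation A := ((`[t, s] `*` setT) : set (R * W)).

Lemma path_joint i : mfun A (fun z => x z.1 z.2 i ord0).
Proof.
have := right_cont_joint ts (fun v vt => mx i vt) (fun v w => (cx w i).1 v).
move=> h; apply: (eq_measurable_fun (fun z : R * W => x (clamp t s z.1) z.2 i ord0)).
  by move=> [v w] /set_mem /= [h1 _]; rewrite clamp_id; rewrite in_itv in h1.
exact: mfunTS h.
Qed.

Lemma left_joint i : mfun ((`]t, s] `*` setT) : set (R * W))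
  (fun z => lim (x v z.2 i ord0 @[v --> z.1^'-])).
Proof.
have := left_lim_joint ts (fun v vt => mx i vt) (fun v w => (cx w i).2 v).
move=> h; apply: (eq_measurable_fun (fun z : R * W =>
   if t < clamp t s z.1 then lim (x v z.2 i ord0 @[v --> (clamp t s z.1)^'-]) else x t z.2 i ord0)).
  move=> [v w] /set_mem /= [h1 _]; rewrite in_itv /= in h1. by case/andP: h1 => h1 h2; rewrite clamp_id ?h1// (ltW h1).
exact: mfunTS h.
Qed.

Lemma measA : measurable A. Proof. exact: measurableX. Qed.

Variable g : R -> 'cV[R]_n -> 'cV[R]_m -> R.
Hypothesis gc : {within dom, continuous (fun z => g z.1.1 z.1.2 z.2)}.

Lemma coef_joint : mfun A (fun z => g z.1 (x z.1 z.2) (u z.1 z.2)).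
Proof.
apply: (coef_meas (S := S) (C := C) (g := g)) => //; first exact: measA. exact: mfunTS; exact: measurable_fst.
  exact: path_joint.
move=> [v w] /= [+ _]; rewrite in_itv /= => vt; split => /=; last exact: hu.
by case/andP: vt => h1 h2; rewrite (le_trans t0 h1) (le_trans h2 sT).
Qed.

Lemma coef_int_meas : mfunT (fun w => \int[leb]_(v in `[t, s]) g v (x v w) (u v w)).
Proof. by apply: (meas_Rint_fst (f := fun z => g z.1 (x z.1 z.2) (u z.1 z.2))) => //; exact: coef_joint. Qed.

Variable L : R.
Hypothesis gb : forall v y c, 0 <= v <= T -> ctrl_set C c -> `|g v y c| <= L * (1 + enorm y).

Lemma path_bounded w : exists K, forall v, t <= v <= s -> enorm (x v w) <= K.
Proof.
have h i := cadl_bounded (cx w i).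
pose K := \sum_i `|projT1 (cid (h i))|.
exists (Num.sqrt (\sum_(i < n) \sum_(j < 1) K ^+ 2)) => v vt.
apply: enorm_bounded => i j; rewrite (ord1 j).
apply: le_trans (projT2 (cid (h i)) v vt) _; apply: le_trans (ler_norm _) _.
by rewrite /K (bigD1 i)//= lerDl sumr_ge0.
Qed.

Lemma coef_bounded w : exists K, forall v, t <= v <= s -> `|g v (x v w) (u v w)| <= K.
Proof.
have [K hK] := path_bounded w; exists (`|L| * (1 + K)) => v vt.
have vT : 0 <= v <= T by case/andP: vt => h1 h2; rewrite (le_trans t0 h1) (le_trans h2 sT).
apply: le_trans (gb _ vT (hu w vt)) _.
apply: le_trans (ler_wpM2r _ (ler_norm L)) _; first by rewrite addr_ge0// enorm_ge0.
by rewrite ler_wpM2l// lerD2l hK.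
Qed.

Lemma coef_section w : mfun `[t, s] (fun v => g v (x v w) (u v w)).
Proof.
apply: (measurable_comp (F := A) (g := fun v => (v, w)) measA _ coef_joint). by move=> _ [v vt <-].
exact: mfunTS; exact: measurable_pair2.
Qed.

Lemma leb_itv_fin (i : interval R) a b : [set` i] `<=` `[a, b] -> (leb [set` i] < +oo)%E.
Proof.
move=> h; apply: (@le_lt_trans _ _ (leb `[a, b])); first by apply: le_measure => //; rewrite inE.
by rewrite lebesgue_measure_itv; case: ifP => _; rewrite// -EFinB ltry.
Qed.

Lemma coef_integrable w : leb.-integrable `[t, s] (EFin \o (fun v => g v (x v w) (u v w))).
Proof.
apply: measurable_bounded_integrable => //; [exact: leb_itv_fin (@subset_refl _ _)|exact: coef_section|].
have [K hK] := coef_bounded w; exists K; split; first exact: num_real.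
by move=> K' KK' v /= vt; apply: le_trans (hK _ _) (ltW KK'); rewrite in_itv in vt.
Qed.

Lemma coef_int_lip w : exists K, forall a b, t <= a -> a <= b -> b <= s ->
  `|\int[leb]_(v in `[t, b]) g v (x v w) (u v w) - \int[leb]_(v in `[t, a]) g v (x v w) (u v w)| <= K * (b - a).
Proof.
have [K hK] := coef_bounded w; exists K => a b ta; rewrite le_eqVlt => /predU1P[<-|ab] bs. by rewrite !subrr normr0 mulr0.
have sub : `]a, b] `<=` `[t, s].
  by move=> v; rewrite /= !in_itv /= => /andP[h1 h2]; rewrite (le_trans ta (ltW h1)) (le_trans h2 bs).
have I := coef_integrable w.
have Ib : leb.-integrable `[t, b] (EFin \o (fun v => g v (x v w) (u v w))).
  apply: integrableS I => // v; rewrite /= !in_itv => /andP[-> h2]; exact: le_trans bs.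
have Iab : leb.-integrable `]a, b] (EFin \o (fun v => g v (x v w) (u v w))). exact: integrableS I.
rewrite Rintegral_itvB ?bnd_simp ?(ltW ab)//; apply: le_trans (le_normr_Rintegral _ _) _ => //.
apply: (@le_trans _ _ (\int[leb]_(v in `]a, b]) (cst K v))). apply: le_Rintegral => //; first exact: integrable_norm Iab.
    apply: measurable_bounded_integrable => //; first exact: leb_itv_fin sub.
    by exists `|K|; split; [exact: num_real|move=> K' KK' v _; exact: ltW].
  by move=> v vab; apply: hK; have := sub v vab; rewrite /= in_itv.
by rewrite Rintegral_cst//= lebesgue_measure_itv lte_fin ab -EFinB.
Qed.
End Coef.

(** * Passing to the limit in time in the state equation *)

Section SdeLim.
Context {R : realType} {d} {T' : measurableType d}.
Variable P : probability T' R.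

(** Along [v_] the drift [D] converges path by path, while [M] converges only in L2. Once the drift
    is subtracted, the almost sure limit of the left side must be the L2-limit of [M]. It serves for
    left limits and, along right grid points, for extending the equation to all times. *)
Lemma sde_lim (t T : R) (x D M : R -> T' -> R) (v_ : nat -> R) s (Y : T' -> R) :
  (forall v, t <= v <= T -> mfunT (x v)) ->
  (forall v, t <= v <= T -> mfunT (D v)) ->
  (forall v, t <= v <= T -> L2 P (M v)) ->
  (forall w, exists K, forall a b, t <= a -> a <= b -> b <= T -> `|D b w - D a w| <= K * (b - a)) ->
  (forall e, 0 < e -> exists2 dl, 0 < dl &
    forall v, t <= v <= T -> `|v - s| < dl -> nrm P (fun w => M v w - M s w) <= e) ->
  t <= s <= T -> (forall j, t <= v_ j <= T) -> v_ @ \oo --> s ->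
  (forall w, x (v_ j) w @[j --> \oo] --> Y w) ->
  (forall j, {ae P, forall w, x (v_ j) w = D (v_ j) w + M (v_ j) w}) ->
  {ae P, forall w, Y w = D s w + M s w}.
Proof.
move=> mx mD LM lipD cM st vT vs xY sde.
have mY : mfunT Y by apply: (@measurable_fun_cvg _ _ _ _ (fun j => x (v_ j))) => // j; exact: mx.
have Dcv w : D (v_ j) w @[j --> \oo] --> D s w. have [K hK] := lipD w; have K0 : 0 <= `|K| by [].
  have bnd j : `|D s w - D (v_ j) w| <= `|K| * `|s - v_ j|.
    case/andP: (st) => s1 s2; case/andP: (vT j) => v1 v2; case: (leP (v_ j) s) => h.
      by apply: le_trans (hK _ _ v1 h s2) _; rewrite -normrM ler_norm.
    rewrite distrC [in leRHS]distrC; apply: le_trans (hK _ _ s1 (ltW h) v2) _; by rewrite -normrM ler_norm.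
  apply/cvgrPdist_le => e e0. have /cvgrPdist_le /(_ (e / (1 + `|K|))) := vs.
  move=> /(_ (divr_gt0 e0 (ltr_pwDl ltr01 K0))); apply: filterS => j hj.
  apply: le_trans (bnd j) _; apply: le_trans (ler_wpM2l K0 hj) _.
  by rewrite mulrA ler_pdivrMr// mulrC ler_wpM2l ?(ltW e0)// lerDr.
have e1 j : {ae P, forall w, (x (v_ j) w - D (v_ j) w + D s w) - (D s w + M s w) = M (v_ j) w - M s w}.
  by apply: filterS (sde j) => w ->; ring.
have mX j : mfunT (fun w => x (v_ j) w - D (v_ j) w + D s w).
  by apply: mfunD; [apply: mfunB; [exact: mx|exact: mD]|exact: mD].
have mZ : mfunT (fun w => D s w + M s w). by apply: mfunD; [exact: mD|exact: L2_meas (LM s st)].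
have mXZ j : mfunT (fun w => (x (v_ j) w - D (v_ j) w + D s w) - (D s w + M s w)) by exact: mfunB.
have LMM j : L2 P (fun w => M (v_ j) w - M s w) by apply: L2B; exact: LM.
apply: (ae_lim_unique (X := fun j w => x (v_ j) w - D (v_ j) w + D s w)) => //.
- by move=> j; apply: L2_ae (LMM j) (e1 j).
- move=> e e0; have [dl dl0 hdl] := cM e e0. have /cvgrPdist_lt /(_ dl dl0)[N _ hN] := vs; exists N => k Nk.
  rewrite (nrm_ae (mXZ k) (L2_meas (LMM k)) (e1 k)); apply: hdl => //. by rewrite distrC; exact: hN.
- apply: aeW => w; rewrite -[Y w](subrK (D s w)). by apply: cvgD (cvg_cst _); apply: cvgB.
Qed.

(** A positive value at [s] would persist on an interval to the right of [s], of positive length,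
    while [phi] vanishes almost everywhere. *)
Lemma int0_right_cont (phi : R -> R) (t T : R) : mfun `[t, T] phi -> (forall v, 0 <= phi v) ->
  (forall s, t <= s < T -> phi v @[v --> s^'+] --> phi s) ->
  (\int[@lebesgue_measure R]_(v in `[t, T]) (phi v)%:E = 0)%E -> forall s, t <= s < T -> phi s = 0.
Proof.
move=> mphi phi0 rc i0 s sT; apply/eqP; case: (ltrgtP (phi s) 0) => // [|h]; first by rewrite ltNge phi0.
have : ae_eq (@lebesgue_measure R) [set` `[t, T]] (EFin \o phi) (cst 0%E).
  apply/ae_eq_integral_abs => //; first exact/measurable_EFinP.
  by rewrite -[RHS]i0; apply: eq_integral => v _ /=; rewrite ger0_norm.
move=> [N [mN N0 sub]]; have /cvgrPdist_lt /(_ _ h)[dl /= dl0 hdl] := rc s sT.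
case/andP: sT => ts sT.
pose b := Num.min T (s + dl / 2).
have sb : s < b by rewrite /b lt_min sT ltrDl divr_gt0.
have : `]s, b[ `<=` N. move=> v; rewrite /= in_itv /= => /andP[sv]; rewrite /b lt_min => /andP[vT vd]; apply: sub => /= hv.
  have := hv _; rewrite in_itv /= (le_trans ts (ltW sv)) (ltW vT) => /(_ isT) [hv'].
  have := hdl v; rewrite /ball_ /= hv' subr0 (ger0_norm (phi0 s)) ltxx.
  have -> : `|s - v| < dl by rewrite distrC ger0_norm ?(ltW sv)//; lra. by move=> /(_ isT sv).
move=> /(@le_measure _ _ _ (@lebesgue_measure R)); rewrite !inE => /(_ (measurable_itv _) mN).
by move: N0; rewrite /= => ->; rewrite lebesgue_measure_itv lte_fin sb -EFinB lee_fin subr_le0 leNgt sb.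
Qed.
End SdeLim.

(** Measurability is not involved: the integral of a nonnegative function is a supremum over the
    simple functions below it, and more of them lie below the larger function. *)
Lemma le_ge0_integral {R : realType} d (T : measurableType d) (mu : {measure set T -> \bar R}) (D : set T)
    (f1 f2 : T -> \bar R) : (forall x, D x -> 0 <= f1 x)%E -> (forall x, D x -> f1 x <= f2 x)%E ->
  (\int[mu]_(x in D) f1 x <= \int[mu]_(x in D) f2 x)%E.
Proof.
move=> f10 f12; have f20 x : D x -> (0 <= f2 x)%E by move=> Dx; exact: le_trans (f10 x Dx) (f12 x Dx).
rewrite !(integral_mkcond D) !ge0_integralTE; try by move=> x; rewrite patchE; case: ifPn => // /set_mem; eauto.
apply: le_ereal_sup => _ [h hf <-]; exists h => // x; apply: le_trans (hf x) _.
by rewrite !patchE; case: ifPn => // /set_mem; exact: f12.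
Qed.

Lemma int_bound {R : realType} d (T : measurableType d) (mu : {measure set T -> \bar R}) (D : set T)
    (f : T -> \bar R) (K : R) : measurable D -> (mu D < +oo)%E -> 0 <= K ->
  (forall x, D x -> 0 <= f x <= K%:E)%E -> (\int[mu]_(x in D) f x <= (K * fine (mu D))%:E)%E.
Proof.
move=> mD muD K0 h; rewrite EFinM fineK ?ge0_fin_numE// -integral_cst//.
by apply: le_ge0_integral => x Dx; have /andP[] := h x Dx.
Qed.

(** * Operations preserving cadlag paths *)

Section CadlOps.
Context {R : realType}.
Variables t T : R.

Lemma cadlD f g : cadl t T f -> cadl t T g -> cadl t T (fun s => f s + g s).
Proof.
move=> [f1 f2] [g1 g2]; split => s st; first by apply: cvgD; [exact: f1|exact: g1].
by apply/cvg_ex; eexists; apply: cvgD; [exact: f2|exact: g2].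
Qed.

Lemma cadlZ (c : R) f : cadl t T f -> cadl t T (fun s => c * f s).
Proof.
move=> [f1 f2]; split => s st; first by apply: cvgM; [exact: cvg_cst|exact: f1].
by apply/cvg_ex; eexists; apply: cvgM; [exact: cvg_cst|exact: f2].
Qed.

Lemma cadlB f g : cadl t T f -> cadl t T g -> cadl t T (fun s => f s - g s).
Proof.
move=> cf cg; have := cadlD cf (cadlZ (-1) cg).
by congr cadl; apply/funext => s; rewrite mulN1r.
Qed.

Lemma cadl_eq f g : (forall s, t <= s <= T -> f s = g s) -> cadl t T f -> cadl t T g.
Proof.
move=> fg [f1 f2]; split => s /andP[s1 s2]. rewrite -fg ?s1 ?ltW//; apply: cvg_trans (f1 s _); last by rewrite s1.
  apply: near_eq_cvg; near=> v; apply/fg/andP; split; last by near: v; exact: nbhs_right_le.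
  exact: le_trans s1 _; near: v; exact: nbhs_right_ge.
apply/cvg_ex; exists (lim (f v @[v --> s^'-])); apply: cvg_trans (f2 s _); last by rewrite s1.
apply: near_eq_cvg; near=> v; apply/fg/andP; split; first by near: v; exact: nbhs_left_ge.
exact: le_trans s2; near: v; exact: nbhs_left_le.
Unshelve. all: by end_near. Qed.

Lemma cadl_cst (c : R) : cadl t T (fun=> c).
Proof. by split => s _; [exact: cvg_cst|apply/cvg_ex; exists c; exact: cvg_cst]. Qed.

Lemma cadl_sum (I : Type) (l : seq I) (F : I -> R -> R) : (forall i, cadl t T (F i)) ->
  cadl t T (fun s => \sum_(i <- l) F i s).
Proof.
move=> h; elim: l => [|i l IH]. by have := cadl_cst 0; congr cadl; apply/funext => s; rewrite big_nil.
by have := cadlD (h i) IH; congr cadl; apply/funext => s; rewrite big_cons.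
Qed.

Lemma cadl_stop f c : cadl t T f -> cadl t T (fun s => f (Num.min c s)).
Proof.
move=> [f1 f2]; split => s st. case: (ltP s c) => sc. apply: cvg_trans (f1 s st); apply: near_eq_cvg; near=> v.
    by rewrite min_r//; near: v; apply: nbhs_right_le.
  apply: cvg_near_cst; near=> v; rewrite !min_l//; apply: le_trans sc _. by near: v; exact: nbhs_right_ge.
case: (ltP c s) => sc; apply/cvg_ex. exists (f c); apply: cvg_near_cst; near=> v; rewrite min_l//.
  by near: v; exact: nbhs_left_ge.
exists (lim (f v @[v --> s^'-])); apply: cvg_trans (f2 s st); apply: near_eq_cvg; near=> v.
by rewrite min_r// (le_trans _ sc)//; near: v; exact: nbhs_left_le.
Unshelve. all: by end_near. Qed.

Lemma cadl_eps f : (forall s e, t <= s <= T -> 0 < e -> exists2 dl, 0 < dl &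
    forall v, `|s - v| < dl -> t <= v <= T -> `|f s - f v| <= e) -> cadl t T f.
Proof.
move=> key; split => s /andP[s1 s2]. apply/cvgrPdist_le => e e0. have sT : t <= s <= T by rewrite s1 ltW.
  have [dl dl0 hdl] := key s e sT e0; near=> v; apply: hdl.
    rewrite distrC ger0_norm ?subr_ge0; last by near: v; exact: nbhs_right_ge.
    by rewrite ltrBlDl; near: v; apply: nbhs_right_lt; rewrite ltrDl.
  apply/andP; split; first by apply: le_trans s1 _; near: v; exact: nbhs_right_ge. by near: v; exact: nbhs_right_le.
apply/cvg_ex; exists (f s); apply/cvgrPdist_le => e e0.
have sT : t <= s <= T by rewrite s2 ltW.
have [dl dl0 hdl] := key s e sT e0; near=> v; apply: hdl. rewrite ger0_norm ?subr_ge0; last by near: v; exact: nbhs_left_le.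
  by rewrite ltrBlDl -ltrBlDr; near: v; apply: nbhs_left_gt; rewrite gtrBl.
apply/andP; split; first by near: v; exact: nbhs_left_ge.
exact: le_trans s2; near: v; exact: nbhs_left_le.
Unshelve. all: by end_near. Qed.

Lemma cadl_lip f (K : R) : (forall a b, t <= a -> a <= b -> b <= T -> `|f b - f a| <= K * (b - a)) -> cadl t T f.
Proof.
move=> h; have K0 : 0 <= `|K| by [].
have h' a b : t <= a <= T -> t <= b <= T -> `|f b - f a| <= `|K| * `|b - a|.
  move=> /andP[a1 a2] /andP[b1 b2]; case: (leP a b) => ab. by apply: le_trans (h a b a1 ab b2) _; rewrite -normrM ler_norm.
  rewrite distrC [in leRHS]distrC; apply: le_trans (h b a b1 (ltW ab) a2) _; by rewrite -normrM ler_norm.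
apply: cadl_eps => s e sT e0; exists (e / (1 + `|K|)); first by rewrite divr_gt0// ltr_pwDl.
move=> v sv vT; apply: le_trans (h' v s vT sT) _; apply: le_trans (ler_wpM2l K0 (ltW sv)) _.
by rewrite mulrA ler_pdivrMr// mulrC ler_wpM2l ?(ltW e0)// lerDr.
Qed.

Lemma cadl_cont (t' : R) f : t' <= t -> {within `[t', T], continuous f} -> cadl t T f.
Proof.
move=> t't /subspace_continuousP fc; apply: cadl_eps => s e /andP[s1 s2] e0.
have sI : `[t', T]%classic s by rewrite /= in_itv /= (le_trans t't s1).
have /cvgrPdist_le /(_ e e0)[dl /= dl0 hdl] := fc s sI; exists dl => // v sv /andP[v1 v2].
by apply: hdl => //=; rewrite in_itv /= v2 (le_trans t't v1).
Qed.

(** A distribution function of a measure: right-continuity is continuity from above along sets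
    shrinking to [A] times []t, s]], and left limits exist by monotonicity. It is applied to the
    paths of the counts. *)
Lemma cadl_cdf d (U : measurableType d) (nu : {measure set (U * R) -> \bar R}) (A : set U) :
  measurable A -> (nu (A `*` `]t, T]) < +oo)%E -> cadl t T (fun s => fine (nu (A `*` `]t, s]))).
Proof.
move=> mA fin.
have mB s : measurable (A `*` `]t, s]) by apply: measurableX.
have sub a b : a <= b -> A `*` `]t, a] `<=` A `*` `]t, b].
  by move=> ab [e v] /= [h1]; rewrite !in_itv => /andP[-> h2]; split => //; exact: le_trans ab.
have fn s : s <= T -> nu (A `*` `]t, s]) \is a fin_num.
  by move=> sT; rewrite ge0_fin_numE//; apply: le_lt_trans fin; apply: le_measure; rewrite ?inE//; exact: sub.
pose f s := fine (nu (A `*` `]t, s])).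
have nd a b : a <= b -> b <= T -> f a <= f b. move=> ab bT; apply: fine_le; [exact: fn (le_trans ab bT)|exact: fn|].
  by apply: le_measure; rewrite ?inE//; exact: sub.
split => s /andP[s1 s2]. have Ts : 0 < T - s by rewrite subr_gt0. pose v_ j := s + (T - s) * einv j.
  have sv j : s < v_ j by rewrite ltrDl mulr_gt0// einv_gt0. have vT j : v_ j <= T.
    rewrite /v_ -lerBrDl -[leRHS]mulr1 ler_pM2l// /einv invf_le1// ler1n//.
  have cs : nu (A `*` `]t, v_ j]) @[j --> \oo] --> nu (A `*` `]t, s]).
    rewrite (_ : A `*` `]t, s] = \bigcap_j (A `*` `]t, v_ j])); last first.
      apply/seteqP; split => [z h j _|[e v] h]; first by apply: sub h; exact: ltW.
      have [h1 h2] := h 0%N Logic.I; split => //=; move: h2; rewrite /= !in_itv => /andP[-> _] /=.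
      rewrite leNgt; apply/negP => svv; have d0 : 0 < (v - s) / (T - s) by rewrite divr_gt0// subr_gt0.
      have [m hm] := inv_lt d0; have [_] := h m Logic.I. rewrite /= in_itv /= => /andP[_]; rewrite leNgt => /negP; apply.
      by move: hm; rewrite ltr_pdivlMr// /v_ mulrC ltrBrDl.
    apply: (@nonincreasing_cvg_mu _ _ _ nu (fun j => A `*` `]t, v_ j])) => //.
    - by rewrite -ge0_fin_numE//; exact: fn.
    - exact: bigcapT_measurable.
    - move=> i j ij; apply/subsetPset; apply: sub; rewrite /v_ lerD2l ler_pM2l//.
      by rewrite /einv lef_pV2 ?posrE// ler_nat ltnS. apply/cvgrPdist_le => e e0.
  have /fine_cvgP[_ /cvgrPdist_le /(_ e e0)[N _ /(_ N (leqnn N)) hN]] : nu (A `*` `]t, v_ j]) @[j --> \oo] --> (f s)%:E.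
    by rewrite /f fineK ?fn ?ltW. near=> v.  have v2 : v <= v_ N by near: v; exact: nbhs_right_le.
  rewrite distrC ger0_norm; last by rewrite subr_ge0; apply: nd => //; exact: le_trans (vT N).
  apply: le_trans hN; rewrite distrC; apply: le_trans (ler_norm _). by rewrite lerD2r; exact: nd.
apply: nondecreasing_at_left_is_cvgr.
  near=> x => a b _; rewrite in_itv => /andP[_ bs] ab; apply: nd => //; exact: le_trans (ltW bs) s2.
near=> x; exists (f s) => _ [b /= + <-]; rewrite in_itv => /andP[_ /ltW bs]; exact: nd.
Unshelve. all: by end_near. Qed.
End CadlOps.

(** The sets whose trace on [D] is in the sigma-algebra form a sigma-algebra on the whole type. This
    turns the predictability conditions, which speak of subsets of a strip, into ordinary
    measurability. *)
Lemma trace_sigma {X : Type} (D0 : set X) (G : set (set X)) (D : set X) : D `<=` D0 -> <<s D0, G >> D ->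
  sigma_algebra setT [set B | <<s D0, G >> (D `&` B)].
Proof.
move=> DD0 GD; have [g0 gC gU] := smallest_sigma_algebra D0 G; split => [|B hB|F hF] /=.
- by rewrite setI0.
- rewrite (_ : D `&` (setT `\` B) = D `\` (D `&` B)); first exact: sigma_diff.
  by apply/seteqP; split => z [h1 h2]; split => //; [case: h2 => _ h2 [_ /h2]|split => // h3; exact: h2].
- by rewrite setI_bigcupr; exact: gU.
Qed.

Lemma enorm0 {R : realType} p k : enorm (0 : 'M[R]_(p, k)) ^+ 2 = 0.
Proof. by rewrite enormE big1// => i _; rewrite big1// => j _; rewrite mxE (expr0n _ 2). Qed.

Lemma ae_ex {R : realType} d (T : measurableType d) (P : probability T R) (Q : T -> Prop) :
  {ae P, forall w, Q w} -> exists w, Q w.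
Proof.
move=> [N [mN N0 sub]]; apply: contrapT => h.
have : (P setT <= P N)%E. by apply: le_measure; rewrite ?inE// => w _; apply: sub => Qw; apply: h; exists w.
by rewrite N0 probability_setT lee_fin ler10.
Qed.

Lemma le_ge0_integral_ae {R : realType} d (T : measurableType d) (mu : {measure set T -> \bar R})
    (f1 f2 : T -> \bar R) : mfunT f1 -> (forall x, 0 <= f1 x)%E -> (forall x, 0 <= f2 x)%E ->
  {ae mu, forall x, f1 x <= f2 x}%E -> (\int[mu]_x f1 x <= \int[mu]_x f2 x)%E.
Proof.
move=> m1 f10 f20 [N [mN N0 sub]].
have mp : mfunT (fun x => if x \in N then 0%E else f1 x) by apply: meas_if_set.
rewrite (@ge0_ae_eq_integral _ _ _ mu setT f1 (fun x => if x \in N then 0%E else f1 x))//.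
- apply: le_ge0_integral => x _; case: ifPn => // /negP h. by apply: contrapT => hx; apply: h; apply/mem_set/sub.
- by move=> x _; case: ifP.
- exists N; split => // x h; apply: contrapT => hx; apply: h => _. by case: ifPn => // /set_mem.
Qed.

Lemma meas_enorm2W {R : realType} d (T : measurableType d) p q (A : set T) (f : T -> 'M[R]_(p, q)) :
  measurable A -> (forall i j, mfun A (fun w => f w i j)) ->
  mfun A (fun w => enorm (f w) ^+ 2).
Proof.
move=> mA mf.
apply: (eq_measurable_fun (fun w => enorm (if w \in A then f w else 0) ^+ 2)). by move=> w wA; rewrite wA.
apply: mfunTS; apply: meas_enorm2 => i j.
rewrite (_ : (fun w => _) = (fun w => if w \in A then f w i j else 0)); first exact: meas_patch.
by apply/funext => w; case: ifP => // _; rewrite mxE.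
Qed.

Lemma nrm_lim_unique {R : realType} d (T : measurableType d) (P : probability T R)
    (W : nat -> T -> R) (U M : T -> R) (c1 c2 : R) :
  (forall j, L2 P (fun w => W j w - U w) /\ nrm P (fun w => W j w - U w) <= c1 / 8 ^+ j) ->
  (forall j, L2 P (fun w => W j w - M w) /\ nrm P (fun w => W j w - M w) <= c2 / 8 ^+ j) ->
  {ae P, forall w, U w = M w}.
Proof.
move=> h1 h2.
have LD j : L2 P (fun w => U w - M w) /\ nrm P (fun w => U w - M w) <= (2 * c1 + 2 * c2) / 8 ^+ j.
  have [L1 n1] := h1 j; have [L2' n2] := h2 j.
  have e : (fun w => U w - M w) = (fun w => (W j w - M w) - (W j w - U w)) by apply/funext => w; ring.
  rewrite e; split; first exact: L2B. apply: le_trans (nrmB_le L2' L1) _.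
  have -> : (2 * c1 + 2 * c2) / 8 ^+ j = 2 * (c2 / 8 ^+ j) + 2 * (c1 / 8 ^+ j) by ring. by apply: lerD; rewrite ler_pM2l.
have [L _] := LD 0%N.
have n0 : nrm P (fun w => U w - M w) = 0. apply: nrm_le_eps_eq0; first exact: nrm_ge0. move=> e e0.
  have g0 : (fun j => (2 * c1 + 2 * c2) / 8 ^+ j : R) @ \oo --> (0 : R).
    rewrite -(mulr0 (2 * c1 + 2 * c2)); apply: cvgM; first exact: cvg_cst.
    rewrite (_ : (fun x => _) = GRing.exp (8^-1 : R)); last by apply/funext => j; rewrite exprVn.
    by apply: cvg_expr; rewrite ger0_norm// invf_lt1// ltr1n. have /cvgrPdist_le /(_ e e0)[N _ /(_ N (leqnn N))] := g0.
  by rewrite sub0r normrN => /(le_trans (ler_norm _)); apply: le_trans; have [] := LD N.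
by apply: filterS (nrm_eq0 L n0) => w /eqP; rewrite subr_eq0 => /eqP.
Qed.

Lemma le_ge0_integral_sub {R : realType} d (T : measurableType d) (mu : {measure set T -> \bar R}) (A B : set T)
    (f : T -> \bar R) : A `<=` B -> (forall x, 0 <= f x)%E -> (\int[mu]_(x in A) f x <= \int[mu]_(x in B) f x)%E.
Proof.
move=> AB f0; rewrite (integral_mkcond A) (integral_mkcond B); apply: le_ge0_integral => x _. by rewrite patchE; case: ifP.
rewrite !patchE; case: ifPn => [/set_mem /AB /mem_set ->//|_]; by case: ifP.
Qed.

Lemma ereal_geo0 {R : realType} (u_ : nat -> \bar R) (c : R) : (forall j, 0 <= u_ j)%E ->
  (forall j, u_ j <= (c / 8 ^+ j)%:E)%E -> u_ @ \oo --> 0%E.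
Proof.
move=> u0 uc; apply/ereal_cvg0P => // e e0.
have g0 : (fun j => c / 8 ^+ j : R) @ \oo --> (0 : R). rewrite -(mulr0 c); apply: cvgM; first exact: cvg_cst.
  rewrite (_ : (fun x => _) = GRing.exp (8^-1 : R)); last by apply/funext => j; rewrite exprVn.
  by apply: cvg_expr; rewrite ger0_norm// invf_lt1// ltr1n.
have /cvgrPdist_lt /(_ e e0)[N _ hN] := g0; exists N => k Nk.
apply: le_lt_trans (uc k) _; rewrite lte_fin; have := hN k Nk.
by rewrite sub0r normrN; apply: le_lt_trans; exact: ler_norm.
Qed.

Lemma step_meas {R : realType} d (U : measurableType d) (lo hi : R) (c : U -> R) : mfunT c ->
  mfunT (fun z : R * U => if lo < z.1 <= hi then c z.2 else 0).
Proof.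
move=> mc; rewrite (_ : (fun _ => _) = (fun z => if z \in `]lo, hi] `*` setT then c z.2 else 0)).
  apply: meas_patch; first exact: measurableX. by apply: mfunTS; apply: (mfun_comp mc); exact: measurable_snd.
apply/funext => -[s w] /=; case: ifPn => h; first by rewrite mem_set//; split => /=; rewrite in_itv.
by rewrite memNset// => -[/=]; rewrite in_itv (negbTE h).
Qed.

Lemma step_measE {R : realType} d d' (U : measurableType d) (M : measurableType d') (lo hi : R) (A : set M) (c : U -> R) :
  measurable A -> mfunT c ->
  mfunT (fun z : R * U * M => if (lo < z.1.1 <= hi) && (z.2 \in A) then c z.1.2 else 0).
Proof.
move=> mA mc; rewrite (_ : (fun _ => _) = (fun z => if z \in (`]lo, hi] `*` setT) `*` A then c z.1.2 else 0)).
  apply: meas_patch; first by do 2 apply: measurableX => //. apply: mfunTS; apply: (mfun_comp mc).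
  exact: (mfun_comp (@measurable_snd _ _ _ _)); exact: measurable_fst.
apply/funext => -[[s w] e] /=; case: ifPn => h.
  by case/andP: h => h1 h2; rewrite mem_set; split => /=; [split => //; rewrite in_itv|exact: set_mem].
rewrite memNset// => -[[/=]]; rewrite in_itv /= => h1 _ /mem_set h2.
by move: h; rewrite h1 h2.
Qed.

(** The sum is the integer part of [y] capped at [M], written through indicators of upper level
    sets: the staircase approximation of a bounded function. *)
Lemma count_below {R : realType} (M : nat) (y : R) : 0 <= y ->
  [/\ \sum_(j < M) (j.+1%:R <= y)%R%:R <= y, y < M%:R + 1 -> y <= \sum_(j < M) (j.+1%:R <= y)%R%:R + 1
    & M%:R <= y -> \sum_(j < M) (j.+1%:R <= y)%R%:R = M%:R :> R].
Proof.
move=> y0; elim: M => [|M [h1 h2 h3]]. by rewrite big_ord0 !add0r; split => // /ltW.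
rewrite big_ord_recr /=; case: (lerP M.+1%:R y) => h. have e : M%:R <= y by apply: le_trans h; rewrite ler_nat.
  rewrite (h3 e) mulr1n !natr1; split => //; exact: ltW.
rewrite mulr0n addr0; split => //.
move=> _; case: (ltP y M%:R) => h4; first by apply: h2; rewrite (lt_trans h4)// ltrDl.
by rewrite h3// natr1 ltW.
Qed.

(** * Moments of Brownian increments and Poisson counts *)

Section Noise.
Context {R : realType} {dO} {Omega : measurableType dO} (P : probability Omega R)
  {r q} (S : @noise R dO Omega r q).
Local Notation T := (horizon S).
Local Notation E := (marks S).
Local Notation fm := (fm P S).
Local Notation Fil s := (sigT_of (Fgen P S s)).
Local Notation leb := (@lebesgue_measure R).
Hypothesis hN : noise_axioms P S.

Definition incB (i : 'I_r) (s s' : R) (w : Omega) : R :=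
  bm S s' w i ord0 - bm S s w i ord0.

Definition cnt (D : set (mark R q * R)) (w : Omega) : R := fine (prm S w D).

Definition rate (A : set (mark R q)) : R := fine (levy S A).

Definition box (A : set (mark R q)) (s s' : R) : set (mark R q * R) := A `*` `]s, s'].

Lemma incB_meas i s s' : 0 <= s <= T -> 0 <= s' <= T -> mfunT (incB i s s').
Proof. by move=> hs hs'; apply: mfunB; exact: (bm_meas hN). Qed.

Lemma incB_law i s s' (A : set R) : 0 <= s -> s < s' -> s' <= T -> measurable A ->
  P [set w | A (incB i s s' w)] = normal_prob 0 (Num.sqrt (s' - s)) A.
Proof.
move=> s0 ss' s'T mA.
case: hN => _ _ [_ _ _ h] _ _.
have mAs j : measurable ((fun j => if j == i then A else setT) j) by case: ifP.
have := h s s' (fun j => if j == i then A else setT) setT s0 ss' s'T mAs.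
have sT : sigma_bm S s setT by exact: (@measurableT _ (sigT_of _)).
move=> /(_ sT); rewrite setIT probability_setT mule1.
rewrite (_ : [set _ | _] = [set w | A (incB i s s' w)]); last first. apply/seteqP; split => w /=.
    by move=> /(_ i); rewrite eqxx !mxE. by move=> hA j; case: eqP => // ->; rewrite !mxE.
move=> ->; rewrite (bigD1 i)//= eqxx big1 ?mule1// => j /negbTE ->.
exact: probability_setT.
Qed.

Lemma incB_integral i s s' (f : R -> \bar R) : 0 <= s -> s < s' -> s' <= T ->
  mfunT f -> (forall x, 0 <= f x)%E ->
  (\int[P]_w f (incB i s s' w) = \int[normal_prob 0 (Num.sqrt (s' - s))]_x f x)%E.
Proof.
move=> s0 ss' s'T mf f0.
have mI : mfunT (incB i s s'). apply: incB_meas; apply/andP; split => //; first by rewrite (le_trans _ s'T)// ltW.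
  by rewrite (le_trans s0)// ltW.
transitivity (\int[pushforward P (incB i s s' : Omega -> measurableTypeR R)]_x f x)%E. by rewrite ge0_integral_pushforward.
by apply: eq_measure_integral => A mA _; exact: incB_law.
Qed.

(** Only the fourth moment is estimated, from the normal law. The second follows from
    [x <= h + x ^+ 2 / h] with [x] the squared increment and [h] the length, so 65 is 1 + 64; the
    mean vanishes by symmetry. Only the orders in [h] matter later. *)
Lemma incB_moments i s s' : 0 <= s -> s <= s' -> s' <= T ->
  [/\ L2 P (incB i s s'), L2 P (fun w => incB i s s' w ^+ 2),
   Ex P (incB i s s') = 0, nrm P (incB i s s') <= 65 * (s' - s) &
   nrm P (fun w => incB i s s' w ^+ 2) <= 64 * (s' - s) ^+ 2].
Proof.
move=> s0; rewrite le_eqVlt => /predU1P[<- s'T|ss' s'T].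
  have -> : incB i s s = cst 0 by apply/funext => w; rewrite /incB subrr.
  have E0 : (fun w : Omega => (cst 0 w : R) ^+ 2) = cst (0 : R). by apply/funext => w; rewrite /cst (expr0n _ 2).
  have n0 : nrm P (cst (0 : R)) = 0 by rewrite /nrm E0 Ex_cst. rewrite E0 n0 Ex_cst subrr (expr0n _ 2) !mulr0.
  by split => //; exact: L2_cst.
have mI : mfunT (incB i s s'). apply: incB_meas; apply/andP; split => //; first by rewrite (le_trans _ s'T)// ltW.
  by rewrite (le_trans s0)// ltW.
set h := s' - s; have h0 : 0 < h by rewrite subr_gt0.
have sh : 0 < Num.sqrt h by rewrite sqrtr_gt0.
have E4 : (\int[P]_w (incB i s s' w ^+ 4)%:E <= (64 * h ^+ 2)%:E)%E.
  rewrite (@incB_integral i s s' (fun x => (x ^+ 4)%:E))//.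
  - apply: (le_trans (normal_fourth_moment sh)). by rewrite lee_fin (exprM _ 2 2) sqr_sqrtr// ltW.
  - by apply/measurable_EFinP; exact: mfunX.
  - by move=> x; rewrite lee_fin exprn_even_ge0.
have L4 : L2 P (fun w => incB i s s' w ^+ 2). split; first exact: mfunX. under eq_integral do rewrite -exprM.
  by rewrite (le_lt_trans E4)// ltry.
have L : L2 P (incB i s s'). apply: (L2P mI); exact: L2_L1 L4.
have n4 : nrm P (fun w => incB i s s' w ^+ 2) <= 64 * h ^+ 2.
  rewrite -lee_fin nrmE//; under eq_integral do rewrite -exprM. exact: E4.
split => //.
- pose Y : Omega -> measurableTypeR R := incB i s s'.
  have iY : P.-integrable setT (EFin \o (id : R -> R) \o Y) by exact: (L2_L1 L). rewrite /Ex /Rintegral.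
  have E1 : (\int[P]_w (incB i s s' w)%:E = \int[pushforward P Y]_x x%:E)%E. by rewrite integral_pushforward.
  have E2 : (\int[pushforward P Y]_x x%:E = \int[normal_prob 0 (Num.sqrt h)]_x x%:E)%E.
    by apply: eq_measure_integral => A mA _; exact: incB_law.
  have i2 : (normal_prob 0 (Num.sqrt h)).-integrable setT (EFin \o (id : R -> R)).
    apply/integrableP; split; first exact/measurable_EFinP. rewrite -(@incB_integral i s s' (fun x => `|x%:E|)%E)//.
      by have /integrableP[_] := L2_L1 L. exact: mfun_comp.
  rewrite E1 E2; have := normal_mean_sym sh (f := id) (fun x => erefl) _ i2. by apply.
- have : nrm P (incB i s s') <= Ex P (fun w => h + h^-1 * (incB i s s' w ^+ 2) ^+ 2). apply: Ex_le.
    + exact: L2_sqr.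
    + by apply: L1D; [exact: L1_cst|apply: L1Z; exact: L2_sqr]. move=> w; set x := _ ^+ 2. rewrite -subr_ge0.
    have -> : h + h^-1 * x ^+ 2 - x = h^-1 * ((x - h) ^+ 2 + h * x). by field; rewrite gt_eqF.
    have x0 : 0 <= x := sqr_ge0 _. apply: mulr_ge0; first by rewrite invr_ge0 ltW.
    by apply: addr_ge0; [exact: sqr_ge0|apply: mulr_ge0 => //; exact: ltW].
  rewrite ExD; [|exact: L1_cst|by apply: L1Z; exact: L2_sqr]. rewrite Ex_cst ExZ; last exact: L2_sqr.
  move=> /le_trans; apply. have : h^-1 * nrm P (fun w => incB i s s' w ^+ 2) <= h^-1 * (64 * h ^+ 2).
    by rewrite ler_wpM2l// invr_ge0 ltW. have -> : h^-1 * (64 * h ^+ 2) = 64 * h by field; rewrite gt_eqF. rewrite /nrm; lra.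
Qed.

Definition lam (D : set (mark R q * R)) : R := fine ((levy S \x leb) D)%E.

Lemma levy_le A : measurable A -> A `<=` E -> (levy S A <= levy S E)%E.
Proof.
move=> mA AE; apply: le_measure; rewrite ?inE//.
by case: hN => _ [mE _ _ _ _] _ _ _.
Qed.

Lemma levy_fin A : measurable A -> A `<=` E -> levy S A \is a fin_num.
Proof.
move=> mA AE; rewrite ge0_fin_numE// (le_lt_trans (levy_le mA AE))//.
by case: hN => _ [_ _ _ h _] _ _ _.
Qed.

Lemma rate_ge0 A : 0 <= rate A. Proof. exact: fine_ge0. Qed.

Lemma mE : measurable E. Proof. by case: hN => _ [h _ _ _ _] _ _ _. Qed.

Lemma rate_le A : measurable A -> A `<=` E -> rate A <= rate E.
Proof.
move=> mA AE; rewrite /rate fine_le ?levy_fin//; first exact: mE.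
exact: levy_le.
Qed.

Lemma box_meas A s s' : measurable A -> measurable (box A s s').
Proof. by move=> mA; apply: measurableX. Qed.

Lemma box_sub A s s' : A `<=` E -> 0 <= s -> s' <= T -> box A s s' `<=` E `*` `[0, T].
Proof.
move=> AE s0 s'T z [Az]; rewrite /= !in_itv/= => /andP[h1 h2]; split; first exact: AE.
by rewrite (le_trans s0 (ltW h1)) (le_trans h2).
Qed.

Lemma lam_box A s s' : measurable A -> A `<=` E -> s <= s' ->
  lam (box A s s') = rate A * (s' - s).
Proof.
move=> mA AE ss'; rewrite /lam product_measure1E//= lebesgue_measure_itv/= lte_fin.
rewrite -[levy S A]fineK ?levy_fin//; case: ltP => h. by rewrite -EFinM.
by rewrite mule0/= (_ : s' = s) ?subrr ?mulr0//; apply/eqP; rewrite eq_le h.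
Qed.

Lemma lam_ge0 D : 0 <= lam D. Proof. exact: fine_ge0. Qed.

Lemma prm_law D k : measurable D -> D `<=` E `*` `[0, T] ->
  P [set w | prm S w D = k%:R%:E] = (poisson_weight (lam D) k)%:E.
Proof.
move=> mD DE; case: hN => _ _ _ [_ h] _.
have := h 1%N (fun _ => D) (fun _ => k) _ _; rewrite big_ord1 => <- //.
- by congr (P _); apply/seteqP; split => w hw; [move=> _; exact: hw|exact: (hw ord0)].
- by apply/trivIsetP => i j _ _; rewrite (ord1 i) (ord1 j) eqxx.
Qed.

Lemma prm_nat D : measurable D -> D `<=` E `*` `[0, T] ->
  {ae P, forall w, exists k : nat, prm S w D = k%:R%:E}.
Proof.
move=> mD DE.
have [] := poisson_integral (lam_ge0 D) (prm_meas hN mD DE) (fun k => prm_law k mD DE)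
  (measurable_cst (0 : R)) (fun _ => lexx 0).
by [].
Qed.

Lemma prm_finite : {ae P, forall w, prm S w (E `*` `[0, T]) \is a fin_num}.
Proof.
have mET : measurable (E `*` `[0, T]) by apply: measurableX => //; exact: mE.
have := prm_nat mET (@subset_refl _ _).
by apply: filterS => w [k ->].
Qed.

Lemma cnt_meas D : measurable D -> D `<=` E `*` `[0, T] -> mfunT (cnt D).
Proof. by move=> mD DE; apply: mfun_comp => //; exact: (prm_meas hN). Qed.

(* The second and fourth moments come from the factorial moments
   E[N (N - 1) ... (N - j + 1)] = lam ^ j. *)
Lemma cnt_moments D : measurable D -> D `<=` E `*` `[0, T] ->
  let l := lam D in
  [/\ L2 P (cnt D), L2 P (fun w => cnt D w ^+ 2 - cnt D w), Ex P (cnt D) = l,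
   nrm P (cnt D) = l + l ^+ 2 &
   nrm P (fun w => cnt D w ^+ 2 - cnt D w) = l ^+ 4 + 4 * l ^+ 3 + 2 * l ^+ 2].
Proof.
move=> mD DE /=; set l := lam D; have l0 : 0 <= l := lam_ge0 D.
have mX := cnt_meas mD DE.
have H h := @poisson_integral _ _ _ P l _ l0 (prm_meas hN mD DE) (fun k => prm_law k mD DE) h.
have F j := nneseries_ffact l0 j.
have p0 k := poisson_weight_ge0 l0 k.
pose x (k : nat) : R := k%:R.
have f1 k : (k ^_ 1)%:R = x k by rewrite ffactn1.
have f2 k : (k ^_ 2)%:R = x k ^+ 2 - x k. rewrite ffactnSr ffactn1 natrM; case: k => [|k]; rewrite /x.
    by rewrite mul0r (expr0n _ 2) subr0. by rewrite subn1/= -natr1; ring.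
have f3 k : (k ^_ 3)%:R = x k ^+ 3 - 3 * x k ^+ 2 + 2 * x k. rewrite ffactnSr natrM f2; case: k => [|[|k]]; rewrite /x.
  - by rewrite !expr0n/=; ring.
  - by rewrite !expr1n/=; ring.
  - by rewrite subn2/= -!natr1; ring.
have f4 k : (k ^_ 4)%:R = x k ^+ 4 - 6 * x k ^+ 3 + 11 * x k ^+ 2 - 6 * x k.
  rewrite ffactnSr natrM f3; case: k => [|[|[|k]]]; rewrite /x.
  - by rewrite !expr0n/=; ring.
  - by rewrite !expr1n/=; ring.
  - by ring.
  - by rewrite (_ : (k.+3 - 3 = k)%N) ?subSS ?subn0// -!natr1; ring.
have fp j k : (0 <= ((k ^_ j)%:R * poisson_weight l k)%:E)%E. by rewrite lee_fin mulr_ge0.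
have sq : (\int[P]_w (cnt D w ^+ 2)%:E = (l + l ^+ 2)%:E)%E.
  have [-> _] := H (fun y => y ^+ 2) (mfunX 2 (@measurable_id _ _ _)) (fun y => sqr_ge0 y).
  rewrite EFinD -{1}[l]expr1 -(F 1%N) -(F 2%N) -nneseriesD//.
  apply: eq_eseriesr => k _; rewrite -EFinD f1 f2 -/(x k); congr EFin; ring.
have qd : (\int[P]_w ((cnt D w ^+ 2 - cnt D w) ^+ 2)%:E = (l ^+ 4 + 4 * l ^+ 3 + 2 * l ^+ 2)%:E)%E.
  have [-> _] := H (fun y => (y ^+ 2 - y) ^+ 2)
    (mfunX 2 (mfunB (mfunX 2 (@measurable_id _ _ _)) (@measurable_id _ _ _))) (fun y => sqr_ge0 _).
  rewrite [RHS](_ : _ = (l ^+ 4)%:E + 4%:E * (l ^+ 3)%:E + 2%:E * (l ^+ 2)%:E)%E; last first.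
    by rewrite -!EFinM -!EFinD. rewrite -(F 2%N) -(F 3%N) -(F 4%N) -!nneseriesZl// -!nneseriesD//; first last.
  - by move=> k _ _; rewrite mule_ge0// lee_fin.
  - by move=> k _ _; rewrite mule_ge0// lee_fin.
  - by move=> k _ _; rewrite adde_ge0// mule_ge0// lee_fin.
  apply: eq_eseriesr => k _; rewrite -!EFinM -!EFinD f2 f3 f4 -/(x k); congr EFin; ring.
have c0 w : 0 <= cnt D w by exact: fine_ge0.
have L : L2 P (cnt D) by split => //; rewrite sq ltry.
have L' : L2 P (fun w => cnt D w ^+ 2 - cnt D w). by split; [apply: mfunB => //; exact: mfunX|rewrite qd ltry].
split => //.
- apply: EFin_inj; rewrite ge0_ExE; last exact: L2_L1.
  have [E1 _] := H (fun y => `|y|) (@normr_measurable _ _) (fun y => normr_ge0 y).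
  transitivity (\int[P]_w (`|cnt D w|)%:E)%E. by apply: eq_integral => w _; rewrite ger0_norm.
  rewrite E1 -[l in RHS]expr1 -(F 1%N). by apply: eq_eseriesr => k _; rewrite f1 ger0_norm.
- by apply: EFin_inj; rewrite nrmE.
- by apply: EFin_inj; rewrite nrmE.
Qed.

Lemma compensatedE A s s' w : compensated S w A s s' = cnt (box A s s') w - rate A * (s' - s).
Proof. by []. Qed.

Lemma comp_moments A s s' : measurable A -> A `<=` E -> 0 <= s -> s <= s' -> s' <= T ->
  [/\ L2 P (fun w => compensated S w A s s'),
   Ex P (fun w => compensated S w A s s') = 0 &
   nrm P (fun w => compensated S w A s s') <= rate E * (s' - s)].
Proof.
move=> mA AE s0 ss' s'T.
have [h1 _ h2 h3 _] := cnt_moments (box_meas s s' mA) (box_sub AE s0 s'T).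
rewrite lam_box// in h2 h3.
have L1c : L1 P (cst (rate A * (s' - s))) := L1_cst P _.
split.
- by apply: L2B => //; exact: L2_cst.
- by rewrite (ExB (L2_L1 h1) L1c) h2 Ex_cst subrr.
- set m := rate A * (s' - s). have -> : nrm P (fun w => compensated S w A s s') = nrm P (cnt (box A s s')) - m ^+ 2.
    rewrite /nrm. transitivity (Ex P (fun w => (cnt (box A s s') w ^+ 2 - 2 * m * cnt (box A s s') w) + m ^+ 2)).
      by apply: Ex_eq => w; rewrite compensatedE -/m; ring.
    rewrite ExD; [|apply: L1B; [exact: L2_sqr|apply: L1Z; exact: L2_L1]|exact: L1_cst].
    rewrite ExB; [|exact: L2_sqr|by apply: L1Z; exact: L2_L1]. rewrite Ex_cst ExZ ?h2; last exact: L2_L1.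
    rewrite -/m; ring. rewrite h3 -/m addrK /m ler_wpM2r ?subr_ge0//. exact: rate_le.
Qed.

(** * Independence of the past from the noise of a later interval *)

Section PoissonIndep.
Local Notation space := (set (mark R q * R)).

Definition prm_event (K : finType) (D : K -> space) (c : {ffun K -> nat}) : set Omega :=
  [set w | forall k, prm S w (D k) = (c k)%:R%:E].

Definition okD (K : finType) (D : K -> space) :=
  (forall k, measurable (D k) /\ D k `<=` E `*` `[0, T]) /\
  (forall j k z, D j z -> D k z -> j = k).

Lemma prm_event_meas (K : finType) (D : K -> space) c : okD D -> measurable (prm_event D c).
Proof.
move=> [h _]; apply: meas_forall => k; have [mD DE] := h k.
rewrite -[X in measurable X]setTI.
apply: (prm_meas hN mD DE measurableT (emeasurable_set1 _)).
Qed.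

Lemma prm_event_law (K : finType) (D : K -> space) c : okD D ->
  P (prm_event D c) = (\prod_k poisson_weight (lam (D k)) (c k))%:E.
Proof.
move=> [h dD]; case: (hN) => _ _ _ [_ H] _.
have := H #|K| (fun i => D (enum_val i)) (fun i => c (enum_val i)).
rewrite (reindex (@enum_val K K)); last first. exact: onW_bij; apply: enum_val_bij.
move=> <-.
- congr (P _); apply/seteqP; split => w /= hw; first by move=> i; exact: hw.
  by move=> k; have := hw (enum_rank k); rewrite enum_rankK.
- by move=> i; exact: h.
- apply/trivIsetP => i j _ _ /eqP ij; apply/seteqP; split => // z [/= zi zj].
  by apply: ij; apply: enum_val_inj; exact: (dD _ _ z).
Qed.

Section Two.
Variables (K1 K2 : finType) (D1 : K1 -> space) (D2 : K2 -> space).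
Hypotheses (ok1 : okD D1) (ok2 : okD D2).
Hypothesis dis : forall i j z, D1 i z -> D2 j z -> False.

Lemma prm_event_indep c1 c2 : indepS P (prm_event D1 c1) (prm_event D2 c2).
Proof.
pose D (k : K1 + K2) := match k with inl i => D1 i | inr j => D2 j end.
pose c : {ffun K1 + K2 -> nat} := [ffun k => match k with inl i => c1 i | inr j => c2 j end].
have okk : okD D. split; first by case=> k; [exact: ok1.1|exact: ok2.1]. move=> [i|i] [j|j] z /=.
  - by move=> h1 h2; congr inl; exact: (ok1.2 _ _ _ h1 h2).
  - by move=> h1 h2; case: (dis h1 h2).
  - by move=> h1 h2; case: (dis h2 h1).
  - by move=> h1 h2; congr inr; exact: (ok2.2 _ _ _ h1 h2).
rewrite /indepS (_ : _ `&` _ = prm_event D c); last first. apply/seteqP; split => w /=.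
    by move=> [h1 h2] [k|k]; rewrite ffunE; [exact: h1|exact: h2].
  by move=> h; split => k; [have := h (inl k)|have := h (inr k)]; rewrite ffunE.
rewrite !prm_event_law// big_sumType/= EFinM.
by congr (_ * _)%E; congr EFin; apply: eq_bigr => k _; rewrite ffunE.
Qed.

(** The joint law of the counts is given only at natural values and for disjoint sets; events are
    therefore written, up to a null set, as countable unions of the events [prm_event D c], for
    which independence is a product formula. *)
Definition countable_event (K : finType) (D : K -> space) (X : set Omega) :=
  measurable X /\ exists U : set {ffun K -> nat},
    {ae P, forall w, X w <-> exists2 c, U c & prm_event D c w}.

Lemma prm_event_inj (K : finType) (D : K -> space) c c' w :
  prm_event D c w -> prm_event D c' w -> c = c'.
Proof.
move=> h h'; apply/ffunP => k; have := h k; rewrite h' => -[/eqP].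
by rewrite eqr_nat => /eqP.
Qed.

Lemma countable_event_indep X1 X2 : countable_event D1 X1 -> countable_event D2 X2 ->
  indepS P X1 X2.
Proof.
move=> [m1 [U1 a1]] [m2 [U2 a2]].
apply: (indep_countable (F := prm_event D1) (U := U1)) => //.
- by move=> c; exact: prm_event_meas.
- by move=> c c' w; exact: prm_event_inj.
move=> c1; apply: indepSC.
apply: (indep_countable (F := prm_event D2) (U := U2)) => //.
- by move=> c; exact: prm_event_meas.
- by move=> c c' w; exact: prm_event_inj.
- exact: prm_event_meas.
by move=> c2; apply: indepSC; exact: prm_event_indep.
Qed.
End Two.

Lemma ae_nat (K : finType) (D : K -> space) : okD D ->
  {ae P, forall w, exists c, prm_event D c w}.
Proof.
move=> [h _].
have : {ae P, forall w, forall k : K, exists n : nat, prm S w (D k) = n%:R%:E}.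
  by apply: filter_forall => k; have [mD DE] := h k; exact: (prm_nat mD DE).
apply: filterS => w hw.
have [c hc] := choice hw.
by exists [ffun k => c k] => k; rewrite ffunE.
Qed.

Lemma countable_event_future (K : finType) (D : K -> space) (Z : K -> set \bar R) :
  okD D -> (forall k, measurable (Z k)) ->
  countable_event D [set w | forall k, Z k (prm S w (D k))].
Proof.
move=> ok mZ; split. apply: meas_forall => k; have [mD DE] := ok.1 k.
  by rewrite -[X in measurable X]setTI; exact: (prm_meas hN mD DE).
exists [set c | forall k, Z k (c k)%:R%:E].
apply: filterS (ae_nat ok) => w [c hc]; split. by move=> h; exists c =>  k; rewrite -hc.
by move=> [c' h' hc'] k; rewrite hc'.
Qed.

(** The points of [E] times [[0, s]] lying in [D i] exactly for the [i] of [B]: atoms of the Boolean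
    algebra generated by the [D i]. Counts of overlapping sets become sums of counts of disjoint
    atoms. *)
Definition atom m (s : R) (D : 'I_m -> space) (B : {set 'I_m}) : space :=
  (E `*` `[0, s]) `&` [set z | forall i, (if i \in B then D i else ~` D i) z].

Lemma atom_ok m s (D : 'I_m -> space) : s <= T ->
  (forall i, measurable (D i)) -> okD (atom s D).
Proof.
move=> sT mD; split. move=> B; split. apply: measurableI; first by apply: measurableX => //; exact: mE.
    apply: meas_forall => i; case: (i \in B) => //. exact: measurableC. move=> z [[Ez zs] _]; split => //.
  by move: zs; rewrite /= !in_itv/= => /andP[-> /le_trans->].
move=> B B' z [_ h] [_ h']; apply/setP => i; have := h i; have := h' i.
by case: (i \in B); case: (i \in B').
Qed.

Lemma prm_atom m s (D : 'I_m -> space) i w : (forall i, measurable (D i)) ->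
  D i `<=` E `*` `[0, s] ->
  prm S w (D i) = (\sum_(B \in [set B : {set 'I_m} | i \in B]) prm S w (atom s D B))%E.
Proof.
move=> mD DE.
rewrite -measure_fin_bigcup//=; last 2 first.
- move=> B B' _ _ [z [[_ h] [_ h']]]. apply/setP => j; have := h j; have := h' j. by case: (j \in B); case: (j \in B').
- move=> B _; apply: measurableI; first by apply: measurableX => //; exact: mE.
  apply: meas_forall => j; case: (j \in B) => //. exact: measurableC.
congr (prm S w _); apply/seteqP; split => z.
  move=> Dz; exists [set j | `[< D j z >]]%SET; first by rewrite /= inE; exact/asboolP. split; first exact: DE.
  by move=> j; rewrite inE; case: asboolP.
by move=> [B iB [_ h]]; have := h i; rewrite iB.
Qed.

Definition pastG (s : R) : set (set Omega) := [set X | exists m (D : 'I_m -> space) (Y : 'I_m -> set \bar R),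
  (forall i, [/\ measurable (D i), D i `<=` E `*` `[0, s] & measurable (Y i)]) /\
  X = [set w | forall i, Y i (prm S w (D i))]].

Lemma pastG_setI s : setI_closed (pastG s).
Proof.
move=> _ _ [m1 [D1 [Y1 [h1 ->]]]] [m2 [D2 [Y2 [h2 ->]]]].
exists (m1 + m2)%N, (fun i => match fintype.split i with inl j => D1 j | inr j => D2 j end),
  (fun i => match fintype.split i with inl j => Y1 j | inr j => Y2 j end); split. by move=> i; case: fintype.split.
apply/seteqP; split => w /=. by move=> [hw1 hw2] i; case: fintype.split.
move=> h; split => i. by have := h (unsplit (inl i)); rewrite unsplitK.
by have := h (unsplit (inr i)); rewrite unsplitK.
Qed.

Lemma pastG_countable s X : s <= T -> pastG s X ->
  exists m (D : 'I_m -> space), (forall i, measurable (D i)) /\ countable_event (atom s D) X.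
Proof.
move=> sT [m [D [Y [h ->]]]]; exists m, D; split; first by move=> i; have [] := h i.
have mD i : measurable (D i) by have [] := h i.
have ok := atom_ok sT mD.
split. apply: meas_forall => i; have [_ DE mY] := h i.
  rewrite -[X in measurable X]setTI; apply: (prm_meas hN) => // z /DE [Ez zs].
  by split => //; move: zs; rewrite /= !in_itv/= => /andP[-> /le_trans->].
exists [set c : {ffun {set 'I_m} -> nat} | forall i, Y i (\sum_(B \in [set B : {set 'I_m} | i \in B]) ((c B)%:R : R)%:E)%E].
apply: filterS (ae_nat ok) => w [c hc].
have eE i : prm S w (D i) = (\sum_(B \in [set B : {set 'I_m} | i \in B]) ((c B)%:R : R)%:E)%E. have [_ DE _] := h i.
  by rewrite (prm_atom _ mD DE); apply: eq_fsbigr => B _; rewrite hc.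
split. by move=> hw; exists c => // i; rewrite -eE.
by move=> [c' h' /(prm_event_inj hc) cc] i; rewrite eE cc; exact: h'.
Qed.

Lemma sigma_prm_pastG s : sigma_prm S s `<=` <<s pastG s >>.
Proof.
apply: sub_sigma_algebra2 => A [D [Y [mD DE mY ->]]].
exists 1%N, (fun _ => D), (fun _ => Y); split => //.
by apply/seteqP; split => w h; [move=> _|exact: (h ord0)].
Qed.

Lemma pastG_meas s : s <= T -> pastG s `<=` measurable.
Proof. by move=> sT X /(pastG_countable sT) [m [D [_ []]]]. Qed.

(** The past sets are cut into atoms below time [s], the sets [D k] lie above it, so all of them
    together are disjoint and the product formula applies; a pi-lambda argument, with the finite
    cylinders [pastG] as generators, covers the whole past. *)
Lemma prm_past_future (K : finType) (D : K -> space) (s : R) (Z : K -> set \bar R) C :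
  s <= T -> okD D -> (forall k z, D k z -> s < z.2) ->
  (forall k, measurable (Z k)) -> sigma_prm S s C ->
  indepS P C [set w | forall k, Z k (prm S w (D k))].
Proof.
move=> sT ok fut mZ /sigma_prm_pastG.
have ce := countable_event_future ok mZ.
apply: indep_sigma_l.
- exact: pastG_setI.
- exact: pastG_meas.
- by case: ce.
move=> X /(pastG_countable sT)[m [D' [mD' cX]]].
apply: (countable_event_indep (atom_ok sT mD') ok) => //.
move=> B k z [[_ /=]]; rewrite in_itv/= => /andP[_ zs] _ /fut.
by rewrite ltNge zs.
Qed.

Section OneStep.
Variables (K : finType) (A : K -> set (mark R q)).
Hypothesis mA : forall k, measurable (A k) /\ A k `<=` E.
Hypothesis dA : forall j k e, A j e -> A k e -> j = k.

Definition freshG (s s' : R) : set (set Omega) :=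
  [set X | exists (Z : 'I_r -> set R) (Y : K -> set \bar R),
    [/\ forall i, measurable (Z i), forall k, measurable (Y k) &
     X = [set w | forall i, Z i (incB i s s' w)] `&`
         [set w | forall k, Y k (prm S w (box (A k) s s'))]]].

Lemma freshG_setI s s' : setI_closed (freshG s s').
Proof.
move=> _ _ [Z1 [Y1 [mZ1 mY1 ->]]] [Z2 [Y2 [mZ2 mY2 ->]]].
exists (fun i => Z1 i `&` Z2 i), (fun k => Y1 k `&` Y2 k); split.
- by move=> i; exact: measurableI.
- by move=> i; exact: measurableI.
apply/seteqP; split => w /=. by move=> [[h1 h2] [h3 h4]]; split=> i; split.
by move=> [h1 h2]; split; split => i; have := h1; have := h2 => g1 g2; [case: (g2 i)|case: (g1 i)|case: (g2 i)|case: (g1 i)].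
Qed.

Lemma box_okD s s' : 0 <= s -> s' <= T -> okD (fun k => box (A k) s s').
Proof.
move=> s0 s'T; split. by move=> k; have [m1 m2] := mA k; split; [exact: box_meas|exact: box_sub].
by move=> j k z [h1 _] [h2 _]; exact: (dA h1 h2).
Qed.

Lemma incB_sigma i (s s' : R) (Z : set R) : 0 <= s <= T -> 0 <= s' <= T -> measurable Z ->
  sigma_bm S T [set w | Z (incB i s s' w)].
Proof.
move=> hs hs' mZ.
pose gT := sigT_of [set A : set Omega | exists v Y, [/\ 0 <= v <= T, borel Y & A = bm S v @^-1` Y]].
have mb v : 0 <= v <= T -> mfun [set: gT] ((fun w => bm S v w i ord0) : gT -> R).
  move=> hv; apply: (@mx_measP R _ gT r 1 (bm S v)).1 => Y bY. by apply: sub_sigma_algebra; exists v, Y.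
have m : mfun [set: gT] (incB i s s' : gT -> R). by apply: mfunB; exact: mb.
by have := m measurableT Z mZ; rewrite setTI.
Qed.

Lemma incBs_sigma (s s' : R) (Z : 'I_r -> set R) : 0 <= s <= T -> 0 <= s' <= T ->
  (forall i, measurable (Z i)) ->
  sigma_bm S T [set w | forall i, Z i (incB i s s' w)].
Proof.
move=> hs hs' mZ.
pose gT := sigT_of [set A : set Omega | exists v Y, [/\ 0 <= v <= T, borel Y & A = bm S v @^-1` Y]].
apply: (@meas_forall _ gT) => i.
exact: incB_sigma.
Qed.

Lemma prms_sigma (s s' : R) (Y : K -> set \bar R) : 0 <= s -> s' <= T ->
  (forall k, measurable (Y k)) ->
  sigma_prm S T [set w | forall k, Y k (prm S w (box (A k) s s'))].
Proof.
move=> s0 s'T mY.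
pose gT := sigT_of [set A : set Omega | exists (D : set (mark R q * R)) (Y : set (\bar R)),
        [/\ measurable D, D `<=` E `*` `[0, T], measurable Y & A = (fun w => prm S w D) @^-1` Y]].
apply: (@meas_forall _ gT) => k.
apply: sub_sigma_algebra; exists (box (A k) s s'), (Y k).
by have [h1 h2] := (box_okD s0 s'T).1 k; split.
Qed.

Lemma freshG_meas s s' : 0 <= s -> s <= s' -> s' <= T -> freshG s s' `<=` measurable.
Proof.
move=> s0 ss' s'T X [Z [Y [mZ mY ->]]].
apply: measurableI. apply: (sigma_bm_meas hN (lexx T)); apply: incBs_sigma => //. by rewrite s0 (le_trans ss').
  by rewrite s'T (le_trans s0).
exact: (sigma_prm_meas hN (lexx T) (prms_sigma s0 s'T mY)).
Qed.

Lemma BN_indep C D : sigma_bm S T C -> sigma_prm S T D -> indepS P C D.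
Proof. by case: hN => _ _ _ _ h; exact: h. Qed.

(** Intersection-stable generators of the filtration: up to a null set, a Brownian event and a
    Poisson event combined. *)
Definition pastF (s : R) : set (set Omega) := [set X | measurable X /\
  exists C1 C2, [/\ sigma_bm S s C1, sigma_prm S s C2 &
    {ae P, forall w, X w <-> (C1 w /\ C2 w)}]].

Lemma pastF_setI s : setI_closed (pastF s).
Proof.
move=> X X' [mX [C1 [C2 [h1 h2 h3]]]] [mX' [C1' [C2' [h1' h2' h3']]]].
split; first exact: measurableI.
exists (C1 `&` C1'), (C2 `&` C2'); split.
- exact: (@measurableI _ (sigT_of _)).
- exact: (@measurableI _ (sigT_of _)).
apply: filterS2 h3 h3' => w h h'; rewrite /= h h'; tauto.
Qed.

Lemma filt_pastF s : s <= T -> filt P S s `<=` <<s pastF s >>.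
Proof.
move=> sT; apply: sub_sigma_algebra2 => X [[h|h]|h].
- split; first exact: (sigma_bm_meas hN sT). exists X, setT; split => //; first exact: (@measurableT _ (sigT_of _)).
  by apply: aeW => w; split => [|[]].
- split; first exact: (sigma_prm_meas hN sT). exists setT, X; split => //; first exact: (@measurableT _ (sigT_of _)).
  by apply: aeW => w; split => [|[]].
- split; first exact: (negl_meas hN). exists set0, setT; split.
  + exact: (@measurable0 _ (sigT_of _)).
  + exact: (@measurableT _ (sigT_of _)). by apply: negligibleS h => w nh; apply: contrapT => nX; apply: nh; split => // -[].
Qed.

(** A fourfold factorisation: the Brownian and the Poisson sides are independent of each other, and
    within each side the past is independent of the new noise. *)
Lemma pastF_freshG s s' C D : 0 <= s -> s < s' -> s' <= T ->
  pastF s C -> freshG s s' D -> indepS P C D.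
Proof.
move=> s0 ss' s'T [mC [C1 [C2 [h1 h2 h3]]]] [Z [Y [mZ mY DE]]].
have sT : s <= T by rewrite (le_trans _ s'T)// ltW.
have s'0 : 0 <= s' by rewrite (le_trans s0)// ltW.
have mD : measurable D. by apply: (freshG_meas s0 (ltW ss') s'T); exists Z, Y.
set D1 := [set w | _] in DE; set D2 := [set w | _] in DE.
have b1 : sigma_bm S T C1 by exact: (sigma_bm_mono sT).
have b2 : sigma_prm S T C2 by exact: (sigma_prm_mono sT).
have d1 : sigma_bm S T D1 by apply: incBs_sigma; rewrite ?s0 ?s'0 ?s'T.
have d2 : sigma_prm S T D2 by exact: prms_sigma.
have cd1 : sigma_bm S T (C1 `&` D1) by exact: (@measurableI _ (sigT_of _)).
have cd2 : sigma_prm S T (C2 `&` D2) by exact: (@measurableI _ (sigT_of _)).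
have mb X : sigma_bm S T X -> measurable X by apply: (sigma_bm_meas hN).
have mp X : sigma_prm S T X -> measurable X by apply: (sigma_prm_meas hN).
have i1 : indepS P C1 D1. rewrite /indepS setIC muleC; case: (hN) => _ _ [_ _ _ H] _ _.
  have Dinc : D1 = [set w | forall i, Z i ((bm S s' w - bm S s w) i ord0)].
    by apply/seteqP; split => w h i; have := h i; rewrite !mxE.
  have HT : sigma_bm S s setT by exact: (@measurableT _ (sigT_of _)). rewrite Dinc H//; congr (_ * _)%E.
  have := H s s' Z setT s0 ss' s'T mZ HT. by rewrite setIT probability_setT mule1 => <-.
have i2 : indepS P C2 D2. apply: (prm_past_future sT (box_okD s0 s'T)) => // k z [_ /=]. by rewrite in_itv/= => /andP[].
apply: (@indep_negl _ _ _ _ (C1 `&` C2)) => //.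
- by apply: measurableI; [exact: mb|exact: mp].
- by apply: filterS h3 => w h; rewrite h.
rewrite /indepS DE setIACA (BN_indep cd1 cd2) i1 i2 (BN_indep b1 b2) (BN_indep d1 d2).
by rewrite muleACA.
Qed.

Lemma filt_fresh s s' C D : 0 <= s -> s < s' -> s' <= T ->
  filt P S s C -> <<s freshG s s' >> D -> indepS P C D.
Proof.
move=> s0 ss' s'T fC fD.
have sT : s <= T by rewrite (le_trans _ s'T)// ltW.
apply: (@indep_sigma _ _ _ _ (pastF s) (freshG s s')) => //.
- exact: pastF_setI.
- by move=> X [].
- exact: freshG_setI.
- by apply: freshG_meas => //; exact: ltW.
- by move=> ? ?; exact: pastF_freshG.
- exact: filt_pastF.
Qed.

End OneStep.

End PoissonIndep.

(** Square-integrable martingales that start at 0 and are continuous in L2. Conditional expectations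
    are avoided: increments are orthogonal to all square-integrable variables of the past.
    L2-continuity is what excludes jumps at fixed times. *)
Definition mart (t : R) (X : R -> Omega -> R) : Prop :=
  [/\ forall s, t <= s <= T -> fm s (X s) /\ L2 P (X s),
      forall s s' Z, t <= s -> s <= s' -> s' <= T -> fm s Z -> L2 P Z ->
        Ex P (fun w => (X s' w - X s w) * Z w) = 0,
      forall s e, t <= s <= T -> 0 < e -> exists2 d, 0 < d &
        forall s', t <= s' <= T -> `|s' - s| < d -> nrm P (fun w => X s' w - X s w) <= e
    & {ae P, forall w, X t w = 0}].

Lemma fm_cst (s k : R) : fm s (cst k).
Proof. exact: measurable_cst. Qed.

Lemma fmD s X Y : fm s X -> fm s Y -> fm s (fun w => X w + Y w).
Proof. by move=> hX hY; exact: mfunD. Qed.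

Lemma fmM s X Y : fm s X -> fm s Y -> fm s (fun w => X w * Y w).
Proof. by move=> hX hY; exact: mfunM. Qed.

Lemma fmB s X Y : fm s X -> fm s Y -> fm s (fun w => X w - Y w).
Proof. by move=> hX hY; exact: mfunB. Qed.

Lemma fm_sum s (I : Type) (l : seq I) (X : I -> Omega -> R) :
  (forall i, fm s (X i)) -> fm s (fun w => \sum_(i <- l) X i w).
Proof.
move=> h; elim: l => [|i l IH]. by under [X in fm s X]funext do rewrite big_nil; exact: fm_cst.
by under [X in fm s X]funext do rewrite big_cons; exact: fmD.
Qed.

Lemma mart0 t : mart t (fun _ => cst 0).
Proof.
split.
- by move=> s _; split; [exact: fm_cst|exact: L2_cst].
- move=> s s' Z _ _ _ _ _; rewrite -[RHS](Ex_cst P 0); apply: Ex_eq => w. by rewrite subrr mul0r.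
- move=> s e _ e0; exists 1 => // s' _ _. rewrite (_ : nrm P _ = 0) ?ltW//.
  by rewrite -[RHS](Ex_cst P 0); apply: Ex_eq => w; rewrite subrr (expr0n _ 2).
- exact: aeW.
Qed.

Lemma martD t X Y : mart t X -> mart t Y -> mart t (fun s w => X s w + Y s w).
Proof.
move=> [x1 x2 x3 x4] [y1 y2 y3 y4]; split.
- move=> s hs; have [a b] := x1 s hs; have [c d] := y1 s hs. by split; [exact: fmD|exact: L2D].
- move=> s s' Z ts ss' s'T fZ LZ. have hs : t <= s <= T by rewrite ts (le_trans ss').
  have hs' : t <= s' <= T by rewrite s'T (le_trans ts). have LX := L2B (x1 _ hs').2 (x1 _ hs).2.
  have LY := L2B (y1 _ hs').2 (y1 _ hs).2.
  rewrite -[RHS](addr0 0) -{1}(x2 _ _ _ ts ss' s'T fZ LZ) -(y2 _ _ _ ts ss' s'T fZ LZ).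
  rewrite -ExD; [|exact: L2_mul|exact: L2_mul]. by apply: Ex_eq => w; ring.
- move=> s e hs e0. have e4 : 0 < e / 4 by rewrite divr_gt0.
  have [d d0 hd] := x3 s _ hs e4; have [d' d'0 hd'] := y3 s _ hs e4. exists (Num.min d d'); first by rewrite lt_min d0.
  move=> s' hs'; rewrite lt_min => /andP[l1 l2]. have LX := L2B (x1 _ hs').2 (x1 _ hs).2.
  have LY := L2B (y1 _ hs').2 (y1 _ hs).2. have := nrmD_le LX LY.
  rewrite (_ : (fun w => _ + _) = (fun w => X s' w + Y s' w - (X s w + Y s w))); last first. by apply/funext => w; ring.
  move=> /le_trans; apply; have := hd _ hs' l1; have := hd' _ hs' l2; lra.
- by apply: filterS2 x4 y4 => w -> ->; rewrite addr0.
Qed.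

Lemma martZ t k X : mart t X -> mart t (fun s w => k * X s w).
Proof.
move=> [x1 x2 x3 x4]; split.
- move=> s hs; have [a b] := x1 s hs. by split; [apply: fmM => //; exact: fm_cst|exact: L2Z].
- move=> s s' Z ts ss' s'T fZ LZ. have hs : t <= s <= T by rewrite ts (le_trans ss').
  have hs' : t <= s' <= T by rewrite s'T (le_trans ts). have LX := L2B (x1 _ hs').2 (x1 _ hs).2.
  rewrite -[RHS](mulr0 k) -(x2 _ _ _ ts ss' s'T fZ LZ) -ExZ; last exact: L2_mul. by apply: Ex_eq => w; ring.
- move=> s e hs e0. have k0 : 0 < k ^+ 2 + 1 by have := sqr_ge0 k; lra.
  have [d d0 hd] := x3 s (e / (k ^+ 2 + 1)) hs (divr_gt0 e0 k0). exists d => // s' hs' l.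
  have LX := L2B (x1 _ hs').2 (x1 _ hs).2. rewrite (_ : (fun w => _ - _) = (fun w => k * (X s' w - X s w))); last first.
    by apply/funext => w; ring. rewrite nrmZ; have := hd _ hs' l; rewrite ler_pdivlMr// => h.
  have := nrm_ge0 P (fun w => X s' w - X s w); have := sqr_ge0 k; nra.
- by apply: filterS x4 => w ->; rewrite mulr0.
Qed.

Lemma martB t X Y : mart t X -> mart t Y -> mart t (fun s w => X s w - Y s w).
Proof.
move=> hX hY; have := martD hX (martZ (-1) hY).
rewrite (_ : (fun s w => X s w + -1 * Y s w) = (fun s w => X s w - Y s w))//.
by apply/funext => s; apply/funext => w; rewrite mulN1r.
Qed.

Lemma mart_sum t (I : Type) (l : seq I) (X : I -> R -> Omega -> R) :
  (forall i, mart t (X i)) -> mart t (fun s w => \sum_(i <- l) X i s w).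
Proof.
move=> h; elim: l => [|i l IH]. rewrite (_ : (fun s w => _) = (fun _ : R => cst 0)); first exact: mart0.
  by apply/funext => s; apply/funext => w; rewrite big_nil.
rewrite (_ : (fun s w => _) = (fun s w => X i s w + \sum_(i <- l) X i s w)); first exact: martD.
by apply/funext => s; apply/funext => w; rewrite big_cons.
Qed.

(** Pythagoras: the increment is orthogonal to the earlier value. Estimates at the horizon thus
    cover all earlier times. *)
Lemma mart_nrm_le t X s s' : mart t X -> t <= s -> s <= s' -> s' <= T ->
  nrm P (X s) <= nrm P (X s').
Proof.
move=> [x1 x2 _ _] ts ss' s'T.
have hs : t <= s <= T by rewrite ts (le_trans ss').
have hs' : t <= s' <= T by rewrite s'T (le_trans ts).
have [f1 L1] := x1 _ hs; have [f2 L2'] := x1 _ hs'.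
have o := x2 _ _ _ ts ss' s'T f1 L1.
have LB := L2B L2' L1.
have : nrm P (X s') = nrm P (X s) + 2 * Ex P (fun w => (X s' w - X s w) * X s w)
    + nrm P (fun w => X s' w - X s w). rewrite /nrm -ExZ; last exact: L2_mul.
  rewrite -ExD; [|exact: L2_sqr|by apply: L1Z; exact: L2_mul].
  rewrite -ExD; [|by apply: L1D; [exact: L2_sqr|apply: L1Z; exact: L2_mul]|exact: L2_sqr]. by apply: Ex_eq => w; ring.
rewrite o mulr0 addr0 => ->; rewrite lerDl; exact: nrm_ge0.
Qed.

Lemma mart_mean t X s : t <= s <= T -> mart t X -> Ex P (X s) = 0.
Proof.
move=> /andP[ts sT] [x1 x2 _ x4].
have ht : t <= t <= T by rewrite lexx (le_trans ts).
have hs : t <= s <= T by rewrite ts.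
have [f1 L1] := x1 _ ht; have [f2 L2'] := x1 _ hs.
have <- := x2 t s (cst 1) (lexx t) ts sT (@fm_cst t 1) (L2_cst P 1).
apply: Ex_ae; [exact: L2_meas L2'| |]. by apply: mfunM => //; apply: mfunB; [exact: L2_meas L2'|exact: L2_meas L1].
by apply: filterS x4 => w ->; rewrite subr0 mulr1.
Qed.

(** The way orthogonality passes to L2-limits: Young's inequality with a small weight on [Z] bounds
    [x] by any positive number. *)
Lemma Ex_small (x : R) Z : L2 P Z ->
  (forall e, 0 < e -> exists F, [/\ L2 P F, nrm P F <= e & x = Ex P (fun w => F w * Z w)]) ->
  x = 0.
Proof.
move=> LZ h; apply/eqP; rewrite -normr_eq0; apply/eqP.
apply: nrm_le_eps_eq0 => // e e0.
have nZ := nrm_ge0 P Z; set n := nrm P Z in nZ.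
have n1 : 0 < 2 * (n + 1) by lra.
pose a := e / (2 * (n + 1)).
have a0 : 0 < a by rewrite divr_gt0.
have ai : 0 < a^-1 by rewrite invr_gt0.
have [F [LF nF ->]] := h (a * e / 2) (divr_gt0 (mulr_gt0 a0 e0) (ltr0n R 2)).
apply: (le_trans (Ex_mul_le ai LF LZ)); rewrite invrK -/n.
have h1 : a^-1 * nrm P F <= a^-1 * (a * e / 2) by rewrite ler_wpM2l// ltW.
have h2 : a^-1 * (a * e / 2) = e / 2 by field; rewrite gt_eqF.
have h3 : a * n <= e / 2. have -> : e / 2 = a * (n + 1) by rewrite /a; field; rewrite gt_eqF; lra.
  by rewrite ler_wpM2l ?ltW//; lra.
lra.
Qed.

(** Differences of the [X k] are martingales, so their norms grow in time and convergence at [T]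
    controls all times uniformly. Uniformity is what carries L2-continuity over to the limit. *)
Lemma mart_lim t (X : nat -> R -> Omega -> R) Y : t <= T ->
  (forall k, mart t (X k)) -> (forall s, t <= s <= T -> fm s (Y s)) ->
  (forall s e, t <= s <= T -> 0 < e -> exists N, forall k, (N <= k)%N ->
     L2 P (fun w => X k s w - Y s w) /\ nrm P (fun w => X k s w - Y s w) <= e) ->
  mart t Y.
Proof.
move=> tT mX fY h.
have LX k s : t <= s <= T -> L2 P (X k s) by move=> hs; have [/(_ _ hs)[]] := mX k.
have LY s : t <= s <= T -> L2 P (Y s). move=> hs; have [N hNk] := h s 1 hs ltr01.
  have [L _] := hNk N (leqnn N); have := L2B (LX N s hs) L. by under [X in L2 P X]funext do rewrite subKr.
have LXY k s : t <= s <= T -> L2 P (fun w => X k s w - Y s w). by move=> hs; apply: L2B; [exact: LX|exact: LY].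
have hT : t <= T <= T by rewrite tT lexx.
have ht : t <= t <= T by rewrite lexx.
(* Triangle inequalities through [X j] at [s] and at [T], with [j] so late that its own errors are
   negligible, give the factor 4. *)
have unif k s : t <= s <= T -> nrm P (fun w => X k s w - Y s w) <= 4 * nrm P (fun w => X k T w - Y T w).
  move=> hs; apply/ler_addgt0Pr => e e0. have e8 : 0 < e / 8 by rewrite divr_gt0.
  have [N1 h1] := h s _ hs e8; have [N2 h2] := h T _ hT e8. pose j := maxn N1 N2.
  have [_ n1] := h1 j (leq_maxl _ _); have [_ n2] := h2 j (leq_maxr _ _).
  have a1 := nrm_tri (LX k s hs) (LX j s hs) (LY s hs). have /andP[ts sT] := hs.
  have a2 := mart_nrm_le (martB (mX k) (mX j)) ts sT (lexx T). have a3 := nrm_tri (LX k T hT) (LY T hT) (LX j T hT).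
  rewrite [X in _ <= _ + 2 * X](nrmBC P) in a3. lra.
split.
- by move=> s hs; split; [exact: fY|exact: LY].
- move=> s s' Z ts ss' s'T fZ LZ. have hs : t <= s <= T by rewrite ts (le_trans ss').
  have hs' : t <= s' <= T by rewrite s'T (le_trans ts). apply: (Ex_small LZ) => e e0.
  have d0 : 0 < e / 4 by rewrite divr_gt0. have [N1 h1] := h s _ hs d0; have [N2 h2] := h s' _ hs' d0.
  pose k := maxn N1 N2. have [_ n1] := h1 k (leq_maxl _ _); have [_ n2] := h2 k (leq_maxr _ _).
  exists (fun w => (X k s w - Y s w) - (X k s' w - Y s' w)); split.
  + by apply: L2B; exact: LXY.
  + by apply: (le_trans (nrmB_le (LXY k s hs) (LXY k s' hs'))); lra. have [_ o _ _] := mX k.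
  have := o s s' Z ts ss' s'T fZ LZ. set u := Ex P (fun w => (Y s' w - Y s w) * Z w) => o0.
  rewrite -[LHS]subr0 -o0 -ExB; last 2 first.
  + by apply: L2_mul => //; apply: L2B; exact: LY.
  + by apply: L2_mul => //; apply: L2B; exact: LX. by apply: Ex_eq => w; ring.
- move=> s e hs e0. have d0 : 0 < e / 64 by rewrite divr_gt0.
  have [N hNk] := h T _ hT d0; have [_ nT] := hNk N (leqnn N). have e8 : 0 < e / 8 by rewrite divr_gt0.
  have [_ _ c _] := mX N; have [d d1 hd] := c s _ hs e8. exists d => // s' hs' ss'.
  have a1 := nrm_tri (LY s' hs') (LX N s' hs') (LY s hs). have a2 := nrm_tri (LX N s' hs') (LX N s hs) (LY s hs).
  rewrite [X in _ <= 2 * X + _](nrmBC P) in a1. have := unif N s hs; have := unif N s' hs'; have := hd s' hs' ss'; lra.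
- apply: nrm_eq0; first exact: LY. apply: nrm_le_eps_eq0; first exact: nrm_ge0.
  move=> e e0; have e2 : 0 < e / 2 by rewrite divr_gt0. have [N hNk] := h t _ ht e2; have [_ n] := hNk N (leqnn N).
  have [_ _ _ z] := mX N. have z0 : nrm P (X N t) = 0. rewrite /nrm -[RHS](Ex_cst P 0); apply: Ex_ae.
    + by apply: mfunX; exact: L2_meas (LX N t ht).
    + exact: measurable_cst.
    + by apply: filterS z => w ->; rewrite (expr0n _ 2). have := nrmB_le (LX N t ht) (LXY N t ht).
  rewrite z0 (_ : (fun w => _ - _) = Y t); last by apply/funext => w; ring. lra.
Qed.

(** What Brownian increments and compensated counts share as integrators: measurability, a squared
    norm at most linear in the length, additivity up to null sets, and orthogonality to the past.
    Simple integrals against both are then treated once. *)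
Definition noiseI (D : R -> R -> Omega -> R) : Prop :=
  [/\ forall a b, 0 <= a -> a <= b -> b <= T -> fm b (D a b) /\ L2 P (D a b),
      exists2 C : R, 0 <= C & forall a b, 0 <= a -> a <= b -> b <= T ->
        nrm P (D a b) <= C * (b - a),
      forall a b c, 0 <= a -> a <= b -> b <= c -> c <= T ->
        {ae P, forall w, D a c w = D a b w + D b c w}
    & forall a b Z, 0 <= a -> a <= b -> b <= T -> fm a Z -> L2 P Z ->
        Ex P (fun w => D a b w * Z w) = 0].

Lemma noiseI_diag D a : noiseI D -> 0 <= a -> a <= T -> {ae P, forall w, D a a w = 0}.
Proof.
move=> [h1 [C C0 h2] _ _] a0 aT; have [_ L] := h1 a a a0 (lexx a) aT.
apply: (nrm_eq0 L); apply/eqP; rewrite eq_le nrm_ge0 andbT.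
by have := h2 a a a0 (lexx a) aT; rewrite subrr mulr0.
Qed.

Section Unit.
Variables (D : R -> R -> Omega -> R) (t lo hi : R) (c : Omega -> R) (k : R).
Hypotheses (nD : noiseI D) (t0 : 0 <= t) (tlo : t <= lo) (lohi : lo <= hi) (hiT : hi <= T).
Hypotheses (fc : fm lo c) (ck : forall w, `|c w| <= k).

Let U (s : R) (w : Omega) : R := c w * D (Num.min lo s) (Num.min hi s) w.

Lemma unit_small s : t <= s -> s <= lo -> {ae P, forall w, U s w = 0}.
Proof.
move=> ts slo; rewrite /U (min_r slo) (min_r (le_trans slo lohi)).
have s0 : 0 <= s by rewrite (le_trans t0).
have sT : s <= T by rewrite (le_trans (le_trans slo lohi)).
by apply: filterS (noiseI_diag nD s0 sT) => w ->; rewrite mulr0.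
Qed.

(** The increment of [U] is [c] times the noise on the part of [[lo, hi]] between [s] and [s']. If
    that part is empty the witnesses satisfy [a = b], and their position relative to [s] is then
    left open. *)
Lemma unit_diff s s' : t <= s -> s <= s' -> s' <= T -> exists a b,
  [/\ [/\ lo <= a, a <= b, b <= T & b - a <= s' - s], s <= a \/ a = b &
   {ae P, forall w, U s' w - U s w = c w * D a b w}].
Proof.
move=> ts ss' s'T.
have lo0 : 0 <= lo by exact: le_trans tlo.
have hi0 : 0 <= hi by exact: le_trans lohi.
have loT : lo <= T by exact: le_trans hiT.
case: (leP s' lo) => s'lo. exists lo, lo; split; [split => //; lra|by right|]. have h0 := noiseI_diag nD lo0 loT.
  have h1 := unit_small (le_trans ts ss') s'lo; have h2 := unit_small ts (le_trans ss' s'lo).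
  by apply: filterS3 h0 h1 h2 => w -> -> ->; rewrite subrr mulr0.
case: (leP s lo) => slo. exists lo, (Num.min hi s'); split.
  - split => //; first by rewrite le_min lohi ltW. by rewrite ge_min hiT.
    have : Num.min hi s' <= s' by rewrite ge_min lexx orbT. lra.
  - by left. have h2 := unit_small ts slo. by apply: filterS h2 => w ->; rewrite /U subr0 (min_l (ltW s'lo)).
case: (leP s hi) => shi; last first. exists hi, hi; split; [split => //; lra|by right|].
  have h0 := noiseI_diag nD hi0 hiT. apply: filterS h0 => w ->; rewrite /U (min_l (ltW slo)) (min_l (ltW s'lo)).
  by rewrite (min_l (ltW shi)) (min_l (le_trans (ltW shi) ss')) subrr mulr0.
have sm : s <= Num.min hi s' by rewrite le_min shi.
have mT : Num.min hi s' <= T by rewrite ge_min hiT.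
exists s, (Num.min hi s'); split.
- split => //; first exact: ltW. have : Num.min hi s' <= s' by rewrite ge_min lexx orbT. lra.
- by left.
have [_ _ ad _] := nD.
apply: filterS (ad lo s (Num.min hi s') lo0 (ltW slo) sm mT) => w h.
by rewrite /U (min_l (ltW slo)) (min_l (ltW s'lo)) (min_r shi) h; ring.
Qed.

Lemma unit_mart : mart t U.
Proof.
have [d1 [C C0 d2] ad d3] := nD.
have lo0 : 0 <= lo by exact: le_trans tlo.

have loT : lo <= T by exact: le_trans hiT.
have mc := fm_meas hN loT fc.
have LU s : t <= s <= T -> fm s (U s) /\ L2 P (U s). move=> /andP[ts sT]; case: (leP s lo) => slo.
    have h0 := unit_small ts slo. have f : fm s (U s). by apply: (fm_ae (@fm_cst s 0)); apply: filterS h0 => w ->.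
    by split => //; apply: (L2_ae _ (L2_cst P 0) h0); exact: fm_meas f. rewrite /U (min_l (ltW slo)).
  have lm : lo <= Num.min hi s by rewrite le_min lohi ltW. have mT : Num.min hi s <= T by rewrite ge_min hiT.
  have [f L] := d1 lo (Num.min hi s) lo0 lm mT. split; last exact: L2M_bounded L.
  apply: fmM; first by apply: fm_mono fc; exact: ltW. by apply: fm_mono f; rewrite ge_min lexx orbT.
split => //.
- move=> s s' Z ts ss' s'T fZ LZ. have hs : t <= s <= T by rewrite ts (le_trans ss').
  have hs' : t <= s' <= T by rewrite s'T (le_trans ts). have sT : s <= T by rewrite (le_trans ss').
  have [a [b [[loa ab bT _] sa ae]]] := unit_diff ts ss' s'T. have a0 : 0 <= a by exact: le_trans loa.
  have aT : a <= T by exact: le_trans bT. have [fD LD] := d1 a b a0 ab bT. have mZ := fm_meas hN sT fZ.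
  have -> : Ex P (fun w => (U s' w - U s w) * Z w) = Ex P (fun w => D a b w * (c w * Z w)). apply: Ex_ae.
    + apply: mfunM => //; apply: mfunB; [exact: L2_meas (LU _ hs').2|exact: L2_meas (LU _ hs).2].
    + by apply: mfunM; [exact: L2_meas LD|exact: mfunM].
    + by apply: filterS ae => w ->; ring. case: sa => [sa|ab']; last first. rewrite -[RHS](Ex_cst P 0); apply: Ex_ae => //.
      by apply: mfunM; [exact: L2_meas LD|exact: mfunM].
    by apply: filterS (noiseI_diag nD a0 aT) => w; rewrite -ab' => ->; rewrite mul0r.
  apply: d3 => //; last exact: L2M_bounded LZ. by apply: fmM; [exact: fm_mono fc|exact: fm_mono fZ].
- move=> s e hs e0. have B0 : 0 < k ^+ 2 * C + 1. have : 0 <= k ^+ 2 * C by rewrite mulr_ge0 ?sqr_ge0. lra.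
  have key s1 s2 : t <= s1 -> s1 <= s2 -> s2 <= T -> nrm P (fun w => U s2 w - U s1 w) <= k ^+ 2 * C * (s2 - s1).
    move=> ts ss' s'T. have hs1 : t <= s1 <= T by rewrite ts (le_trans ss').
    have hs2 : t <= s2 <= T by rewrite s'T (le_trans ts). have [a [b [[loa ab bT ba] sa ae]]] := unit_diff ts ss' s'T.
    have a0 : 0 <= a by exact: le_trans loa. have [fD LD] := d1 a b a0 ab bT.
    rewrite (@nrm_ae _ _ _ P _ (fun w => c w * D a b w))//; last 2 first.
    + apply: mfunB; [exact: L2_meas (LU _ hs2).2|exact: L2_meas (LU _ hs1).2].
    + by apply: mfunM => //; exact: L2_meas LD. apply: (@le_trans _ _ (nrm P (fun w => k * D a b w))).
      apply: nrm_le; [|exact: L2Z|].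
      + by apply: mfunM => //; exact: L2_meas LD.
      + move=> w; rewrite !normrM ler_wpM2r//. by rewrite (le_trans (ck w))// ler_norm.
    rewrite nrmZ// -mulrA ler_wpM2l ?sqr_ge0//. by apply: (le_trans (d2 a b a0 ab bT)); rewrite ler_wpM2l.
  exists (e / (k ^+ 2 * C + 1)); first by rewrite divr_gt0. move=> s' hs' ss'.

  have fin : (k ^+ 2 * C) * `|s' - s| <= e.
    have : (k ^+ 2 * C + 1) * `|s' - s| <= (k ^+ 2 * C + 1) * (e / (k ^+ 2 * C + 1)). by rewrite ler_wpM2l// ltW.
    have -> : (k ^+ 2 * C + 1) * (e / (k ^+ 2 * C + 1)) = e by field; rewrite gt_eqF.
    by have := normr_ge0 (s' - s); lra. apply: (le_trans _ fin); move: hs hs' => /andP[ts sT] /andP[ts' s'T].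
  case: (leP s s') => h. by rewrite ger0_norm ?subr_ge0//; exact: key.
  rewrite nrmBC ltr0_norm ?subr_lt0// opprB; apply: key => //; exact: ltW.
- exact: unit_small.
Qed.
End Unit.

(** * Brownian increments and compensated counts as integrators *)

Section Fresh.
Variables (K : finType) (A : K -> set (mark R q)).
Hypothesis mA : forall k, measurable (A k) /\ A k `<=` E.
Hypothesis dA : forall j k e, A j e -> A k e -> j = k.
Variables a b : R.
Hypotheses (a0 : 0 <= a) (ab : a < b) (bT : b <= T).
Local Notation Fre := (sigT_of (freshG A a b)).

Lemma fresh_indep_maps : indep_maps P (id : Omega -> Fil a) (id : Omega -> Fre).
Proof. by move=> X Y mX mY; exact: (filt_fresh mA dA a0 ab bT). Qed.

Lemma fil_id_meas : mfunT (id : Omega -> Fil a).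
Proof.
move=> _ Y mY; rewrite setTI; apply: (filt_meas hN) mY.
by rewrite (le_trans _ bT)// ltW.
Qed.

Lemma fresh_id_meas : mfunT (id : Omega -> Fre).
Proof.
move=> _ Y mY; rewrite setTI; apply: (smallest_sub _ _ mY). exact: sigma_algebra_measurable.
exact: (freshG_meas mA dA a0 (ltW ab) bT).
Qed.

Lemma fresh_mul (Y Z : Omega -> R) : mfun [set: Fre] (Y : Fre -> R) ->
  fm a Z -> L1 P Y -> L1 P Z ->
  L1 P (fun w => Z w * Y w) /\ Ex P (fun w => Z w * Y w) = Ex P Z * Ex P Y.
Proof.
move=> mY mZ LY LZ.
have H := @indep_mul _ _ _ _ _ _ _ P _ _ fil_id_meas fresh_id_meas fresh_indep_maps _ _ mZ mY LZ LY.
case: H => H1 H2; split; [exact H1|exact H2].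
Qed.

Lemma fresh_incB i : mfun [set: Fre] (incB i a b : Fre -> R).
Proof.
move=> _ Y mY; rewrite setTI; apply: sub_sigma_algebra.
exists (fun j => if j == i then Y else setT), (fun _ => setT); split => //. by move=> j; case: ifP.
apply/seteqP; split => w /=. by move=> h; split=> // j; case: eqP => // ->.
by move=> [/(_ i)]; rewrite eqxx.
Qed.

Lemma fresh_prm k : mfun [set: Fre] ((fun w => prm S w (box (A k) a b)) : Fre -> \bar R).
Proof.
move=> _ Y mY; rewrite setTI; apply: sub_sigma_algebra.
exists (fun _ => setT), (fun j => if j == k then Y else setT); split => //. by move=> j; case: ifP.
apply/seteqP; split => w /=. by move=> h; split=> // j; case: eqP => // ->.
by move=> [_ /(_ k)]; rewrite eqxx.
Qed.

Lemma fresh_cnt k : mfun [set: Fre] (cnt (box (A k) a b) : Fre -> R).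
Proof. by apply: mfun_comp => //; exact: fresh_prm. Qed.

Lemma fresh_comp k : mfun [set: Fre] ((fun w => compensated S w (A k) a b) : Fre -> R).
Proof. by apply: mfunB => //; exact: fresh_cnt. Qed.
End Fresh.

Lemma noiseI_incB i : noiseI (incB i).
Proof.
split.
- move=> a b a0 ab bT; split; last by have [] := incB_moments i a0 ab bT.
  by apply: fmB; apply: fm_bm; rewrite ?lexx// (le_trans a0).
- by exists 65 => // a b a0 ab bT; have [] := incB_moments i a0 ab bT.
- by move=> a b c _ _ _ _; apply: aeW => w; rewrite /incB; ring.
- move=> a b Z a0; rewrite le_eqVlt => /predU1P[<- aT _ _|ab bT fZ LZ]. rewrite -[RHS](Ex_cst P 0); apply: Ex_eq => w.
    by rewrite /incB subrr mul0r. have [L _ E0 _ _] := incB_moments i a0 (ltW ab) bT.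
  (* The empty family of mark sets: only Brownian increments are involved. *)
  have A0 : forall k : void, measurable ((fun _ => set0) k : set (mark R q)) /\ (fun _ => set0) k `<=` E by case.
  have [_] := fresh_mul A0 (fun j => match j with end) a0 ab bT (@fresh_incB _ (fun _ : void => set0) a b i) fZ (L2_L1 L) (L2_L1 LZ).
  rewrite E0 mulr0 => <-; apply: Ex_eq => w; exact: mulrC.
Qed.

Lemma cnt_add A a b c w : measurable A -> A `<=` E -> 0 <= a -> a <= b -> b <= c -> c <= T ->
  prm S w (E `*` `[0, T]) \is a fin_num ->
  cnt (box A a c) w = cnt (box A a b) w + cnt (box A b c) w.
Proof.
move=> mA AE a0 ab bc cT fin.
have bT : b <= T by exact: le_trans cT.
have b0 : 0 <= b by exact: le_trans ab.
have mET : measurable (E `*` `[0, T]) by apply: measurableX => //; exact: mE.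
have sub D : measurable D -> D `<=` E `*` `[0, T] -> prm S w D \is a fin_num. move=> mD DE; rewrite ge0_fin_numE//.
  apply: (@le_lt_trans _ _ (prm S w (E `*` `[0, T]))); last by rewrite -ge0_fin_numE. by apply: le_measure; rewrite ?inE.
rewrite /cnt -fineD; last 2 first.
- by apply: sub; [exact: box_meas|exact: box_sub].
- by apply: sub; [exact: box_meas|exact: box_sub].
rewrite -measureU; [|exact: box_meas|exact: box_meas|].
  congr (fine (prm S w _)); apply/seteqP; split => z; rewrite /box /setX/= !in_itv/=.
    move=> [Az /andP[h1 h2]]; case: (leP z.2 b) => h; [left|right]; split => //. by rewrite h1.
  move=> [[Az /andP[h1 h2]]|[Az /andP[h1 h2]]]; split => //. by rewrite h1 (le_trans h2). by rewrite h2 (le_lt_trans ab).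
apply/seteqP; split => // z [[_ /=]]; rewrite in_itv/= => /andP[_ h1] [_ /=].
by rewrite in_itv/= ltNge h1.
Qed.

Lemma noiseI_comp A : measurable A -> A `<=` E ->
  noiseI (fun a b w => compensated S w A a b).
Proof.
move=> mA AE; split.
- move=> a b a0 ab bT; split; last by have [] := comp_moments mA AE a0 ab bT. apply: fmB; last exact: fm_cst.
  apply: (@mfun_comp _ _ _ (Fil b)) => //. apply: fm_prm; first exact: box_meas.
  move=> z [Az]; rewrite /= !in_itv/= => /andP[h1 h2]; split; first exact: AE. by rewrite h2 (le_trans a0)// ltW.
- exists (rate E); first exact: rate_ge0. by move=> a b a0 ab bT; have [] := comp_moments mA AE a0 ab bT.
- move=> a b c a0 ab bc cT. apply: filterS prm_finite => w fin.
  by rewrite !compensatedE (cnt_add mA AE a0 ab bc cT fin); ring.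
- move=> a b Z a0; rewrite le_eqVlt => /predU1P[<- aT fZ LZ|ab bT fZ LZ].
    have [L E0 n0] := comp_moments mA AE a0 (lexx a) aT. rewrite subrr mulr0 in n0.
    have {}n0 : nrm P (fun w => compensated S w A a a) = 0. by apply/eqP; rewrite eq_le n0 nrm_ge0.
    rewrite -[RHS](Ex_cst P 0); apply: Ex_ae => //. by apply: mfunM; [exact: L2_meas L|exact: L2_meas LZ].
    by apply: filterS (nrm_eq0 L n0) => w ->; rewrite mul0r. have [L E0 _] := comp_moments mA AE a0 (ltW ab) bT.
  have A0 : forall k : unit, measurable ((fun _ => A) k : set (mark R q)) /\ (fun _ => A) k `<=` E by [].
  have [_] := fresh_mul A0 (fun j k _ _ _ => match j, k with tt, tt => erefl end) a0 ab bT (@fresh_comp _ (fun _ : unit => A) a b tt) fZ (L2_L1 L) (L2_L1 LZ).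
  rewrite E0 mulr0 => <-; apply: Ex_eq => w; exact: mulrC.
Qed.

Lemma bsE p (H : bsimple (Omega := Omega) (R := R) r p) s w i :
  bs_int S H s w i ord0 =
  \sum_k \sum_j @bs_coef _ _ _ _ _ H k w i j *
     incB j (Num.min (bs_lo k) s) (Num.min (bs_hi k) s) w.
Proof.
rewrite /bs_int summxE; apply: eq_bigr => k _; rewrite !mxE.
by apply: eq_bigr => j _; rewrite !mxE.
Qed.

Lemma psE p (H : psimple (Omega := Omega) (R := R) q p) s w i :
  ps_int S H s w i ord0 =
  \sum_k @ps_coef _ _ _ _ _ H k w i ord0 *
     compensated S w (@ps_set _ _ _ _ _ H k) (Num.min (ps_lo k) s) (Num.min (ps_hi k) s).
Proof.
rewrite /ps_int summxE; apply: eq_bigr => k _; rewrite !mxE; exact: mulrC.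
Qed.

Lemma bs_mart p (t : R) (H : bsimple (Omega := Omega) (R := R) r p) i : 0 <= t ->
  bs_ok P S t H -> mart t (fun s w => bs_int S H s w i ord0).
Proof.
move=> t0 ok.
rewrite (_ : (fun s w => bs_int S H s w i ord0) = (fun s w => \sum_k \sum_j @bs_coef _ _ _ _ _ H k w i j *
     incB j (Num.min (bs_lo k) s) (Num.min (bs_hi k) s) w)); last first. by apply/funext => s; apply/funext => w; exact: bsE.
apply: mart_sum => k; apply: mart_sum => j.
have [tlo /andP[lohi hiT] mc [K hK]] := ok k.
apply: (unit_mart (noiseI_incB j) t0 tlo lohi hiT (k := K)).
  exact: (@mx_measP R _ (Fil (bs_lo k)) p r (@bs_coef _ _ _ _ _ H k)).1.
by move=> w; apply: le_trans (hK w); exact: coord_le_enorm.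
Qed.

Lemma ps_mart p (t : R) (H : psimple (Omega := Omega) (R := R) q p) i : 0 <= t ->
  ps_ok P S t H -> mart t (fun s w => ps_int S H s w i ord0).
Proof.
move=> t0 ok.
rewrite (_ : (fun s w => ps_int S H s w i ord0) = (fun s w => \sum_k @ps_coef _ _ _ _ _ H k w i ord0 *
     compensated S w (@ps_set _ _ _ _ _ H k) (Num.min (ps_lo k) s) (Num.min (ps_hi k) s))); last first.
  by apply/funext => s; apply/funext => w; exact: psE.
apply: mart_sum => k.
have [tlo /andP[lohi hiT] [mA AE] mc [K hK]] := ok k.
apply: (unit_mart (noiseI_comp mA AE) t0 tlo lohi hiT (k := K)).
  exact: (@mx_measP R _ (Fil (ps_lo k)) p 1 (@ps_coef _ _ _ _ _ H k)).1.
by move=> w; apply: le_trans (hK w); exact: coord_le_enorm.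
Qed.

Lemma enorm_cvg_coord p (X : nat -> Omega -> 'cV[R]_p) (Y : Omega -> 'cV[R]_p) i :
  (forall k i, mfunT (fun w => X k w i ord0)) ->
  (forall i, mfunT (fun w => Y w i ord0)) ->
  (\int[P]_w (enorm (X k w - Y w) ^+ 2)%:E)%E @[k --> \oo] --> 0%E ->
  forall e, 0 < e -> exists N, forall k, (N <= k)%N ->
     L2 P (fun w => X k w i ord0 - Y w i ord0) /\
     nrm P (fun w => X k w i ord0 - Y w i ord0) <= e.
Proof.
move=> mX mY cv e e0.
have h0 k : (0 <= \int[P]_w (enorm (X k w - Y w) ^+ 2)%:E)%E. by apply: integral_ge0 => w _; rewrite lee_fin sqr_ge0.
have [N HN] := (ereal_cvg0P h0).1 cv e e0.
exists N => k /HN le.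
have m : mfunT (fun w => X k w i ord0 - Y w i ord0) by exact: mfunB.
have me : mfunT (fun w => enorm (X k w - Y w) ^+ 2). apply: meas_enorm2 => a b; rewrite (ord1 b).
  by under [X in mfun _ X]funext do rewrite !mxE; exact: mfunB.
have le2 : (\int[P]_w ((X k w i ord0 - Y w i ord0) ^+ 2)%:E <= \int[P]_w (enorm (X k w - Y w) ^+ 2)%:E)%E.
  apply: ge0_le_integral => //.
  - by move=> w _; rewrite lee_fin sqr_ge0.
  - by apply/measurable_EFinP; exact: mfunX.
  - by apply/measurable_EFinP.
  - move=> w _; rewrite lee_fin. by have := coord_le_enorm2 (X k w - Y w) i ord0; rewrite !mxE.
have L : L2 P (fun w => X k w i ord0 - Y w i ord0).
  by split => //; apply: (le_lt_trans le2); apply: (lt_trans le); exact: ltry.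
by split => //; rewrite -lee_fin nrmE//; apply: (le_trans le2); exact: ltW.
Qed.

Lemma bint_mart p (t : R) (Phi : R -> Omega -> 'M[R]_(p, r)) I i : 0 <= t -> t <= T ->
  is_bint P S t Phi I -> mart t (fun s w => I s w i ord0).
Proof.
move=> t0 tT [aI [H [ok _ cI]]].
have mH k := bs_mart _ t0 (ok k).
apply: (mart_lim tT (mH i)). by move=> s hs; exact: (mx_adaptedP P S t I).1.
move=> s e hs; apply: enorm_cvg_coord; last exact: cI.
- by move=> k j; have [/(_ _ hs)[_ /L2_meas]] := mH j k.
- move=> j; have /andP[_ sT] := hs; apply: (fm_meas hN sT). exact: (mx_adaptedP P S t I).1.
Qed.

Lemma pint_mart p (t : R) (Phi : R -> mark R q -> Omega -> 'cV[R]_p) J i : 0 <= t -> t <= T ->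
  is_pint P S t Phi J -> mart t (fun s w => J s w i ord0).
Proof.
move=> t0 tT [aI [H [ok _ cI]]].
have mH k := ps_mart _ t0 (ok k).
apply: (mart_lim tT (mH i)). by move=> s hs; exact: (mx_adaptedP P S t J).1.
move=> s e hs; apply: enorm_cvg_coord; last exact: cI.
- by move=> k j; have [/(_ _ hs)[_ /L2_meas]] := mH j k.
- move=> j; have /andP[_ sT] := hs; apply: (fm_meas hN sT). exact: (mx_adaptedP P S t J).1.
Qed.

(** The error allowed in one step: a squared norm of second order in the length. Over [(b - a) / h]
    steps with orthogonal errors the total is of order [h]. *)
Definition small2 (F : R -> R -> Omega -> R) := exists2 C : R, 0 <= C &
  forall s s', 0 <= s -> s < s' -> s' <= T -> L2 P (F s s') /\ nrm P (F s s') <= C * (s' - s) ^+ 2.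

Lemma small2D F G : small2 F -> small2 G -> small2 (fun s s' w => F s s' w + G s s' w).
Proof.
move=> [C C0 hC] [D D0 hD]; exists (2 * C + 2 * D); first lra.
move=> s s' s0 ss s'T; have [h1 h2] := hC _ _ s0 ss s'T; have [h3 h4] := hD _ _ s0 ss s'T.
split; first exact: L2D.
apply: le_trans (nrmD_le h1 h3) _; lra.
Qed.

Lemma small2Z k F : small2 F -> small2 (fun s s' w => k * F s s' w).
Proof.
move=> [C C0 hC]; exists (k ^+ 2 * C); first by rewrite mulr_ge0// sqr_ge0.
move=> s s' s0 ss s'T; have [h1 h2] := hC _ _ s0 ss s'T.
by split; [exact: L2Z|rewrite nrmZ// -mulrA ler_wpM2l// sqr_ge0].
Qed.

Lemma small2_sum (I : Type) (l : seq I) (F : I -> R -> R -> Omega -> R) :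
  (forall i, small2 (F i)) -> small2 (fun s s' w => \sum_(i <- l) F i s s' w).
Proof.
move=> h; elim: l => [|i l ih]. exists 0 => // s s' _ _ _; rewrite mul0r.
  rewrite (_ : (fun w => _) = cst 0); last by apply/funext => w; rewrite big_nil. split; first exact: L2_cst.
  by rewrite /nrm (_ : (fun w => _) = cst 0) ?Ex_cst//; apply/funext => w; rewrite expr2 mulr0.
have [C C0 hC] := small2D (h i) ih; exists C => // s s' h1 h2 h3.
have [k1 k2] := hC s s' h1 h2 h3.
by rewrite (_ : (fun w => _) = (fun w => F i s s' w + \sum_(j <- l) F j s s' w)); [split|apply/funext => w; rewrite big_cons].
Qed.

Lemma small2_sqr i : small2 (fun s s' w => incB i s s' w ^+ 2).
Proof.
exists 64 => // s s' s0 ss s'T.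
by have [_ h1 _ _ h2] := incB_moments i s0 (ltW ss) s'T.
Qed.

Section Counts.
Variable A : set (mark R q).
Hypotheses (mA : measurable A) (AE : A `<=` E).

(** With [l = c * h], the moment [l ^+ 4 + 4 * l ^+ 3 + 2 * l ^+ 2] has no term of order below
    [h ^+ 2]; the excess powers of [h] are bounded by powers of [T]. *)
Lemma small2_cnt : small2 (fun s s' w => cnt (box A s s') w ^+ 2 - cnt (box A s s') w).
Proof.
pose c := rate A; have c0 : 0 <= c := rate_ge0 A; have T0 := T_gt0 hN.
exists (c ^+ 4 * T ^+ 2 + 4 * c ^+ 3 * T + 2 * c ^+ 2). by do ?[exact: ltW|apply: addr_ge0|apply: mulr_ge0|apply: exprn_ge0].
move=> s s' s0 ss s'T.
have [_ h1 _ _ ->] := cnt_moments (box_meas s s' mA) (box_sub AE s0 s'T).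
split => //; rewrite (lam_box mA AE (ltW ss)) -/c.
set h := s' - s; have h0 : 0 <= h by rewrite /h; lra.
have hT : h <= T by rewrite /h; lra.
rewrite !exprMn !mulrDl; apply: lerD; last by rewrite mulrA.
apply: lerD. rewrite -mulrA ler_wpM2l ?exprn_ge0// -[4%N]/(2 + 2)%N exprD ler_wpM2r ?exprn_ge0//.
  by apply: lerXn2r => //; rewrite nnegrE ltW.
have : c ^+ 3 * h ^+ 3 <= c ^+ 3 * T * h ^+ 2. rewrite -mulrA ler_wpM2l ?exprn_ge0// -[3%N]/(1 + 2)%N exprD expr1.
  by rewrite ler_wpM2r ?exprn_ge0.
lra.
Qed.

(** Increment and count are independent, so the squared norm is a product of two terms, each of
    first order in the length: at most [65 * h] and [c * h + (c * h) ^+ 2]. *)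
Lemma small2_mixed i : small2 (fun s s' w => `|incB i s s' w| * cnt (box A s s') w).
Proof.
pose c := rate A; have c0 : 0 <= c := rate_ge0 A; have T0 := T_gt0 hN.
exists (65 * (c + c ^+ 2 * T)). by rewrite mulr_ge0// addr_ge0// mulr_ge0 ?exprn_ge0// ltW.
move=> s s' s0 ss s'T.
have [h1 _ _ h2 _] := incB_moments i s0 (ltW ss) s'T.
have [h3 _ _ h4 _] := cnt_moments (box_meas s s' mA) (box_sub AE s0 s'T).
have ind : indep_maps P (incB i s s') (cnt (box A s s')). move=> X Y mX mY; apply: (BN_indep).
    by apply: incB_sigma => //; apply/andP; split; lra.
  apply: sub_sigma_algebra; exists (box A s s'), (fine @^-1` Y); split => //.
  - exact: box_meas.
  - exact: box_sub.
  - by rewrite -[X in measurable X]setTI; have mf : mfun [set: \bar R] fine by []; exact: mf.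
have m1 := L2_meas h1; have m3 := L2_meas h3.
have m2 : mfun [set: R] (fun x : R => x ^+ 2) by exact: mfunX.
have [k1 k2] := indep_mul_ge0 m1 m3 ind m2 m2 (fun x => sqr_ge0 x) (fun x => sqr_ge0 x) (L2_sqr h1) (L2_sqr h3).
have mm : mfunT (fun w => `|incB i s s' w| * cnt (box A s s') w). by apply: mfunM => //; exact: mfun_comp.
have E w : (`|incB i s s' w| * cnt (box A s s') w) ^+ 2 = incB i s s' w ^+ 2 * cnt (box A s s') w ^+ 2.
  by rewrite exprMn sqr_abs.
move/funext: E => E; split; first by apply: L2P => //; rewrite E.
rewrite /nrm E k2 -/(nrm P (incB i s s')) -/(nrm P (cnt (box A s s'))) h4.
rewrite (lam_box mA AE (ltW ss)) -/c.
set h := s' - s in h2 *; have hh0 : 0 <= h by rewrite /h; lra.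
have hT : h <= T by rewrite /h; lra.

apply: (@le_trans _ _ (65 * h * (c * h + (c * h) ^+ 2))). apply: ler_wpM2r => //; by rewrite addr_ge0 ?mulr_ge0.
have h2T : c ^+ 2 * h <= c ^+ 2 * T by rewrite ler_wpM2l// exprn_ge0.
have -> : 65 * h * (c * h + (c * h) ^+ 2) = (c + c ^+ 2 * h) * (65 * (h * h)) by ring.
have -> : 65 * (c + c ^+ 2 * T) * h ^+ 2 = (c + c ^+ 2 * T) * (65 * (h * h)) by ring.
apply: ler_wpM2r; first by rewrite !mulr_ge0.
by rewrite lerD2l.
Qed.
End Counts.

(** * Approximate martingale representation over one interval *)

Section OneStep.
Definition elemI (a b : R) (X : Omega -> R) := exists lo hi c (k : R),
  [/\ [/\ a <= lo, lo <= hi & hi <= b], fm lo c, forall w, `|c w| <= k &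
   (exists i, X = (fun w => c w * incB i lo hi w)) \/
   (exists A : set (mark R q), [/\ measurable A, A `<=` E &
      X = (fun w => c w * compensated S w A lo hi)])].

Definition simpI (a b : R) (X : Omega -> R) := exists m (F : 'I_m -> Omega -> R),
  (forall i, elemI a b (F i)) /\ X = (fun w => \sum_(i < m) F i w).

Lemma simpI0 a b : simpI a b (cst 0).
Proof.
by exists 0, (fun _ => cst 0); split => [[]//|]; apply/funext => w; rewrite big_ord0.
Qed.

Lemma simpID a b X Y : simpI a b X -> simpI a b Y -> simpI a b (fun w => X w + Y w).
Proof.
move=> [m [F [hF ->]]] [m' [F' [hF' ->]]].
exists (m + m')%N, (fun i => match fintype.split i with inl j => F j | inr j => F' j end); split.
  by move=> i; case: (fintype.split i).
apply/funext => w; rewrite big_split_ord/=; congr (_ + _); apply: eq_bigr => i _.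
  by rewrite (unsplitK (inl i : 'I_m + 'I_m')).
by rewrite (unsplitK (inr i : 'I_m + 'I_m')).
Qed.

Lemma simpI_elem a b X : elemI a b X -> simpI a b X.
Proof.
by move=> h; exists 1, (fun _ => X); split => //; apply/funext => w; rewrite big_ord1.
Qed.

Lemma simpI_sum a b (I : Type) (l : seq I) (F : I -> Omega -> R) :
  (forall i, simpI a b (F i)) -> simpI a b (fun w => \sum_(i <- l) F i w).
Proof.
move=> h; elim: l => [|i l ih]. by rewrite (_ : (fun w => _) = cst 0); [exact: simpI0|apply/funext => w; rewrite big_nil].
rewrite (_ : (fun w => _) = (fun w => F i w + \sum_(j <- l) F j w)); first exact: simpID.
by apply/funext => w; rewrite big_cons.
Qed.

Lemma simpI_sub a b a' b' X : a' <= a -> b <= b' -> simpI a b X -> simpI a' b' X.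
Proof.
move=> aa bb [m [F [hF ->]]]; exists m, F; split => // i.
have [lo [hi [c [k [[h1 h2 h3] h4 h5 h6]]]]] := hF i.
by exists lo, hi, c, k; split => //; split => //; [exact: le_trans h1|exact: le_trans bb].
Qed.

Lemma simpI_scale a b X Y (k : R) : fm a Y -> (forall w, `|Y w| <= k) ->
  simpI a b X -> simpI a b (fun w => Y w * X w).
Proof.
move=> fY Yk [m [F [hF ->]]].
exists m, (fun i w => Y w * F i w); split; last by apply/funext => w; rewrite mulr_sumr.
move=> i; have [lo [hi [c [k' [[h1 h2 h3] h4 h5 h6]]]]] := hF i.
exists lo, hi, (fun w => Y w * c w), (k * k'); split => //.
- by apply: fmM => //; exact: fm_mono fY.
- by move=> w; rewrite normrM; apply: ler_pM.
- case: h6 => [[j ->]|[A [mA AE ->]]]; [left; exists j|right; exists A; split => //]; by apply/funext => w; rewrite mulrA.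
Qed.

Lemma elemI_mart a b X : 0 <= a -> a <= b -> b <= T -> elemI a b X ->
  [/\ L2 P X, fm b X & forall Z, fm a Z -> L2 P Z -> Ex P (fun w => X w * Z w) = 0].
Proof.
move=> a0 ab bT [lo [hi [c [k [[h1 h2 h3] h4 h5 h6]]]]].
have [D [nD ->]] : exists D, noiseI D /\ X = (fun w => c w * D lo hi w). case: h6 => [[i ->]|[A [mA AE ->]]].
    by exists (incB i); split => //; exact: noiseI_incB.
  by exists (fun lo hi w => compensated S w A lo hi); split => //; exact: noiseI_comp.
have [m1 m2 _ m4] := unit_mart nD a0 h1 h2 (le_trans h3 bT) h4 h5.
have hb : a <= b <= T by rewrite ab.
have ha : a <= a <= T by rewrite lexx (le_trans ab).
have eqb : (fun w => c w * D (Num.min lo b) (Num.min hi b) w) = (fun w => c w * D lo hi w).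
  by rewrite (min_l h3) (min_l (le_trans h2 h3)).
have [] := m1 _ hb; rewrite eqb => f1 l1; split => // Z fZ LZ.
have := m2 a b Z (lexx _) ab bT fZ LZ; rewrite (min_l h3) (min_l (le_trans h2 h3)) => H; rewrite -[RHS]H.
have [fa la] := m1 _ ha.
apply: Ex_ae.
- exact: (L1_meas (L2_mul l1 LZ)).
- exact: (L1_meas (L2_mul (L2B l1 la) LZ)).
- by apply: filterS m4 => w ->; rewrite subr0.
Qed.

Lemma simpI_mart a b X : 0 <= a -> a <= b -> b <= T -> simpI a b X ->
  [/\ L2 P X, fm b X & forall Z, fm a Z -> L2 P Z -> Ex P (fun w => X w * Z w) = 0].
Proof.
move=> a0 ab bT [m [F [hF ->]]]; have h i := elemI_mart a0 ab bT (hF i).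
split.
- by apply: L2_sum => i; have [] := h i.
- by apply: fm_sum => i; have [] := h i.
move=> Z fZ LZ.
have [_ e] : L1 P (fun w => \sum_(i < m) F i w * Z w) /\
   Ex P (fun w => \sum_(i < m) F i w * Z w) = \sum_(i < m) Ex P (fun w => F i w * Z w).
  by apply: Ex_sum => i; apply: L2_mul; have [] := h i.
transitivity (Ex P (fun w => \sum_(i < m) F i w * Z w)). by apply: Ex_eq => w; rewrite mulr_suml.
by rewrite e big1// => i _; have [_ _ ->] := h i.
Qed.

Variables (K : finType) (A : K -> set (mark R q)).
Hypothesis mA : forall k, measurable (A k) /\ A k `<=` E.
Hypothesis dA : forall j k e, A j e -> A k e -> j = k.

(** Joint measurability of [g], expressed by composition with measurable families, so that no
    sigma-algebra on the function spaces is involved. *)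
Definition gmeas (g : ('I_r -> R) -> (K -> R) -> R) := forall d (Q : measurableType d)
  (x : 'I_r -> Q -> R) (c : K -> Q -> R), (forall i, mfunT (x i)) ->
  (forall k, mfunT (c k)) ->
  mfunT (fun w => g (x^~ w) (c^~ w)).

Variables (a b : R).
Hypotheses (a0 : 0 <= a) (ab : a < b) (bT : b <= T).

(** For [s' = s] this is the conditional expectation at time [s] of [g] of the noise on []a, b]]:
    the noise up to [s] is kept, the rest is averaged over a copy [v]. With [s < s'] the noise on
    []s, s']] is left out, which gives the base point of the expansion over one step. *)
Definition cexp (g : ('I_r -> R) -> (K -> R) -> R) (s s' : R) (w : Omega) : R :=
  Ex P (fun v => g (fun i => incB i a s w + incB i s' b v)
                   (fun k => cnt (box (A k) a s) w + cnt (box (A k) s' b) v)).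

Lemma fm_incB i (s s' v : R) : 0 <= s -> s <= s' -> s' <= v -> fm v (incB i s s').
Proof.
move=> s0 ss s'v; apply: fmB; apply: (@fm_bm _ _ _ P); apply/andP; split => //. exact: le_trans ss.
exact: le_trans s'v.
Qed.

Lemma fm_cnt k (s s' v : R) : 0 <= s -> s' <= v -> fm v (cnt (box (A k) s s')).
Proof.
move=> s0 s'v; have [m1 m2] := mA k; apply: mfun_comp => //.
apply: (@fm_prm _ _ _ P); first exact: box_meas.
move=> z [h1 /=]; rewrite !in_itv/= => /andP[h2 h3]; split; first exact: m2.
by rewrite (ltW (le_lt_trans s0 h2)) (le_trans h3).
Qed.

Lemma cexp_meas g (C : R) (s s' : R) d (Q : measurableType d) (W : Q -> Omega) : gmeas g ->
  (forall x c, `|g x c| <= C) ->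
  (forall i, mfunT (fun z => incB i a s (W z))) ->
  (forall k, mfunT (fun z => cnt (box (A k) a s) (W z))) ->
  0 <= s' -> s' <= b -> mfunT (fun z => cexp g s s' (W z)).
Proof.
move=> mg gC m1 m2 s'0 s'b.
apply: (@Ex_snd_bounded _ _ _ _ _ _ _ P id (fun z => g (fun i => incB i a s (W z.1) + incB i s' b z.2)
     (fun k => cnt (box (A k) a s) (W z.1) + cnt (box (A k) s' b) z.2)) C) => //.
apply: mg => [i|k]; apply: mfunD.
- exact: (mfun_comp (m1 i)).
- apply: (mfun_comp (f := incB i s' b)) => //; apply: incB_meas; rewrite ?s'0 ?(le_trans s'b bT) ?(le_trans a0 (ltW ab))//.
- exact: (mfun_comp (m2 k)).
- apply: (mfun_comp (f := cnt (box (A k) s' b))) => //; apply: cnt_meas => //; have [? ?] := mA k.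
    exact: box_meas. exact: box_sub.
Qed.

Lemma cexp_fm g (C : R) (s s' : R) : gmeas g -> (forall x c, `|g x c| <= C) ->
  a <= s -> 0 <= s' -> s' <= b -> fm s (cexp g s s').
Proof.
move=> mg gC as_ s'0 s'b.
apply: (@cexp_meas g C s s' _ (Fil s) id) => // [i|k]; last exact: fm_cnt.
exact: fm_incB.
Qed.

Lemma cexp_L1 g (C : R) (s s' : R) w : gmeas g -> (forall x c, `|g x c| <= C) -> 0 <= s' -> s' <= b ->
  L1 P (fun v => g (fun i => incB i a s w + incB i s' b v)
                   (fun k => cnt (box (A k) a s) w + cnt (box (A k) s' b) v)).
Proof.
move=> mg gC s'0 s'b; apply: (L1_le _ (L1_cst P C)) => //.
apply: mg => [i|k]; apply: mfunD => //.
- by apply: incB_meas; rewrite ?s'0 ?(le_trans s'b bT) ?(le_trans a0 (ltW ab)).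
- apply: cnt_meas => //; have [? ?] := mA k; first exact: box_meas. exact: box_sub.
Qed.

Lemma cexp_bound g (C : R) (s s' : R) w : gmeas g -> (forall x c, `|g x c| <= C) ->
  0 <= s' -> s' <= b -> `|cexp g s s' w| <= C.
Proof.
move=> mg gC s'0 s'b; rewrite ler_norml; apply/andP; split.
  rewrite -[leLHS](Ex_cst P); apply: Ex_le; first exact: L1_cst. exact: cexp_L1.
  by move=> v; have := gC (fun i => incB i a s w + incB i s' b v)
     (fun k => cnt (box (A k) a s) w + cnt (box (A k) s' b) v); rewrite ler_norml => /andP[].
rewrite -[leRHS](Ex_cst P); apply: Ex_le; last 1 first.
- by move=> v; apply: le_trans (gC _ _); exact: ler_norm.
- exact: cexp_L1.
- exact: L1_cst.
Qed.

Lemma cnt_empty k s w : cnt (box (A k) s s) w = 0.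
Proof. by rewrite /cnt /box set_itv_ge ?setX0 ?measure0//= bnd_simp ltxx. Qed.

Lemma cexp_end g w : cexp g b b w = g (fun i => incB i a b w) (fun k => cnt (box (A k) a b) w).
Proof.
rewrite /cexp -[RHS](Ex_cst P); apply: Ex_eq => v; congr g; apply/funext => j. by rewrite /incB subrr addr0.
by rewrite cnt_empty addr0.
Qed.

Lemma cexp_start g v : cexp g a a v = Ex P (fun w => g (fun i => incB i a b w) (fun k => cnt (box (A k) a b) w)).
Proof.
apply: Ex_eq => w; congr g; apply/funext => j. by rewrite /incB subrr add0r.
by rewrite cnt_empty add0r.
Qed.

Lemma cnt_add_ae (s s' s'' : R) : 0 <= s -> s <= s' -> s' <= s'' -> s'' <= T ->
  {ae P, forall w, forall k, cnt (box (A k) s s'') w = cnt (box (A k) s s') w + cnt (box (A k) s' s'') w}.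
Proof.
move=> h1 h2 h3 h4; have := prm_finite; apply: filterS => w hw k.
by have [? ?] := mA k; exact: cnt_add.
Qed.

(** The martingale property of [cexp g s s]: given the past of [s], the noise on []s, b]] is
    independent and can be averaged separately. Additivity of counts holds almost surely, so the two
    sides are first matched off a null set. *)
Lemma cexp_cond g (s : R) Z : gmeas g -> (forall x c, 0 <= g x c <= 1) -> a <= s -> s <= b ->
  fm s Z -> L1 P Z ->
  Ex P (fun w => cexp g b b w * Z w) = Ex P (fun w => cexp g s s w * Z w).
Proof.
move=> mg g01 as_; rewrite le_eqVlt => /predU1P[-> //|sb] fZ LZ.
have s0 : 0 <= s by exact: le_trans as_.
have g1 x c : `|g x c| <= 1 by have /andP[h1 h2] := g01 x c; rewrite ger0_norm.
pose Fre := sigT_of (freshG A s b).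
pose phi (z : Fil s * Fre) := g (fun i => incB i a s z.1 + incB i s b z.2)
     (fun k => cnt (box (A k) a s) z.1 + cnt (box (A k) s b) z.2).
have mphi : mfunT phi. apply: mg => [i|k]; apply: mfunD.
  - by apply: (mfun_comp (f := (incB i a s : Fil s -> R))) => //=; exact: fm_incB.
  - by apply: (mfun_comp (f := (incB i s b : Fre -> R))) => //; exact: fresh_incB.
  - by apply: (mfun_comp (f := (cnt (box (A k) a s) : Fil s -> R))) => //; exact: fm_cnt.
  - by apply: (mfun_comp (f := (cnt (box (A k) s b) : Fre -> R))) => //; exact: fresh_cnt.
have := @indep_bounded_mul _ _ _ _ _ _ _ P _ _ phi Z (fil_id_meas sb bT)
  (fresh_id_meas mA dA s0 sb bT) (fresh_indep_maps mA dA s0 sb bT) mphi (fun z => g01 _ _) fZ LZ.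
move=> H; transitivity (Ex P (fun w => phi (w, w) * Z w)); last exact: H.
have mZ := L1_meas LZ.
apply: Ex_ae.
- apply: mfunM => //; apply: (@fm_meas _ _ _ P _ _ S hN b) => //.
  by apply: (cexp_fm (C := 1)) => //; [exact: ltW|exact: le_trans (ltW ab)].
- apply: mfunM => //. have md : mfunT (fun w : Omega => ((w : Fil s), (w : Fre))).
    apply: measurable_fun_pair; first exact: (fil_id_meas sb bT). exact: (fresh_id_meas mA dA s0 sb bT).
  exact: (mfun_comp mphi md).
- have := cnt_add_ae a0 as_ (ltW sb) bT; apply: filterS => w hw.
  rewrite cexp_end; congr (g _ _ * _); apply/funext => j; last exact: hw. by rewrite /incB; ring.
Qed.

Variables (kap : R) (z : 'I_r -> R) (psi : K -> R -> R).
Hypotheses (kap0 : 0 <= kap) (mpsi : forall k, mfunT (psi k))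
  (psi01 : forall k x, 0 <= psi k x <= 1).

(** A smooth substitute for the indicator of [x i <= z i] for all [i], sharp as [kap] grows; [gN] is
    an arbitrary product in the counts. [dgB i] is the derivative in [x i] and [dgN k] the effect of
    one more point in [A k]; averaged by [cexp], they become the integrands of the
    representation. *)
Definition gB (x : 'I_r -> R) : R := \prod_(i <- index_enum 'I_r) ramp (kap * (x i - z i)).
Definition gN (c : K -> R) : R := \prod_(k <- index_enum K) psi k (c k).
Definition g0 x c := gB x * gN c.
Definition dgB i x (c : K -> R) := kap * prodcf (fun i => ramp (kap * (x i - z i)))
   (fun i => dramp (kap * (x i - z i))) (index_enum 'I_r) i * gN c.
Definition dgN k x c := gB x * (gN (fun j => c j + (j == k)%:R) - gN c).

Lemma gN01 c : 0 <= gN c <= 1.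
Proof.
rewrite /gN; elim: (index_enum K) => [|k l /andP[ih1 ih2]]; first by rewrite big_nil ler01 lexx.
have /andP[h1 h2] := psi01 k (c k); rewrite big_cons mulr_ge0//=.
by rewrite -[leRHS]mul1r; apply: ler_pM.
Qed.

Lemma gB01 x : 0 <= gB x <= 1.
Proof.
rewrite /gB; elim: (index_enum 'I_r) => [|k l /andP[ih1 ih2]]; first by rewrite big_nil ler01 lexx.
have /andP[h1 h2] := ramp_bound (kap * (x k - z k)); rewrite big_cons mulr_ge0//=; last exact: ltW.
by rewrite -[leRHS]mul1r; apply: ler_pM => //; exact: ltW.
Qed.

Lemma g001 x c : 0 <= g0 x c <= 1.
Proof.
have /andP[h1 h2] := gB01 x; have /andP[h3 h4] := gN01 c.
by rewrite /g0 mulr_ge0//= -[leRHS]mul1r; apply: ler_pM.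
Qed.

Lemma g0_bound x c : `|g0 x c| <= 1.
Proof. by have /andP[h1 h2] := g001 x c; rewrite ger0_norm. Qed.

Lemma dgB_bound i x c : `|dgB i x c| <= kap * (size (index_enum 'I_r))%:R.
Proof.
have /andP[h3 h4] := gN01 c.
rewrite /dgB !normrM (ger0_norm kap0) (ger0_norm h3) -[leRHS]mulr1; apply: ler_pM => //. by rewrite mulr_ge0.
rewrite ler_wpM2l//; apply: prodcf_bound => j; last exact: dramp_bound.
by have /andP[u1 u2] := ramp_bound (kap * (x j - z j)); rewrite gtr0_norm.
Qed.

Lemma dgN_bound k x c : `|dgN k x c| <= 1.
Proof.
have /andP[h1 h2] := gB01 x; have /andP[h3 h4] := gN01 c.
have /andP[h5 h6] := gN01 (fun j => c j + (j == k)%:R).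
rewrite /dgN normrM (ger0_norm h1) -[leRHS]mul1r; apply: ler_pM => //.
by rewrite ler_norml; lra.
Qed.

Lemma gN_meas d (Q : measurableType d) (c : K -> Q -> R) : (forall k, mfunT (c k)) ->
  mfunT (fun w => gN (c^~ w)).
Proof.
by move=> h; apply: measurable_prod => k _; exact: mfun_comp.
Qed.

Lemma gB_meas d (Q : measurableType d) (x : 'I_r -> Q -> R) : (forall k, mfunT (x k)) ->
  mfunT (fun w => gB (x^~ w)).
Proof.
move=> h; apply: measurable_prod => k _; apply: (mfun_comp ramp_meas).
by apply: mfunM => //; apply: mfunB.
Qed.

Lemma g0_meas : gmeas g0.
Proof. by move=> d Q x c mx mc; apply: mfunM; [exact: gB_meas|exact: gN_meas]. Qed.

Lemma dgN_meas k : gmeas (dgN k).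
Proof.
move=> d Q x c mx mc; apply: mfunM; first exact: gB_meas.
apply: mfunB; last exact: gN_meas.
by apply: (gN_meas (c := fun j w => c j w + (j == k)%:R)) => j; exact: mfunD.
Qed.

Lemma dgB_meas i : gmeas (dgB i).
Proof.
move=> d Q x c mx mc; apply: mfunM; last exact: gN_meas.
apply: mfunM => //.
have m1 j : mfunT (fun w => kap * (x j w - z j)). by apply: mfunM => //; apply: mfunB.
elim: (index_enum 'I_r) => [|j l ih] /=; first exact: measurable_cst.
apply: mfunD; apply: mfunM => //.
- apply: mfunM => //; exact: (mfun_comp dramp_meas).
- by apply: measurable_prod => k _; exact: (mfun_comp ramp_meas).
- exact: (mfun_comp ramp_meas).
Qed.

(** The sum of three constants: expansion of the product of ramps, mixed terms of an increment and a
    count, and expansion in the counts. *)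
Definition C0 : R := kap ^+ 2 * ((size (index_enum 'I_r))%:R * (3 + (size (index_enum 'I_r))%:R)) + kap + 2.

Lemma g0_expand x c (dl : 'I_r -> R) (nu : K -> R) (N : R) : N = \sum_k nu k ->
  (forall k, exists n : nat, nu k = n%:R) ->
  `|g0 (fun i => x i + dl i) (fun k => c k + nu k) - g0 x c - \sum_i dl i * dgB i x c - \sum_k nu k * dgN k x c|
  <= C0 * (\sum_i dl i ^+ 2 + (\sum_i `|dl i| * N) + (N ^+ 2 - N)).
Proof.
move=> NS /choice[n hn].
have {}hn : nu = (fun k => (n k)%:R) by apply/funext.
have N0 : 0 <= N by rewrite NS hn; apply: sumr_ge0.
have NN : 0 <= N ^+ 2 - N. have -> : N = (\sum_k n k)%:R by rewrite NS hn natr_sum.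
  by rewrite subr_ge0 -natrX ler_nat; case: (\sum_k n k)%N => // n'; rewrite expnS expn1 leq_pmulr.
have [c1 c2] := count_expand gN01 c n; rewrite /= in c1 c2.
have NE : \sum_k (n k)%:R = N by rewrite NS hn.
rewrite NE in c1 c2; have hn' k : (n k)%:R = nu k by rewrite hn.
rewrite (_ : (fun k => c k + (n k)%:R) = (fun k => c k + nu k)) in c1 c2; last by rewrite hn.
set L := size (index_enum 'I_r).
pose F i := ramp (kap * (x i - z i)); pose F' i := ramp (kap * (x i + dl i - z i)).
pose a' i := dramp (kap * (x i - z i)); pose d i := kap * dl i.
have FE i : F' i = ramp (kap * (x i - z i) + d i) by rewrite /F' /d; congr ramp; ring.
have F1 i : `|F i| <= 1 by have /andP[u1 u2] := ramp_bound (kap * (x i - z i)); rewrite gtr0_norm.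
have F1' i : `|F' i| <= 1 by have /andP[u1 u2] := ramp_bound (kap * (x i + dl i - z i)); rewrite gtr0_norm.
pose D2 := \sum_i dl i ^+ 2.
have dl2 i : dl i ^+ 2 <= D2. rewrite /D2 (bigD1 i)//= lerDl; apply: sumr_ge0 => j _; exact: sqr_ge0.
have dB i j : `|d i| * `|d j| <= kap ^+ 2 * D2. rewrite /d !normrM (ger0_norm kap0) mulrACA -expr2 ler_wpM2l ?sqr_ge0//.
  have := sqr_ge0 (`|dl i| - `|dl j|); have := dl2 i; have := dl2 j. rewrite -(sqr_abs (dl i)) -(sqr_abs (dl j)) !expr2; lra.
have e1 i : `|F' i - F i| <= `|d i| by rewrite FE; exact: ramp_lip.
have e2 i : `|F' i - F i - a' i * d i| <= 3 * d i ^+ 2 by rewrite FE; exact: ramp_expand.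
have p1 := prod_expand F1 F1' e1 e2 dB (index_enum 'I_r).
have p2 := prod_lip F1 F1' e1 (index_enum 'I_r).
have /andP[u1 u2] := gB01 x; have /andP[u3 u4] := gN01 c.
set A1 := \prod_(k <- _) F' k in p1 p2; set A0 := \prod_(k <- _) F k in p1 p2.
have A1E : gB (fun i => x i + dl i) = A1 by [].
have A0E : gB x = A0 by [].
rewrite -/L in p1.
have sE : \sum_i dl i * dgB i x c = (\sum_i prodcf F a' (index_enum 'I_r) i * d i) * gN c.
  by rewrite mulr_suml; apply: eq_bigr => i _; rewrite /dgB /d; ring.
have sE' : \sum_k nu k * dgN k x c = gB x * \sum_k (gN (fun j => c j + (j == k)%:R) - gN c) * (n k)%:R.
  by rewrite mulr_sumr; apply: eq_bigr => k _; rewrite /dgN hn'; ring.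
rewrite sE sE' /g0 A1E A0E.
set SB := \sum_i prodcf F a' _ i * d i in p1 *; set SN := \sum_k _ * (n k)%:R in c2 *.
set G1 := gN _ in c1 c2 *; set G := gN c in c1 c2 u3 u4 *.
have -> : A1 * G1 - A0 * G - SB * G - A0 * SN = (A1 - A0 - SB) * G + A0 * (G1 - G - SN) + (A1 - A0) * (G1 - G) by ring.
have b1 : `|(A1 - A0 - SB) * G| <= L%:R * (3 + L%:R) * (kap ^+ 2 * D2).
  by rewrite normrM (ger0_norm u3) -[leRHS]mulr1; apply: ler_pM.
have b2 : `|A0 * (G1 - G - SN)| <= 2 * (N ^+ 2 - N). by rewrite normrM -A0E (ger0_norm u1) -[leRHS]mul1r; apply: ler_pM.
have b3 : `|(A1 - A0) * (G1 - G)| <= kap * (\sum_i `|dl i| * N). rewrite normrM -mulr_suml mulrA; apply: ler_pM => //.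
  apply: le_trans p2 _; rewrite mulr_sumr; apply: ler_sum => i _. by rewrite /d normrM (ger0_norm kap0).
have D20 : 0 <= D2 by apply: sumr_ge0 => j _; exact: sqr_ge0.
have X0 : 0 <= \sum_i `|dl i| * N by apply: sumr_ge0 => j _; exact: mulr_ge0.
apply: le_trans (ler_normD _ _) _; apply: le_trans (lerD (ler_normD _ _) b3) _.
apply: le_trans (lerD (lerD b1 b2) (lexx _)) _.
rewrite /C0 -/L -/D2; move: X0 D20 NN; set X := \sum_i _ * N; set Y := N ^+ 2 - N.
move=> X0 D20 NN; set LL := L%:R * (3 + L%:R).
have LL0 : 0 <= LL by rewrite /LL mulr_ge0// addr_ge0.
have k2 : 0 <= kap ^+ 2 by exact: sqr_ge0.
have := mulr_ge0 (mulr_ge0 k2 LL0) X0; have := mulr_ge0 (mulr_ge0 k2 LL0) NN.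
have := mulr_ge0 kap0 D20; have := mulr_ge0 kap0 NN; nra.
Qed.

Definition Aall : set (mark R q) := [set e | exists k, A k e].

Lemma Aall_meas : measurable Aall /\ Aall `<=` E.
Proof.
split; last by move=> e [k]; exact: (mA k).2.
by apply: (meas_exists (F := A)) => k; exact: (mA k).1.
Qed.

Lemma cnt_all s s' : 0 <= s -> s' <= T ->
  {ae P, forall w, cnt (box Aall s s') w = \sum_k cnt (box (A k) s s') w}.
Proof.
move=> s0 s'T; have := prm_finite; apply: filterS => w fin.
have fk k : prm S w (box (A k) s s') \is a fin_num. have [m1 m2] := mA k; rewrite ge0_fin_numE//.
  apply: (@le_lt_trans _ _ (prm S w (E `*` `[0, T]))); last by rewrite -ge0_fin_numE.
  apply: le_measure; rewrite ?inE; first exact: box_meas. by apply: measurableX => //; exact: mE. exact: box_sub.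
rewrite /cnt sum_fine; last by move=> k _; exact: fk.
congr fine; rewrite fsbig_seq ?index_enum_uniq// -measure_fin_bigcup//=; last 2 first.
- by move=> i j _ _ [u [[/= h1 _] [h2 _]]]; exact: dA h1 h2.
- by move=> k _; apply: box_meas; exact: (mA k).1.
congr (prm S w _); apply/seteqP; split => u. by move=> [[k h] h2]; exists k => //=; exact: mem_index_enum.
by move=> [k _ [h1 h2]]; split => //; exists k.
Qed.

Definition Qerr s s' w : R := \sum_i incB i s s' w ^+ 2 +
  (\sum_i `|incB i s s' w| * cnt (box Aall s s') w) +
  (cnt (box Aall s s') w ^+ 2 - cnt (box Aall s s') w).

Lemma Qerr_small : small2 Qerr.
Proof.
have [m1 m2] := Aall_meas.
apply: small2D; last exact: small2_cnt.
apply: small2D; apply: small2_sum => i; first exact: small2_sqr.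
exact: small2_mixed.
Qed.

(** Clipping [f] between the two signs of [g] in absolute value makes the bound hold everywhere and
    changes [f] only on a null set. *)
Lemma nrm_le_ae (f g : Omega -> R) : mfunT f -> L2 P g ->
  {ae P, forall w, `|f w| <= `|g w|} -> L2 P f /\ nrm P f <= nrm P g.
Proof.
move=> mf Lg h.
have ma : mfunT (fun w => `|g w|) by apply: mfun_comp => //; exact: (L2_meas Lg).
pose f' w := Num.max (- `|g w|) (Num.min (f w) `|g w|).
have mf' : mfunT f'. by apply: measurable_maxr; [exact: mfun_comp|exact: measurable_minr].
have f'g w : `|f' w| <= `|g w|. have g0 := normr_ge0 (g w).
  by rewrite ler_norml /f' le_max lexx ge_max ge_min lexx orbT andbT; lra.
have ff' : {ae P, forall w, f w = f' w}. apply: filterS h => w; rewrite ler_norml => /andP[h1 h2].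
  by rewrite /f' (min_l h2) (max_r h1).
have L' : L2 P f'. apply: L2P => //; apply: (L1_le _ (L2_sqr Lg)) => [|w]; first exact: mfunX.
  by rewrite ger0_norm ?sqr_ge0// -sqr_abs -(sqr_abs (g w)); apply: lerXn2r; rewrite ?nnegrE.
split; first exact: L2_ae ff'.
by rewrite (nrm_ae mf mf' ff'); exact: nrm_le.
Qed.

(** The expansion is applied for each copy [v], at the base point made of the noise up to [s] and
    the copy after [s'], and then averaged over [v]; its error bound does not depend on [v]. *)
Lemma step_rem s s' : a <= s -> s < s' -> s' <= b -> {ae P, forall w,
  `|cexp g0 s' s' w - cexp g0 s s' w - \sum_i incB i s s' w * cexp (dgB i) s s' w
    - \sum_k cnt (box (A k) s s') w * cexp (dgN k) s s' w| <= C0 * Qerr s s' w}.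
Proof.
move=> as_ ss s'b.
have s0 : 0 <= s := le_trans a0 as_; have s'T := le_trans s'b bT.
have s'0 : 0 <= s' := le_trans s0 (ltW ss).
have hnat : {ae P, forall w, forall k, exists n : nat, cnt (box (A k) s s') w = n%:R}.
  apply: filter_forall => k; have [m1 m2] := mA k. have := prm_nat (box_meas s s' m1) (box_sub m2 s0 s'T).
  by apply: filterS => w [n]; rewrite /cnt => ->; exists n.
have h1 := cnt_add_ae a0 as_ (ltW ss) s'T; have h2 := cnt_all s0 s'T.
apply: filterS3 hnat h1 h2 => w hn h1 h2.
rewrite /Qerr; set N := cnt (box Aall s s') w in h2 *.
pose x v i := incB i a s w + incB i s' b v.
pose c v k := cnt (box (A k) a s) w + cnt (box (A k) s' b) v.
have ex v := @g0_expand (x v) (c v) (fun i => incB i s s' w) (fun k => cnt (box (A k) s s') w) N h2 hn.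
have L0 g (C : R) : gmeas g -> (forall x c, `|g x c| <= C) -> L1 P (fun v => g (x v) (c v)).
  by move=> mg gC; exact: (cexp_L1 _ _ mg gC).
have e1 : cexp g0 s' s' w = Ex P (fun v => g0 (fun i => x v i + incB i s s' w) (fun k => c v k + cnt (box (A k) s s') w)).
  apply: Ex_eq => v; congr g0; apply/funext => j; rewrite /x /c. by rewrite /incB; ring. by rewrite h1; ring.
have L1' : L1 P (fun v => g0 (fun i => x v i + incB i s s' w) (fun k => c v k + cnt (box (A k) s s') w)).
  apply: (L1_le _ (L1_cst P 1)) => [|v]; last exact: g0_bound.
  apply: g0_meas => [i|k]; apply: mfunD => //; apply: mfunD => //.
    by apply: incB_meas; rewrite ?s'0 ?s'T ?(le_trans a0 (ltW ab)).
  by have [? ?] := mA k; apply: cnt_meas; [exact: box_meas|exact: box_sub].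
have [l2 e2] : L1 P (fun v => \sum_i incB i s s' w * dgB i (x v) (c v)) /\
  Ex P (fun v => \sum_i incB i s s' w * dgB i (x v) (c v)) = \sum_i incB i s s' w * cexp (dgB i) s s' w.
  have h i : L1 P (fun v => incB i s s' w * dgB i (x v) (c v)).
    by apply: L1Z; apply: L0; [exact: dgB_meas|exact: dgB_bound]. have [k1 k2] := Ex_sum (index_enum 'I_r) h.
  split => //; rewrite k2; apply: eq_bigr => i _; apply: ExZ. by apply: L0; [exact: dgB_meas|exact: dgB_bound].
have [l3 e3] : L1 P (fun v => \sum_k cnt (box (A k) s s') w * dgN k (x v) (c v)) /\
  Ex P (fun v => \sum_k cnt (box (A k) s s') w * dgN k (x v) (c v)) = \sum_k cnt (box (A k) s s') w * cexp (dgN k) s s' w.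
  have h i : L1 P (fun v => cnt (box (A i) s s') w * dgN i (x v) (c v)).
    by apply: L1Z; apply: L0; [exact: dgN_meas|exact: dgN_bound]. have [k1 k2] := Ex_sum (index_enum K) h.
  split => //; rewrite k2; apply: eq_bigr => i _; apply: ExZ. by apply: L0; [exact: dgN_meas|exact: dgN_bound].
have l0 := L0 _ _ g0_meas g0_bound.
rewrite e1 -e2 -e3 [cexp g0 s s' w](_ : _ = Ex P (fun v => g0 (x v) (c v)))//.
rewrite -(ExB L1' l0) -(ExB (L1B L1' l0) l2) -(ExB (L1B (L1B L1' l0) l2) l3).
set bd := C0 * _ in ex *.
have lD := L1B (L1B (L1B L1' l0) l2) l3.
rewrite ler_norml; apply/andP; split. rewrite -[leLHS](Ex_cst P); apply: Ex_le => //; first exact: L1_cst.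
  by move=> v; have := ex v; rewrite ler_norml => /andP[].
rewrite -[leRHS](Ex_cst P); apply: Ex_le => //; first exact: L1_cst.
by move=> v; have := ex v; rewrite ler_norml => /andP[].
Qed.

(** [M] integrates the averaged derivatives against the noise of the step; [D] is what it fails to
    represent. Both the increment of the conditional expectation and [M] are orthogonal to the past
    of [s], hence so is [D]. *)
Lemma step_main : exists2 C1 : R, 0 <= C1 & forall s s', a <= s -> s < s' -> s' <= b ->
  exists M D, [/\ simpI s s' M,
   D = (fun w => cexp g0 s' s' w - cexp g0 s s w - M w),
   L2 P D /\ fm s' D, nrm P D <= C1 * (s' - s) ^+ 2 &
   forall Z, fm s Z -> L2 P Z -> Ex P (fun w => D w * Z w) = 0].
Proof.
have [C C_0 hC] := small2Z C0 Qerr_small.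
exists C => // s s' as_ ss s'b.
have s0 : 0 <= s := le_trans a0 as_; have s'T := le_trans s'b bT.
have s'0 : 0 <= s' := le_trans s0 (ltW ss); have sb := le_trans (ltW ss) s'b.
have [LQ nQ] := hC s s' s0 ss s'T.
pose M w := \sum_i cexp (dgB i) s s' w * incB i s s' w + \sum_k cexp (dgN k) s s' w * compensated S w (A k) s s'.
have fB i : fm s (cexp (dgB i) s s') by apply: cexp_fm => //; [exact: dgB_meas|exact: dgB_bound].
have fN k : fm s (cexp (dgN k) s s') by apply: cexp_fm => //; [exact: dgN_meas|exact: dgN_bound].
have sM : simpI s s' M. apply: simpID; apply: simpI_sum => i; apply: simpI_elem.
    exists s, s', (cexp (dgB i) s s'), (kap * (size (index_enum 'I_r))%:R); split => //.
    - by split => //; exact: ltW.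
    - by move=> w; apply: cexp_bound => //; [exact: dgB_meas|exact: dgB_bound].
    - by left; exists i. exists s, s', (cexp (dgN i) s s'), 1; split => //.
  - by split => //; exact: ltW.
  - by move=> w; apply: cexp_bound => //; [exact: dgN_meas|exact: dgN_bound].
  - by right; exists (A i); have [? ?] := mA i; split.
have [LM fM oM] := simpI_mart s0 (ltW ss) s'T sM.
pose D w := cexp g0 s' s' w - cexp g0 s s w - M w.
have f1 u v : a <= u -> 0 <= v -> v <= b -> fm u (cexp g0 u v).
  by move=> h1 h2 h3; apply: cexp_fm => //; [exact: g0_meas|exact: g0_bound].
have L1g u v : a <= u -> u <= b -> 0 <= v -> v <= b -> L2 P (cexp g0 u v).
  move=> h1 h2 h3 h4; apply: (@L2_bounded _ _ _ _ _ 1).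
    by apply: (@fm_meas _ _ _ P _ _ S hN u); [exact: le_trans bT|exact: f1].
  by move=> w; apply: cexp_bound => //; [exact: g0_meas|exact: g0_bound].
have LD : L2 P D by apply: L2B => //; apply: L2B; apply: L1g => //; exact: le_trans (ltW ss).
have fD : fm s' D. apply: fmB => //; apply: fmB; first by apply: f1 => //; exact: le_trans (ltW ss).
  by apply: (@fm_mono _ _ _ _ _ _ _ s); [exact: ltW|exact: f1].
have oD Z : fm s Z -> L2 P Z -> Ex P (fun w => D w * Z w) = 0. move=> fZ LZ.
  have u1 : L1 P (fun w => cexp g0 s' s' w * Z w). by apply: L2_mul => //; apply: L1g => //; exact: le_trans (ltW ss).
  have u2 : L1 P (fun w => cexp g0 s s w * Z w) by apply: L2_mul => //; exact: L1g.
  have u3 : L1 P (fun w => M w * Z w) by exact: L2_mul.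
  transitivity (Ex P (fun w => cexp g0 s' s' w * Z w - cexp g0 s s w * Z w - M w * Z w)).
    by apply: Ex_eq => w; rewrite /D; ring. rewrite ExB ?ExB//; last exact: L1B. rewrite oM// subr0.
  rewrite -(cexp_cond g0_meas g001 as_ sb fZ (L2_L1 LZ)).
  rewrite -(cexp_cond g0_meas g001 (le_trans as_ (ltW ss)) s'b _ (L2_L1 LZ)) ?subrr//. exact: fm_mono (ltW ss) fZ.
exists M, D; split => //.
(* [cc] collects all terms already known at time [s], including the compensators; subtracted from
   [D] it leaves the remainder of the expansion. As [D] is orthogonal to the past, [nrm D] is at
   most [nrm (D - cc)], so these terms need no estimate. *)
pose cc w := cexp g0 s s' w - cexp g0 s s w + \sum_k (rate (A k) * (s' - s)) * cexp (dgN k) s s' w.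
have fcc : fm s cc. apply: fmD; first by apply: fmB; exact: f1. by apply: fm_sum => k; apply: fmM => //; exact: fm_cst.
have Lcc : L2 P cc. apply: L2D; first by apply: L2B; exact: L1g.
  apply: L2_sum => k; apply: L2Z; apply: (@L2_bounded _ _ _ _ _ 1).
    by apply: (@fm_meas _ _ _ P _ _ S hN s); [exact: le_trans bT|].
  by move=> w; apply: cexp_bound => //; [exact: dgN_meas|exact: dgN_bound].
pose Rem w := D w - cc w.
have LR : L2 P Rem by exact: L2B.
have RE w : Rem w = cexp g0 s' s' w - cexp g0 s s' w - \sum_i incB i s s' w * cexp (dgB i) s s' w
    - \sum_k cnt (box (A k) s s') w * cexp (dgN k) s s' w. have e : \sum_k cexp (dgN k) s s' w * compensated S w (A k) s s' =
     \sum_k cnt (box (A k) s s') w * cexp (dgN k) s s' w - \sum_k (rate (A k) * (s' - s)) * cexp (dgN k) s s' w.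
    by rewrite -sumrB; apply: eq_bigr => k _; rewrite compensatedE; ring.
  have e' : \sum_i cexp (dgB i) s s' w * incB i s s' w = \sum_i incB i s s' w * cexp (dgB i) s s' w.
    by apply: eq_bigr => i _; rewrite mulrC. by rewrite /Rem /D /cc /M e e'; ring.
have nR : nrm P Rem <= C * (s' - s) ^+ 2. apply: le_trans nQ; apply: (nrm_le_ae (L2_meas LR) LQ _).2.
  apply: filterS (step_rem as_ ss s'b) => w; rewrite -RE => h. by apply: le_trans h _; exact: ler_norm.
apply: le_trans nR.
rewrite -[nrm P Rem]addr0 -[X in _ + X](mulr0 2) -(oD _ fcc Lcc) -ExZ; last exact: L2_mul.
rewrite -ExD; [|exact: L2_sqr|by apply: L1Z; exact: L2_mul].
apply: Ex_le => [||w]; [exact: L2_sqr| |]. by apply: L1D; [exact: L2_sqr|apply: L1Z; exact: L2_mul].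
rewrite /Rem -subr_ge0.
have -> : (D w - cc w) ^+ 2 + 2 * (D w * cc w) - D w ^+ 2 = cc w ^+ 2 by ring.
exact: sqr_ge0.
Qed.

Lemma onestep (e : R) : 0 < e -> exists M, simpI a b M /\
  nrm P (fun w => cexp g0 b b w - Ex P (cexp g0 b b) - M w) <= e.
Proof.
move=> e0; have [C C_0 hC] := step_main.
have chain (h : R) j : 0 < h -> a + j%:R * h <= b -> exists M D, [/\ simpI a (a + j%:R * h) M,
   D = (fun w => cexp g0 (a + j%:R * h) (a + j%:R * h) w - cexp g0 a a w - M w),
   L2 P D, fm (a + j%:R * h) D & nrm P D <= j%:R * (C * h ^+ 2)]. move=> h0; elim: j => [|j ih] hb.
    exists (cst 0), (cst 0); split.
    - exact: simpI0.
    - by apply/funext => w; rewrite mul0r addr0 subrr subr0.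
    - exact: L2_cst.
    - exact: fm_cst.
    - by rewrite mul0r /nrm (Ex_eq _ (g := cst 0)) ?Ex_cst// => w; rewrite expr2 mulr0.
  set s := a + j%:R * h; set s' := a + j.+1%:R * h in hb *.
  have ss : s < s' by rewrite /s /s' ltrD2l ltr_pM2r// ltr_nat. have as_ : a <= s by rewrite /s lerDl mulr_ge0// ltW.
  have s's : s' - s = h by rewrite /s /s' -addn1 natrD; ring. have [M [D [sM DE LD fD nD]]] := ih (le_trans (ltW ss) hb).
  have [M' [D' [sM' DE' [LD' fD'] nD' oD']]] := hC s s' as_ ss hb.
  exists (fun w => M w + M' w), (fun w => D w + D' w); split.
  - apply: simpID; first by apply: simpI_sub sM => //; exact: ltW. exact: simpI_sub sM'.
  - by apply/funext => w; rewrite DE DE'; ring.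
  - exact: L2D.
  - by apply: fmD => //; exact: (fm_mono (ltW ss) fD).
  (* The accumulated error [D] is known at time [s] and [D'] is orthogonal to that past, so squared
     norms add exactly, without the factor 2 of the triangle inequality. *)
  - have -> : nrm P (fun w => D w + D' w) = nrm P D + nrm P D'.
      transitivity (Ex P (fun w => D w ^+ 2 + D' w ^+ 2 + 2 * (D' w * D w))). by apply: Ex_eq => w; ring.
      rewrite ExD; [|by apply: L1D; exact: L2_sqr|by apply: L1Z; exact: L2_mul].
      rewrite ExD; [|exact: L2_sqr|exact: L2_sqr]. by rewrite (ExZ 2 (L2_mul LD' LD)) oD' ?mulr0 ?addr0.
    by rewrite -addn1 natrD mulrDl mul1r; apply: lerD => //; rewrite -s's.
(* With [n] steps of length [(b - a) / n] the total error is at most [C * (b - a) ^+ 2 / n], which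
   this [n] brings below [e]. *)
pose n := (Num.truncn (C * (b - a) ^+ 2 / e)).+1.

pose h := (b - a) / n%:R.
have h0 : 0 < h by rewrite divr_gt0// subr_gt0.
have nh : a + n%:R * h = b by rewrite /h mulrCA mulfV ?gt_eqF// mulr1; ring.
have nhb : a + n%:R * h <= b by rewrite nh.
have [M [D [sM DE LD fD nD]]] := chain h n h0 nhb; rewrite nh in sM DE.
exists M; split => //.
rewrite (_ : (fun w => _) = D); last first. rewrite DE; apply/funext => w; congr (_ - _ - _); rewrite cexp_start.
  by apply: Ex_eq => v; rewrite cexp_end.
apply: le_trans nD _; rewrite /h expr_div_n.
have -> : n%:R * (C * ((b - a) ^+ 2 / n%:R ^+ 2)) = C * (b - a) ^+ 2 / n%:R. by field; exact: lt0r_neq0.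
rewrite ler_pdivrMr// [e * _]mulrC -ler_pdivrMr//.
exact: (ltW (truncnS_gt _)).
Qed.

End OneStep.

(** * Variables approximable by constants plus simple integrals *)

Section Appr.
(* The centred part of [X] is a limit of stochastic integrals over ]a, b]: the
   martingale representation property, in approximate form. *)
Definition appr (a b : R) (X : Omega -> R) := L2 P X /\
  forall e, 0 < e -> exists M, simpI a b M /\ nrm P (fun w => X w - Ex P X - M w) <= e.

Lemma nrm0 : nrm P (cst 0) = 0.
Proof. by rewrite /nrm (Ex_eq _ (g := cst 0)) ?Ex_cst// => w; rewrite expr2 mulr0. Qed.

Lemma nrm_center X : L2 P X -> nrm P (fun w => X w - Ex P X) <= nrm P X.
Proof.
move=> LX; have c := Ex P X.
have l1 : L1 P (fun w => 2 * Ex P X * X w) by apply: L1Z; exact: L2_L1.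
have l2 := L1_cst P (Ex P X ^+ 2).
rewrite (_ : nrm P (fun w => _) = Ex P (fun w => X w ^+ 2 - 2 * Ex P X * X w + Ex P X ^+ 2)); last first.
  by apply: Ex_eq => w; ring.
rewrite ExD ?ExB ?Ex_cst//; try exact: L2_sqr. rewrite ExZ; last exact: L2_L1.
  rewrite -/(nrm P X); have := sqr_ge0 (Ex P X); rewrite expr2; lra.
by apply: L1B => //; exact: L2_sqr.
Qed.

Lemma ExB2 X Y : L2 P X -> L2 P Y -> Ex P (fun w => X w - Y w) = Ex P X - Ex P Y.
Proof. by move=> LX LY; apply: ExB; exact: L2_L1. Qed.

Variables (a b : R).
Hypotheses (a0 : 0 <= a) (ab : a <= b) (bT : b <= T).

Lemma appr_lim X : L2 P X ->
  (forall e, 0 < e -> exists Y, appr a b Y /\ nrm P (fun w => X w - Y w) <= e) -> appr a b X.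
Proof.
move=> LX h; split => // e e0; have [|Y [[LY hY] nY]] := h (e / 4); first by rewrite divr_gt0.
have [|M [sM nM]] := hY (e / 4); first by rewrite divr_gt0.
have [LM _ _] := simpI_mart a0 ab bT sM.
exists M; split => //.
have LXY := L2B LX LY.
have c1 := nrm_center LXY; rewrite ExB2// in c1.
have LYc : L2 P (fun w => Y w - Ex P Y - M w) by apply: L2B => //; apply: L2B => //; exact: L2_cst.
have LXc : L2 P (fun w => (X w - Y w) - (Ex P X - Ex P Y)) by apply: L2B => //; exact: L2_cst.
have := nrmD_le LXc LYc.
rewrite (_ : (fun w => _) = (fun w => X w - Ex P X - M w)); last by apply/funext => w; ring.
move: nM c1 nY; set u1 := nrm P _; set u2 := nrm P _; set u3 := nrm P _; set u4 := nrm P _.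
by clear; lra.
Qed.

Lemma appr_cst k : appr a b (cst k).
Proof.
split; first exact: L2_cst.
move=> e e0; exists (cst 0); split; first exact: simpI0.
rewrite (_ : (fun w => _) = cst 0); last by apply/funext => w; rewrite Ex_cst/= subrr subr0.
by rewrite nrm0 ltW.
Qed.

Lemma apprB X Y : appr a b X -> appr a b Y -> appr a b (fun w => X w - Y w).
Proof.
move=> [LX hX] [LY hY]; split; first exact: L2B.
move=> e e0.
have [|M [sM nM]] := hX (e / 4); first by rewrite divr_gt0.
have [|N [sN nN]] := hY (e / 4); first by rewrite divr_gt0.
have sN' : simpI a b (fun w => -1 * N w).
  by apply: (simpI_scale (Y := cst (-1)) (k := 1)) sN => [|w]; [exact: fm_cst|rewrite normrN normr1].
have [LM _ _] := simpI_mart a0 ab bT sM; have [LN _ _] := simpI_mart a0 ab bT sN.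
exists (fun w => M w + -1 * N w); split; first exact: simpID.
have l1 : L2 P (fun w => X w - Ex P X - M w) by apply: L2B => //; apply: L2B => //; exact: L2_cst.
have l2 : L2 P (fun w => Y w - Ex P Y - N w) by apply: L2B => //; apply: L2B => //; exact: L2_cst.
have := nrmB_le l1 l2; rewrite ExB2//.
rewrite (_ : (fun w => _) = (fun w => X w - Y w - (Ex P X - Ex P Y) - (M w + -1 * N w))); last first.
  by apply/funext => w; ring.
move: nM nN; set u1 := nrm P _; set u2 := nrm P _; set u3 := nrm P _; by clear; lra.
Qed.

Lemma appr_ae X (Y : Omega -> R) : appr a b X -> mfunT Y -> {ae P, forall w, X w = Y w} -> appr a b Y.
Proof.
move=> [LX hX] mY XY.
have YX : {ae P, forall w, Y w = X w} by apply: filterS XY => w ->.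
have LY := L2_ae mY LX YX.
apply: appr_lim => // e e0; exists X; split => //.
rewrite (nrm_ae (g := cst 0)); first by rewrite nrm0 ltW.
- exact: (L2_meas (L2B LY LX)).
- exact: measurable_cst.
- by apply: filterS YX => w ->; rewrite subrr.
Qed.

(** The centred part of [X] is a limit of integrals over []a, b]], each orthogonal to the past of
    [a]. Applied to indicators, this is the source of the independence of past and future. *)
Lemma appr_indep X Z : appr a b X -> fm a Z -> L2 P Z ->
  Ex P (fun w => X w * Z w) = Ex P X * Ex P Z.
Proof.
move=> [LX hX] fZ LZ.
have lc : L2 P (fun w => X w - Ex P X) by apply: L2B => //; exact: L2_cst.
suff : Ex P (fun w => (X w - Ex P X) * Z w) = 0. have l1 := L2_mul LX LZ; have l2 := L1Z (Ex P X) (L2_L1 LZ).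
  rewrite (_ : Ex P (fun w => _) = Ex P (fun w => X w * Z w - Ex P X * Z w)); last first. by apply: Ex_eq => w; ring.
  by rewrite ExB// ExZ; [lra|exact: L2_L1].
apply: (Ex_small LZ) => e e0; have [M [sM nM]] := hX e e0.
have [LM _ oM] := simpI_mart a0 ab bT sM.
exists (fun w => X w - Ex P X - M w); split => //; first exact: L2B.
have l1 := L2_mul lc LZ; have l2 := L2_mul LM LZ.
rewrite -[LHS]subr0 -(oM Z fZ LZ) -ExB//.
by apply: Ex_eq => w; ring.
Qed.

Lemma nrm_bounded_cvg (X : nat -> Omega -> R) (k : R) :
  (forall n, mfunT (X n)) -> (forall n w, `|X n w| <= k) ->
  (forall w, X n w @[n --> \oo] --> 0) ->
  forall e, 0 < e -> exists N, forall n, (N <= n)%N -> nrm P (X n) <= e.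
Proof.
move=> mX Xk X0 e e0.
have LX n : L2 P (X n) := L2_bounded P (mX n) (Xk n).
have [] := @dominated_convergence _ _ _ P setT measurableT (fun n w => ((X n w) ^+ 2)%:E) (cst 0%E) (cst (k ^+ 2)%:E).
- by move=> n; apply/measurable_EFinP; exact: mfunX.
- exact: measurable_cst.
- apply: aeW => w _; apply: cvg_EFin; first by near=> n. have -> : 0 = 0 * 0 :> R by rewrite mulr0. exact: cvgM.
- exact: (L1_cst P (k ^+ 2)).
- apply: aeW => w n _; rewrite lee_fin ger0_norm ?sqr_ge0// -sqr_abs.
  by apply: lerXn2r => //; rewrite nnegrE (le_trans _ (Xk n w)).
move=> _ h _.
have i0 n : (0 <= \int[P]_x `|(X n x ^+ 2)%:E - cst 0%R x|)%E. exact: integral_ge0 => w _; exact: abse_ge0.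
have [N hN'] := (ereal_cvg0P i0).1 h e e0; exists N => n Nn.
rewrite -lee_fin nrmE//; apply: le_trans (ltW (hN' n Nn)).
rewrite le_eqVlt; apply/orP; left; apply/eqP; apply: eq_integral => w _.
by rewrite sube0 gee0_abs// lee_fin sqr_ge0.
Unshelve. all: by end_near. Qed.

Lemma appr_bounded_cvg (X : nat -> Omega -> R) (Y : Omega -> R) (k : R) :
  (forall n, appr a b (X n)) -> (forall n w, `|X n w| <= k) -> mfunT Y ->
  (forall w, `|Y w| <= k) ->
  (forall w, X n w @[n --> \oo] --> Y w) -> appr a b Y.
Proof.
move=> hX Xk mY Yk XY.
have LX n : L2 P (X n) by have [] := hX n.
have mX n := L2_meas (LX n).
have LY : L2 P Y := L2_bounded P mY Yk.
apply: appr_lim => // e e0.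
have [||w|N hN'] := @nrm_bounded_cvg (fun n w => Y w - X n w) (2 * k) _ _ _ e e0.
- by move=> n; exact: mfunB.
- by move=> n w; apply: le_trans (ler_normB _ _) _; have := Xk n w; have := Yk w; lra.
- by rewrite -[X in _ --> X](subrr (Y w)); apply: cvgB => //; exact: cvg_cst.
by exists (X N); split => //; exact: hN'.
Qed.

Lemma appr1_lambda : lambda_system setT [set A : set Omega | measurable A /\ appr a b (\1_A)].
Proof.
split => /=.
- by move=> A _; exact: subsetT.
- split => //; rewrite (_ : \1_setT = cst 1); first exact: appr_cst. by apply/funext => w; rewrite indicT.
- move=> A C CA [mA iA] [mC iC]; split; first exact: measurableD.
  rewrite (_ : \1_(A `\` C) = (fun w => \1_A w - \1_C w)); first exact: apprB.
  apply/funext => w; rewrite !indicE in_setD; case: (boolP (w \in C)) => wC /=.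
    by rewrite andbF (mem_set (CA _ (set_mem wC))) subrr. by rewrite andbT subr0.
- move=> F ndF FP; split; first by apply: bigcupT_measurable => n; have [] := FP n.
  have i1 (A : set Omega) w : `|\1_A w| <= 1 :> R by rewrite indicE; case: (_ \in _); rewrite ?normr1 ?normr0.
  apply: (appr_bounded_cvg (X := fun n => \1_(F n)) (k := 1)) => //.
  + by move=> n; have [] := FP n.
  + by apply: measurable_indic; apply: bigcupT_measurable => n; have [] := FP n.
  + move=> w; case: (pselect ((\bigcup_n F n) w)) => [[n _ Fn]|nF]; last first.
      rewrite indicE memNset// (_ : (fun n => _) = cst 0); first exact: cvg_cst.
      by apply/funext => n; rewrite indicE memNset// => Fn; apply: nF; exists n.
    rewrite indicE mem_set; last by exists n. apply: cvg_near_cst; near=> m.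
    rewrite indicE mem_set//; have nm : (n <= m)%N by near: m; exact: nbhs_infty_ge.
    by have /subsetPset := ndF _ _ nm; apply.
Unshelve. all: by end_near. Qed.

Lemma appr1_sigma (G : set (set Omega)) : setI_closed G -> G `<=` measurable ->
  (forall A, G A -> appr a b (\1_A)) -> forall A, <<s G >> A -> measurable A /\ appr a b (\1_A).
Proof.
move=> GI Gm h A sA.
by apply: (lambda_system_subset GI appr1_lambda) => // C GC; split; [exact: Gm|exact: h].
Qed.
End Appr.

Lemma appr_sub a b a' b' X : a' <= a -> b <= b' -> appr a b X -> appr a' b' X.
Proof.
move=> aa bb [LX hX]; split => // e e0; have [M [sM nM]] := hX e e0.
by exists M; split => //; exact: simpI_sub sM.
Qed.

(** [X Y - E[X] E[Y]] equals [E[Y] (X - E[X]) + X (Y - E[Y])], and the mean of the product is the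
    product of the means by [appr_indep]. As [X] is bounded and known at [s], it can be moved into
    the coefficients of integrals over []s, b]]. *)
Lemma appr_mul a s b X Y (k : R) : 0 <= a -> a <= s -> s <= b -> b <= T ->
  fm s X -> (forall w, `|X w| <= k) -> appr a s X ->
  appr s b Y -> appr a b (fun w => X w * Y w).
Proof.
move=> a0 as_ sb bT fX Xk aX aY.
have ab := le_trans as_ sb; have s0 := le_trans a0 as_; have sT := le_trans sb bT.
have k0 : 0 <= k by apply: le_trans (Xk point).
have [LX _] := aX; have [LY hY] := aY.
have mX : mfunT X := L2_meas LX.
have EXY := appr_indep s0 sb bT aY fX LX.
have LXY : L2 P (fun w => X w * Y w) by apply: L2M_bounded LY; [exact: mX|exact: Xk].
have [_ hX] := appr_sub (lexx a) sb aX.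
split; first exact: LXY.
move=> e e0.
(* Each of the two errors is to be at most [e / 4], as the triangle inequality doubles both; the
   added 1 keeps the denominators positive. *)
pose eX := e / (4 * (Ex P Y ^+ 2 + 1)); pose eY := e / (4 * (k ^+ 2 + 1)).
have pX : 0 < Ex P Y ^+ 2 + 1 by have := sqr_ge0 (Ex P Y); lra.
have pk : 0 < k ^+ 2 + 1 by have := sqr_ge0 k; lra.
have [|M [sM nM]] := hX eX; first by rewrite divr_gt0// mulr_gt0.
have [|N [sN nN]] := hY eY; first by rewrite divr_gt0// mulr_gt0.
have [LM _ _] := simpI_mart a0 ab bT sM; have [LN _ _] := simpI_mart s0 sb bT sN.
exists (fun w => Ex P Y * M w + X w * N w); split. apply: simpID.
    by apply: (simpI_scale (Y := cst (Ex P Y)) (k := `|Ex P Y|)) sM => //; exact: fm_cst.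
  by apply: simpI_sub as_ (lexx b) _; exact: simpI_scale fX Xk sN.
have l1 : L2 P (fun w => X w - Ex P X - M w) by apply: L2B => //; apply: L2B => //; exact: L2_cst.
have l2 : L2 P (fun w => Y w - Ex P Y - N w) by apply: L2B => //; apply: L2B => //; exact: L2_cst.
have l3 : L2 P (fun w => X w * (Y w - Ex P Y - N w)) by apply: L2M_bounded l2; [exact: mX|exact: Xk].
have := nrmD_le (L2Z (Ex P Y) l1) l3.
rewrite (_ : (fun w => _ + _) = (fun w => X w * Y w - Ex P (fun w => X w * Y w) - (Ex P Y * M w + X w * N w))); last first.
  apply/funext => w; have -> : Ex P (fun w => X w * Y w) = Ex P X * Ex P Y.
    by rewrite mulrC -EXY; apply: Ex_eq => v; rewrite mulrC. by ring.
rewrite nrmZ//.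
have : nrm P (fun w => X w * (Y w - Ex P Y - N w)) <= k ^+ 2 * nrm P (fun w => Y w - Ex P Y - N w).
  rewrite -nrmZ//; apply: nrm_le (L2Z k l2) _; first exact: L2_meas l3.
  by move=> w; rewrite !normrM; apply: ler_wpM2r => //; rewrite (ger0_norm k0).
move: nM nN; set u1 := nrm P _; set u2 := nrm P _; set u3 := nrm P _; set u4 := nrm P _.
move=> h1 h2 h3 h4.
have h5 : Ex P Y ^+ 2 * u1 <= e / 4. apply: le_trans (_ : (Ex P Y ^+ 2 + 1) * eX <= _).
    apply: ler_pM => //; [exact: sqr_ge0|exact: nrm_ge0|lra].
  by rewrite /eX le_eqVlt; apply/orP; left; apply/eqP; field; exact: lt0r_neq0.
have h6 : k ^+ 2 * u2 <= e / 4. apply: le_trans (_ : (k ^+ 2 + 1) * eY <= _).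
    apply: ler_pM => //; [exact: sqr_ge0|exact: nrm_ge0|lra].
  by rewrite /eY le_eqVlt; apply/orP; left; apply/eqP; field; exact: lt0r_neq0.
by move: h3 h4 h5 h6; clear; lra.
Qed.

Lemma cvg_prod_seq (I : Type) (l : seq I) (f : I -> nat -> R) (g : I -> R) :
  (forall i, f i n @[n --> \oo] --> g i) ->
  (\prod_(i <- l) f i n) @[n --> \oo] --> \prod_(i <- l) g i.
Proof.
move=> h; elim: l => [|i l ih].
  by rewrite big_nil (_ : (fun n => _) = cst 1); [exact: cvg_cst|apply/funext => n; rewrite big_nil].
rewrite big_cons (_ : (fun n => _) = (fun n => f i n * \prod_(j <- l) f j n)). exact: cvgM.
by apply/funext => n; rewrite big_cons.
Qed.

(** * Approximability of the events of one interval *)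

Section Step.
Variables (K : finType) (A : K -> set (mark R q)).
Hypothesis mA : forall k, measurable (A k) /\ A k `<=` E.
Hypothesis dA : forall j k e, A j e -> A k e -> j = k.
Variables (a b : R).
Hypotheses (a0 : 0 <= a) (ab : a <= b) (bT : b <= T).

Definition stepG : set (set Omega) := [set X | exists (z : 'I_r -> R) (Y : K -> set (\bar R)),
  (forall k, measurable (Y k)) /\
  X = [set w | (forall i, incB i a b w <= z i) /\ forall k, Y k (prm S w (box (A k) a b))]].

Lemma incB_meas' i : mfunT (incB i a b).
Proof.
by apply: incB_meas; rewrite ?a0 ?(le_trans a0 ab) ?(le_trans ab bT).
Qed.

Lemma prm_meas' k : mfunT (fun w => prm S w (box (A k) a b)).
Proof.
by have [? ?] := mA k; apply: (prm_meas hN); [exact: box_meas|exact: box_sub].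
Qed.

Lemma stepG_meas : stepG `<=` measurable.
Proof.
move=> X [z [Y [mY ->]]].
rewrite (_ : [set w | _] = [set w | forall i, incB i a b w <= z i] `&` [set w | forall k, Y k (prm S w (box (A k) a b))])//.
apply: measurableI; apply: meas_forall. by move=> i; apply: meas_le => //; exact: incB_meas'.
by move=> k; rewrite -[X in measurable X]setTI; exact: prm_meas'.
Qed.

Lemma stepG_setI : setI_closed stepG.
Proof.
move=> _ _ [z [Y [mY ->]]] [z' [Y' [mY' ->]]].
exists (fun i => Num.min (z i) (z' i)), (fun k => Y k `&` Y' k); split. by move=> k; exact: measurableI.
apply/seteqP; split => w /=. move=> [[h1 h2] [h3 h4]]; split; last by move=> k; split. by move=> i; rewrite le_min h1 h3.
move=> [h1 h2]; split; split.
- by move=> i; have := h1 i; rewrite le_min => /andP[].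
- by move=> k; have [] := h2 k.
- by move=> i; have := h1 i; rewrite le_min => /andP[].
- by move=> k; have [] := h2 k.
Qed.

(** Sharpening ramps converge boundedly to the indicator of the half-lines, and each stage is
    covered by [onestep], which requires [a < b]; for [a = b] the event is trivial. The limit [Y']
    is the indicator of [X] only where the counts are finite, that is almost surely. *)
Lemma stepG_appr X : stepG X -> appr a b (\1_X).
Proof.
move=> GX; have mX := stepG_meas GX; case: GX => z [Y [mY XE]].
have [eab|ab'] : a = b \/ a < b by move: ab; rewrite le_eqVlt => /predU1P. have cX w w' : X w -> X w'.
    rewrite XE => -[h1 h2]; split => [i|k]. by have := h1 i; rewrite /incB eab !subrr.
    have := h2 k; rewrite eab /box set_itv_ge ?setX0 ?measure0//= bnd_simp ltxx//.
  rewrite (_ : \1_X = cst (\1_X point)); first by apply: appr_cst; rewrite eab.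
  apply/funext => w; rewrite /cst !indicE; case: (pselect (X point)) => h. by rewrite !mem_set//; exact: cX h.
  by rewrite !memNset// => h'; apply: h; exact: cX h'.
pose psi k (x : R) : R := \1_(EFin @^-1` (Y k)) x.
have mpsi k : mfunT (psi k).
  by apply: measurable_indic; rewrite -[X in measurable X]setTI; have mf : mfun [set: R] EFin by []; exact: mf.
have psi01 k x : 0 <= psi k x <= 1 by rewrite /psi indicE; case: (_ \in _); rewrite ?ler01 ?lexx.
pose V n := cexp A a b (g0 n%:R z psi) b b.
have VE n w : V n w = (\prod_i ramp (n%:R * (incB i a b w - z i))) * \prod_k psi k (cnt (box (A k) a b) w).
  by rewrite /V cexp_end.
have aV n : appr a b (V n). split; last by move=> e e0; exact: (onestep mA dA a0 ab' bT z (ler0n R n) mpsi psi01 e0).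
  apply: (@L2_bounded _ _ _ _ _ 1). apply: (@fm_meas _ _ _ P _ _ S hN b) => //.
    apply: (@cexp_fm _ _ mA a b a0 ab' bT _ 1) => //.
    - exact: g0_meas.
    - by move=> x c; apply: g0_bound.
    - exact: le_trans a0 ab. by move=> w; rewrite /V cexp_end; apply: g0_bound.
pose Y' w : R := (\prod_i ((incB i a b w - z i <= 0)%R%:R)) * \prod_k psi k (cnt (box (A k) a b) w).
have YE : {ae P, forall w, Y' w = \1_X w}. have := prm_finite; apply: filterS => w fin.
  have fk k : prm S w (box (A k) a b) = (cnt (box (A k) a b) w)%:E.
    have [m1 m2] := mA k; rewrite /cnt fineK// ge0_fin_numE//.
    apply: (@le_lt_trans _ _ (prm S w (E `*` `[0, T]))); last by rewrite -ge0_fin_numE.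
    apply: le_measure; rewrite ?inE; first exact: box_meas. by apply: measurableX => //; exact: mE. exact: box_sub.
  rewrite /Y' indicE; case: (pselect (X w)) => Xw. rewrite mem_set//; move: Xw; rewrite XE /= => -[h1 h2].
    rewrite !big1 ?mulr1// => [k|i] _; last by rewrite subr_le0 h1. by rewrite /psi indicE mem_set//= -fk.
  rewrite memNset//; apply/eqP; rewrite mulf_eq0; apply: contra_notT Xw.
  rewrite negb_or => /andP[/prodf_neq0 h1 /prodf_neq0 h2]; rewrite XE; split => [i|k].
    have := h1 i isT; rewrite subr_le0; by case: (_ <= _); rewrite ?eqxx.
  have := h2 k isT; rewrite /psi indicE; case: (boolP (_ \in _)); rewrite ?eqxx// => /set_mem /=. by rewrite -fk.
have mY' : mfunT Y'. apply: mfunM; apply: measurable_prod => k _.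
    rewrite (_ : (fun w => _) = \1_[set w | incB k a b w - z k <= 0]).
      apply: measurable_indic; apply: meas_le => //; apply: mfunB => //; exact: incB_meas'.
    apply/funext => w; rewrite indicE; case: (boolP (incB k a b w - z k <= 0)) => h; first by rewrite mem_set.
    by rewrite memNset//; exact/negP. apply: (mfun_comp (mpsi k)); apply: (mfun_comp _ (prm_meas' k)) => //.
apply: (@appr_ae a b a0 ab bT Y') => //.
apply: (@appr_bounded_cvg a b a0 ab bT V Y' 1) => //.
- by move=> n w; rewrite /V cexp_end; apply: g0_bound.
- move=> w; rewrite /Y' normrM; apply: mulr_ile1 => //; apply: prod_le1 => i.
    by case: (incB i a b w - z i <= 0); rewrite ?normr1 ?normr0.
  by have /andP[h1 h2] := psi01 i (cnt (box (A i) a b) w); rewrite ger0_norm.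
- move=> w; rewrite (_ : (fun n => V n w) = (fun n => (\prod_i ramp (n%:R * (incB i a b w - z i))) *
     \prod_k psi k (cnt (box (A k) a b) w))); last by apply/funext => n; rewrite VE. apply: cvgM; last exact: cvg_cst.
  by apply: cvg_prod_seq => i; exact: ramp_cvg.
Qed.
End Step.

(** * Approximability of all events of the future of [t] *)

Section Grid.
Section OneGrid.
Variables (K : finType) (A : K -> set (mark R q)).
Hypothesis mA : forall k, measurable (A k) /\ A k `<=` E.
Hypothesis dA : forall j k e, A j e -> A k e -> j = k.
Variables (g : nat -> R) (t : R).
Hypotheses (gmono : forall i j, (i <= j)%N -> g i <= g j) (g0 : g 0%N = t) (t0 : 0 <= t)
  (gT : forall j, g j <= T).

Local Notation stp j := (stepG A (g j) (g j.+1)).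

Lemma g_ge0 j : 0 <= g j.
Proof. by apply: le_trans t0 _; rewrite -g0; exact: gmono. Qed.

Lemma stp_props j B : <<s stp j >> B ->
  [/\ measurable B, appr (g j) (g j.+1) (\1_B) & filt P S (g j.+1) B].
Proof.
move=> sB; have h : g j <= g j.+1 by exact: gmono.
have [m1 m2] := appr1_sigma (g_ge0 j) h (gT _) (@stepG_setI _ A _ _)
  (stepG_meas mA (g_ge0 j) h (gT _)) (stepG_appr mA dA (g_ge0 j) h (gT _)) sB.
split => //; apply: (smallest_sub _ _ sB); first exact: smallest_sigma_algebra.
move=> _ [z [Y [mY ->]]].
rewrite (_ : [set w | _] = [set w | forall i, incB i (g j) (g j.+1) w <= z i] `&`
   [set w | forall k, Y k (prm S w (box (A k) (g j) (g j.+1)))])//.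
apply: (@measurableI _ (Fil (g j.+1))). apply: (@meas_forall _ (Fil (g j.+1))) => i.
  apply: (@meas_le _ _ (Fil (g j.+1))) => //. by apply: fm_incB => //; exact: g_ge0.
apply: (@meas_forall _ (Fil (g j.+1))) => k; have [h1 h2] := mA k.
rewrite -[X in measurable X]setTI; apply: (@fm_prm _ _ _ P) => //; first exact: box_meas.
move=> z' [/= k1]; rewrite in_itv/= => /andP[k2 k3]; split; first exact: h2.
by rewrite in_itv/= k3 (le_trans (g_ge0 j) (ltW k2)).
Qed.

Definition gridG (n : nat) : set (set Omega) := [set X | exists B : nat -> set Omega,
  (forall j, (j < n)%N -> <<s stp j >> (B j)) /\ X = [set w | forall j, (j < n)%N -> B j w]].

Lemma gridG_setI n : setI_closed (gridG n).
Proof.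
move=> _ _ [B [hB ->]] [C [hC ->]]; exists (fun j => B j `&` C j); split.
  move=> j jn; apply: (@measurableI _ (sigT_of (stp j))); [exact: hB|exact: hC].
apply/seteqP; split => w /=; first by move=> [h1 h2] j jn; split; [exact: h1|exact: h2].
by move=> h; split => j jn; have [] := h j jn.
Qed.

(** Induction along the grid: the event of the earlier intervals is known at [g n] and approximable,
    the event of the last interval is approximable over that interval, and [appr_mul] joins them. *)
Lemma gridG_props n X : gridG n X ->
  [/\ measurable X, appr t (g n) (\1_X) & filt P S (g n) X].
Proof.
elim: n X => [|n ih] X [B [hB ->]]. rewrite (_ : [set w | _] = setT); last by apply/seteqP; split.
  have m : filt P S (g 0%N) setT by exact: (@measurableT _ (Fil (g 0%N))).
  split => //; rewrite (_ : \1_setT = cst 1); first by rewrite g0; apply: appr_cst; rewrite  -g0.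
  by apply/funext => w; rewrite indicT.
pose Y := [set w | forall j, (j < n)%N -> B j w].
have [mY aY fY] : [/\ measurable Y, appr t (g n) (\1_Y) & filt P S (g n) Y].
  by apply: ih; exists B; split => // j jn; apply: hB; exact: leqW.
have [mB aB fB] := stp_props (hB n (ltnSn n)).
have -> : [set w | forall j, (j < n.+1)%N -> B j w] = Y `&` B n.
  apply/seteqP; split => w /=; first by move=> h; split => [j jn|]; apply: h => //; exact: leqW.
  by move=> [h1 h2] j; rewrite ltnS leq_eqVlt => /predU1P[->//|]; exact: h1.
split; first exact: measurableI. rewrite (_ : \1_(_ `&` _) = (fun w => \1_Y w * \1_(B n) w)); last first.
    by apply/funext => w; rewrite indicI. apply: (@appr_mul t (g n) (g n.+1) _ _ 1) => //.
  - by rewrite -g0; exact: gmono.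
  - exact: gmono.
  - exact: (@measurable_indic _ (Fil (g n))).
  - by move=> w; rewrite indicE; case: (_ \in _); rewrite ?normr1 ?normr0.
apply: (@measurableI _ (Fil (g n.+1))) => //.
by apply: filt_mono fY; exact: gmono.
Qed.

Lemma gridG_stp n j B : (j < n)%N -> <<s stp j >> B -> <<s gridG n >> B.
Proof.
move=> jn sB; apply: sub_sigma_algebra; exists (fun l => if l == j then B else setT); split.
  move=> l ln; case: eqP => [->//|_]; exact: (@measurableT _ (sigT_of (stp l))).
apply/seteqP; split => w /=; first by move=> Bw l ln; case: eqP.
by move=> /(_ j jn); rewrite eqxx.
Qed.

(** The generators of a step bound all coordinates at once; one coordinate is isolated by letting
    the bounds on the others run through the natural numbers, and a strict inequality is reached as
    a union of weak ones. *)
Lemma stp_incB j i Y : measurable Y -> <<s stp j >> (incB i (g j) (g j.+1) @^-1` Y).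
Proof.
move=> mY; pose GT := sigT_of (stp j).
suff m : mfun [set: GT] (incB i (g j) (g j.+1) : GT -> R). by rewrite -[X in <<s _ >> X]setTI; exact: m.
apply: (measurability _ (RGenCInfty.measurableE R)) => _ [_ [x ->] <-].
rewrite setTI -[X in measurable X]setCK; apply: (@measurableC _ GT).
rewrite (_ : ~` _ = [set w | exists m : nat, exists N : nat, forall i', incB i' (g j) (g j.+1) w <=
   (if i' == i then x - m.+1%:R^-1 else N%:R)]). apply: (@meas_exists _ GT) => m; apply: (@meas_exists _ GT) => N.
  apply: sub_sigma_algebra; exists (fun i' => if i' == i then x - m.+1%:R^-1 else N%:R), (fun _ => setT).
  by split => //; apply/seteqP; split => w; [move=> h; split|case].
apply/seteqP; split => w /=; rewrite in_itv/= andbT. move=> /negP; rewrite -ltNge => h.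
  have h' : 0 < x - incB i (g j) (g j.+1) w by rewrite subr_gt0.
  have [m _ /(_ m (leqnn m)) /= hm] := near_infty_natSinv_lt (PosNum h').
  exists m; pose F i' := incB i' (g j) (g j.+1) w. pose Mx := \sum_i' `|F i'|.
  exists (Num.truncn Mx).+1 => i'; case: eqP => [->|_]; first by rewrite lerBrDr -lerBrDl ltW.
  apply: le_trans (ler_norm _) _; apply: le_trans (ltW (truncnS_gt Mx)). by rewrite /Mx (bigD1 i')//= lerDl; apply: sumr_ge0.
move=> [m [N /(_ i)]]; rewrite eqxx => h; apply/negP; rewrite -ltNge.
by apply: le_lt_trans h _; rewrite ltrBlDr ltrDl.
Qed.

Lemma stp_prm j k Y : measurable Y ->
  <<s stp j >> ((fun w => prm S w (box (A k) (g j) (g j.+1))) @^-1` Y).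
Proof.
move=> mY; pose GT := sigT_of (stp j).
rewrite (_ : _ @^-1` _ = [set w | exists N : nat, (forall i', incB i' (g j) (g j.+1) w <= N%:R) /\
   forall k', (if k' == k then Y else setT) (prm S w (box (A k') (g j) (g j.+1)))]). apply: (@meas_exists _ GT) => N.
  apply: sub_sigma_algebra; exists (fun i' => N%:R), (fun k' => if k' == k then Y else setT). by split => // k'; case: eqP.
apply/seteqP; split => w /=; last by move=> [N [_ /(_ k)]]; rewrite eqxx.
move=> h; pose F i' := incB i' (g j) (g j.+1) w.
pose Mx := \sum_i' `|F i'|.
exists (Num.truncn Mx).+1; split => [i'|k']; last by case: eqP => // ->.
apply: le_trans (ler_norm _) _; apply: le_trans (ltW (truncnS_gt Mx)).
by rewrite /Mx (bigD1 i')//= lerDl; apply: sumr_ge0.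
Qed.

Lemma grid_incB n i j : (j <= n)%N ->
  mfun [set: sigT_of (gridG n)] (incB i t (g j) : sigT_of (gridG n) -> R).
Proof.
elim: j => [|j ih] jn. rewrite (_ : incB i t (g 0%N) = cst 0); first exact: measurable_cst.
  by apply/funext => w; rewrite /incB g0 subrr.
rewrite (_ : incB i t (g j.+1) = (fun w => incB i t (g j) w + incB i (g j) (g j.+1) w)); last first.
  by apply/funext => w; rewrite /incB; ring.
apply: mfunD; first exact: ih (ltnW jn).
by move=> _ Y mY; rewrite setTI; apply: (gridG_stp jn); exact: stp_incB.
Qed.

Lemma prm_box_cat (B : set (mark R q)) (u v w : R) om : measurable B -> u <= v -> v <= w ->
  prm S om (box B u w) = (prm S om (box B u v) + prm S om (box B v w))%E.
Proof.
move=> mB uv vw; rewrite -measureU; [|exact: box_meas|exact: box_meas|].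
  congr (prm S om _); apply/seteqP; split => z; rewrite /box /setX/= !in_itv/=.
    move=> [Az /andP[h1 h2]]; case: (leP z.2 v) => h; [left|right]; split => //. by rewrite h1.
  move=> [[Az /andP[h1 h2]]|[Az /andP[h1 h2]]]; split => //. by rewrite h1 (le_trans h2). by rewrite h2 (le_lt_trans uv).
apply/seteqP; split => // z [[_ /=]]; rewrite in_itv/= => /andP[_ h1] [_ /=].
by rewrite in_itv/= ltNge h1.
Qed.

Lemma grid_prm n k j j' : (j <= j')%N -> (j' <= n)%N ->
  mfun [set: sigT_of (gridG n)]
    ((fun w => prm S w (box (A k) (g j) (g j'))) : sigT_of (gridG n) -> \bar R).
Proof.
elim: j' => [|j' ih] jj jn. rewrite (_ : (fun w => _) = cst 0%E); first exact: measurable_cst.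
  move: jj; rewrite leqn0 => /eqP ->. by apply/funext => w; rewrite /box set_itv_ge ?setX0//= bnd_simp ltxx.
move: jj; rewrite leq_eqVlt => /predU1P[->|jj]. rewrite (_ : (fun w => _) = cst 0%E); first exact: measurable_cst.
  by apply/funext => w; rewrite /box set_itv_ge ?setX0//= bnd_simp ltxx.
rewrite (_ : (fun w => _) = (fun w => prm S w (box (A k) (g j) (g j')) + prm S w (box (A k) (g j') (g j'.+1)))%E).
  apply: emeasurable_funD; first by apply: ih => //; exact: ltnW.
  by move=> _ Y mY; rewrite setTI; apply: (gridG_stp jn); exact: stp_prm.
by apply/funext => w; apply: prm_box_cat; [exact: (mA k).1|exact: gmono|exact: gmono].
Qed.
End OneGrid.

Variables (t : R).
Hypotheses (t0 : 0 <= t) (tT : t <= T).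

(** The noise after [t] only: increments of [B] counted from [t] and [N] on times after [t]. Null
    sets are included here as in the past, since objects are determined only almost surely. *)
Definition futureG (s : R) : set (set Omega) :=
  [set X | exists i (v : R) (Y : set R), [/\ t <= v <= s, measurable Y & X = incB i t v @^-1` Y]] `|`
  [set X | exists (D : set (mark R q * R)) (Y : set (\bar R)), [/\ measurable D,
     D `<=` E `*` `]t, s], measurable Y & X = (fun w => prm S w D) @^-1` Y]] `|`
  [set N | P.-negligible N].

Definition cylG : set (set Omega) := [set X | exists m (i : 'I_m -> 'I_r) (v : 'I_m -> R)
   (Y : 'I_m -> set R) m' (B : 'I_m' -> set (mark R q)) (s s' : 'I_m' -> R) (Z : 'I_m' -> set (\bar R)),
   [/\ forall l, t <= v l <= T /\ measurable (Y l),
     forall l, [/\ measurable (B l), B l `<=` E, t <= s l, s l <= s' l <= T & measurable (Z l)] &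
     X = [set w | (forall l, Y l (incB (i l) t (v l) w)) /\
                  forall l, Z l (prm S w (box (B l) (s l) (s' l)))]]].

Lemma cylG_setI : setI_closed cylG.
Proof.
move=> _ _ [m [i [v [Y [m' [B [s [s' [Z [h1 h2 ->]]]]]]]]]] [n [j [u [X [n' [C [p [p' [W [k1 k2 ->]]]]]]]]]].
pose J T' (f : 'I_m -> T') (g : 'I_n -> T') (l : 'I_(m + n)) := match fintype.split l with inl a => f a | inr b => g b end.
pose J' T' (f : 'I_m' -> T') (g : 'I_n' -> T') (l : 'I_(m' + n')) :=
  match fintype.split l with inl a => f a | inr b => g b end.
exists (m + n)%N, (J _ i j), (J _ v u), (J _ Y X), (m' + n')%N, (J' _ B C), (J' _ s p), (J' _ s' p'), (J' _ Z W).
split.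
- by move=> l; rewrite /J; case: (fintype.split l) => a.
- by move=> l; rewrite /J'; case: (fintype.split l) => a.
apply/seteqP; split => w /=. move=> [[a1 a2] [a3 a4]]; split => l; first by rewrite /J; case: (fintype.split l) => a.
  by rewrite /J'; case: (fintype.split l) => a.
move=> [a1 a2]; split; split => l.
- by have := a1 (lshift n l); rewrite /J (unsplitK (inl l : 'I_m + 'I_n)).
- by have := a2 (lshift n' l); rewrite /J' (unsplitK (inl l : 'I_m' + 'I_n')).
- by have := a1 (rshift m l); rewrite /J (unsplitK (inr l : 'I_m + 'I_n)).
- by have := a2 (rshift m' l); rewrite /J' (unsplitK (inr l : 'I_m' + 'I_n')).
Qed.

(** All time endpoints are sorted into one grid and all mark sets are cut into disjoint atoms; the
    increments and counts of the cylinder are then sums of those of the grid cells, so the cylinder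
    belongs to the sigma-algebra of the grid. *)
Lemma cylG_appr X : cylG X -> measurable X /\ appr t T (\1_X).
Proof.
move=> [m [i [v [Y [m' [B [s [s' [Z [h1 h2 ->]]]]]]]]]].
pose sq := sort <=%R ([seq v l | l <- enum 'I_m] ++ ([seq s l | l <- enum 'I_m'] ++ [seq s' l | l <- enum 'I_m'])).
have sqE x : (x \in sq) = [|| x \in [seq v l | l <- enum 'I_m], x \in [seq s l | l <- enum 'I_m']
    | x \in [seq s' l | l <- enum 'I_m']] by rewrite /sq mem_sort !mem_cat.
have sq_in x : x \in t :: sq -> t <= x <= T. rewrite inE sqE => /orP[/eqP ->|/or3P[]]; first by rewrite lexx.
  - by move=> /mapP[l _ ->]; have [] := h1 l.
  - by move=> /mapP[l _ ->]; have [_ _ -> /andP[a1 a2] _] := h2 l; rewrite (le_trans a1).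
  - by move=> /mapP[l _ ->]; have [_ _ a0 /andP[a1 a2] _] := h2 l; rewrite (le_trans a0).
(* Past the last endpoint the default value [T] keeps [g] at the horizon, so it is monotone on all
   indices. *)
pose g := nth T (t :: sq).
have g0 : g 0%N = t by [].
have gt j : t <= g j <= T. case: (ltnP j (size (t :: sq))) => hj; first by apply: sq_in; exact: mem_nth.
  by rewrite /g nth_default// tT lexx.
have gT j : g j <= T by have /andP[] := gt j.
have srt : sorted <=%R (t :: sq). rewrite /= path_sortedE; last exact: le_trans.
  rewrite sort_sorted ?andbT; last exact: le_total.
  by apply/allP => x xs; have /andP[] : t <= x <= T by apply: sq_in; rewrite inE xs orbT.
have gmono j j' : (j <= j')%N -> g j <= g j'.
  move=> jj; case: (ltnP j' (size (t :: sq))) => hj; last by rewrite [g j']nth_default.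
  apply: (sorted_leq_nth le_trans lexx T srt) => //. by rewrite inE (leq_ltn_trans jj).
(* Atoms of the Boolean algebra generated by the mark sets, indexed by the sets that contain
   them. *)
pose A (C : {set 'I_m'}) : set (mark R q) := E `&` [set e | forall l, if l \in C then B l e else ~ B l e].
have mA C : measurable (A C) /\ A C `<=` E. split; last exact: subIsetl. apply: measurableI; first exact: mE.
  apply: meas_forall => l; have [b1 _ _ _ _] := h2 l; case: (l \in C) => //. exact: measurableC.
have dA C C' e : A C e -> A C' e -> C = C'. move=> [_ a1] [_ a2]; apply/setP => l; have := a1 l; have := a2 l.
  by case: (l \in C); case: (l \in C').
pose n := size sq.
have idx x : x \in t :: sq -> exists2 j, (j <= n)%N & g j = x.
  move=> xs; exists (index x (t :: sq)); last exact: nth_index. by rewrite -ltnS; move: xs; rewrite -index_mem.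
pose GT := sigT_of (gridG A g n).
have mg : gridG A g n `<=` measurable by move=> W /(gridG_props mA dA gmono g0 t0 gT)[].
suff cg : <<s gridG A g n >> [set w | (forall l, Y l (incB (i l) t (v l) w)) /\
                  forall l, Z l (prm S w (box (B l) (s l) (s' l)))].
  have := appr1_sigma t0 tT (lexx T) (@gridG_setI _ A g n) mg _ cg; apply.
  move=> W /(gridG_props mA dA gmono g0 t0 gT)[_ aW _]. exact: (appr_sub (lexx t) (gT n) aW).
rewrite (_ : [set w | _] = [set w | forall l, Y l (incB (i l) t (v l) w)] `&`
   [set w | forall l, Z l (prm S w (box (B l) (s l) (s' l)))])//.
apply: (@measurableI _ GT); apply: (@meas_forall _ GT) => l. have [vl mYl] := h1 l.
  have [|j jn gj] := idx (v l); first by rewrite inE sqE map_f ?mem_enum ?orbT. rewrite -[X in measurable X]setTI -gj.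
  have mm : mfun [set: GT] (incB (i l) t (g j) : GT -> R) by apply: grid_incB. exact: mm.
have [bl1 bl2 a0 /andP[a1 a2] mZ] := h2 l.
have [|j jn gj] := idx (s l); first by rewrite inE sqE map_f ?mem_enum ?orbT.
have [|j' jn' gj'] := idx (s' l); first by rewrite inE sqE (map_f s') ?mem_enum ?orbT.
rewrite -[X in measurable X]setTI; suff mm : mfun [set: GT] ((fun w => prm S w (box (B l) (s l) (s' l))) : GT -> \bar R).
  exact: mm.
have [k [k' [kk kn gk gk']]] : exists k k', [/\ (k <= k')%N, (k' <= n)%N, g k = s l & g k' = s' l].
  case: (leqP j j') => jj; first by exists j, j'.
  exists j, j; split => //; apply/eqP; rewrite eq_le gj a1 -gj' -gj; exact: gmono (ltnW jj).
rewrite (_ : (fun w => _) = (fun w => \sum_(C <- index_enum {set 'I_m'})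
    prm S w (box (if l \in C then A C else set0) (g k) (g k')))%E).
  apply: emeasurable_sum => C; case: ifP => _; first exact: grid_prm.
  rewrite (_ : (fun w => _) = cst 0%E); first exact: measurable_cst. by apply/funext => w; rewrite /box set0X measure0.
apply/funext => w.
rewrite fsbig_seq ?index_enum_uniq// -measure_fin_bigcup//=; last 2 first.
- move=> C C' _ _ [u [[/= u1 _] [/= u2 _]]]; move: u1 u2; case: ifP =>  _; case: ifP => // _; exact: dA.
- by move=> C _; apply: box_meas; case: ifP => // _; exact: (mA C).1.
congr (prm S w _); rewrite gk gk'; apply/seteqP; split => u.
  move=> [u1 u2]; exists [set j | `[< B j u.1 >]]%SET; first by rewrite /= mem_index_enum.
  split => //=; rewrite inE asboolT//; split; first exact: bl2. by move=> p; rewrite inE; case: asboolP.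
move=> [C _ [/= u1 u2]]; split; move: u1; case: ifP => // lC [_ /(_ l)]; by rewrite lC.
Qed.

Definition cylN : set (set Omega) := [set X | measurable X /\ exists2 X', cylG X' & {ae P, forall w, X w <-> X' w}].

Lemma cylN_appr X : <<s cylN >> X -> measurable X /\ appr t T (\1_X).
Proof.
apply: (appr1_sigma t0 tT (lexx T)).
- move=> X1 X2 [m1 [Y1 c1 e1]] [m2 [Y2 c2 e2]]; split; first exact: measurableI. exists (Y1 `&` Y2); first exact: cylG_setI.
  by apply: filterS2 e1 e2 => w h1 h2; split => -[a1 a2]; split; [exact/h1|exact/h2|exact/h1|exact/h2].
- by move=> X1 [].
move=> X1 [m1 [Y1 c1 e1]]; have [mY aY] := cylG_appr c1.
apply: (appr_ae t0 tT (lexx T) aY); first exact: measurable_indic.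
apply: filterS e1 => w h; rewrite !indicE; congr (_%:R).
by case: (pselect (X1 w)) => Xw; [rewrite !mem_set//; exact/h|rewrite !memNset// => /h].
Qed.

Lemma cylG_box (B : set (mark R q)) (s s' : R) (Z : set (\bar R)) : measurable B -> B `<=` E ->
  t <= s -> s <= s' -> s' <= T -> measurable Z -> cylG ((fun w => prm S w (box B s s')) @^-1` Z).
Proof.
move=> mB BE ts ss s'T mZ.
exists 0%N, (fun x : 'I_0 => match x with Ordinal _ p => match (notF p) with end end), (fun _ => 0), (fun _ => set0),
  1%N, (fun _ => B), (fun _ => s), (fun _ => s'), (fun _ => Z).
split; first by case. by move=> _; split => //; rewrite ss s'T.
apply/seteqP; split => w /=; last by move=> [_ /(_ ord0)].
by move=> h; split =>  -[].
Qed.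

Lemma cylN_negl N : P.-negligible N -> <<s cylN >> N.
Proof.
move=> nN; apply: sub_sigma_algebra; split; first exact: (negl_meas hN).
exists ((fun w => prm S w (box set0 t t)) @^-1` set0); first exact: cylG_box.
rewrite preimage_set0.
move: nN => [M [mM M0 NM]]; exists M; split => // w /= h; apply: NM.
by apply: contrapT => nN; apply: h; split.
Qed.

Local Notation GN := (sigT_of cylN).

(** Counts are additive and continuous along increasing unions. Subtraction needs a finite measure
    and so holds almost surely only, which is harmless because the target sigma-algebra contains the
    null sets. It is used with [p] the time projection, then with the identity to pass from
    rectangles to all sets. *)
Lemma prm_lambda d (U : measurableType d) (p : mark R q * R -> U) (F : set (mark R q * R)) :
  mfunT p -> measurable F -> F `<=` E `*` `[0, T] ->
  mfun [set: GN] ((fun w => prm S w F) : GN -> \bar R) ->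
  lambda_system setT [set D : set U | measurable D /\
    mfun [set: GN] ((fun w => prm S w (p @^-1` D `&` F)) : GN -> \bar R)].
Proof.
move=> mp mF FE hF.
have mpD D : measurable D -> measurable (p @^-1` D `&` F).
  by move=> mD; apply: measurableI => //; rewrite -[X in measurable X]setTI; exact: mp.
have fin : {ae P, forall w, forall D, measurable D -> prm S w (p @^-1` D `&` F) \is a fin_num}.
  have := prm_finite; apply: filterS => w fin D mD; rewrite ge0_fin_numE//.
  apply: (@le_lt_trans _ _ (prm S w (E `*` `[0, T]))); last by rewrite -ge0_fin_numE.
  apply: le_measure; rewrite ?inE; first exact: mpD. by apply: measurableX => //; exact: mE. by move=> z [_]; exact: FE.
split => /=.
- by move=> A _; exact: subsetT.
- by split => //; rewrite preimage_setT setTI.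
- move=> A C CA [mA hA] [mC hC]; split; first exact: measurableD.
  apply: (@sigma_fun_ae R _ _ P cylN _ _ (fun w => prm S w (p @^-1` A `&` F) - prm S w (p @^-1` C `&` F))%E).
  + exact: cylN_negl.
  + exact: emeasurable_funB. apply: filterS fin => w fin.

  rewrite -{1}[p @^-1` A `&` F](@setDUK _ (p @^-1` C `&` F)); last first. by move=> z [h1 h2]; split => //; exact: CA.
  rewrite measureU; [|exact: mpD|by apply: measurableD; exact: mpD|]; last first.
    by apply/seteqP; split => // z [h1 [_ h2]]. rewrite addeAC subee ?add0e; last exact: fin.
  congr (prm S w _); apply/seteqP; split => z /=. by move=> [[h1 h2] h3]; split => //; split => // h4; apply: h3.
  by move=> [[h1 h2] h3]; split; [split|move=> [h4 _]].
- move=> B ndB hB; split; first by apply: bigcupT_measurable => n; have [] := hB n.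
  apply: (@emeasurable_fun_cvg _ GN R setT (fun n w => prm S w (p @^-1` (B n) `&` F))). by move=> n; have [] := hB n.
  move=> w _; rewrite preimage_bigcup setI_bigcupl. apply: nondecreasing_cvg_mu.
  + by move=> n; apply: mpD; have [] := hB n.
  + by apply: bigcupT_measurable => n; apply: mpD; have [] := hB n.
  + move=> n m nm; apply/subsetPset; apply: setSI; apply: preimage_subset. by have /subsetPset := ndB _ _ nm.
Qed.

Lemma cylN_rect (A : set (mark R q)) (D : set R) : measurable A -> measurable D ->
  mfun [set: GN] ((fun w => prm S w ((A `*` D) `&` (E `*` `]t, T]))) : GN -> \bar R).
Proof.
move=> mA mD; set F := E `*` `]t, T].
have mAE : measurable (A `&` E) by apply: measurableI => //; exact: mE.
have boxm u v (tu : t <= u) (uv : u <= v) (vT : v <= T) :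
    mfun [set: GN] ((fun w => prm S w (box (A `&` E) u v)) : GN -> \bar R).
  move=> _ Y mY; rewrite setTI; apply: sub_sigma_algebra. have c := cylG_box mAE (@subIsetr _ _ _) tu uv vT mY.
  by split; [have [] := cylG_appr c|exists ((fun w => prm S w (box (A `&` E) u v)) @^-1` Y) => //; exact: aeW].
have FE : (box (A `&` E) t T) `<=` E `*` `[0, T].
  move=> [e x] [[_ h1]]; rewrite /= !in_itv/= => /andP[h2 h3]; split => //=. by rewrite h3 (le_trans t0 (ltW h2)).
have mFb := box_meas t T mAE.
have L := @prm_lambda _ _ snd _ measurable_snd mFb FE (boxm t T (lexx t) tT (lexx T)).
have : [set D : set R | measurable D /\
    mfun [set: GN] ((fun w => prm S w (snd @^-1` D `&` box (A `&` E) t T)) : GN -> \bar R)] D.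
  apply: (lambda_system_subset (@ocitvI R) L) => // I oI; split; first exact: sub_sigma_algebra.
  have [->|[[x y] /= xy ->]] := (ocitvP I).1 oI. rewrite (_ : (fun w => _) = cst 0%E); first exact: measurable_cst.
    by apply/funext => w; rewrite preimage_set0 set0I measure0.
  pose u := Num.max t (Num.min x T); pose v := Num.max u (Num.min y T). have tu : t <= u by rewrite le_max lexx.
  have uv : u <= v by rewrite le_max lexx. have uT : u <= T by rewrite ge_max tT ge_min lexx orbT.
  have vT : v <= T by rewrite ge_max uT ge_min lexx orbT. rewrite (_ : _ `&` _ = box (A `&` E) u v); first exact: boxm.
  apply/seteqP; split => -[e z] /=.
    rewrite !in_itv/= => -[/andP[h1 h2] [h3 /=]]; rewrite in_itv/= => /andP[h4 h5]; split => //=.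
    rewrite in_itv/=; apply/andP; split; first by rewrite /u gt_max h4 gt_min h1.
    by rewrite /v le_max le_min h2 h5 orbT. move=> [h3 /=]; rewrite in_itv/= => /andP[h4 h5]; rewrite in_itv/=.
  have h6 : t < z by apply: le_lt_trans h4. have h7 : z <= T by apply: le_trans vT. have h8 : x < z.
    by move: h4; rewrite /u gt_max gt_min => /andP[_ /orP[//|]]; rewrite ltNge h7.
  split; last by split => //=; rewrite in_itv/= h6 h7.
  rewrite h8 /=; move: h5; rewrite /v le_max => /orP[|]; last by rewrite le_min => /andP[]. by rewrite leNgt h4.
move=> [_ h]; rewrite (_ : _ `*` _ `&` _ = snd @^-1` D `&` box (A `&` E) t T)//.
by apply/seteqP; split => -[e z] => [[[h1 h2] [h3 h4]]|[h2 [[h1 h3] h4]]]; split.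
Qed.

Lemma cylN_prm D : measurable D ->
  mfun [set: GN] ((fun w => prm S w (D `&` (E `*` `]t, T]))) : GN -> \bar R).
Proof.
move=> mD; set F := E `*` `]t, T].
have mF : measurable F by apply: measurableX => //; exact: mE.
have FE : F `<=` E `*` `[0, T]. move=> [e x] [h1]; rewrite /= !in_itv/= => /andP[h2 h3]; split => //=.
  by rewrite h3 (le_trans t0 (ltW h2)).
have hF : mfun [set: GN] ((fun w => prm S w F) : GN -> \bar R). have := @cylN_rect setT setT measurableT measurableT.
  by rewrite setXTT setTI.
have L := @prm_lambda _ _ id F (@measurable_id _ _ _) mF FE hF.
move: (mD); rewrite measurable_prod_measurableType => sD.
suff : [set D : set (mark R q * R) | measurable D /\
    mfun [set: GN] ((fun w => prm S w (id @^-1` D `&` F)) : GN -> \bar R)] D by case.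
apply: (lambda_system_subset _ L) sD => //. move=> _ _ [A1 mA1 [B1 mB1 <-]] [A2 mA2 [B2 mB2 <-]].
  exists (A1 `&` A2); first exact: measurableI. by exists (B1 `&` B2); [exact: measurableI|rewrite setXI].
move=> _ [A1 mA1 [B1 mB1 <-]]; split; first exact: measurableX.
exact: cylN_rect.
Qed.

Lemma futureG_cylN : <<s futureG T >> `<=` <<s cylN >>.
Proof.
apply: smallest_sub; first exact: smallest_sigma_algebra.
move=> X [[|]|].
- move=> [i [v [Y [tv mY ->]]]]; apply: sub_sigma_algebra. suff c : cylG (incB i t v @^-1` Y).
    by split; [have [] := cylG_appr c|exists (incB i t v @^-1` Y) => //; exact: aeW].
  exists 1%N, (fun _ => i), (fun _ => v), (fun _ => Y), 0%N, (fun _ => set0), (fun _ => 0), (fun _ => 0), (fun _ => set0).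
  split => //; first by case. by apply/seteqP; split => w; [move=> h; split =>  -[]|move=> [/(_ ord0)]].
- move=> [D [Y [mD DF mY ->]]]. rewrite -[X in <<s _ >> X]setTI.
  have := cylN_prm mD; rewrite (_ : D `&` _ = D); first by move=> h; exact: h.
  by apply/seteqP; split => z; [case|move=> h; split => //; exact: DF].
- exact: cylN_negl.
Qed.

(** The approximate representation for every event of the future: such an event is, by generation, a
    set built from cylinders up to null sets, and approximability of indicators is stable under the
    operations of a lambda-system. *)
Lemma future_appr X : <<s futureG T >> X -> measurable X /\ appr t T (\1_X).
Proof. by move=> /futureG_cylN; exact: cylN_appr. Qed.
End Grid.

(** * Splitting an event or a variable into past and future of [t] *)

Section Lift.
Variable t : R.
Hypotheses (t0 : 0 <= t) (tT : t <= T).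
Local Notation Fut s := (sigT_of (futureG t s)).

(** Indicators of future events are approximable by integrals after [t], and this alone makes them
    uncorrelated with indicators of past events. *)
Lemma past_future_indep : indep_maps P (id : Omega -> Fil t) (id : Omega -> Fut T).
Proof.
move=> A B fA fB; have [mB aB] := future_appr t0 tT fB.
have mA : @measurable _ Omega A by exact: (filt_meas hN tT fA).
have iA : fm t (\1_A) by exact: (@measurable_indic _ (Fil t)).
have LA : L2 P (\1_A). apply: (@L2_bounded _ _ _ _ _ 1); first exact: measurable_indic.
  by move=> w; rewrite indicE; case: (_ \in _); rewrite ?normr1 ?normr0.
have := appr_indep t0 tT (lexx T) aB iA LA.
have E1 C : measurable C -> (Ex P (\1_C))%:E = P C. move=> mC; rewrite ge0_ExE; first by rewrite integral_indic// setIT.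
  apply: L2_L1; apply: (@L2_bounded _ _ _ _ _ 1); first exact: measurable_indic.
  by move=> w; rewrite indicE; case: (_ \in _); rewrite ?normr1 ?normr0.
rewrite (_ : (fun w => _) = \1_(A `&` B)); last first. by apply/funext => w; rewrite indicI mulrC.
move=> H; rewrite !preimage_id -!E1//; last exact: measurableI.
by rewrite H EFinM muleC.
Qed.

Lemma past_id_meas : mfunT (id : Omega -> Fil t).
Proof. by move=> _ Y mY; rewrite setTI; exact: (filt_meas hN tT). Qed.

Lemma future_id_meas : mfunT (id : Omega -> Fut T).
Proof. by move=> _ Y mY; rewrite setTI; have [] := future_appr t0 tT mY. Qed.

Lemma future_mono s s' : s <= s' -> <<s futureG t s >> `<=` <<s futureG t s' >>.
Proof.
move=> ss; apply: smallest_sub; first exact: smallest_sigma_algebra.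
move=> X [[[i [v [Y [/andP[v1 v2] mY ->]]]]|[D [Y [mD DF mY ->]]]]|nX]; apply: sub_sigma_algebra; [left;left|left;right|by right].
  by exists i, v, Y; rewrite v1 (le_trans v2).
exists D, Y; split => // z /DF[h1 h2]; split => //; move: h2; rewrite /= !in_itv/= => /andP[-> h3].
exact: le_trans ss.
Qed.

Lemma future_filt s : t <= s -> <<s futureG t s >> `<=` filt P S s.
Proof.
move=> ts; apply: smallest_sub; first exact: smallest_sigma_algebra.
move=> X [[[i [v [Y [/andP[v1 v2] mY ->]]]]|[D [Y [mD DF mY ->]]]]|nX]; last exact: filt_negl.
  rewrite -[X in filt _ _ _ X]setTI. have m : fm s (incB i t v) by exact: fm_incB. exact: m.
have m : mfun [set: Fil s] ((fun w => prm S w D) : Fil s -> \bar R).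
  apply: fm_prm => // z /DF[h1 h2]; split => //; move: h2; rewrite /= !in_itv/= => /andP[h2 ->].
  by rewrite (le_trans t0 (ltW h2)).
by rewrite -[X in filt _ _ _ X]setTI; exact: m.
Qed.

Local Notation dlift A B := {ae P, forall w, A w <-> B (w, w)}.

(** Generators are split at time [t]: [B] at time [v] is its value at [min v t] plus an increment
    from [t] to [max v t], and the count of [D] is the count of its part up to [t] plus that of its
    part after [t]. Each summand reads one of the two arguments; on the diagonal the sum is the
    original. *)
Lemma lift_filt s A : t <= s -> s <= T -> filt P S s A ->
  exists B : set (Fil t * Fut s), measurable B /\ dlift A B.
Proof.
move=> ts sT.
have key A' : (exists B, @lifts R _ Omega P unit Omega _ (Fil t * Fut s)%type setT (fun _ w => w) (fun _ w => (w, w)) A' B) <->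
   exists B : set (Fil t * Fut s), measurable B /\ dlift A' B. split => -[B [mB lB]]; exists B; split => //.
    by apply: filterS lB => w /(_ tt Logic.I). exact: filterS lB => w h _ _.
have hT : exists B, @lifts R _ Omega P unit Omega _ (Fil t * Fut s)%type setT (fun _ w => w) (fun _ w => (w, w)) setT B.
  by exists setT; split => //; exact: aeW.
have m1 (f : Omega -> R) : fm t f -> mfun [set: Fil t * Fut s] (fun z : Fil t * Fut s => f z.1).
  by move=> mf; exact: (mfun_comp (mf : mfunT _) measurable_fst).
move=> fA; apply/key; move: A fA; apply: lifts_sigma => // A [[|]|].
- move: A; apply: lifts_sigma => // A [v [Y [/andP[v0 vs] mY ->]]]; apply/key.
  pose F (z : Fil t * Fut s) : 'cV[R]_r := \col_i (bm S (Num.min v t) z.1 i ord0 + incB i t (Num.max v t) z.2).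
  exists (F @^-1` Y); split. move: Y mY; apply/mx_measP => i j.
    rewrite (_ : (fun w => _) = (fun z => bm S (Num.min v t) z.1 i ord0 + incB i t (Num.max v t) z.2)); last first.
      by apply/funext => z; rewrite mxE. apply: mfunD.
      apply: (m1 (fun w => bm S (Num.min v t) w i ord0)); apply: fm_bm. by rewrite le_min v0 t0 ge_min lexx orbT.
    apply: (mfun_comp (f := (incB i t (Num.max v t) : Fut s -> R))) => //.
    move=> _ Y mY; rewrite setTI; apply: sub_sigma_algebra; left; left.
    by exists i, (Num.max v t), Y; rewrite le_max lexx orbT ge_max vs ts.
  apply: aeW => w /=; rewrite (_ : F (w, w) = bm S v w)//; apply/matrixP => i j.
  rewrite mxE (ord1 j) /incB; case: (leP v t) => _; by rewrite ?subrr ?addr0// addrC subrK.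
- move: A; apply: lifts_sigma => // A [D [Y [mD DE mY ->]]]; apply/key.
  pose D1 := D `&` (E `*` `[0, t]); pose D2 := D `&` (E `*` `]t, s]).
  have mD1 : measurable D1 by apply: measurableI => //; apply: measurableX => //; exact: mE.
  have mD2 : measurable D2 by apply: measurableI => //; apply: measurableX => //; exact: mE.
  pose F (z : Fil t * Fut s) : \bar R := (prm S z.1 D1 + prm S z.2 D2)%E. exists (F @^-1` Y); split.
    rewrite -[X in measurable X]setTI; suff mF : mfunT F by exact: mF. apply: emeasurable_funD.
      apply: (mfun_comp (f := ((fun w => prm S w D1) : Fil t -> \bar R))) => //. by apply: fm_prm => //; exact: subIsetr.
    apply: (mfun_comp (f := ((fun w => prm S w D2) : Fut s -> \bar R))) => //.
    move=> _ Z mZ; rewrite setTI; apply: sub_sigma_algebra; left; right. by exists D2, Z; split => //; exact: subIsetr.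
  apply: aeW => w /=; rewrite (_ : F (w, w) = prm S w D)// /F /= -measureU//.
    congr (prm S w _); apply/seteqP; split => z; first by move=> [[]|[]].
    move=> Dz; have [h1 h2] := DE _ Dz; move: h2; rewrite /= in_itv/= => /andP[h2 h3].
    by case: (leP z.2 t) => h; [left|right]; split => //; split => //=; rewrite in_itv/= ?h ?h2.
  apply/seteqP; split => // z [[_ [_ h1]] [_ [_ h2]]]; move: h1 h2; rewrite /= !in_itv/= => /andP[_ h1] /andP[h2 _].
  by move: h2; rewrite ltNge h1.
- move=> nA; apply/key; exists set0; split => //.
  have := nA => -[M [mM M0 AM]]; exists M; split => // w /= h; apply: AM. by apply: contrapT => nA'; apply: h; split.
Qed.

Lemma lift_fm s (X : Omega -> R) : t <= s -> s <= T -> fm s X ->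
  exists X' : Fil t * Fut s -> R, mfunT X' /\ {ae P, forall w, X w = X' (w, w)}.
Proof.
move=> ts sT fX.
have [c|X' [mX' hX']] := @lifts_fun R _ Omega P unit Omega _ (Fil t * Fut s)%type setT (fun _ w => w) (fun _ w => (w, w)) setT X.
  have [|B [mB lB]] := @lift_filt s [set w | X w < c] ts sT. exact: (@meas_lt _ _ (Fil s)) => //; exact: measurable_cst.
  exists B; split => //; apply: filterS lB => w h _ _; rewrite -h; by split => [[]|].
by exists X'; split => //; apply: filterS hX' => w /(_ tt Logic.I Logic.I).
Qed.
End Lift.

(** * Lifting predictable controls *)

Section LiftPred.
Variable t : R.
Hypotheses (t0 : 0 <= t) (tT : t <= T).
Local Notation Fut s := (sigT_of (futureG t s)).
Local Notation Z := (Fil t * Fut T)%type.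
Local Notation pred := (predictable_sets P S).

Lemma pred_oc (a b : R) A : t <= a -> b <= T -> filt P S a A -> pred (`]a, b] `*` A).
Proof.
move=> ta bT fA; case: (leP a b) => ab.
  apply: sub_sigma_algebra; right; exists a, b, A; split => //; last by rewrite ab. exact: le_trans ta.
rewrite set_itv_ge ?set0X; first by have [] := smallest_sigma_algebra (`[0, T] `*` setT) ([set C | exists A, filt P S 0 A /\ C = [set 0] `*` A] `|`
      [set C | exists a b A, [/\ 0 <= a, a <= b <= T, filt P S a A & C = `]a, b] `*` A]]).
by rewrite bnd_simp -leNgt ltW.
Qed.

Lemma filt_setT s : filt P S s setT.
Proof. exact: (@measurableT _ (Fil s)). Qed.

(** For positive [t] the slice at [t] is []0, t]] minus the union of the intervals ending at
    [t - 1 / n.+1]; at [t = 0] it is a generator. *)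
Lemma pred_start : pred ([set t] `*` setT).
Proof.
have [h0 hC hU] := smallest_sigma_algebra (`[0, T] `*` setT) ([set C | exists A, filt P S 0 A /\ C = [set 0] `*` A] `|`
      [set C | exists a b A, [/\ 0 <= a, a <= b <= T, filt P S a A & C = `]a, b] `*` A]]).
have hz : pred ([set 0] `*` setT). by apply: sub_sigma_algebra; left; exists setT; split => //; exact: filt_setT.
have hoc b : b <= T -> pred (`]0, b] `*` setT). move=> bT; case: (leP 0 b) => b0.
    by apply: sub_sigma_algebra; right; exists 0, b, setT; rewrite b0 bT; split => //; exact: filt_setT.
  by rewrite set_itv_ge ?set0X// bnd_simp -leNgt ltW.

case: (ltP 0 t) => tp; last first. by rewrite (_ : t = 0)//; apply/eqP; rewrite eq_le tp t0.
rewrite (_ : _ `*` _ = (`]0, t] `*` setT) `\` \bigcup_n (`]0, (t - n.+1%:R^-1)] `*` setT)). apply: sigma_diff; last 2 first.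
  - exact: hoc.
  - by apply: (hU) => n; apply: hoc; rewrite lerBlDr (le_trans tT)// lerDl.
  move=> z [/=]; rewrite !in_itv/= => /andP[h1 h2] _; split => //=. by rewrite (ltW h1) (le_trans h2).
apply/seteqP; split => -[s w] /=. move=> [-> _]; rewrite !in_itv/= tp lexx; split => //.
  move=> [n _ [/=]]; rewrite in_itv/= => /andP[_]; rewrite leNgt ltrBlDr ltrDl => /negP h _; exact: h.
rewrite in_itv/= => -[[/andP[s0 st] _] h]; split => //.
apply/eqP; rewrite eq_le st leNgt; apply/negP => ts; apply: h.
have d0 : 0 < t - s by rewrite subr_gt0.
have [n _ /(_ n (leqnn n)) /= hn] := near_infty_natSinv_lt (PosNum d0).
exists n; split => //=; rewrite in_itv/= s0 lerBrDr addrC -lerBrDr; exact: ltW.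
Qed.

Definition sec (w : Omega) (B : set (R * (Omega * Omega))) : set (R * Omega) :=
  [set z | t < z.1 <= T /\ B (z.1, (w, z.2))].

(** Measurable sets of times, pasts and futures whose section at each past, over times in []t, T]],
    is predictable. Demanding this for every past, and not almost every one, lets a frozen control
    be predictable without exceptions. *)
Definition predB : set (set (R * Z)) := [set B | @measurable _ (R * Z)%type B /\ forall w, pred (sec w B)].

Lemma predB_sigma : sigma_algebra setT predB.
Proof.
have [h0 hC hU] := smallest_sigma_algebra (`[0, T] `*` setT) ([set C | exists A, filt P S 0 A /\ C = [set 0] `*` A] `|`
      [set C | exists a b A, [/\ 0 <= a, a <= b <= T, filt P S a A & C = `]a, b] `*` A]]).
split.
- by split => // w; rewrite (_ : sec w set0 = set0)//; apply/seteqP; split =>  z [].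
- move=> A [mA hA]; split; first exact: measurableD. move=> w; rewrite (_ : sec w _ = (`]t, T] `*` setT) `\` sec w A).
    apply: sigma_diff; [|exact: pred_oc (lexx t) (lexx T) (@filt_setT t)|exact: hA].
    move=> z [/=]; rewrite !in_itv/= => /andP[h1 h2] _; split => //=. by rewrite h2 (le_trans t0 (ltW h1)).
  apply/seteqP; split => z; rewrite /sec /= in_itv/=. by move=> [h1 [_ h2]]; split => //; move=> [_].
  by move=> [[h1 _] h2]; split => //; split => // h3; apply: h2.
- move=> F hF; split; first by apply: bigcupT_measurable => n; have [] := hF n.
  move=> w; rewrite (_ : sec w _ = \bigcup_n sec w (F n)); first by apply: (hU) => n; exact: (hF n).2.
  apply/seteqP; split => z; first by move=> [h1 [n _ h2]]; exists n. by move=> [n _ [h1 h2]]; split => //; exists n.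
Qed.

Local Notation YB := (sigT_of predB).

Lemma YBE (B : set YB) : measurable B -> predB B.
Proof.
move=> mB; have : <<s predB >> B by exact: mB.
by rewrite (sigma_algebra_id predB_sigma).
Qed.

Lemma fut_le s (B : set (Fil t * Fut s)) : s <= T -> measurable B -> @measurable _ Z B.
Proof.
move=> sT mB.
have mi : mfun [set: Fut T] (id : Fut T -> Fut s). by move=> _ Y mY; rewrite setTI; exact: (future_mono sT mY).
have m : mfun [set: Z] (fun z : Z => ((z.1 : Fil t), (z.2 : Fut s))).
  by apply: measurable_fun_pair => //; exact: (mfun_comp mi measurable_snd).
have := m measurableT _ mB; rewrite setTI.
rewrite (_ : _ @^-1` B = B)//; by apply/seteqP; split => -[].
Qed.

(** For a generator that starts at or after [t] the event is split into past and future. If it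
    starts before [t], only its part after [t] matters and its event belongs to the past alone. Time
    [t] itself is excluded from the comparison. *)
Lemma lift_pred A : pred A -> exists B, @lifts R _ Omega P R _ _ YB
  [set s | t < s <= T] (fun s w => (s, w)) (fun s w => (s, (w, w))) A B.
Proof.
have sub B : predB B -> @measurable _ YB B by move=> h; exact: sub_sigma_algebra.
have mR (D : set R) (Q : set Z) : measurable D -> measurable Q -> measurable (D `*` Q) by exact: measurableX.
move: A; apply: lifts_sigma. exists (`]t, T] `*` setT); split. apply: sub; split; first exact: measurableX.
    move=> w; rewrite (_ : sec _ _ = `]t, T] `*` setT); first exact: (pred_oc (lexx t) (lexx T) (@filt_setT t)).
    by apply/seteqP; split => z; rewrite /sec /= in_itv/= => -[].
  apply: aeW => w s /= /andP[h1 h2]; rewrite !in_itv/= h1 h2; split => // _. by rewrite (le_trans t0 (ltW h1)).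
move=> A [[A' [fA' ->]]|[a [b [A' [a0 /andP[ab bT] fA' ->]]]]].
  exists set0; split => //; apply: aeW => w s /= /andP[h1 h2]; split => // -[h3 _]. by move: h1; rewrite h3 ltNge t0.
have aT := le_trans ab bT.
case: (leP t a) => ta. have [Q [mQ lQ]] := lift_filt t0 ta aT fA'. exists (`]a, b] `*` Q); split.
    apply: sub; split; first by apply: mR => //; exact: (fut_le aT mQ).
    move=> w; rewrite (_ : sec _ _ = `]a, b] `*` [set w2 | Q (w, w2)]).
      apply: pred_oc => //; apply: (future_filt t0 ta). have mp : mfun [set: Fut a] (fun v : Fut a => ((w : Fil t), v)).
        exact: measurable_fun_pair => //; exact: measurable_cst. by have := mp measurableT _ mQ; rewrite setTI.
    apply/seteqP; split => z; rewrite /sec /= in_itv/=; first by move=> [_ []].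
    move=> [/andP[h1 h2] h3]; split; last by split => //; rewrite h1. by rewrite (le_lt_trans ta h1) (le_trans h2).
  apply: filterS lQ => w h s _; by split => -[h1 h2]; split => //; exact/h.
have fA : filt P S t A' by apply: filt_mono fA'; exact: ltW.
exists (`]t, b] `*` (A' `*` setT)); split. apply: sub; split; first by apply: mR => //; exact: measurableX.
  move=> w; rewrite (_ : sec _ _ = `]t, b] `*` [set w2 | A' w]). apply: pred_oc => //; case: (pselect (A' w)) => h.
      by rewrite (_ : [set _ | _] = setT); [exact: filt_setT|apply/seteqP; split].
    by rewrite (_ : [set _ | _] = set0); [exact: (@measurable0 _ (Fil t))|apply/seteqP; split].
  apply/seteqP; split => z; rewrite /sec /= in_itv/=; first by move=> [_ [? []]].
  move=> [/andP[h1 h2] h3]; split; last by split => //; rewrite h1. by rewrite h1 (le_trans h2).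
apply: aeW => w s /= /andP[h1 h2]; rewrite !in_itv/= h1 (lt_trans ta h1) /=.
by split => [[]|[? []]].
Qed.

Lemma coord_borel m i (c : R) : borel [set x : 'cV[R]_m | x i ord0 < c].
Proof.
pose M := sigT_of (@open 'cV[R]_m).
have h := (@mx_measP R _ M m 1 (id : M -> 'cV[R]_m)).1 (fun Y bY => bY) i ord0.
by have := @meas_lt _ _ M _ _ h (measurable_cst c); exact.
Qed.

(* [u'] is [u] with the past and the future of time [t] made independent arguments. *)
Lemma lift_control m (U : set 'cV[R]_m) (u : R -> Omega -> 'cV[R]_m) :
  compact U -> predictable P S t u -> (forall s w, t <= s <= T -> U (u s w)) ->
  exists u' : R -> Z -> 'cV[R]_m,
  [/\ forall s z, U (u' s z),
      forall i, mfun [set: R * Z] (fun z => u' z.1 z.2 i ord0),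
      forall w, predictable P S t (fun s v => u' s (w, v)) &
      {ae P, forall w, forall s, t < s <= T -> u s w = u' s (w, w)}].
Proof.
move=> cU pu uU.
have lf i : exists f' : YB -> R, mfunT f' /\ {ae P, forall w, forall s, t < s <= T -> u s w i ord0 = f' (s, (w, w))}.
  have [c|f' [mf' hf']] := @lifts_fun R _ Omega P R _ _ YB [set s | t < s <= T] (fun s w => (s, w)) (fun s w => (s, (w, w)))
     [set z | t <= z.1 <= T] (fun z => u z.1 z.2 i ord0). apply: lift_pred; exact: (pu _ (coord_borel i c)).
  exists f'; split => //; apply: filterS hf' => w h s st; apply: h => //=. by case/andP: st => /ltW -> ->.
have [f hf] := choice lf.
pose v (y : YB) : 'cV[R]_m := \col_i f i y.
have mv Y : borel Y -> predB (v @^-1` Y). move=> bY; apply: YBE; move: Y bY; apply/mx_measP => i j.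
  rewrite (_ : (fun w => _) = f i); first by have [] := hf i. by apply/funext => y; rewrite mxE.
have clU : closed U by apply: compact_closed => //; exact: norm_hausdorff.
have bU : borel U by rewrite -[U]setCK; apply: (@measurableC _ (sigT_of (@open 'cV[R]_m))); apply: sub_sigma_algebra; exact: closed_openC.
pose u0 := u t point.
have Uu0 : U u0 by apply: uU; rewrite lexx.
pose B0 : set (R * Z) := [set y | t < y.1 <= T /\ U (v y)].
(* Outside [B0] a fixed element of [U] is taken, so that [u'] is [U]-valued everywhere; at time [t]
   it is constantly [u0], so the slice at [t] stays predictable. *)
pose u' (s : R) (z : Z) := if (s, z) \in B0 then v (s, z) else u0.
have ocE : [set s | t < s <= T] = `]t, T]%classic. by apply/seteqP; split => x /=; rewrite in_itv.
have hT : predB ([set s | t < s <= T] `*` setT). split; first by apply: measurableX => //; rewrite ocE.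
  move=> w; rewrite (_ : sec _ _ = `]t, T] `*` setT); first exact: (pred_oc (lexx t) (lexx T) (@filt_setT t)).
  by apply/seteqP; split => z; rewrite /sec /= in_itv/= => -[].
have mB0 : predB B0.

  apply: YBE; rewrite (_ : B0 = ([set s | t < s <= T] `*` setT) `&` (v @^-1` U)).
    by apply: measurableI; apply: sub_sigma_algebra => //; exact: mv. by apply/seteqP; split => y [h1 h2]; split; case: h1.
have mu' Y : borel Y -> @measurable _ YB [set y | Y (u' y.1 y.2)].
  move=> bY; rewrite (_ : [set y | _] = (B0 `&` (v @^-1` Y)) `|` (~` B0 `&` [set _ | Y u0])).
    apply: measurableU; apply: measurableI; first exact: sub_sigma_algebra.
    - by apply: sub_sigma_algebra; exact: mv.
    - by apply: measurableC; exact: sub_sigma_algebra.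
    - case: (pselect (Y u0)) => h; first by rewrite (_ : [set _ | _] = setT)//; apply/seteqP; split.
      by rewrite (_ : [set _ | _] = set0)//; apply/seteqP; split. apply/seteqP; split => -[s z] /=; rewrite /u'.
    by case: ifPn => [/set_mem h1 h2|/negP h1 h2]; [left|right; split => // h; apply: h1; exact/mem_set].
  by move=> [[h1 h2]|[h1 h2]]; [rewrite mem_set|rewrite memNset].
exists u'; split.
- by move=> s z; rewrite /u'; case: ifPn => // /set_mem[].
- move=> i. have := (@mx_measP R _ (R * Z)%type m 1 (fun z => u' z.1 z.2)).1 _ i ord0; apply.
  move=> Y bY; have h := YBE (mu' Y bY); case: h => h _; exact: h.
- move=> w Y bY; have [_ /(_ w) h] := YBE (mu' Y bY).
  rewrite (_ : [set z | _] = sec w [set y | Y (u' y.1 y.2)] `|` ([set t] `*` [set _ | Y u0])).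
    apply: sigma_union => //; case: (pselect (Y u0)) => h'.
      by rewrite (_ : [set _ : Omega | Y u0] = setT); [exact: pred_start|apply/seteqP; split].
    rewrite (_ : [set _ : Omega | Y u0] = set0); last by apply/seteqP; split.
    by rewrite setX0; have [] := smallest_sigma_algebra (`[0, T] `*` setT) ([set C | exists A, filt P S 0 A /\ C = [set 0] `*` A] `|`
      [set C | exists a b A, [/\ 0 <= a, a <= b <= T, filt P S a A & C = `]a, b] `*` A]]). have ut z : u' t z = u0.
    by rewrite /u' memNset// => -[/=]; rewrite ltxx. apply/seteqP; split => -[s z]; rewrite /sec /=.
    move=> [/andP[]]; rewrite le_eqVlt => /predU1P[<-|ts] sT h1; last by left; rewrite ts sT.
    by right; rewrite ut in h1. move=> [[/andP[/ltW h1 h2] h3]|[-> h3]]; first by rewrite h1 h2. by rewrite lexx tT ut.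
- have : {ae P, forall w, forall i s, t < s <= T -> u s w i ord0 = f i (s, (w, w))}.
    by apply: filter_forall => i; have [] := hf i. apply: filterS => w h s st.
  have vE : v (s, (w, w)) = u s w by apply/matrixP => i j; rewrite mxE (ord1 j) -h.
  rewrite /u' mem_set//; split => //=; rewrite vE; apply: uU. by case/andP: st => /ltW -> ->.
Qed.
End LiftPred.

(** * Lifting adapted cadlag paths *)

Section LiftPath.
Variable t : R.
Hypotheses (t0 : 0 <= t) (tT : t < T).
Local Notation Fut s := (sigT_of (futureG t s)).
Local Notation Z := (Fil t * Fut T)%type.
Local Notation K := (nat * nat)%type.
Local Notation pnt := (pnt t T).

Lemma meas_imp d (U : measurableType d) (Q : Prop) (A : set U) : measurable A ->
  measurable [set z | Q -> A z].
Proof.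
move=> mA; case: (pselect Q) => h. by rewrite (_ : [set z | _] = A)//; apply/seteqP; split => z; [apply|move=> ? _].
rewrite (_ : [set z | Q -> A z] = setT); first exact: measurableT.
by apply/seteqP; split => z //= _ /h.
Qed.

Lemma good_meas d (U : measurableType d) (g : K -> U -> R) : (forall k, mfunT (g k)) ->
  measurable [set z | good t T (fun k => g k z)].
Proof.
move=> mg.
have le e k k' : measurable [set z | `|g k z - g k' z| <= einv e :> R].
  by apply: meas_le; apply: mfun_comp => //; exact: mfunB.
rewrite (_ : [set z | _] = [set z | forall e, exists m, forall k1 k2 k3 : K, pnt k1 < pnt k2 -> pnt k2 < pnt k3 ->
        pnt k3 < pnt k1 + einv m -> `|g k2 z - g k1 z| <= einv e \/ `|g k3 z - g k2 z| <= einv e] `&`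
  ([set z | forall (k : K) (e : nat), pnt k < T -> exists m, forall k' : K, pnt k <= pnt k' ->
        pnt k' < pnt k + einv m -> `|g k' z - g k z| <= einv e] `&`
   [set z | forall k k' : K, pnt k = pnt k' -> g k z = g k' z])); last first.
  by apply/seteqP; split => z; [case|move=> [? []]].
apply: measurableI; last apply: measurableI.
- apply: meas_forall => e; apply: meas_exists => m. apply: (meas_forall (I := K)) => k1; apply: (meas_forall (I := K)) => k2.
  apply: (meas_forall (I := K)) => k3. do 3 apply: meas_imp; apply: measurableU; exact: le.
- apply: (meas_forall (I := K)) => k; apply: meas_forall => e; apply: meas_imp.
  apply: meas_exists => m; apply: (meas_forall (I := K)) => k'. by do 2 apply: meas_imp; exact: le.
- apply: (meas_forall (I := K)) => k; apply: (meas_forall (I := K)) => k'. by apply: meas_imp; exact: meas_eq.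
Qed.

Lemma fut_fm s (f : Fil t * Fut s -> R) w : t <= s -> mfunT f -> fm s (fun v => f (w, v)).
Proof.
move=> ts mf _ Y mY; rewrite setTI; apply: (future_filt t0 ts).
have mp : mfun [set: Fut s] (fun v : Fut s => ((w : Fil t), v)). exact: measurable_fun_pair => //; exact: measurable_cst.
by have := (mfun_comp mf mp) measurableT _ mY; rewrite setTI.
Qed.

(** Only the values at grid points are lifted, each with its own measurability; where they satisfy
    [good], right limits rebuild a cadlag path, elsewhere the path is set to 0. For a frozen past,
    measurability in the filtration is obtained at grid points only; other times are settled later
    with the help of the state equation. *)
Lemma lift_path1 (x : R -> Omega -> R) : (forall s, t <= s <= T -> fm s (x s)) ->
  (forall w, cadl t T (x^~ w)) ->
  exists x' : R -> Z -> R, [/\ forall z, cadl t T (x'^~ z),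
    forall s, t <= s <= T -> mfunT (x' s),
    {ae P, forall w, forall s, t <= s <= T -> x s w = x' s (w, w)} &
    {ae P, forall w, forall k, fm (pnt k) (fun v => x' (pnt k) (w, v))}].
Proof.
move=> fx cx; have tT' := ltW tT.
have pP k : t <= pnt k <= T := pntP tT k.
have lf k : exists g : Fil t * Fut (pnt k) -> R, mfunT g /\ {ae P, forall w, x (pnt k) w = g (w, w)}.
  by have /andP[h1 h2] := pP k; apply: (lift_fm t0 h1 h2); exact: fx.
pose g (k : K) : Z -> R := projT1 (cid (lf k)).
have gm k : mfun [set: Fil t * Fut (pnt k)] (g k : Fil t * Fut (pnt k) -> R). by have [] := projT2 (cid (lf k)).
have ge : {ae P, forall w, forall k, x (pnt k) w = g k (w, w)}.
  have : {ae P, forall w, forall m, if @unpickle K m is Some k then x (pnt k) w = g k (w, w) else True}.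
    apply/ae_foralln => m; case: (unpickle m) => [k|]; last exact: aeW. by have [] := projT2 (cid (lf k)).
  by apply: filterS => w h k; have := h (pickle k); rewrite pickleK.
have mg k : mfunT (g k). move=> _ Y mY; rewrite setTI; have /andP[h1 h2] := pP k.
  by apply: (fut_le h2); have := gm k measurableT _ mY; rewrite setTI.
pose G := [set z | good t T (fun k => g k z)].
have mG : measurable G := good_meas mg.
have Gd : {ae P, forall w, G (w, w)}.
  apply: filterS ge => w h; rewrite /G /= (_ : (fun k => _) = (x^~ w) \o pnt); first exact: cadl_good.
  by apply/funext => k /=; rewrite h.
(* [good] holds almost surely on the diagonal, hence by independence, for almost every past, at
   almost every future. *)
have G2 := indep_ae (past_id_meas tT') (future_id_meas t0 tT') (past_future_indep t0 tT') mG Gd.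
pose x' s (z : Z) : R := if z \in G then ext t T (fun k => g k z) s else 0.
have cadl0 : cadl t T (fun _ => 0 : R). by split => s _; [exact: cvg_cst|apply/cvg_ex; exists 0; exact: cvg_cst].
exists x'; split.
- move=> z; have [zG|/negbTE zG] := boolP (z \in G).
    rewrite (_ : x'^~ z = ext t T (g^~ z)); last by apply/funext => s; rewrite /x' zG.
    by apply: ext_cadl; move: zG => /set_mem.
  by rewrite (_ : x'^~ z = cst 0); [exact: cadl0|apply/funext => s; rewrite /x' zG].
- move=> s /andP[ts]; rewrite le_eqVlt => /predU1P[->|sT].
    rewrite (_ : x' T = (fun z => if z \in G then g (kT t T) z else cst 0 z)); first exact: meas_if_set.
    by apply/funext => z; rewrite /x' /ext ltxx.
  apply: (@measurable_fun_cvg _ _ _ _ (fun j z => if z \in G then g (near_idx t s j) z else cst 0 z)).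
    by move=> j; apply: meas_if_set. move=> z _; rewrite /x'; case: ifPn => [/set_mem zG|_]; last exact: cvg_cst.
  by apply: (ext_cvg zG); rewrite ts sT.
- apply: filterS2 ge Gd => w h gw s /andP[ts]; rewrite /x' mem_set// le_eqVlt => /predU1P[->|sT].
    by rewrite /ext ltxx -h pnt_kT. have sT' : t <= s < T by rewrite ts sT.
  have c1 := ext_cvg gw sT'; apply/esym; rewrite -(cvg_lim _ c1)//; apply/cvg_lim => //.
  rewrite (_ : (fun j => _) = (fun j => x (pnt (near_idx t s j)) w)); last by apply/funext => j; rewrite h.
  apply: (cvg_at_right_seq (s := s) (f := x^~ w)).
  + by have [rc _] := cx w; exact: rc.
  + by move=> j; have /andP[] := near_idxP j sT'.
  + exact: upg_cvg.
- apply: filterS G2 => w hw k; have /andP[h1 h2] := pP k.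
  apply: (fm_ae (fut_fm w h1 (gm k))); apply: filterS hw => v gv. by rewrite /x' mem_set// (ext_pnt tT gv).
Qed.

(** The value at [s] is a limit of values at grid points to the right of [s], eventually before
    [s']; this gives measurability at every later time. *)
Lemma fm_right (x : R -> Omega -> R) s s' : t <= s -> s < s' -> s' <= T ->
  (forall w, cadl t T (x^~ w)) -> (forall k, fm (pnt k) (x (pnt k))) -> fm s' (x s).
Proof.
move=> ts ss s'T cx fx.
have sT : t <= s < T by rewrite ts (lt_le_trans ss).
have d0 : 0 < s' - s by rewrite subr_gt0.
have [N _ hN'] := near_idx_near sT d0.
apply: (@measurable_fun_cvg _ (Fil s') R setT (fun j w => x (pnt (near_idx t s (j + N))) w)).
  move=> j; apply: fm_mono (fx _).
  have /andP[_ h] := hN' (j + N)%N (leq_addl _ _); rewrite (_ : s + (s' - s) = s') in h; [exact: ltW|ring].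
move=> w _; apply: (cvg_at_right_seq (s := s) (f := x^~ w)).
- by have [rc _] := cx w; exact: rc.
- by move=> j; have /andP[] := near_idxP (j + N) sT.
- have c := upg_cvg sT. exact: (cvg_comp (fun j => (j + N)%N) _ (cvg_addnr N) c).
Qed.

Lemma lift_path n (x : R -> Omega -> 'cV[R]_n) : adapted P S t x -> cadlag S t x ->
  exists x' : R -> Z -> 'cV[R]_n, [/\ forall z i, cadl t T (fun s => x' s z i ord0),
    forall s i, t <= s <= T -> mfunT (fun z => x' s z i ord0),
    {ae P, forall w, forall s, t <= s <= T -> x s w = x' s (w, w)} &
    {ae P, forall w, forall k i, fm (pnt k) (fun v => x' (pnt k) (w, v) i ord0)}].
Proof.
move=> /mx_adaptedP fx /cadlag_mxP cx.
have h i : exists x' : R -> Z -> R, [/\ forall z, cadl t T (x'^~ z), forall s, t <= s <= T -> mfunT (x' s),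
    {ae P, forall w, forall s, t <= s <= T -> x s w i ord0 = x' s (w, w)} &
    {ae P, forall w, forall k, fm (pnt k) (fun v => x' (pnt k) (w, v))}].
  by apply: lift_path1 => [s st|w]; [exact: fx|exact: cx].
exists (fun s z => \col_i projT1 (cid (h i)) s z); split.
- move=> z i; have [+ _ _ _] := projT2 (cid (h i)). by move=> /(_ z); congr cadl; apply/funext => s; rewrite mxE.
- move=> s i st; have [_ + _ _] := projT2 (cid (h i)). by move=> /(_ s st); congr mfun; apply/funext => z; rewrite mxE.
- have : {ae P, forall w, forall i s, t <= s <= T -> x s w i ord0 = projT1 (cid (h i)) s (w, w)}.
    by apply: filter_forall => i; have [] := projT2 (cid (h i)).
  by apply: filterS => w hw s st; apply/matrixP => i j; rewrite mxE (ord1 j) hw.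
- have : {ae P, forall w, forall i k, fm (pnt k) (fun v => projT1 (cid (h i)) (pnt k) (w, v))}.
    by apply: filter_forall => i; have [] := projT2 (cid (h i)).
  apply: (@filterS Omega _ (ae_filter_ringOfSetsType P)) => w hw k i.
  by have := hw i k; congr mfun; apply/funext => v; rewrite mxE.
Qed.
End LiftPath.

(** Predictable sets are progressive: a generator over []a, b]] with [a <= s] has its event in the
    sigma-algebra of time [s], and one with [a > s] does not meet [[0, s]]. *)
Lemma pred_prog s (B : set (R * Omega)) : 0 <= s -> predictable_sets P S B ->
  @measurable _ (R * Fil s)%type (`[0, s] `*` setT `&` B).
Proof.
move=> s0; have mD : @measurable _ (R * Fil s)%type (`[0, s] `*` setT) by exact: measurableX.
move: B; apply: smallest_sub. split => [|A mA|F mF].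
  - by rewrite setI0.
  - rewrite (_ : _ `&` _ = (`[0, s] `*` setT `&` `[0, T] `*` setT) `\` (`[0, s] `*` setT `&` A)); last first.
      apply/seteqP; split => z /=; first by move=> [h1 [h2 h3]]; split => // -[].
      by move=> [[h1 h2] h3]; split => //; split => // h4; exact: h3.
    apply: measurableD => //; apply: measurableI; exact: measurableX.
  - by rewrite setI_bigcupr; apply: bigcupT_measurable.
move=> B [[A [fA ->]]|[a [b [A [a0 /andP[ab bT] fA ->]]]]].
  apply: measurableI; apply: measurableX => //; exact: filt_mono fA.
case: (leP a s) => as_. by apply: measurableI; apply: measurableX => //; exact: filt_mono fA.
rewrite (_ : _ `&` _ = set0)//; apply/seteqP; split => // -[v w] /=; rewrite !in_itv /=.
by move=> [[/andP[_ h1] _] [/andP[h2 _] _]]; move: (lt_le_trans (lt_trans as_ h2) h1); rewrite ltxx.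
Qed.

Lemma pred_meas m t s (u : R -> Omega -> 'cV[R]_m) i : 0 <= t -> t <= s -> s <= T -> predictable P S t u ->
  mfun ((`[t, s] `*` setT) : set (R * Fil s)) (fun z => u z.1 z.2 i ord0).
Proof.
move=> t0 ts sT pu; apply: (measurability _ (RGenInftyO.measurableE R)) => _ [_ [c ->] <-].
have := pred_prog (le_trans t0 ts) (pu _ (coord_borel i c)).
move=> h; rewrite (_ : _ `&` _ = (`[t, s] `*` setT) `&` (`[0, s] `*` setT `&` [set z | t <= z.1 <= T /\ u z.1 z.2 i ord0 < c])).
  by apply: measurableI => //; exact: measurableX.
apply/seteqP; split => -[v w] /=; rewrite !in_itv /=.
  move=> [[/andP[h1 h2] _] h3]; rewrite h1 h2 (le_trans t0 h1) (le_trans h2 sT); do !split => //.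
by move=> [h1 [_ [_ h3]]].
Qed.

(** * Limits of martingales converging at a geometric rate *)

Section MartFast.
Variable t : R.
Hypotheses (t0 : 0 <= t) (tT : t <= T).

Lemma geo_cauchy (x : nat -> R) (c : R) : (forall j, `|x j.+1 - x j| <= c / 2 ^+ j) ->
  cvg (x @ \oo).
Proof.
move=> h; have c0 : 0 <= c by have := le_trans (normr_ge0 _) (h 0%N); rewrite expr0 divr1.
have key k j : `|x (j + k)%N - x j| <= 2 * c / 2 ^+ j. elim: k j => [|k IH] j.
    by rewrite addn0 subrr normr0 divr_ge0 ?mulr_ge0// exprn_ge0.
  have -> : x (j + k.+1)%N - x j = (x (j.+1 + k)%N - x j.+1) + (x j.+1 - x j). by rewrite addSnnS; ring.
  apply: le_trans (ler_normD _ _) _; apply: le_trans (lerD (IH _) (h j)) _.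
  rewrite exprS; have p : (2 : R) ^+ j != 0 by rewrite expf_neq0. by rewrite le_eqVlt; apply/orP; left; apply/eqP; field.
have g0 : (fun j => 2 * c / 2 ^+ j : R) @ \oo --> (0 : R). rewrite -(mulr0 (2 * c)); apply: cvgM; first exact: cvg_cst.
  rewrite (_ : (fun x => _) = GRing.exp (2^-1 : R)); last by apply/funext => j; rewrite exprVn.
  by apply: cvg_expr; rewrite ger0_norm// invf_lt1// ltr1n.
apply: osc_cvg => e e0; have /cvgrPdist_le /(_ (e / 2)) := g0.
move=> /(_ (divr_gt0 e0 (ltr0Sn _ 1)))[N _ /(_ N (leqnn N))].
rewrite sub0r normrN ger0_norm ?mulr_ge0// => hN'.
have tl k : (N <= k)%N -> `|x k - x N| <= e / 2. by move=> Nk; rewrite -(subnKC Nk); apply: le_trans (key _ _) hN'.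
exists [set k | (N <= k)%N]; first by exists N.
move=> i j /tl hi /tl hj; have -> : x i - x j = (x i - x N) - (x j - x N) by ring.
apply: le_trans (ler_normB _ _) _; lra.
Qed.

(** The rate at [T] holds at all earlier times by monotonicity of norms, and forces almost sure
    convergence at each time; the upper limit is a version measurable in the filtration. The
    constant 4 survives the recursion for the tails because [2 + 2 * 4 / 8] is below 4. *)
Lemma mart_fast (X : nat -> R -> Omega -> R) (C : R) : (forall j, mart t (X j)) ->
  (forall j, nrm P (fun w => X j.+1 T w - X j T w) <= C / 8 ^+ j) ->
  exists Y : R -> Omega -> R, forall s, t <= s <= T -> fm s (Y s) /\ forall j,
    L2 P (fun w => X j s w - Y s w) /\ nrm P (fun w => X j s w - Y s w) <= 4 * C / 8 ^+ j.
Proof.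
move=> mX hX.
have C0 : 0 <= C by have := le_trans (nrm_ge0 _ _) (hX 0%N); rewrite expr0 divr1.
pose Y s w := fine (limn_esup (fun j => (X j s w)%:E)).
exists Y => s st; case/andP: (st) => ts sT.
have fX j : fm s (X j s) by have [/(_ s st)[]] := mX j.
have LX j : L2 P (X j s) by have [/(_ s st)[]] := mX j.
have fY : fm s (Y s). have mf : mfun [set: \bar R] fine by [].
  apply: (mfun_comp mf); apply: (@measurable_fun_limn_esup _ (Fil s)) => j. by apply/measurable_EFinP; exact: fX.
have dX j : nrm P (fun w => X j.+1 s w - X j s w) <= C / 8 ^+ j.
  apply: le_trans (hX j); exact: (mart_nrm_le (martB (mX j.+1) (mX j)) ts sT (lexx T)).
have cauchy k j : nrm P (fun w => X j s w - X (j + k)%N s w) <= 4 * C / 8 ^+ j. elim: k j => [|k IH] j.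
    rewrite addn0 (_ : (fun w => _) = cst 0); last by apply/funext => w; rewrite subrr.
    by rewrite nrm0 divr_ge0 ?mulr_ge0// exprn_ge0. rewrite -addSnnS; apply: le_trans (nrm_tri (LX j) (LX j.+1) (LX _)) _.
  have h1 := IH j.+1; have h2 := dX j; rewrite (nrmBC P (X j.+1 s)) in h2.
  apply: le_trans (lerD (ler_wpM2l _ h2) (ler_wpM2l _ h1)) _ => //.
  rewrite exprS invfM; have : 0 <= C / 8 ^+ j by rewrite divr_ge0// exprn_ge0. by rewrite -!mulrA; set v := (8 ^+ j)^-1; lra.
have cv : {ae P, forall w, X j s w @[j --> \oo] --> Y s w}.
  have h1 : {ae P, forall w, exists c : R, forall j, (((X j.+1 s w - X j s w) ^+ 2)%:E <= (c / 4 ^+ j)%:E)%E}.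
    apply: (@fast_ae _ _ _ P _ C) => //.
    - by move=> j; apply/measurable_EFinP; apply: mfunX; apply: mfunB; exact: L2_meas (LX _).
    - by move=> j w; rewrite lee_fin sqr_ge0.
    - by move=> j; rewrite -nrmE; [rewrite -natrM; exact: dX|exact: L2B]. apply: filterS h1 => w [c hc].
  have cX : cvg (X j s w @[j --> \oo]). apply: (@geo_cauchy _ (Num.sqrt c)) => j.
    have := hc j; rewrite lee_fin -sqr_abs => h.
    have c0 : 0 <= c by have := hc 0%N; rewrite lee_fin expr0 divr1; apply: le_trans; exact: sqr_ge0.
    rewrite -(@ler_pXn2r _ 2) ?nnegrE//.
    by rewrite expr_div_n sqr_sqrtr// -exprM mulnC exprM (_ : 2 ^+ 2 = 4)// expr2 -natrM.
  have e1 : (X j s w)%:E @[j --> \oo] --> (lim (X j s w @[j --> \oo]))%:E. by apply: cvg_EFin; [exact: nearW|].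
  by rewrite /Y; have [_ ->] := cvg_limn_einf_sup e1.
split=> // j; apply: (@L2_fatou _ _ _ P (fun k w => X j s w - X (k + j)%N s w)).
- by move=> k; exact: L2B.
- by move=> k; rewrite addnC; exact: cauchy.
- by apply: mfunB; [exact: L2_meas (LX _)|exact: fm_meas hN _ _ sT fY].
- by apply: filterS cv => w hw; apply: cvgB (cvg_cst _) _; rewrite (cvg_shiftn j (fun k => X k s w)).
Qed.

Lemma enorm_int p (X : Omega -> 'cV[R]_p) : (forall i, L2 P (fun w => X w i ord0)) ->
  (\int[P]_w (enorm (X w) ^+ 2)%:E)%E = (\sum_i nrm P (fun w => X w i ord0))%:E.
Proof.
move=> LX; have [h1 h2] := @Ex_sum _ _ _ P _ (index_enum 'I_p) (fun i w => X w i ord0 ^+ 2) (fun i => L2_sqr (LX i)).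
rewrite -[in RHS]h2 ge0_ExE//; apply: eq_integral => w _; congr EFin.
by rewrite enormE; apply: eq_bigr => i _; rewrite big_ord1.
Qed.

Lemma mx_fast p (X : nat -> R -> Omega -> 'cV[R]_p) (C : R) : (forall j i, mart t (fun s w => X j s w i ord0)) ->
  (forall j i, nrm P (fun w => X j.+1 T w i ord0 - X j T w i ord0) <= C / 8 ^+ j) ->
  exists Y : R -> Omega -> 'cV[R]_p, [/\ adapted P S t Y,
    forall s, t <= s <= T -> (\int[P]_w (enorm (X j s w - Y s w) ^+ 2)%:E)%E @[j --> \oo] --> 0%E &
    forall s i j, t <= s <= T -> L2 P (fun w => X j s w i ord0 - Y s w i ord0) /\
      nrm P (fun w => X j s w i ord0 - Y s w i ord0) <= 4 * C / 8 ^+ j].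
Proof.
move=> mX hX; have h i := mart_fast (fun j => mX j i) (fun j => hX j i).
pose Y s w : 'cV[R]_p := \col_i projT1 (cid (h i)) s w.
have hY s i j : t <= s <= T -> L2 P (fun w => X j s w i ord0 - Y s w i ord0) /\
      nrm P (fun w => X j s w i ord0 - Y s w i ord0) <= 4 * C / 8 ^+ j.
  move=> st; have [_ /(_ j)] := projT2 (cid (h i)) s st.
  by rewrite (_ : (fun w => _) = (fun w => X j s w i ord0 - Y s w i ord0))//; apply/funext => w; rewrite mxE.
exists Y; split => //.
- apply/mx_adaptedP => s i j st; have [+ _] := projT2 (cid (h i)) s st. by congr mfun; apply/funext => w; rewrite mxE.
- move=> s st; apply/ereal_cvg0P => [k|e e0]; first by apply: integral_ge0 => w _; rewrite lee_fin sqr_ge0.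
  have g0 : (fun j => (p%:R * (4 * C)) / 8 ^+ j : R) @ \oo --> (0 : R).
    rewrite -(mulr0 (p%:R * (4 * C))); apply: cvgM; first exact: cvg_cst.
    rewrite (_ : (fun x => _) = GRing.exp (8^-1 : R)); last by apply/funext => j; rewrite exprVn.
    by apply: cvg_expr; rewrite ger0_norm// invf_lt1// ltr1n.
  have /cvgrPdist_lt /(_ e e0)[N _ hN'] := g0; exists N => k Nk. have LL i : L2 P (fun w => (X k s w - Y s w) i ord0).
    by have [+ _] := hY s i k st; congr L2; apply/funext => w; rewrite !mxE. rewrite enorm_int// lte_fin.
  have := hN' k Nk; rewrite /= sub0r normrN => /(le_lt_trans (ler_norm _)); apply: le_lt_trans.
  have -> : p%:R * (4 * C) / 8 ^+ k = \sum_(i < p) (4 * C / 8 ^+ k).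
    by rewrite sumr_const card_ord -(mulr_natl (4 * C / _)) !mulrA.
  apply: ler_sum => i _; have [_] := hY s i k st; congr (_ <= _); congr nrm. by apply/funext => w; rewrite !mxE.
Qed.
End MartFast.

(** * Freezing the past in simple integrands *)

Section Freeze.
Variable t : R.
Hypotheses (t0 : 0 <= t) (tT : t < T).
Local Notation Fut s := (sigT_of (futureG t s)).
Local Notation Z := (Fil t * Fut T)%type.

Lemma fut_incB i a b : t <= a <= T -> t <= b <= T -> mfun [set: Fut T] (incB i a b : Fut T -> R).
Proof.
move=> ta tb; rewrite (_ : incB i a b = (fun w => incB i t b w - incB i t a w)); last first.
  by apply/funext => w; rewrite /incB; ring.
have h v : t <= v <= T -> mfun [set: Fut T] (incB i t v : Fut T -> R).
  by move=> tv _ Y mY; rewrite setTI; apply: sub_sigma_algebra; left; left; exists i, v, Y.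
by apply: mfunB; exact: h.
Qed.

Lemma fut_comp A a b : measurable A -> A `<=` E -> t <= a -> a <= b -> b <= T ->
  mfun [set: Fut T] ((fun w => compensated S w A a b) : Fut T -> R).
Proof.
move=> mA AE ta ab bT.
have h : mfun [set: Fut T] ((fun w => prm S w (A `*` `]a, b])) : Fut T -> \bar R).
  move=> _ Y mY; rewrite setTI; apply: sub_sigma_algebra; left; right.
  exists (A `*` `]a, b]), Y; split => //; first exact: measurableX.
  move=> [e v] /= [/AE Ee]; rewrite !in_itv /= => /andP[v1 v2]; split => //. by rewrite (le_lt_trans ta v1) (le_trans v2 bT).
have mf : mfun [set: \bar R] fine by [].
by apply: mfunB => //; exact: (mfun_comp mf h).
Qed.

Lemma sec_meas (w : Omega) : mfun [set: Omega] ((fun v => (w, v)) : Omega -> Z).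
Proof. apply: measurable_fun_pair => //; exact: (future_id_meas t0 (ltW tT)). Qed.

Lemma snd_meas (X : Omega -> R) : mfun [set: Fut T] (X : Fut T -> R) -> mfun [set: Z] (fun z => X z.2).
Proof. by move=> mX; apply: (mfun_comp mX); exact: measurable_snd. Qed.

Lemma diag_int (phi : Z -> \bar R) : mfunT phi -> (forall z, 0 <= phi z)%E ->
  (\int[P]_w phi (w, w) = \int[P]_w \int[P]_v phi (w, v))%E.
Proof.
exact: (indep_tonelli (past_id_meas (ltW tT)) (future_id_meas t0 (ltW tT)) (past_future_indep t0 (ltW tT))).
Qed.

Lemma sec_int_meas (phi : Z -> \bar R) : mfunT phi -> (forall z, 0 <= phi z)%E ->
  mfun [set: Omega] (fun w => \int[P]_v phi (w, v))%E.
Proof.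
move=> mp p0; have h := measurable_Ex_snd _ (future_id_meas t0 (ltW tT)) mp p0.
exact: (mfun_comp (h P) (past_id_meas (ltW tT))).
Qed.

Lemma freeze_fast (G : nat -> Z -> \bar R) (c : R) : 0 <= c -> (forall j, mfunT (G j)) ->
  (forall j z, 0 <= G j z)%E -> (forall j, \int[P]_w G j (w, w) <= (c / 16 ^+ j)%:E)%E ->
  {ae P, forall w : Omega, exists c : R, forall j, (\int[P]_v G j (w, v) <= (c / 8 ^+ j)%:E)%E}.
Proof.
move=> c0 mG G0 h; apply: (@fast_ae _ _ _ P _ c) => //.
- by move=> j; exact: sec_int_meas.
- by move=> j w; exact: integral_ge0.
- by move=> j; rewrite -diag_int// -natrM.
Qed.

Lemma lift_coef p k lo (c : Omega -> 'M[R]_(p, k)) : t <= lo <= T ->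
  (forall Y, borel Y -> filt P S lo (c @^-1` Y)) -> (exists K, forall w, enorm (c w) <= K) ->
  exists h : Z -> 'M[R]_(p, k), [/\ forall i j, mfunT (fun z => h z i j),
    forall w Y, borel Y -> filt P S lo ((fun v => h (w, v)) @^-1` Y),
    exists K, forall z, enorm (h z) <= K & {ae P, forall w : Omega, c w = h (w, w)}].
Proof.
move=> /andP[tlo loT] /(mx_measP (T := Fil lo)) fc [K hK].
have l i j := lift_fm t0 tlo loT (fc i j).
pose g i j : Fil t * Fut lo -> R := projT1 (cid (l i j)).
have mg i j : mfunT (g i j) by have [] := projT2 (cid (l i j)).
have eg : {ae P, forall w, forall i j, c w i j = g i j (w, w)}.
  by apply: filter_forall => i; apply: filter_forall => j; have [] := projT2 (cid (l i j)).
(* The lifted coefficient obeys the bound only on the diagonal, almost surely. Clipping restores it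
   for every pair of past and future and changes nothing on the diagonal. *)
pose clip (y : R) := Num.max (- `|K|) (Num.min y `|K|).
have mclip d (U : measurableType d) (f : U -> R) : mfunT f -> mfunT (fun z => clip (f z)).
  by move=> mf; apply: measurable_maxr => //; exact: measurable_minr.
exists (fun z => \matrix_(i, j) clip (g i j z)); split.
- move=> i j; rewrite (_ : (fun z => _) = (fun z : Z => clip (g i j z))); last by apply/funext => z; rewrite mxE.
  by move=> _ Y mY; rewrite setTI; apply: (fut_le loT); have := mclip _ _ _ (mg i j) measurableT _ mY; rewrite setTI.
- move=> w; apply/(mx_measP (T := Fil lo)) => i j.
  rewrite (_ : (fun v => _) = (fun v => clip (g i j (w, v)))); last by apply/funext => v; rewrite mxE.
  by apply: (fut_fm t0 w tlo (f := fun z => clip (g i j z))); exact: mclip.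
- eexists => z; apply: (enorm_bounded (k := `|K|)) => i j; rewrite mxE /clip ler_norml.
  by rewrite le_max lexx ge_max ge_min lexx orbT andbT /= (le_trans (_ : _ <= 0))// oppr_le0.
- apply: filterS eg => w h; apply/matrixP => i j; rewrite mxE -h /clip.
  have : `|c w i j| <= `|K| by apply: le_trans (coord_le_enorm _ _ _) (le_trans (hK w) (ler_norm _)).
  by rewrite ler_norml => /andP[h1 h2]; rewrite min_l// max_r.
Qed.

Definition bs_at p (H : bsimple (R := R) (Omega := Omega) r p) (h : 'I_(bs_len H) -> Z -> 'M[R]_(p, r)) (w : Omega) :
  bsimple (R := R) (Omega := Omega) r p := BSimple (@bs_lo _ _ _ _ _ H) (@bs_hi _ _ _ _ _ H) (fun i (v : Omega) => h i (w, v)).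

Lemma bs_lift p (H : bsimple r p) : bs_ok P S t H ->
  exists h : 'I_(bs_len H) -> Z -> 'M[R]_(p, r), [/\ forall l i j, mfunT (fun z => h l z i j),
    forall w, bs_ok P S t (bs_at h w) & {ae P, forall w, forall l, @bs_coef _ _ _ _ _ H l w = h l (w, w)}].
Proof.
move=> ok.
have l i : exists h : Z -> 'M[R]_(p, r), [/\ forall k j, mfunT (fun z => h z k j),
    forall w Y, borel Y -> filt P S (bs_lo i) ((fun v => h (w, v)) @^-1` Y),
    exists K, forall z, enorm (h z) <= K & {ae P, forall w : Omega, @bs_coef _ _ _ _ _ H i w = h (w, w)}].
  have [h1 /andP[h2 h3] h4 h5] := ok i; apply: lift_coef h4 h5. by rewrite h1 (le_trans h2).
have [h hh] := choice l; exists h; split.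
- by move=> i; have [] := hh i.
- move=> w i; have [h1 h2 _ _] := ok i; have [_ h3 [K hK] _] := hh i; split => //=; first exact: h3.
  by exists K => v; exact: hK.
- by apply: filter_forall => i; have [] := hh i.
Qed.

Definition ps_at p (H : psimple (R := R) (Omega := Omega) q p) (h : 'I_(ps_len H) -> Z -> 'cV[R]_p) (w : Omega) :
  psimple (R := R) (Omega := Omega) q p := PSimple (@ps_lo _ _ _ _ _ H) (@ps_hi _ _ _ _ _ H) (@ps_set _ _ _ _ _ H) (fun i (v : Omega) => h i (w, v)).

Lemma ps_lift p (H : psimple q p) : ps_ok P S t H ->
  exists h : 'I_(ps_len H) -> Z -> 'cV[R]_p, [/\ forall l i j, mfunT (fun z => h l z i j),
    forall w, ps_ok P S t (ps_at h w) & {ae P, forall w, forall l, @ps_coef _ _ _ _ _ H l w = h l (w, w)}].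
Proof.
move=> ok.
have l i : exists h : Z -> 'cV[R]_p, [/\ forall k j, mfunT (fun z => h z k j),
    forall w Y, borel Y -> filt P S (ps_lo i) ((fun v => h (w, v)) @^-1` Y),
    exists K, forall z, enorm (h z) <= K & {ae P, forall w : Omega, @ps_coef _ _ _ _ _ H i w = h (w, w)}].
  have [h1 /andP[h2 h3] _ h4 h5] := ok i; apply: lift_coef h4 h5. by rewrite h1 (le_trans h2).
have [h hh] := choice l; exists h; split.
- by move=> i; have [] := hh i.
- move=> w i; have [h1 h2 h6 _ _] := ok i; have [_ h3 [K hK] _] := hh i; split => //=; first exact: h3.
  by exists K => v; exact: hK.
- by apply: filter_forall => i; have [] := hh i.
Qed.

Lemma bs_at_meas p (H : bsimple r p) (h : 'I_(bs_len H) -> Z -> 'M[R]_(p, r)) s i : bs_ok P S t H ->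
  (forall l i j, mfunT (fun z => h l z i j)) -> t <= s <= T ->
  mfun [set: Z] (fun z => bs_int S (bs_at h z.1) s z.2 i ord0).
Proof.
move=> ok mh /andP[ts sT].
have -> : (fun z => bs_int S (bs_at h z.1) s z.2 i ord0) = (fun z => \sum_l \sum_j h l z i j *
     incB j (Num.min (bs_lo l) s) (Num.min (bs_hi l) s) z.2). by apply/funext => -[w v]; rewrite bsE.
apply: measurable_sum => l; apply: measurable_sum => j; have [h1 /andP[h2 h3] _ _] := ok l.
apply: mfunM => //; apply: (snd_meas (X := incB j _ _)); apply: fut_incB. by rewrite le_min h1 ts ge_min sT orbT.
by rewrite le_min (le_trans h1 h2) ts ge_min sT orbT.
Qed.

Lemma ps_at_meas p (H : psimple q p) (h : 'I_(ps_len H) -> Z -> 'cV[R]_p) s i : ps_ok P S t H ->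
  (forall l i j, mfunT (fun z => h l z i j)) -> t <= s <= T ->
  mfun [set: Z] (fun z => ps_int S (ps_at h z.1) s z.2 i ord0).
Proof.
move=> ok mh /andP[ts sT].
have -> : (fun z => ps_int S (ps_at h z.1) s z.2 i ord0) = (fun z => \sum_l h l z i ord0 *
     compensated S z.2 (@ps_set _ _ _ _ _ H l) (Num.min (ps_lo l) s) (Num.min (ps_hi l) s)).
  by apply/funext => -[w v]; rewrite psE.
apply: measurable_sum => l; have [h1 /andP[h2 h3] [mA AE] _ _] := ok l.
apply: mfunM => //; apply: (snd_meas (X := fun v => compensated S v _ _ _)); apply: fut_comp => //.
- by rewrite le_min h1.
- by rewrite le_min2.
- by rewrite ge_min sT orbT.
Qed.
End Freeze.

(** * Freezing the past in stochastic integrals *)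

Section FreezeInt.
Variable t : R.
Hypotheses (t0 : 0 <= t) (tT : t < T).
Local Notation Fut s := (sigT_of (futureG t s)).
Local Notation Z := (Fil t * Fut T)%type.

Lemma coord_nrm p (X Y : Omega -> 'cV[R]_p) i (c : R) : L2 P (fun w => X w i ord0 - Y w i ord0) ->
  (\int[P]_w (enorm (X w - Y w) ^+ 2)%:E <= c%:E)%E -> nrm P (fun w => X w i ord0 - Y w i ord0) <= c.
Proof.
move=> L h; rewrite -lee_fin nrmE//; apply: le_trans h; apply: le_ge0_integral => w _; rewrite lee_fin ?sqr_ge0//.
by apply: le_trans (coord_le_enorm2 _ i ord0); rewrite !mxE.
Qed.

Lemma lt16 j : (0 : R) < 1 / 16 ^+ j. Proof. by rewrite divr_gt0// exprn_gt0. Qed.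

(** A subsequence is chosen for the integrands and for the integrals at [T] only; the difference of
    two martingales has its largest norm at [T], so earlier times inherit the rate. *)
Lemma bint_fast p Phi (I : R -> Omega -> 'cV[R]_p) : is_bint P S t Phi I -> exists H : nat -> bsimple r p,
  [/\ forall j, bs_ok P S t (H j),
      forall j, (\int[P]_w \int[leb]_(s in `[t, T]) (enorm (bs_val (H j) s w - Phi s w) ^+ 2)%:E <= (1 / 16 ^+ j)%:E)%E &
      forall s i j, t <= s <= T -> L2 P (fun w => bs_int S (H j) s w i ord0 - I s w i ord0) /\
        nrm P (fun w => bs_int S (H j) s w i ord0 - I s w i ord0) <= 1 / 16 ^+ j].
Proof.
move=> hI; have TT : t <= T <= T by rewrite (ltW tT) lexx.
have mI i := bint_mart i t0 (ltW tT) hI.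
have [_ [H [ok h1 /(_ T TT) h2]]] := hI.
have g j : exists k, (\int[P]_w \int[leb]_(s in `[t, T]) (enorm (bs_val (H k) s w - Phi s w) ^+ 2)%:E <= (1 / 16 ^+ j)%:E)%E /\
    (\int[P]_w (enorm (bs_int S (H k) T w - I T w) ^+ 2)%:E <= (1 / 16 ^+ j)%:E)%E.
  move/ereal_cvg0P : h1 => /(_ _ _ (lt16 j))[|N1 hN1]. by move=> k; do 2 apply: integral_ge0 => ? _; rewrite lee_fin sqr_ge0.
  move/ereal_cvg0P : h2 => /(_ _ _ (lt16 j))[|N2 hN2]. by move=> k; apply: integral_ge0 => ? _; rewrite lee_fin sqr_ge0.
  by exists (maxn N1 N2); split; apply: ltW; [apply: hN1|apply: hN2]; rewrite ?leq_maxl ?leq_maxr.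
have [k hk] := choice g; exists (H \o k); split => [j|j|s i j st] /=; [exact: ok|by have [] := hk j|].
have mD := martB (bs_mart i t0 (ok (k j))) (mI i).
split; first by have [/(_ s st)[]] := mD.
case/andP: (st) => s1 s2; apply: le_trans (mart_nrm_le mD s1 s2 (lexx T)) _.
by apply: coord_nrm; [have [/(_ T TT)[]] := mD|have [] := hk j].
Qed.

Lemma pint_fast p Phi (I : R -> Omega -> 'cV[R]_p) : is_pint P S t Phi I -> exists H : nat -> psimple q p,
  [/\ forall j, ps_ok P S t (H j),
      forall j, (\int[P]_w \int[leb]_(s in `[t, T]) \int[levy S]_(e in E)
        (enorm (ps_val (H j) s e w - Phi s e w) ^+ 2)%:E <= (1 / 16 ^+ j)%:E)%E &
      forall s i j, t <= s <= T -> L2 P (fun w => ps_int S (H j) s w i ord0 - I s w i ord0) /\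
        nrm P (fun w => ps_int S (H j) s w i ord0 - I s w i ord0) <= 1 / 16 ^+ j].
Proof.
move=> hI; have TT : t <= T <= T by rewrite (ltW tT) lexx.
have mI i := pint_mart i t0 (ltW tT) hI.
have [_ [H [ok h1 /(_ T TT) h2]]] := hI.
have g j : exists k, (\int[P]_w \int[leb]_(s in `[t, T]) \int[levy S]_(e in E)
      (enorm (ps_val (H k) s e w - Phi s e w) ^+ 2)%:E <= (1 / 16 ^+ j)%:E)%E /\
    (\int[P]_w (enorm (ps_int S (H k) T w - I T w) ^+ 2)%:E <= (1 / 16 ^+ j)%:E)%E.
  move/ereal_cvg0P : h1 => /(_ _ _ (lt16 j))[|N1 hN1]. by move=> k; do 3 apply: integral_ge0 => ? _; rewrite lee_fin sqr_ge0.
  move/ereal_cvg0P : h2 => /(_ _ _ (lt16 j))[|N2 hN2]. by move=> k; apply: integral_ge0 => ? _; rewrite lee_fin sqr_ge0.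
  by exists (maxn N1 N2); split; apply: ltW; [apply: hN1|apply: hN2]; rewrite ?leq_maxl ?leq_maxr.
have [k hk] := choice g; exists (H \o k); split => [j|j|s i j st] /=; [exact: ok|by have [] := hk j|].
have mD := martB (ps_mart i t0 (ok (k j))) (mI i).
split; first by have [/(_ s st)[]] := mD.
case/andP: (st) => s1 s2; apply: le_trans (mart_nrm_le mD s1 s2 (lexx T)) _.
by apply: coord_nrm; [have [/(_ T TT)[]] := mD|have [] := hk j].
Qed.

Lemma diag_meas : mfun [set: Omega] ((fun w => (w, w)) : Omega -> Z).
Proof.
apply: measurable_fun_pair; [exact: (past_id_meas (ltW tT))|exact: (future_id_meas t0 (ltW tT))].
Qed.

(* The increments of the frozen integrals decay fast for almost every past, hence these converge. *)
Lemma frozen_limit p (B : nat -> R -> Z -> 'cV[R]_p) (I : R -> Omega -> 'cV[R]_p) :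
  (forall j s i, t <= s <= T -> mfunT (fun z => B j s z i ord0)) ->
  (forall j w i, mart t (fun s v => B j s (w, v) i ord0)) ->
  (forall s i j, t <= s <= T -> L2 P (fun w => B j s (w, w) i ord0 - I s w i ord0) /\
        nrm P (fun w => B j s (w, w) i ord0 - I s w i ord0) <= 1 / 16 ^+ j) ->
  {ae P, forall w : Omega, exists (Y : R -> Omega -> 'cV[R]_p) (c : R), [/\ adapted P S t Y,
    forall s, t <= s <= T -> (\int[P]_v (enorm (B j s (w, v) - Y s v) ^+ 2)%:E)%E @[j --> \oo] --> 0%E &
    forall s i j, t <= s <= T -> L2 P (fun v => B j s (w, v) i ord0 - Y s v i ord0) /\
      nrm P (fun v => B j s (w, v) i ord0 - Y s v i ord0) <= c / 8 ^+ j]}.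
Proof.
move=> mB maB hB; have TT : t <= T <= T by rewrite (ltW tT) lexx.
pose G i j (z : Z) := ((B j.+1 T z i ord0 - B j T z i ord0) ^+ 2)%:E.
have mG i j : mfunT (G i j). by apply/measurable_EFinP; apply: mfunX; apply: mfunB; exact: mB.
have h i : {ae P, forall w : Omega, exists c : R, forall j, (\int[P]_v G i j (w, v) <= (c / 8 ^+ j)%:E)%E}.
  apply: (freeze_fast t0 tT (c := 4)) => // [j z|j]; first by rewrite lee_fin sqr_ge0.
  have [L1 n1] := hB T i j TT; have [L2' n2] := hB T i j.+1 TT.
  have e : (fun w => B j.+1 T (w, w) i ord0 - B j T (w, w) i ord0) =
    (fun w => (B j.+1 T (w, w) i ord0 - I T w i ord0) - (B j T (w, w) i ord0 - I T w i ord0)).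
    by apply/funext => w; ring. have LD := L2B L2' L1; rewrite -e in LD; rewrite /G -nrmE// lee_fin e.
  apply: le_trans (nrmB_le L2' L1) _; have := lt16 j; move: n1 n2; rewrite exprS invfM.
  have -> : 4 / 16 ^+ j = 4 * (1 / 16 ^+ j) :> R by ring.
  have -> : 1 * (16^-1 / 16 ^+ j) = 16^-1 * (1 / 16 ^+ j) :> R by ring.
  set v := 1 / _; set a := nrm P _; set b := nrm P _; clear; lra.
have {}h : {ae P, forall w : Omega, forall i, exists c : R, forall j, (\int[P]_v G i j (w, v) <= (c / 8 ^+ j)%:E)%E}.
  exact: filter_forall.
apply: filterS h => w hw; have [c hc] := choice hw.
have [i j|Y [h1 h2 h3]] := mx_fast (X := fun j s v => B j s (w, v)) (C := \sum_i `|c i|) (fun j => maB j w).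
  have L : L2 P (fun v => B i.+1 T (w, v) j ord0 - B i T (w, v) j ord0).
    by apply: L2B; [have [/(_ T TT)[]] := maB i.+1 w j|have [/(_ T TT)[]] := maB i w j].
  rewrite -lee_fin nrmE//; apply: le_trans (hc j i) _; rewrite lee_fin ler_pM2r//.
  by apply: le_trans (ler_norm _) _; rewrite (bigD1 j)//= lerDl sumr_ge0.
by exists Y, (4 * \sum_i `|c i|).
Qed.

Lemma conv_fast (G : nat -> Z -> \bar R) : (forall j, mfunT (G j)) ->
  (forall j z, 0 <= G j z)%E -> (forall j, \int[P]_w G j (w, w) <= (1 / 16 ^+ j)%:E)%E ->
  {ae P, forall w : Omega, (\int[P]_v G j (w, v))%E @[j --> \oo] --> 0%E}.
Proof.
move=> mG G0 h; have := freeze_fast t0 tT ler01 mG G0 h.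
apply: filterS => w [c hc]; apply: ereal_geo0 hc => j; exact: integral_ge0.
Qed.

(** The common outcome for both kinds of integrals. [B j] are lifted simple integrals; [F w] says of
    which frozen integrand the limit is the integral. Rates are kept both on the diagonal and at
    almost every past, so that the state equation can be compared on both sides. *)
Definition frozen_int p (I : R -> Omega -> 'cV[R]_p) (B : nat -> R -> Z -> 'cV[R]_p)
   (F : forall w : Omega, (R -> Omega -> 'cV[R]_p) -> Prop) :=
  [/\ forall j s i, t <= s <= T -> mfunT (fun z => B j s z i ord0),
    forall s i j, t <= s <= T -> L2 P (fun w => B j s (w, w) i ord0 - I s w i ord0) /\
        nrm P (fun w => B j s (w, w) i ord0 - I s w i ord0) <= 1 / 16 ^+ j &
    {ae P, forall w : Omega, exists (Y : R -> Omega -> 'cV[R]_p) (c : R), F w Y /\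
      forall s i j, t <= s <= T -> L2 P (fun v => B j s (w, v) i ord0 - Y s v i ord0) /\
      nrm P (fun v => B j s (w, v) i ord0 - Y s v i ord0) <= c / 8 ^+ j}].

(** On the diagonal the lifted simple integrands have the error of the original ones, so at almost
    every past they still approximate [Phi'] in L2. Agreement of [Phi] and [Phi'] is asked only
    after [t], where the lifted control is faithful; the single time [t] does not affect the
    integrals. *)
Lemma freeze_bint p Phi (I : R -> Omega -> 'cV[R]_p) (Phi' : R -> Z -> 'M[R]_(p, r)) :
  is_bint P S t Phi I ->
  (forall i j, mfun ((`]t, T] `*` setT) : set (R * Z)) (fun z => Phi' z.1 z.2 i j)) ->
  {ae P, forall w : Omega, forall s, t < s <= T -> Phi s w = Phi' s (w, w)} ->
  exists B, frozen_int I B (fun w Y => is_bint P S t (fun s v => Phi' s (w, v)) Y).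
Proof.
move=> hI mPhi ePhi; have [H [ok h1 h2]] := bint_fast hI.
pose h j := projT1 (cid (bs_lift t0 (ok j))); have hh j := projT2 (cid (bs_lift t0 (ok j))).
have mh j l a b : mfunT (fun z => h j l z a b) by have [h3 _ _] := hh j; exact: h3.
have okh j w : bs_ok P S t (bs_at (h j) w) by have [_ h3 _] := hh j; exact: h3.
have eh : {ae P, forall w : Omega, forall j l, @bs_coef _ _ _ _ _ (H j) l w = h j l (w, w)}.
  by apply/ae_foralln => j; have [_ _ h3] := hh j; exact: h3.
pose B j s (z : Z) := bs_int S (bs_at (h j) z.1) s z.2.
have mB j s i : t <= s <= T -> mfunT (fun z => B j s z i ord0). by move=> st; apply: bs_at_meas.
have maB j w i : mart t (fun s v => B j s (w, v) i ord0) by exact: (bs_mart i t0 (okh j w)).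
have eB : {ae P, forall w : Omega, forall j s i, bs_int S (H j) s w i ord0 = B j s (w, w) i ord0}.
  apply: filterS eh => w hw j s i; rewrite /B !bsE; apply: eq_bigr => l _; apply: eq_bigr => k _ /=. by rewrite hw.
have dB s i j : t <= s <= T -> L2 P (fun w => B j s (w, w) i ord0 - I s w i ord0) /\
    nrm P (fun w => B j s (w, w) i ord0 - I s w i ord0) <= 1 / 16 ^+ j. move=> st; have [L n] := h2 s i j st.
  have mD : mfun [set: Omega] (fun w => B j s (w, w) i ord0 - I s w i ord0).
    apply: mfunB; first exact: (mfun_comp (mB j s i st) diag_meas). by have [/(_ s st)[_ []]] := bint_mart i t0 (ltW tT) hI.
  have e : {ae P, forall w : Omega, B j s (w, w) i ord0 - I s w i ord0 = bs_int S (H j) s w i ord0 - I s w i ord0}.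
    by apply: filterS eB => w ->. by split; [exact: L2_ae mD L e|rewrite (nrm_ae mD (L2_meas L) e)].
pose F j (z : R * Z) := (enorm (bs_val (bs_at (h j) z.2.1) z.1 z.2.2 - Phi' z.1 z.2) ^+ 2)%:E.
have mF j : mfun (`]t, T] `*` setT) (F j). apply/measurable_EFinP; apply: meas_enorm2W; first exact: measurableX.
  move=> a b; rewrite (_ : (fun z => _) = (fun z : R * Z => \sum_l (if bs_lo l < z.1 <= bs_hi l then h j l z.2 a b else 0) - Phi' z.1 z.2 a b)).
    apply: mfunB => //; apply: mfunTS; apply: measurable_sum => l. exact: (@step_meas _ _ Z _ _ (fun z => h j l z a b)).
  apply/funext => -[s [w v]]; rewrite !mxE summxE big_mkcond; congr (_ - _); exact: eq_bigr => l _.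
have F0 j z : (0 <= F j z)%E by rewrite lee_fin sqr_ge0.
pose G j (z : Z) : \bar R := (\int[leb]_(s in `]t, T]) F j (s, z))%E.
have mG j : mfun [set: Z] (G j). refine (@meas_int_fst _ _ _ _ _ leb [set` `]t, T]] [set: Z] (F j) _ _ (mF j) _) => //.
have G0 j z : (0 <= G j z)%E by apply: integral_ge0.
have dG j : (\int[P]_w G j (w, w) <= (1 / 16 ^+ j)%:E)%E. apply: le_trans (h1 j); apply: le_ge0_integral_ae => //.
  - exact: (mfun_comp (mG j) diag_meas).
  - by move=> w; apply: integral_ge0 => s _; rewrite lee_fin sqr_ge0.
  - apply: filterS2 ePhi eh => w e1 e2.
    apply: le_trans (_ : _ <= \int[leb]_(s in `]t, T]) (enorm (bs_val (H j) s w - Phi s w) ^+ 2)%:E)%E _; last first.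
      apply: le_ge0_integral_sub; last by move=> s; rewrite lee_fin sqr_ge0.
      by move=> s /=; rewrite !in_itv /= => /andP[/ltW -> ->].
    apply: le_ge0_integral => // s; rewrite /= in_itv /= => st; rewrite /F /= e1// lee_fin.
    rewrite le_eqVlt; apply/orP; left; apply/eqP; congr (enorm (_ - _) ^+ 2). exact: eq_bigr => l _; rewrite e2.
exists B; split => //.
apply: filterS2 (frozen_limit mB maB dB) (conv_fast mG G0 dG) => w [Y [c [y1 y2 y3]]] g0.
exists Y, c; split; last exact: y3.
split; first exact: y1.
exists (fun j => bs_at (h j) w); split; [by move=> j; exact: okh| |exact: y2].
suff eG j : (\int[P]_v G j (w, v) = \int[P]_v \int[leb]_(s in `[t, T])
    (enorm (bs_val (bs_at (h j) w) s v - Phi' s (w, v)) ^+ 2)%:E)%E.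
  by apply: (cvg_trans (near_eq_cvg _) g0); apply: nearW => j; exact: eG.
apply: eq_integral => v _; apply: integral_itv_obnd_cbnd.
apply: (measurable_comp (F := (`]t, T] `*` setT) : set (R * Z)) (g := fun s => (s, (w, v) : Z)) _ _ (mF j)).
- exact: measurableX.
- by move=> _ [s st <-].
- exact: mfunTS; exact: measurable_pair2.
Qed.

(** The measure [levy S] is finite on [E]; its restriction there is a finite measure, to which the
    measurability part of Fubini applies. *)
Lemma meas_int_marks d (U : measurableType d) (A : set U) (f : U * mark R q -> \bar R) : measurable A ->
  mfun (A `*` E) f -> (forall z, (A `*` E) z -> 0 <= f z)%E ->
  mfun A (fun z => \int[levy S]_(e in E) f (z, e))%E.
Proof.
move=> mA mf f0; have mE' := mE; have levE : (levy S E < +oo)%E by have [_ []] := hN.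
apply: (eq_measurable_fun (fun z => \int[mfrestr mE' levE]_(e in E) f (z, e))%E).
  move=> z _; apply: eq_measure_integral => B mB BE /=. by rewrite /mfrestr /mrestr setIidl.
exact: (@meas_int_snd _ _ _ _ _ (mfrestr mE' levE) A E f).
Qed.

Lemma freeze_pint p Phi (I : R -> Omega -> 'cV[R]_p) (Phi' : R -> mark R q -> Z -> 'cV[R]_p) :
  is_pint P S t Phi I ->
  (forall i, mfun (((`]t, T] `*` setT) `*` E) : set (R * Z * mark R q)) (fun z => Phi' z.1.1 z.2 z.1.2 i ord0)) ->
  {ae P, forall w : Omega, forall s e, t < s <= T -> Phi s e w = Phi' s e (w, w)} ->
  exists B, frozen_int I B (fun w Y => is_pint P S t (fun s e v => Phi' s e (w, v)) Y).
Proof.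
move=> hI mPhi ePhi; have [H [ok h1 h2]] := pint_fast hI.
pose h j := projT1 (cid (ps_lift t0 (ok j))); have hh j := projT2 (cid (ps_lift t0 (ok j))).
have mh j l a b : mfunT (fun z => h j l z a b) by have [h3 _ _] := hh j; exact: h3.
have okh j w : ps_ok P S t (ps_at (h j) w) by have [_ h3 _] := hh j; exact: h3.
have eh : {ae P, forall w : Omega, forall j l, @ps_coef _ _ _ _ _ (H j) l w = h j l (w, w)}.
  by apply/ae_foralln => j; have [_ _ h3] := hh j; exact: h3.
pose B j s (z : Z) := ps_int S (ps_at (h j) z.1) s z.2.
have mB j s i : t <= s <= T -> mfunT (fun z => B j s z i ord0). by move=> st; apply: ps_at_meas.
have maB j w i : mart t (fun s v => B j s (w, v) i ord0) by exact: (ps_mart i t0 (okh j w)).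
have eB : {ae P, forall w : Omega, forall j s i, ps_int S (H j) s w i ord0 = B j s (w, w) i ord0}.
  apply: filterS eh => w hw j s i; rewrite /B !psE; apply: eq_bigr => l _ /=. by rewrite hw.
have dB s i j : t <= s <= T -> L2 P (fun w => B j s (w, w) i ord0 - I s w i ord0) /\
    nrm P (fun w => B j s (w, w) i ord0 - I s w i ord0) <= 1 / 16 ^+ j. move=> st; have [L n] := h2 s i j st.
  have mD : mfun [set: Omega] (fun w => B j s (w, w) i ord0 - I s w i ord0).
    apply: mfunB; first exact: (mfun_comp (mB j s i st) diag_meas). by have [/(_ s st)[_ []]] := pint_mart i t0 (ltW tT) hI.
  have e : {ae P, forall w : Omega, B j s (w, w) i ord0 - I s w i ord0 = ps_int S (H j) s w i ord0 - I s w i ord0}.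
    by apply: filterS eB => w ->. by split; [exact: L2_ae mD L e|rewrite (nrm_ae mD (L2_meas L) e)].
pose F j (z : R * Z * mark R q) := (enorm (ps_val (ps_at (h j) z.1.2.1) z.1.1 z.2 z.1.2.2 - Phi' z.1.1 z.2 z.1.2) ^+ 2)%:E.
have mF j : mfun ((`]t, T] `*` setT) `*` E) (F j).
  apply/measurable_EFinP; apply: meas_enorm2W; first by apply: measurableX; [exact: measurableX|exact: mE].
  move=> a b; rewrite (ord1 b) (_ : (fun z => _) = (fun z : R * Z * mark R q => \sum_l (if (ps_lo l < z.1.1 <= ps_hi l) && (z.2 \in @ps_set _ _ _ _ _ (H j) l) then h j l z.1.2 a ord0 else 0) - Phi' z.1.1 z.2 z.1.2 a ord0)).
    apply: mfunB => //; apply: mfunTS; apply: measurable_sum => l.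
    by have [_ _ [mA _] _ _] := ok j l; exact: (@step_measE _ _ _ Z _ _ _ _ (fun z => h j l z a ord0)).
  apply/funext => -[[s [w v]] e]; rewrite !mxE summxE big_mkcond; congr (_ - _); exact: eq_bigr => l _.
have F0 j z : (0 <= F j z)%E by rewrite lee_fin sqr_ge0.
pose F1 j (z : R * Z) : \bar R := (\int[levy S]_(e in E) F j (z, e))%E.
have mF1 j : mfun (`]t, T] `*` setT) (F1 j) by apply: meas_int_marks => //; exact: measurableX.
have F10 j z : (0 <= F1 j z)%E by apply: integral_ge0.
pose G j (z : Z) : \bar R := (\int[leb]_(s in `]t, T]) F1 j (s, z))%E.
have mG j : mfun [set: Z] (G j). refine (@meas_int_fst _ _ _ _ _ leb [set` `]t, T]] [set: Z] (F1 j) _ _ (mF1 j) _) => //.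
have G0 j z : (0 <= G j z)%E by apply: integral_ge0.
have dG j : (\int[P]_w G j (w, w) <= (1 / 16 ^+ j)%:E)%E. apply: le_trans (h1 j); apply: le_ge0_integral_ae => //.
  - exact: (mfun_comp (mG j) diag_meas).
  - by move=> w; do 2 apply: integral_ge0 => ? _; rewrite lee_fin sqr_ge0.
  - apply: filterS2 ePhi eh => w e1 e2.
    apply: le_trans (_ : _ <= \int[leb]_(s in `]t, T]) \int[levy S]_(e in E) (enorm (ps_val (H j) s e w - Phi s e w) ^+ 2)%:E)%E _; last first.
      apply: le_ge0_integral_sub; last by move=> s; apply: integral_ge0 => ? _; rewrite lee_fin sqr_ge0.
      by move=> s /=; rewrite !in_itv /= => /andP[/ltW -> ->]. apply: le_ge0_integral => [s _|s]; first exact: F10.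
    rewrite /= in_itv /= => st. apply: le_ge0_integral => [e _|e Ee]; first exact: F0. rewrite /F /= e1// lee_fin.
    rewrite le_eqVlt; apply/orP; left; apply/eqP; congr (enorm (_ - _) ^+ 2). exact: eq_bigr => l _; rewrite e2.
exists B; split => //.
apply: filterS2 (frozen_limit mB maB dB) (conv_fast mG G0 dG) => w [Y [c [y1 y2 y3]]] g0.
exists Y, c; split; last exact: y3.
split; first exact: y1.
exists (fun j => ps_at (h j) w); split; [by move=> j; exact: okh| |exact: y2].
suff eG j : (\int[P]_v G j (w, v) = \int[P]_v \int[leb]_(s in `[t, T])
    \int[levy S]_(e in E) (enorm (ps_val (ps_at (h j) w) s e v - Phi' s e (w, v)) ^+ 2)%:E)%E.
  by apply: (cvg_trans (near_eq_cvg _) g0); apply: nearW => j; exact: eG.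
apply: eq_integral => v _; apply: integral_itv_obnd_cbnd.
apply: (measurable_comp (F := (`]t, T] `*` setT) : set (R * Z)) (g := fun s => (s, (w, v) : Z)) _ _ (mF1 j)).
- exact: measurableX.
- by move=> _ [s st <-].
- exact: mfunTS; exact: measurable_pair2.
Qed.
End FreezeInt.
End Noise.

Section Control.
Context {R : realType} {dO} {Omega : measurableType dO} (P : probability Omega R)
  {r q n m} (S : @noise R dO Omega r q) (C : @problem R r q n m).
Local Notation T := (horizon S).
Local Notation E := (marks S).
Local Notation fm := (fm P S).
Local Notation Fil s := (sigT_of (Fgen P S s)).
Local Notation leb := (@lebesgue_measure R).
Local Notation dom := (txu_dom S C).
Hypotheses (hN : noise_axioms P S) (hC : problem_axioms C)
  (A1 : assumption1 S C) (A2 : assumption2 S C) (A3 : assumption3 C).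

Lemma within_coord p k (i : 'I_p) (j : 'I_k) (f : R * 'cV[R]_n * 'cV[R]_m -> 'M[R]_(p, k)) :
  {within dom, continuous f} -> {within dom, continuous (fun z => f z i j)}.
Proof.
move=> /subspace_continuousP fc; apply/subspace_continuousP => z Dz.
exact: (cvg_comp f (fun M : 'M[R]_(p, k) => M i j) (fc z Dz) (@coord_continuous _ _ _ i j (f z))).
Qed.

Lemma drift_bound i v y c : 0 <= v <= T -> ctrl_set C c -> `|drift C v y c i ord0| <= lip C * (1 + enorm y).
Proof.
move=> vT Uc; have [_ _ _ /(_ v y c vT Uc) h] := A1.
apply: le_trans (coord_le_enorm _ _ _) _; rewrite -lee_fin; apply: le_trans h.
apply: (@le_trans _ _ (enorm (drift C v y c) + enorm (diffusion C v y c))%:E). by rewrite lee_fin lerDl enorm_ge0.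
by apply: leeDl; exact: poweR_ge0.
Qed.

Lemma run_bound v y c : 0 <= v <= T -> ctrl_set C c -> `|running C v y c| <= lip C * (1 + enorm y).
Proof. by move=> vT Uc; have [_ _ /(_ v y c vT Uc) h _ _] := A2; apply: le_trans h; rewrite lerDl. Qed.

Lemma dist_continuous : continuous (dist C).
Proof.
move=> y; apply/(@cvgrPdist_le _ _ _ (nbhs y)) => e e0; have [_ _ _ L0 _] := hC; have [dL _] := A3.

(* The Euclidean norm is at most the square root of [n] times the sup norm that defines the
   topology; the added 1 keeps the divisor positive when [n] is 0. *)
have a0 : 0 < e / (lip C * (1 + Num.sqrt n%:R)) by rewrite divr_gt0// mulr_gt0.
have := nbhsx_ballx y _ a0; apply: filterS => v /(mx_ballP _ _ a0) h.
apply: le_trans (dL _ _) _; set b := e / _ in a0 h.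
have : enorm (y - v) <= Num.sqrt (\sum_(i < n) \sum_(j < 1) b ^+ 2).
  by apply: enorm_bounded => i j; rewrite !mxE; exact/ltW/h.
under eq_bigr do rewrite big_ord1.
rewrite sumr_const card_ord -(mulr_natl (b ^+ 2)) sqrtrM// sqrtr_sqr ger0_norm ?(ltW a0)// => h1.
apply: le_trans (ler_wpM2l (ltW L0) h1) _.
have -> : e = lip C * ((1 + Num.sqrt n%:R) * b). by rewrite /b; field; rewrite !gt_eqF.
by rewrite ler_pM2l// ler_wpM2r ?(ltW a0)// lerDr.
Qed.

Lemma control_joint t (u : R -> Omega -> 'cV[R]_m) i : 0 <= t <= T -> predictable P S t u ->
  mfun ((`[t, T] `*` setT) : set (R * Omega)) (fun z => u z.1 z.2 i ord0).
Proof.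
move=> /andP[t0 tT] pu.
have h := pred_meas i t0 tT (lexx T) pu.
apply: (measurable_comp (F := (`[t, T] `*` setT) : set (R * Fil T)) (f := fun z : R * Fil T => u z.1 z.2 i ord0)
   (g := fun z : R * Omega => (z.1, z.2 : Fil T)) _ _ h).
- exact: measurableX.
- by move=> _ [z vz <-].
apply: mfunTS; apply: measurable_fun_pair => //=.
by move=> _ Y mY; rewrite setTI -[X in measurable X]setTI; apply: measurable_snd => //; exact: filt_meas hN _ (lexx T) _ mY.
Qed.

(** * Solutions of the state equation for a given control *)

Section State.
Variables (t : R) (a : 'cV[R]_n) (u : R -> Omega -> 'cV[R]_m) (x : R -> Omega -> 'cV[R]_n).
Hypotheses (t0 : 0 <= t) (tT : t <= T) (hu : ctrlU P S C t u) (hx : is_state P S C t a u x).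

Lemma state_cadl w i : cadl t T (fun v => x v w i ord0).
Proof. by have [_ /cadlag_mxP + _] := hx; exact. Qed.

Lemma state_meas v i : t <= v <= T -> mfunT (fun w => x v w i ord0).
Proof. by move=> vt; have [/mx_adaptedP h _ _] := hx; apply: (fm_meas hN _ (h v i ord0 vt)); case/andP: vt. Qed.

Lemma ctrl_joint i : mfun ((`[t, T] `*` setT) : set (R * Omega)) (fun z => u z.1 z.2 i ord0).
Proof. by apply: control_joint; [rewrite t0|have [] := hu]. Qed.

Lemma ctrl_in v w : t <= v <= T -> ctrl_set C (u v w).
Proof. by have [_ + _] := hu; exact. Qed.

Definition driftint i s w := \int[leb]_(v in `[t, s]) drift C v (x v w) (u v w) i ord0.

Lemma drift_within i : {within dom, continuous (fun z => drift C z.1.1 z.1.2 z.2 i ord0)}.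
Proof. by apply: within_coord; have [[]] := A1. Qed.

Lemma ctrl_joint_sub s i : s <= T -> mfun ((`[t, s] `*` setT) : set (R * Omega)) (fun z => u z.1 z.2 i ord0).
Proof.
move=> sT; apply: measurable_funS (ctrl_joint i); first exact: measurableX.
by move=> [v w] /=; rewrite !in_itv /= => -[/andP[-> h2] _]; rewrite (le_trans h2 sT).
Qed.

Lemma cadl_sub s (f : R -> R) : s <= T -> cadl t T f -> cadl t s f.
Proof.
move=> sT [h1 h2]; split => v /andP[v1 v2]; first by apply: h1; rewrite v1 (lt_le_trans v2).
by apply: h2; rewrite v1 (le_trans v2).
Qed.

Lemma driftint_meas i s : t <= s <= T -> mfunT (driftint i s).
Proof.
move=> /andP[ts sT].
apply: (@coef_int_meas _ _ _ _ _ _ _ S C _ _ t s x u t0 ts sT _ _ _ _ (fun v y c => drift C v y c i ord0) (@drift_within i)).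
- by move=> w j; apply: cadl_sub => //; exact: state_cadl.
- by move=> v j /andP[v1 v2]; apply: state_meas; rewrite v1 (le_trans v2).
- by move=> j; exact: ctrl_joint_sub.
- by move=> v w /andP[v1 v2]; apply: ctrl_in; rewrite v1 (le_trans v2).
Qed.

Lemma driftint_lip i w : exists K, forall c b, t <= c -> c <= b -> b <= T ->
  `|driftint i b w - driftint i c w| <= K * (b - c).
Proof.
exact: (@coef_int_lip _ _ _ _ _ _ _ S C _ _ t T x u t0 tT (lexx T) state_cadl state_meas ctrl_joint ctrl_in
  (fun v y c => drift C v y c i ord0) (@drift_within i) _ (@drift_bound i) w).
Qed.

Lemma state_sde : exists M : 'I_n -> R -> Omega -> R, (forall i, mart P S t (M i)) /\
  forall s, t <= s <= T -> {ae P, forall w, forall i, x s w i ord0 = (a i ord0 + driftint i s w) + M i s w}.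
Proof.
have [_ _ [I [J [hI hJ h]]]] := hx.
exists (fun i s w => I s w i ord0 + J s w i ord0); split.
  by move=> i; apply: martD; [exact: (bint_mart hN i t0 tT hI)|exact: (pint_mart hN i t0 tT hJ)].
by move=> s st; apply: filterS (h s st) => w -> i; rewrite !mxE !addrA.
Qed.

(** There is no jump at a fixed time: the drift is continuous and the martingale part is continuous
    in L2, so the left limit satisfies the same equation as the value. *)
Lemma state_left s : t < s <= T -> {ae P, forall w, forall i, lim (x v w i ord0 @[v --> s^'-]) = x s w i ord0}.
Proof.
move=> st; have [M [mM sde]] := state_sde; apply: filter_forall => i.
have sT : t <= s <= T by case/andP: st => /ltW -> ->.
pose v_ j := downg t T j (Num.truncn ((T - s) * j.+1%:R)).
have vT j : t <= v_ j <= T by exact: downgP.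
have h : {ae P, forall w, lim (x v w i ord0 @[v --> s^'-]) = (a i ord0 + driftint i s w) + M i s w}.
  apply: (@sde_lim _ _ _ P t T (fun v w => x v w i ord0) (fun v w => a i ord0 + driftint i v w) (M i) v_) => //.
  - by move=> v; exact: state_meas.
  - by move=> v vt; apply: mfunD => //; exact: driftint_meas.
  - by move=> v vt; have [/(_ v vt)[]] := mM i.
  - move=> w; have [K hK] := driftint_lip i w; exists K => c b h1 h2 h3. by rewrite opprD addrACA subrr add0r; exact: hK.
  - by move=> e e0; have [_ _ /(_ s e sT e0)[dl dl0 hdl] _] := mM i; exists dl.
  - exact: downg_cvg.
  - move=> w; apply: (@cvg_at_left_seq _ (fun v => x v w i ord0) s).
    + by have [_] := state_cadl w i; apply.
    + by move=> j; have /andP[] := downg_lt j st.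
    + exact: downg_cvg.
  - by move=> j; apply: filterS (sde _ (vT j)) => w; exact.
by apply: filterS2 h (sde s sT) => w -> ->.
Qed.

Lemma dist_within : {within dom, continuous (fun z => dist C z.1.2)}.
Proof.
apply/subspace_continuousP => z _; apply: cvg_within_filter.
apply: (@continuous_comp _ _ _ (fun z : R * 'cV[R]_n * 'cV[R]_m => z.1.2)); last exact: dist_continuous.
by apply: (@continuous_comp _ _ _ fst snd); [exact: cvg_fst|exact: cvg_snd].
Qed.

Lemma dist_joint : mfun ((`[t, T] `*` setT) : set (R * Omega)) (fun z => dist C (x z.1 z.2)).
Proof.
exact: (@coef_joint _ _ _ _ _ _ _ S C _ _ t T x u t0 tT (lexx T) state_cadl state_meas ctrl_joint ctrl_in
  (fun v y c => dist C y) dist_within).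
Qed.

Lemma dist_int_meas : mfunT (fun w => \int[leb]_(s in `[t, T]) (dist C (x s w))%:E)%E.
Proof.
apply: (@meas_int_fst _ _ _ _ _ leb _ _ (fun z => (dist C (x z.1 z.2))%:E)) => //.
  by apply/measurable_EFinP; exact: dist_joint.
by move=> z _; rewrite lee_fin; have [_ _ _ _ []] := hC.
Qed.

(** Right-continuity settles the times before [T]. At [T], where nothing lies to the right, the
    state almost surely equals its left limit, and the distance passes to this limit by
    continuity. *)
Lemma constraint_of_int : t < T -> {ae P, forall w, (\int[leb]_(s in `[t, T]) (dist C (x s w))%:E = 0)%E} ->
  in_constraint P S C t x.
Proof.
move=> tT' h; have TT : t < T <= T by rewrite tT' lexx.
have [_ _ _ _ [d0 dG]] := hC.
apply: filterS2 h (state_left TT) => w h1 h2.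
have cx : cadlag S t x by have [] := hx.
have [rc lc] := cx w.
have dz : forall s, t <= s < T -> dist C (x s w) = 0. apply: int0_right_cont => //.
    apply: (measurable_comp (F := (`[t, T] `*` setT) : set (R * Omega)) (g := fun v => (v, w)) _ _ dist_joint).
    - exact: measurableX.
    - by move=> _ [v vt <-].
    - exact: mfunTS; exact: measurable_pair2. by move=> s st; apply: (cvg_comp _ _ (rc s st)); exact: dist_continuous.
move=> s /andP[ts]; rewrite le_eqVlt => /predU1P[->|sT]; last by apply/dG; apply: dz; rewrite ts sT.
apply/dG; have cl := lc T TT.
have e : lim (x v w @[v --> T^'-]) = x T w. apply/matrixP => i j; rewrite (ord1 j) -h2; apply/esym/cvg_lim => //.
  by have /mx_cvgP := cl; exact.
rewrite -e.
have h3 : dist C (x v w) @[v --> T^'-] --> dist C (lim (x v w @[v --> T^'-])).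
  by apply: (cvg_comp _ _ cl); exact: dist_continuous.
rewrite -(cvg_lim _ h3)//; apply/cvg_lim => //.
apply: (@cvg_near_cst); near=> v; apply: dz; apply/andP; split; last by near: v; exact: nbhs_left_lt.
by near: v; exact: nbhs_left_ge.
Unshelve. all: by end_near. Qed.
End State.

(** One common shape with a Brownian and a Poisson term, the absent one having coefficient 0, so
    that a sum of elements gives one [bsimple] and one [psimple] over the same intervals. *)
Lemma elemI_normal a b X : elemI P S a b X -> exists lo hi k (cB : 'I_r -> Omega -> R) (cN : Omega -> R) (A : set (mark R q)),
  [/\ [/\ a <= lo, lo <= hi & hi <= b], measurable A /\ A `<=` E, (forall j, fm lo (cB j)) /\ fm lo cN,
      (forall j w, `|cB j w| <= k) /\ (forall w, `|cN w| <= k) &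
      X = (fun w => \sum_j cB j w * incB S j lo hi w + cN w * compensated S w A lo hi)].
Proof.
move=> [lo [hi [c [k [h fc ck [[i ->]|[A [mA AE ->]]]]]]]].
  exists lo, hi, k, (fun j w => if j == i then c w else 0), (cst 0), set0; split => //.
  - by split => // e.
  - by split => [j|]; [case: (j == i) => //|]; exact: fm_cst.
  - have k0 w : 0 <= k := le_trans (normr_ge0 _) (ck w). by split => [j w|w]; [case: ifP => _ //|]; rewrite normr0 (k0 w).
  - apply/funext => w; rewrite (bigD1 i)//= eqxx big1 ?mul0r ?addr0// => j /negbTE ->. by rewrite mul0r.
exists lo, hi, k, (fun _ => cst 0), c, A; split => //.
- by split => // j; exact: fm_cst.
- by split => // j w; rewrite normr0 (le_trans (normr_ge0 _) (ck w)).
- by apply/funext => w; rewrite big1 ?add0r// => j _; rewrite mul0r.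
Qed.

(** * Targets driven by a simple stochastic integral *)

Section Run.
Variables (t : R) (a : 'cV[R]_n) (u : R -> Omega -> 'cV[R]_m) (x : R -> Omega -> 'cV[R]_n).
Hypotheses (t0 : 0 <= t) (tT : t <= T) (hu : ctrlU P S C t u) (hx : is_state P S C t a u x).

Definition runint s w := \int[leb]_(v in `[t, s]) running C v (x v w) (u v w).

Lemma run_within : {within txu_dom S C, continuous (fun z => running C z.1.1 z.1.2 z.2)}.
Proof. by have [[]] := A2. Qed.

Lemma runint_fm s : t <= s <= T -> fm s (runint s).
Proof.
move=> /andP[ts sT]; have [/mx_adaptedP ax _ _] := hx; have [pu Uu _] := hu.
apply: (@coef_int_meas _ _ _ _ _ _ _ S C _ (Fil s) t s x u t0 ts sT _ _ _ _ (fun v y c => running C v y c) run_within).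
- by move=> w j; apply: cadl_sub (state_cadl hx w j).
- by move=> v j /andP[v1 v2]; apply: (fm_mono v2); apply: ax; rewrite v1 (le_trans v2).
- by move=> j; exact: pred_meas.
- by move=> v w /andP[v1 v2]; apply: Uu; rewrite v1 (le_trans v2).
Qed.

Lemma runint_lip w : exists K, forall c b, t <= c -> c <= b -> b <= T ->
  `|runint b w - runint c w| <= K * (b - c).
Proof.
exact: (@coef_int_lip _ _ _ _ _ _ _ S C _ _ t T x u t0 tT (lexx T) (state_cadl hx) (state_meas hx)
  (ctrl_joint t0 tT hu) (ctrl_in hu) (fun v y c => running C v y c) run_within _ (run_bound) w).
Qed.

Lemma runintE w : (\int[leb]_(v in `[t, T]) (running C v (x v w) (u v w))%:E = (runint T w)%:E)%E.
Proof.
rewrite /runint /Rintegral fineK//; apply: integrable_fin_num => //.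
exact: (@coef_integrable _ _ _ _ _ _ _ S C _ _ t T x u t0 tT (lexx T) (state_cadl hx) (state_meas hx)
  (ctrl_joint t0 tT hu) (ctrl_in hu) (fun v y c => running C v y c) run_within _ (run_bound) w).
Qed.

Variables (b : R) (M : Omega -> R).
Hypothesis sM : simpI P S t T M.

Lemma pred_itv : predictable_sets P S (`[t, T] `*` setT).
Proof.
rewrite (_ : `[t, T] `*` setT = ([set t] `*` setT) `|` (`]t, T] `*` setT)); last first.
  apply/seteqP; split => -[s w] /=; rewrite !in_itv /=.
    by move=> [/andP[+ ->] _]; rewrite le_eqVlt => /predU1P[->|->]; [left|right].
  by case=> [[-> _]|[/andP[/ltW -> ->] _]]; rewrite ?lexx.
by apply: sigma_union; [exact: pred_start|apply: (pred_oc t0) => //; exact: filt_setT].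
Qed.

(** The trace of the predictable sets on the strip over [[t, T]]: predictability becomes
    measurability on the type [YP], and finite sums of steps need no separate argument. [FB] does
    the same for predictable fields on the marks. *)
Local Notation PB := [set B | predictable_sets P S (`[t, T] `*` setT `&` B)].
Local Notation YP := (sigT_of PB).

Lemma YPE (B : set YP) : measurable B -> PB B.
Proof.
move=> mB; have -> : PB = <<s PB >>; last exact: mB.
apply/esym/sigma_algebra_id; apply: trace_sigma; last exact: pred_itv.
by move=> [s w] /=; rewrite !in_itv /= => -[/andP[/(le_trans t0) -> ->]].
Qed.

Lemma step_pred lo hi c : t <= lo -> lo <= hi -> hi <= T -> fm lo c ->
  mfun [set: YP] (fun z => if lo < z.1 <= hi then c z.2 else 0).
Proof.
move=> tlo lohi hiT fc.
have mA : forall A, filt P S lo A -> @measurable _ YP (`]lo, hi] `*` A).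
  move=> A fA; apply: sub_sigma_algebra => /=; rewrite setIidr; first exact: (pred_oc t0 tlo hiT fA).
  by move=> [s w] /= [+ _]; rewrite !in_itv /= => /andP[h1 h2]; rewrite (ltW (le_lt_trans tlo h1)) (le_trans h2 hiT).
rewrite (_ : (fun _ => _) = (fun z => if z \in `]lo, hi] `*` setT then c z.2 else 0)).
  apply: meas_patch; first by apply: mA; exact: filt_setT.
  move=> _ Y mY; rewrite (_ : _ `&` _ = `]lo, hi] `*` (c @^-1` Y)); last first.
    by apply/seteqP; split => -[s w] [h1 h2]; move: h1 h2; case. by apply: mA; have := fc measurableT _ mY; rewrite setTI.
apply/funext => -[s w] /=; case: ifPn => h; first by rewrite mem_set//; split => /=; rewrite in_itv.
by rewrite memNset// => -[/=]; rewrite in_itv (negbTE h).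
Qed.

Local Notation FB := [set B | <<s (`[0, T] `*` setT) `*` E, [set D : set (R * Omega * mark R q) |
           exists D' A, [/\ predictable_sets P S D', measurable A, A `<=` E & D = D' `*` A]] >>
     ((`[t, T] `*` setT) `*` E `&` B)].
Local Notation YF := (sigT_of FB).

Lemma YFE (B : set YF) : measurable B -> FB B.
Proof.
move=> mB; have -> : FB = <<s FB >>; last exact: mB.
apply/esym/sigma_algebra_id; apply: trace_sigma.
  by move=> [[s w] e] /=; rewrite !in_itv /= => -[[/andP[/(le_trans t0) -> ->]]].
apply: sub_sigma_algebra; exists (`[t, T] `*` setT), E; split => //; [exact: pred_itv|exact: (mE hN)].
Qed.

Lemma step_field lo hi c A : t <= lo -> lo <= hi -> hi <= T -> fm lo c -> measurable A -> A `<=` E ->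
  mfun [set: YF] (fun z => if (lo < z.1.1 <= hi) && (z.2 \in A) then c z.1.2 else 0).
Proof.
move=> tlo lohi hiT fc mA AE.
have mB : forall B, filt P S lo B -> @measurable _ YF ((`]lo, hi] `*` B) `*` A).
  move=> B fB; apply: sub_sigma_algebra => /=; rewrite setIidr.
    by apply: sub_sigma_algebra; exists (`]lo, hi] `*` B), A; split => //; exact: (pred_oc t0 tlo hiT fB).
  move=> [[s w] e] /= [[+ _] /AE]; rewrite !in_itv /= => /andP[h1 h2].
  by rewrite (ltW (le_lt_trans tlo h1)) (le_trans h2 hiT).
rewrite (_ : (fun _ => _) = (fun z => if z \in (`]lo, hi] `*` setT) `*` A then c z.1.2 else 0)).
  apply: meas_patch; first by apply: mB; exact: filt_setT.
  move=> _ Y mY; rewrite (_ : _ `&` _ = (`]lo, hi] `*` (c @^-1` Y)) `*` A); last first.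
    apply/seteqP; split => -[[s w] e] /=; first by move=> [[[h1 _] h2] h3]. by move=> [[h1 h2] h3].
  by apply: mB; have := fc measurableT _ mY; rewrite setTI.
apply/funext => -[[s w] e] /=; case: ifPn => h.
  by case/andP: h => h1 h2; rewrite mem_set//; split => /=; [split => //; rewrite in_itv|exact: set_mem].
rewrite memNset// => -[[/=]]; rewrite in_itv /= => h1 _ /mem_set h2.
by move: h; rewrite h1 h2.
Qed.

(** The controls are the simple integrands themselves, so the approximating sequences in the
    definition of the integrals can be constant with error 0; square-integrability comes from their
    bounds. *)
Lemma simpI_target : exists alpha beta y, [/\ ctrlA P S t alpha, ctrlB P S t beta,
  is_target P S C t b u alpha beta x y &
  {ae P, forall w, y T w = b - runint T w + M w}].
Proof.
have [k [F [hF ->]]] := sM.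
have [lo h1] := choice (fun i => elemI_normal (hF i)).
have [hi h2] := choice h1; have [kk h3] := choice h2.
have [cB h4] := choice h3; have [cN h5] := choice h4; have [A h] := choice h5.
clear h1 h2 h3 h4 h5.
have tlo i : t <= lo i by have [[]] := h i.
have lohi i : lo i <= hi i by have [[]] := h i.
have hiT i : hi i <= T by have [[]] := h i.
have mA i : measurable (A i) /\ A i `<=` E by have [] := h i.
have fB i j : fm (lo i) (cB i j) by have [_ _ []] := h i.
have fNc i : fm (lo i) (cN i) by have [_ _ []] := h i.
have bB i j w : `|cB i j w| <= kk i by have [_ _ _ []] := h i.
have bN i w : `|cN i w| <= kk i by have [_ _ _ []] := h i.
have FE i : F i = (fun w => \sum_j cB i j w * incB S j (lo i) (hi i) w + cN i w * compensated S w (A i) (lo i) (hi i)).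
  by have [] := h i.
clear h.
pose HB := @BSimple R _ Omega r 1 k lo hi (fun i w => \row_j cB i j w).
pose HN := @PSimple R _ Omega q 1 k lo hi A (fun i w => \col_j cN i w).
have okB : bs_ok P S t HB. move=> i; split => //=; first by rewrite lohi hiT.
    apply/(mx_measP (T := Fil (lo i))) => i' j; rewrite (_ : (fun w => _) = cB i j); first exact: fB.
    by apply/funext => w; rewrite mxE. by eexists => w; apply: enorm_bounded => i' j; rewrite mxE; exact: bB.
have okN : ps_ok P S t HN. move=> i; split => //=; first by rewrite lohi hiT.
    apply/(mx_measP (T := Fil (lo i))) => i' j; rewrite (_ : (fun w => _) = cN i); first exact: fNc.
    by apply/funext => w; rewrite mxE. by eexists => w; apply: enorm_bounded => i' j; rewrite mxE; exact: bN.
pose KK := \sum_i `|kk i|.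
have sum_le (p : pred 'I_k) (c : 'I_k -> R) : (forall i, `|c i| <= kk i) -> `|\sum_(i < k | p i) c i| <= KK.
  move=> hc; rewrite big_mkcond /=; apply: le_trans (ler_norm_sum _ _ _) _; apply: ler_sum => i _.
  by case: (p i); [exact: le_trans (hc i) (ler_norm _)|rewrite normr0].
exists (fun s w => (bs_val HB s w)^T), (fun s e w => ps_val HN s e w ord0 ord0).
have fin2 : (leb `[t, T] < +oo)%E by exact: leb_itv_fin (@subset_refl _ _).
have PT : (P setT < +oo)%E by rewrite probability_setT ltry.
have levE : (levy S E < +oo)%E by have [_ []] := hN.
have pA : ctrlA P S t (fun s w => (bs_val HB s w)^T). split.
    move=> Y bY; rewrite (_ : [set _ | _] = `[t, T] `*` setT `&` [set z | Y ((bs_val HB z.1 z.2)^T)]); last first.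
      by apply/seteqP; split => z /=; rewrite in_itv /=; [case|case=> [[]]].
    apply: YPE; move: Y bY; apply/(mx_measP (T := YP)) => j i.
    rewrite (_ : (fun w => _) = (fun z => \sum_l if lo l < z.1 <= hi l then cB l j z.2 else 0)).
      by apply: measurable_sum => l; exact: step_pred.
    apply/funext => z; rewrite mxE summxE big_mkcond; apply: eq_bigr => l _ /=. by case: ifP; rewrite ?mxE.
  pose K0 := Num.sqrt (\sum_(i < r) \sum_(j < 1) KK ^+ 2).
  apply: le_lt_trans (ltry (K0 ^+ 2 * fine (leb `[t, T]) * fine (P setT))). apply: int_bound => //.
    by rewrite mulr_ge0 ?sqr_ge0 ?fine_ge0. move=> w _; rewrite integral_ge0/=; last by move=> s _; rewrite lee_fin sqr_ge0.
  apply: int_bound => //; first by rewrite sqr_ge0.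
  move=> s _; rewrite !lee_fin sqr_ge0 /= ler_sqr ?nnegrE ?enorm_ge0 ?sqrtr_ge0//.
  apply: enorm_bounded => i j; rewrite mxE summxE; apply: sum_le => l; rewrite mxE; exact: bB.
have pB : ctrlB P S t (fun s e w => ps_val HN s e w ord0 ord0). split.
    move=> Y bY; rewrite (_ : [set _ | _] = (`[t, T] `*` setT) `*` E `&` [set z | Y (ps_val HN z.1.1 z.2 z.1.2 ord0 ord0)]); last first.
      by apply/seteqP; split => z /=; rewrite in_itv /=; [case|case=> [[[]]]]. apply: YFE; rewrite borelRE in bY.
    rewrite -[X in measurable X]setTI; suff mF : mfun [set: YF] (fun z => ps_val HN z.1.1 z.2 z.1.2 ord0 ord0) by exact: mF.
    rewrite (_ : (fun w => _) = (fun z => \sum_l if (lo l < z.1.1 <= hi l) && (z.2 \in A l) then cN l z.1.2 else 0)).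
      by apply: measurable_sum => l; have [mAl AEl] := mA l; exact: step_field.
    apply/funext => z; rewrite summxE big_mkcond; apply: eq_bigr => l _ /=. by case: ifP; rewrite ?mxE.
  apply: le_lt_trans (ltry (KK ^+ 2 * fine (levy S E) * fine (leb `[t, T]) * fine (P setT))).
  have KK0 : 0 <= KK ^+ 2 * fine (levy S E) by rewrite mulr_ge0 ?sqr_ge0 ?fine_ge0. apply: int_bound => //.
    by rewrite mulr_ge0 ?fine_ge0.
  have sq0 s e w : (0 <= (`|ps_val HN s e w ord0 ord0| ^+ 2)%:E)%E by rewrite lee_fin sqr_ge0.
  move=> w _; rewrite integral_ge0/=; last by move=> s _; exact: integral_ge0.
  apply: int_bound => // s _; rewrite integral_ge0//=. apply: int_bound => //; [exact: (mE hN)|by rewrite sqr_ge0|].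
  move=> e _; rewrite sq0 lee_fin ler_sqr ?nnegrE ?sumr_ge0//. by rewrite summxE; apply: sum_le => l; rewrite mxE; exact: bN.
pose Z s w := bs_int S HB s w ord0 ord0 + ps_int S HN s w ord0 ord0.
have mZ : mart P S t Z by apply: martD; [exact: (bs_mart hN _ t0 okB)|exact: (ps_mart hN _ t0 okN)].
pose G := [set w | {within `[0, T], continuous (fun s => bm S s w)} /\ prm S w (E `*` `[0, T]) \is a fin_num].
have aeG : {ae P, forall w, G w}. have [_ _ [_ _ cB' _] _ _] := hN. by apply: filterS2 cB' (prm_finite hN) => w.
(* A target must be cadlag at every sample point. Off the almost sure event [G], where Brownian
   paths are continuous and the total count is finite, the integral part is therefore replaced by
   0. *)
pose y s w := b - runint s w + (if w \in G then Z s w else 0).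
have yE s : {ae P, forall w, b - runint s w + Z s w = y s w}. by apply: filterS aeG => w hw; rewrite /y mem_set.
have fZ s : t <= s <= T -> fm s (Z s) by move=> st; have [/(_ s st)[]] := mZ.
have cbm w j : {within `[0, T], continuous (fun s => bm S s w)} -> cadl t T (fun s => bm S s w j ord0).
  move=> /subspace_continuousP cb; apply: (cadl_cont t0); apply/subspace_continuousP => s sI.
  exact: (cvg_comp _ (fun M : 'cV[R]_r => M j ord0) (cb s sI) (@coord_continuous _ _ _ j ord0 (bm S s w))).
have cZ w : G w -> cadl t T (Z^~ w). move=> [cb fin]; rewrite /Z; apply: cadlD.
    apply: (cadl_eq (f := fun s => \sum_l \sum_j cB l j w *
       (bm S (Num.min (hi l) s) w j ord0 - bm S (Num.min (lo l) s) w j ord0))).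
      by move=> s _; rewrite bsE; apply: eq_bigr => l _; apply: eq_bigr => j _; rewrite /= mxE.
    apply: cadl_sum => l; apply: cadl_sum => j; apply: cadlZ; apply: cadlB;
      by apply: (@cadl_stop _ _ _ (fun s => bm S s w j ord0)); exact: cbm.
  pose g l v := fine (prm S w (A l `*` `]t, v])) - rate S (A l) * v.
  apply: (cadl_eq (f := fun s => \sum_l cN l w * (g l (Num.min (hi l) s) - g l (Num.min (lo l) s)))).
    move=> s /andP[s1 s2]; rewrite psE; apply: eq_bigr => l _; rewrite /= mxE; congr (_ * _). have [mAl AEl] := mA l.
    have h1 : t <= Num.min (lo l) s by rewrite le_min tlo.
    have h2 : Num.min (lo l) s <= Num.min (hi l) s by rewrite le_min2//.
    have h3 : Num.min (hi l) s <= T by rewrite ge_min hiT.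
    have := cnt_add hN mAl AEl t0 h1 h2 h3 fin; rewrite /g /compensated /cnt /box /rate => ->; ring.
  have mET : measurable (E `*` `[0, T]) by apply: measurableX => //; exact: (mE hN).
  apply: cadl_sum => l; have [mAl AEl] := mA l. have cg : cadl t T (g l). apply: cadlB.
      apply: cadl_cdf => //; apply: (@le_lt_trans _ _ (prm S w (E `*` `[0, T]))); last by rewrite -ge0_fin_numE.
      apply: le_measure; rewrite ?inE//; first exact: measurableX.
      move=> [e v] /= [/AEl Ee]; rewrite !in_itv /= => /andP[v1 ->]; rewrite andbT.
      by split => //; exact: le_trans t0 (ltW v1). apply: (@cadl_lip _ _ _ _ `|rate S (A l)|) => c d _ cd _.
    by rewrite -mulrBr normrM (ger0_norm (x := d - c)) ?subr_ge0. by apply: cadlZ; apply: cadlB; exact: cadl_stop.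
exists y; split => //.
- split.
  + apply/real_adaptedP => s st; apply: fm_ae (yE s); apply: fmD; last exact: fZ.
    by apply: fmB; [exact: fm_cst|exact: runint_fm].
  + move=> w; suff : cadl t T (y^~ w) by []. rewrite /y; apply: cadlD. apply: cadlB; first exact: cadl_cst.
      by have [K hK] := runint_lip w; exact: cadl_lip hK.
    by case: (boolP (w \in G)) => [/set_mem|_]; [exact: cZ|exact: cadl_cst].
  + exists (bs_int S HB), (ps_int S HN); split.
    * split. apply/mx_adaptedP => s i j st; rewrite (ord1 j). by have [/(_ s st)[]] := bs_mart hN i t0 okB.
      exists (fun=> HB); split => //. rewrite (_ : (fun _ => _) = cst 0%E); first exact: cvg_cst.
        apply/funext => ? /=; apply: integral0_eq => w _; apply: integral0_eq => s _. by rewrite trmxK subrr enorm0.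
      move=> s st; rewrite (_ : (fun _ => _) = cst 0%E); first exact: cvg_cst.
      by apply/funext => ? /=; apply: integral0_eq => w _; rewrite subrr enorm0.
    * split. apply/mx_adaptedP => s i j st; rewrite (ord1 j). by have [/(_ s st)[]] := ps_mart hN i t0 okN.
      exists (fun=> HN); split => //. rewrite (_ : (fun _ => _) = cst 0%E); first exact: cvg_cst.
        apply/funext => ? /=; apply: integral0_eq => w _; apply: integral0_eq => s _; apply: integral0_eq => e _.
        rewrite (_ : ps_val HN s e w - _ = 0) ?enorm0//.
        by apply/matrixP => i j; rewrite !mxE (ord1 i) (ord1 j) mulr1n subrr.
      move=> s st; rewrite (_ : (fun _ => _) = cst 0%E); first exact: cvg_cst.
      by apply/funext => ? /=; apply: integral0_eq => w _; rewrite subrr enorm0.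
    * by move=> s st; apply: filterS (yE s) => w <-; rewrite /Z /runint addrA.
- apply: filterS (yE T) => w <-; congr (_ + _); rewrite /Z bsE psE -big_split /=; apply: eq_bigr => l _.
  rewrite FE; congr (_ + _). by apply: eq_bigr => j _; rewrite mxE !min_l ?(le_trans (lohi l)).
  by rewrite mxE !min_l ?(le_trans (lohi l)).
Qed.
End Run.

Lemma dist_ge0 y : 0 <= dist C y. Proof. by have [_ _ _ _ []] := hC. Qed.

Lemma aux_cost_ge0 t x y : (0 <= aux_cost P S C t x y)%E.
Proof.
apply: integral_ge0 => w _; apply: adde_ge0; first by rewrite lee_fin le_max lexx orbT.
by apply: integral_ge0 => s _; rewrite lee_fin dist_ge0.
Qed.

Lemma aux_value_ge0 t a b : (0 <= aux_value P S C t a b)%E.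
Proof. by apply: le_ereal_inf_tmp => _ [x [y [_ ->]]]; exact: aux_cost_ge0. Qed.

(** * The auxiliary cost of one admissible triple *)

Section Fix.
Variables (t b : R) (a : 'cV[R]_n) (u : R -> Omega -> 'cV[R]_m) (x : R -> Omega -> 'cV[R]_n)
  (y : R -> Omega -> R) (alpha : R -> Omega -> 'cV[R]_r) (beta : R -> mark R q -> Omega -> R).
Hypotheses (t0 : 0 <= t) (tT : t <= T) (hu : ctrlU P S C t u) (hx : is_state P S C t a u x).

Lemma TtT : t <= T <= T. Proof. by rewrite tT lexx. Qed.

Lemma term_meas : mfunT (fun w => terminal C (x T w)).
Proof.
apply: meas_cont_mx; first by have [[]] := A2.
by move=> i j; rewrite (ord1 j); exact: (state_meas hx i TtT).
Qed.

Hypothesis hy : is_target P S C t b u alpha beta x y.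

Lemma target_meas : mfunT (y T).
Proof. by have [/real_adaptedP h _ _] := hy; by have := h T TtT; apply: fm_meas. Qed.

Lemma aux_meas : mfunT (fun w => (Num.max (terminal C (x T w) - y T w) 0)%:E
              + \int[leb]_(s in `[t, T]) (dist C (x s w))%:E)%E.
Proof.
apply: emeasurable_funD; last exact: (dist_int_meas t0 tT hu hx).
apply/measurable_EFinP; apply: measurable_maxr => //.
by apply: mfunB; [exact: term_meas|exact: target_meas].
Qed.

Lemma aux_cost0P : aux_cost P S C t x y = 0%E <->
  {ae P, forall w, terminal C (x T w) <= y T w /\ (\int[leb]_(s in `[t, T]) (dist C (x s w))%:E = 0)%E}.
Proof.
have p1 w : (0 <= (Num.max (terminal C (x T w) - y T w) 0)%:E)%E by rewrite lee_fin le_max lexx orbT.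
have p2 w : (0 <= \int[leb]_(s in `[t, T]) (dist C (x s w))%:E)%E. by apply: integral_ge0 => s _; rewrite lee_fin dist_ge0.
split => [h|h]. have : ae_eq P setT (fun w => (Num.max (terminal C (x T w) - y T w) 0)%:E
              + \int[leb]_(s in `[t, T]) (dist C (x s w))%:E)%E (cst 0%E).
    apply/(ae_eq_integral_abs P measurableT aux_meas); rewrite -[RHS]h; apply: eq_integral => w _.
    by rewrite gee0_abs// adde_ge0.
  apply: filterS => w /(_ Logic.I) /eqP; rewrite padde_eq0// => /andP[/eqP h1 /eqP h2]; split => //.
  by case: h1 => h1; rewrite -subr_le0 -h1 le_max lexx.
rewrite /aux_cost; transitivity (\int[P]_w cst (0%E : \bar R) w)%E; last by rewrite /cst integral0.
apply: ge0_ae_eq_integral => //; first exact: aux_meas. by move=> w _; exact: adde_ge0.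
by apply: filterS h => w [h1 ->] _; rewrite adde0 max_r// subr_le0.
Qed.

Lemma cost_le : {ae P, forall w, epigraph (terminal C) (x T w, y T w)} -> (cost P S C t u x <= b%:E)%E.
Proof.
move=> ep; have [_ _ [I [J [hI hJ sde]]]] := hy.
pose Z w := b + I T w ord0 ord0 + J T w ord0 ord0.
have mI := bint_mart hN ord0 t0 tT hI; have mJ := pint_mart hN ord0 t0 tT hJ.
have LI : L2 P (fun w => I T w ord0 ord0) by have [/(_ T TtT)[]] := mI.
have LJ : L2 P (fun w => J T w ord0 ord0) by have [/(_ T TtT)[]] := mJ.
have Lb := L2D (L2_cst P b) LI.
have LZ : L2 P Z := L2D Lb LJ.
have EZ : Ex P Z = b. rewrite /Z ExD; [|exact: L2_L1..]; rewrite ExD; [|exact: L2_L1 (L2_cst P b)|exact: L2_L1].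
  by rewrite Ex_cst (mart_mean TtT mI) (mart_mean TtT mJ) !addr0.
have mZ := L2_meas LZ.
have mZ0 : mfunT (fun w => Num.max (Z w) 0) by exact: measurable_maxr.
have l0 w : 0 <= runint t u x T w. rewrite /runint; apply: Rintegral_ge0 => v /=; rewrite in_itv /= => vt.
  have [_ _ _ l0 _] := A2; apply: l0; last exact: (ctrl_in hu). by case/andP: vt => v1 ->; rewrite (le_trans t0 v1).
have m0 v : 0 <= terminal C v by have [_ _ _ _] := A2; exact.
have aeZ : {ae P, forall w, runint t u x T w + terminal C (x T w) <= Z w}.
  apply: filterS2 ep (sde T TtT) => w; rewrite /epigraph /= /Z /runint => h1 h2; lra.
(* The costs are nonnegative, so [Z] agrees almost surely with its positive part, to which the
   comparison of nonnegative integrals applies. *)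
rewrite -EZ -(Ex_ae mZ0 mZ); last by apply: filterS aeZ => w h; rewrite max_l// (le_trans _ h)// addr_ge0.
have L0 : L1 P (fun w => Num.max (Z w) 0). apply: (L1_le mZ0 (g := fun w => `|Z w|)). by have := integrable_abse (L2_L1 LZ).
  by move=> w; rewrite ger0_norm ?le_max ?lexx ?orbT// ge_max ler_norm normr_ge0.
rewrite ge0_ExE//.
apply: ae_ge0_le_integral => //.
- by move=> w _; rewrite (runintE t0 tT hu hx) -EFinD lee_fin addr_ge0.
- under [X in mfun _ X]eq_fun do rewrite (runintE t0 tT hu hx) -EFinD.
  apply/measurable_EFinP; apply: mfunD; last exact: term_meas. by have := runint_fm t0 hu hx TtT; apply: fm_meas.
- by move=> w _; rewrite lee_fin le_max lexx orbT.
- exact/measurable_EFinP.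
- by apply: filterS aeZ => w h _; rewrite (runintE t0 tT hu hx) -EFinD lee_fin le_max h.
Qed.
End Fix.

Lemma reach_aux t a b : 0 <= t <= T -> reachable P S C t (a, b) -> aux_value P S C t a b = 0%E.
Proof.
move=> /andP[t0 tT] [u [al [be [x [y [[hu hA hB] hx hy ep ct]]]]]].
apply/eqP; rewrite eq_le aux_value_ge0 andbT.
have -> : 0%E = aux_cost P S C t x y. apply/esym/(aux_cost0P t0 tT hu hx hy); apply: filterS2 ep ct => w h1 h2; split => //.
  apply: integral0_eq => s /=; rewrite in_itv /= => /h2. by have [_ _ _ _ [_ dG]] := hC => /dG ->.
by apply: ereal_inf_lbound; exists x, y; split => //; exists u, al, be.
Qed.

Lemma aux_reach t a b : 0 <= t < T -> aux_attained P S C t a b -> aux_value P S C t a b = 0%E ->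
  reachable P S C t (a, b).
Proof.
move=> /andP[t0 tT] [x [y [[u [al [be [[hu hA hB] hx hy]]]] <-]]] /(aux_cost0P t0 (ltW tT) hu hx hy) h.
exists u, al, be, x, y; split => //; first by apply: filterS h => w [].
by apply: (constraint_of_int t0 (ltW tT) hu hx tT); apply: filterS h => w [].
Qed.

Lemma state_horizon a u x : ctrlU P S C T u -> is_state P S C T a u x -> {ae P, forall w, x T w = a}.
Proof.
move=> hu hx; have T0 := ltW (T_gt0 hN); have TT : T <= T <= T by rewrite lexx.
have [M [mM /(_ T TT) sde]] := state_sde T0 (lexx T) hx.
have hM : {ae P, forall w, forall i, M i T w = 0} by apply: filter_forall => i; have [] := mM i.
apply: filterS2 sde hM => w h1 h2; apply/matrixP => i j; rewrite (ord1 j) h1 h2 addr0.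
by rewrite /driftint set_itv1 Rintegral_set1 addr0.
Qed.

(** At the horizon the distance is integrated over a single point, so the auxiliary cost cannot
    detect the constraint; as the state is almost surely the initial point, the constraint reduces
    to [Gam C a], stated separately. *)
Lemma reach_horizon a b : aux_attained P S C T a b ->
  reachable P S C T (a, b) <-> Gam C a /\ aux_value P S C T a b = 0%E.
Proof.
move=> att; have T0 := ltW (T_gt0 hN); have TT : T <= T <= T by rewrite lexx.
split => [h|[Ga W0]]. split; last by apply: reach_aux => //; rewrite T0 lexx.
  move: h => [u [al [be [x [y [[hu hA hB] hx hy ep ct]]]]]]. have : {ae P, forall w, Gam C a}.
    by apply: filterS2 ct (state_horizon hu hx) => w /(_ T TT) h /= e; rewrite -e. move=> h; have [w] := ae_ex h; exact.
move: att W0 => [x [y [[u [al [be [[hu hA hB] hx hy]]]] <-]]] /(aux_cost0P T0 (lexx T) hu hx hy) h.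
exists u, al, be, x, y; split => //; first by apply: filterS h => w [].
apply: filterS (state_horizon hu hx) => w xT s /andP[s1 s2].
by have -> : s = T; [apply: le_anti; rewrite s1 s2|rewrite xT].
Qed.

Lemma value_le t a b : 0 <= t <= T -> reachable P S C t (a, b) -> (value P S C t a <= b%:E)%E.
Proof.
move=> /andP[t0 tT] [u [al [be [x [y [[hu hA hB] hx hy ep ct]]]]]].
apply: le_trans (cost_le t0 tT hu hx hy ep).
by apply: ereal_inf_lbound; exists u, x.
Qed.

(** With no time left the running cost is null and the zero integral already gives a target equal to
    [b]; the choice [b = terminal C a] is reachable without any approximation. *)
Lemma cost_horizon a u x : ctrlU P S C T u -> is_state P S C T a u x -> in_constraint P S C T x ->
  cost P S C T u x = (terminal C a)%:E /\ reachable P S C T (a, terminal C a).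
Proof.
move=> hu hx ct; have T0 := ltW (T_gt0 hN).
have xa := state_horizon hu hx; split. rewrite /cost -[RHS]mule1 -(probability_setT P) -(integral_cst P measurableT).
  apply: ge0_ae_eq_integral => //.
  - under [X in mfun _ X]eq_fun do rewrite set_itv1 integral_set1 add0e.
    by apply/measurable_EFinP; exact: (term_meas (lexx T) hx).
  - by move=> w _; rewrite set_itv1 integral_set1 add0e lee_fin; have [_ _ _ _] := A2; exact.
  - by move=> w _; rewrite lee_fin; have [_ _ _ _] := A2; exact.
  - by apply: filterS xa => w -> _; rewrite set_itv1 integral_set1 add0e.
have [al [be [y [hA hB hy yT]]]] := simpI_target T0 (lexx T) hu hx (terminal C a) (simpI0 P S T T).
exists u, al, be, x, y; split => //.
by apply: filterS2 yT xa => w h1 h2; rewrite /epigraph /= h1 h2 /runint set_itv1 Rintegral_set1 subr0 addr0.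
Qed.

(** * The state equation with a frozen past *)

Section FreezeState.
Variables (t : R) (a : 'cV[R]_n) (u : R -> Omega -> 'cV[R]_m) (x : R -> Omega -> 'cV[R]_n).
Hypotheses (t0 : 0 <= t) (tT : t < T) (hu : ctrlU P S C t u) (hx : is_state P S C t a u x).
Local Notation Fut s := (sigT_of (futureG P S t s)).
Local Notation Z := (Fil t * Fut T)%type.
Local Notation pnt := (pnt t T).

Variables (u' : R -> Z -> 'cV[R]_m) (x' : R -> Z -> 'cV[R]_n).
Hypothesis uU : forall s z, ctrl_set C (u' s z).
Hypothesis uM : forall i, mfun [set: R * Z] (fun z => u' z.1 z.2 i ord0).
Hypothesis uP : forall w, predictable P S t (fun s v => u' s (w, v)).
Hypothesis uE : {ae P, forall w : Omega, forall s, t < s <= T -> u s w = u' s (w, w)}.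
Hypothesis xC : forall z i, cadl t T (fun s => x' s z i ord0).
Hypothesis xM : forall s i, t <= s <= T -> mfunT (fun z => x' s z i ord0).
Hypothesis xE : {ae P, forall w : Omega, forall s, t <= s <= T -> x s w = x' s (w, w)}.
Hypothesis xF : {ae P, forall w : Omega, forall k i, fm (pnt k) (fun v => x' (pnt k) (w, v) i ord0)}.

Let tT' : t <= T := ltW tT.
Let uMs s i : mfun ((`[t, s] `*` setT) : set (R * Z)) (fun z => u' z.1 z.2 i ord0).
Proof. exact: mfunTS (uM i). Qed.

Section Coefficient.
Variables (g : R -> 'cV[R]_n -> 'cV[R]_m -> R) (L : R).
Hypothesis gc : {within dom, continuous (fun z => g z.1.1 z.1.2 z.2)}.
Hypothesis gb : forall v y c, 0 <= v <= T -> ctrl_set C c -> `|g v y c| <= L * (1 + enorm y).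

Lemma lifted_int_meas s : t <= s <= T -> mfun [set: Z] (fun z => \int[leb]_(v in `[t, s]) g v (x' v z) (u' v z)).
Proof.
move=> /andP[ts sT].
apply: (@coef_int_meas _ _ _ _ _ _ _ S C _ Z t s x' u' t0 ts sT _ _ _ _ g gc).
- by move=> z j; exact: cadl_sub (xC z j).
- by move=> v j /andP[v1 v2]; apply: xM; rewrite v1 (le_trans v2).
- exact: uMs.
- by move=> v w _; exact: uU.
Qed.

(** The lifted control agrees with the original only after [t]; passing to the half-open interval
    removes the time [t], which carries no Lebesgue mass. *)
Lemma lifted_int_diag : {ae P, forall w : Omega, forall s, t <= s <= T ->
  \int[leb]_(v in `[t, s]) g v (x v w) (u v w) = \int[leb]_(v in `[t, s]) g v (x' v (w, w)) (u' v (w, w))}.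
Proof.
apply: filterS2 xE uE => w ex eu s /andP[ts sT].
have I1 := @coef_integrable _ _ _ _ _ _ _ S C _ _ t T x u t0 tT' (lexx T) (state_cadl hx) (state_meas hx)
  (ctrl_joint t0 tT' hu) (ctrl_in hu) g gc L gb w.
have I2 := @coef_integrable _ _ _ _ _ _ _ S C _ Z t T x' u' t0 tT' (lexx T) xC (fun v i => xM i) (@uMs T)
  (fun v w _ => uU v w) g gc L gb (w, w).
have sub : `]t, s] `<=` `[t, T]. by move=> v; rewrite /= !in_itv /= => /andP[/ltW -> h]; exact: le_trans h sT.
rewrite -!Rintegral_itv_obnd_cbnd; [|exact: integrableS I2|exact: integrableS I1].
apply: eq_Rintegral => v; rewrite inE /= in_itv /= => /andP[v1 v2].
by rewrite ex ?eu ?v1 ?(ltW v1) ?(le_trans v2 sT).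
Qed.
End Coefficient.

Lemma lifted_diffusion_meas i j : mfun ((`]t, T] `*` setT) : set (R * Z))
  (fun z => diffusion C z.1 (x' z.1 z.2) (u' z.1 z.2) i j).
Proof.
have sub : (`]t, T] `*` setT : set (R * Z)) `<=` `[t, T] `*` setT.
  by move=> [s z] /= [+ _]; rewrite !in_itv /= => /andP[/ltW -> ->].
apply: (coef_meas (S := S) (C := C) (g := fun s y c => diffusion C s y c i j)).
- by apply: within_coord; have [[]] := A1.
- exact: measurableX.
- by apply: mfunTS; exact: measurable_fst.
- move=> k; apply: measurable_funS sub _; first exact: measurableX. exact: (path_joint tT' xC (fun v i => xM i) k).
- by move=> k; exact: mfunTS (uM k).
- move=> [s z] /= [+ _]; rewrite in_itv /= => /andP[s1 s2]; split; last exact: uU. by rewrite /= s2 (le_trans t0 (ltW s1)).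
Qed.

Lemma lifted_left_limit s z i : t < s <= T -> left_limit x' s z i ord0 = lim (x' v z i ord0 @[v --> s^'-]).
Proof.
move=> st; have h : x' v z @[v --> s^'-] --> (\col_i lim (x' v z i ord0 @[v --> s^'-]) : 'cV[R]_n).
  by apply: mx_lim => k; have [_] := xC z k; apply.
by rewrite /left_limit (cvg_lim _ h)// mxE.
Qed.

Lemma lifted_jump_meas i : mfun (((`]t, T] `*` setT) `*` E) : set (R * Z * mark R q))
  (fun z => jump C z.1.1 (left_limit x' z.1.1 z.1.2) (u' z.1.1 z.1.2) z.2 i ord0).
Proof.
have mE' := mE hN; have mA : measurable ((`]t, T] `*` setT) : set (R * Z)) by exact: measurableX.
have mAE : measurable (((`]t, T] `*` setT) `*` E) : set (R * Z * mark R q)) by exact: measurableX.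
have fst_ (f : R * Z -> R) : mfun (`]t, T] `*` setT) f ->
    mfun (((`]t, T] `*` setT) `*` E) : set (R * Z * mark R q)) (fun z => f z.1).
  move=> mf; apply: (measurable_comp (F := `]t, T] `*` setT) _ _ mf) => //; first by move=> _ [z [h _] <-].
  by apply: mfunTS; exact: measurable_fst.
apply: (coef_measE (S := S) (C := C) (g := fun s y c e => jump C s y c e i ord0)) => //.
- by move=> e Ee; have [[_ _ h _] _ _ _] := A1; exact: (within_coord (h e Ee)).
- move=> [[s y] c] /= [sT Uc]; apply: (measurability _ (RGenInftyO.measurableE R)) => _ [_ [b ->] <-].
  have [[_ _ _ +] _ _ _] := A1; move=> /(_ s y c _ sT Uc (coord_borel i b)); congr measurable.
- by apply: fst_; apply: mfunTS; exact: measurable_fst.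
- move=> k; apply: (fst_ (fun z => left_limit x' z.1 z.2 k ord0)).
  apply: (eq_measurable_fun (fun z : R * Z => lim (x' v z.2 k ord0 @[v --> z.1^'-]))).
    by move=> [s z] /set_mem /= [+ _]; rewrite in_itv /= => st; rewrite lifted_left_limit.
  exact: (left_joint tT' xC (fun v i => xM i) k).
- by move=> k; apply: (fst_ (fun z => u' z.1 z.2 k ord0)); exact: mfunTS (uM k).
- by apply: mfunTS; exact: measurable_snd.
- move=> [[s z] e] /= [[+ _] Ee]; rewrite in_itv /= => /andP[s1 s2]; split => //; split; last exact: uU.
  by rewrite /= s2 (le_trans t0 (ltW s1)).
Qed.

Lemma diffusion_diag : {ae P, forall w : Omega, forall s, t < s <= T ->
  diffusion C s (x s w) (u s w) = diffusion C s (x' s (w, w)) (u' s (w, w))}.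
Proof.
by apply: filterS2 xE uE => w ex eu s /andP[s1 s2]; rewrite ex ?eu ?s1 ?(ltW s1).
Qed.

Lemma jump_diag : {ae P, forall w : Omega, forall s e, t < s <= T ->
  jump C s (left_limit x s w) (u s w) e = jump C s (left_limit x' s (w, w)) (u' s (w, w)) e}.
Proof.
apply: filterS2 xE uE => w ex eu s e st; rewrite eu//; congr (jump C s _ _ e).
have [_ cx _] := hx; apply/matrixP => i j; rewrite (ord1 j) (left_limitE w i cx st) lifted_left_limit//.
apply/cvg_lim => //; have [_ /(_ s st) h] := xC (w, w) i.
case/andP: st => s1 s2; apply: cvg_trans h; apply: near_eq_cvg; near=> v.
rewrite ex//; apply/andP; split; first by near: v; exact: nbhs_left_ge.
by apply: le_trans s2; near: v; exact: nbhs_left_le.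
Unshelve. all: by end_near. Qed.

Lemma freeze_ctrl (w : Omega) : ctrlU P S C t (fun s v => u' s (w, v)).
Proof.
split => [|s v _|]; [exact: uP|exact: uU|].
have [cU _ _ _ _] := hC.
have [K hK] : exists K, forall c, ctrl_set C c -> enorm c <= K. have [M [_ hM]] := compact_bounded cU.
  exists (Num.sqrt (\sum_(i < m) \sum_(j < 1) (M + 1) ^+ 2)) => c Uc; apply: enorm_bounded => i j.
  have := hM (M + 1) _ c Uc; rewrite ltrDl => /(_ ltr01) /=; apply: le_trans.
  by rewrite [leRHS]/Num.norm /= mx_normrE; apply: (le_bigmax _ (fun ij => `|c ij.1 ij.2|) (i, j)).
have levT : (leb `[t, T] < +oo)%E by exact: leb_itv_fin (@subset_refl _ _).
have PT : (P setT < +oo)%E by rewrite probability_setT ltry.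
apply: le_lt_trans (ltry (K ^+ 2 * fine (leb `[t, T]) * fine (P setT))).
apply: int_bound => //; first by rewrite mulr_ge0 ?sqr_ge0 ?fine_ge0.
move=> v _; rewrite integral_ge0/=; last by move=> s _; rewrite lee_fin sqr_ge0.
apply: int_bound => // [|s _]; first exact: sqr_ge0.
rewrite !lee_fin sqr_ge0 /= ler_sqr ?nnegrE ?enorm_ge0//; first exact/hK/uU.
exact: le_trans (enorm_ge0 _) (hK _ (uU s (w, v))).
Qed.

Let drift' i s (z : Z) := \int[leb]_(v in `[t, s]) drift C v (x' v z) (u' v z) i ord0.

(** For almost every past the equation is first obtained at the countably many grid points, by
    comparing two limits of the same lifted simple integrals; [sde_lim] along grid points from the
    right extends it to all times. Adaptedness comes last, out of the equation. *)
Lemma freeze_state : {ae P, forall w : Omega, is_state P S C t a (fun s v => u' s (w, v)) (fun s v => x' s (w, v))}.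
Proof.
have [_ _ [I [J [hI hJ sde]]]] := hx.
have mI i := bint_mart hN i t0 tT' hI; have mJ i := pint_mart hN i t0 tT' hJ.
have [BI [BIm BId BIf]] := freeze_bint hN t0 tT (Phi' := fun s z => diffusion C s (x' s z) (u' s z)) hI
  lifted_diffusion_meas diffusion_diag.
have [BJ [BJm BJd BJf]] := freeze_pint hN t0 tT (Phi' := fun s e z => jump C s (left_limit x' s z) (u' s z) e) hJ
  lifted_jump_meas jump_diag.
have mD i s : t <= s <= T -> mfunT (drift' i s).
  move=> st; rewrite /drift'; exact: (@lifted_int_meas (fun s y c => drift C s y c i ord0) (@drift_within i) s st).
(* The defect of the equation when its integrals are replaced by the approximating ones. On the
   diagonal it is the sum of the two approximation errors, whence [4 / 16 ^+ j]; its smallness then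
   passes to almost every past. *)
pose N i s j (z : Z) : R := (BI j s z i ord0 + BJ j s z i ord0) - (x' s z i ord0 - (a i ord0 + drift' i s z)).
have mN i s j : t <= s <= T -> mfunT (N i s j). move=> st; apply: mfunB.
    by apply: mfunD; [exact: BIm|exact: BJm]. apply: mfunB; first exact: xM. by apply: mfunD => //; exact: mD.
have dN i s j : t <= s <= T -> L2 P (fun w => N i s j (w, w)) /\ nrm P (fun w => N i s j (w, w)) <= 4 / 16 ^+ j.
  move=> st; have [L1 n1] := BId s i j st; have [L2' n2] := BJd s i j st.
  have ed := @lifted_int_diag (fun s y c => drift C s y c i ord0) _ (@drift_within i) (@drift_bound i).
  have e : {ae P, forall w : Omega, N i s j (w, w) = (BI j s (w, w) i ord0 - I s w i ord0) + (BJ j s (w, w) i ord0 - J s w i ord0)}.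
    apply: filterS3 xE ed (sde s st) => w e1 e2 e3. by rewrite /N -e1// e3 !mxE /drift' -e2//; ring.
  have mNd : mfun [set: Omega] (fun w : Omega => N i s j (w, w)). exact: (mfun_comp (mN i s j st) (diag_meas hN t0 tT)).
  have LD := L2D L1 L2'; split; first exact: L2_ae mNd LD e.
  rewrite (nrm_ae mNd (L2_meas LD) e); apply: le_trans (nrmD_le L1 L2') _.
  have -> : 4 / 16 ^+ j = 2 * (1 / 16 ^+ j) + 2 * (1 / 16 ^+ j) :> R by ring. by apply: lerD; rewrite ler_pM2l.
have pP k : t <= pnt k <= T := pntP tT k.
have hNf : {ae P, forall w : Omega, forall k1 k2 i, exists c : R, forall j,
    (\int[P]_v (N i (pnt (k1, k2)) j (w, v) ^+ 2)%:E <= (c / 8 ^+ j)%:E)%E}.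
  apply/ae_foralln => k1; apply/ae_foralln => k2; apply: filter_forall => i.
  apply: (freeze_fast hN t0 tT (c := 4) (G := fun j z => (N i (pnt (k1, k2)) j z ^+ 2)%:E)) => //.
  - by move=> j; apply/measurable_EFinP; apply: mfunX; exact: mN.
  - by move=> j z; rewrite lee_fin sqr_ge0.
  - by move=> j; have [L n1] := dN i (pnt (k1, k2)) j (pP _); rewrite -nrmE.
apply: filterS3 (filterI BIf BJf) hNf xF => w [[YI [cI [isI hYI]]] [YJ [cJ [isJ hYJ]]]] hw fw.
pose D i s (v : Omega) := a i ord0 + drift' i s (w, v); pose M i s v := YI s v i ord0 + YJ s v i ord0.
have mM i : mart P S t (M i). by apply: martD; [exact: (bint_mart hN i t0 tT' isI)|exact: (pint_mart hN i t0 tT' isJ)].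
have sm := sec_meas hN t0 tT w.
have mx s i : t <= s <= T -> mfun [set: Omega] (fun v => x' s (w, v) i ord0). by move=> st; exact: (mfun_comp (xM i st) sm).
have mDw s i : t <= s <= T -> mfun [set: Omega] (D i s). by move=> st; apply: mfunD => //; exact: (mfun_comp (mD i s st) sm).
have LM s i : t <= s <= T -> L2 P (M i s) by move=> st; have [/(_ s st)[]] := mM i.
have cx v i : cadl t T (fun s => x' s (w, v) i ord0) by exact: xC.
have sde_pnt k i : {ae P, forall v : Omega, x' (pnt k) (w, v) i ord0 = D i (pnt k) v + M i (pnt k) v}.
  have [c hc] := hw k.1 k.2 i; rewrite -surjective_pairing in hc. have st := pP k; set s := pnt k in hc st *.
  have e : {ae P, forall v : Omega, x' s (w, v) i ord0 - D i s v = M i s v}.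
    apply: (@nrm_lim_unique _ _ _ P (fun j v => BI j s (w, v) i ord0 + BJ j s (w, v) i ord0) _ _ c (2 * cI + 2 * cJ)) => j.
      have L : L2 P (fun v => N i s j (w, v)). split; first exact: (mfun_comp (mN i s j st) sm).
        by apply: le_lt_trans (hc j) (ltry _). by split; [exact: L|rewrite -lee_fin nrmE; [exact: hc|exact: L]].
    have [L1 n1] := hYI s i j st; have [L2' n2] := hYJ s i j st.
    have -> : (fun v => BI j s (w, v) i ord0 + BJ j s (w, v) i ord0 - M i s v) =
      (fun v => (BI j s (w, v) i ord0 - YI s v i ord0) + (BJ j s (w, v) i ord0 - YJ s v i ord0)).
      by apply/funext => v; rewrite /M; ring. split; first exact: L2D. apply: le_trans (nrmD_le L1 L2') _.
    have -> : (2 * cI + 2 * cJ) / 8 ^+ j = 2 * (cI / 8 ^+ j) + 2 * (cJ / 8 ^+ j) by ring.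
    by apply: lerD; rewrite ler_pM2l. by apply: filterS e => v <-; ring.
have lipD i v : exists K, forall c b, t <= c -> c <= b -> b <= T -> `|D i b v - D i c v| <= K * (b - c).
  have [K hK] := @coef_int_lip _ _ _ _ _ _ _ S C _ Z t T x' u' t0 tT' (lexx T) xC (fun v i => @xM v i) (@uMs T)
    (fun v w _ => uU v w) (fun s y c => drift C s y c i ord0) (@drift_within i) _ (@drift_bound i) (w, v).
  by exists K => c b h1 h2 h3; rewrite /D opprD addrACA subrr add0r; exact: hK.
have lim_sde i s v_ Y : t <= s <= T -> (forall j, t <= v_ j <= T) -> v_ @ \oo --> s ->
    (forall v, x' (v_ j) (w, v) i ord0 @[j --> \oo] --> Y v) ->
    (forall j, {ae P, forall v : Omega, x' (v_ j) (w, v) i ord0 = D i (v_ j) v + M i (v_ j) v}) ->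
    {ae P, forall v : Omega, Y v = D i s v + M i s v}.
  move=> st vT vs; apply: (@sde_lim _ _ _ P t T (fun s v => x' s (w, v) i ord0) (D i) (M i) v_ s) => //.
  - by move=> v; exact: mx.
  - by move=> v; exact: mDw.
  - by move=> v; exact: LM.
  - by move=> e e0; have [_ _ /(_ s e st e0)[dl dl0 hdl] _] := mM i; exists dl.
have sde_all s i : t <= s <= T -> {ae P, forall v : Omega, x' s (w, v) i ord0 = D i s v + M i s v}.
  case/andP => ts; rewrite le_eqVlt => /predU1P[->|sT]; first by rewrite -(pnt_kT t T); exact: sde_pnt.
  have st : t <= s < T by rewrite ts sT. have st' : t <= s <= T by rewrite ts ltW.
  apply: (lim_sde i s (fun j => pnt (near_idx t s j))) => //.
  - exact: upg_cvg.
  - move=> v; apply: (cvg_at_right_seq (s := s) (f := fun s => x' s (w, v) i ord0)).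
    + by have [rc _] := cx v i; exact: rc.
    + by move=> j; have /andP[] := near_idxP j st.
    + exact: upg_cvg.
have fm_lt s s' i : t <= s -> s < s' -> s' <= T -> fm s' (fun v => x' s (w, v) i ord0).
  move=> h1 h2 h3; apply: (@fm_right _ _ _ P _ _ S t (fun s (v : Omega) => x' s (w, v) i ord0) s s' h1 h2 h3) => //.
(* Right limits only give measurability at later times. Approaching [s] from the left makes the left
   limit measurable at [s], and by the equation it almost surely equals the value. At [s = t] the
   equation says that the state is almost surely [a]. *)
have ax : adapted P S t (fun s v => x' s (w, v)).
  apply/mx_adaptedP => s i j0 /andP[ts sT]; rewrite (ord1 j0); have st : t <= s <= T by rewrite ts sT.
  move: ts; rewrite le_eqVlt => /predU1P[ts|ts]. have [_ _ _ M0] := mM i; subst s.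
    apply: (@fm_ae _ _ _ P _ _ S t (fun=> a i ord0)); first exact: fm_cst.
    apply: filterS2 M0 (sde_all t i st) => v h ->; rewrite h addr0 /D /drift' set_itv1 Rintegral_set1 addr0//.
  have st2 : t < s <= T by rewrite ts sT. pose v_ j := downg t T j (Num.truncn ((T - s) * j.+1%:R)).
  have vs j : v_ j < s by have /andP[] := downg_lt j st2. have vT j : t <= v_ j <= T by exact: downgP.
  have lc v : x' (v_ j) (w, v) i ord0 @[j --> \oo] --> lim (x' z (w, v) i ord0 @[z --> s^'-]).
    apply: (@cvg_at_left_seq _ (fun z => x' z (w, v) i ord0) s) => //; last exact: downg_cvg.
    by have [_] := cx v i; apply. have f1 : fm s (fun v => lim (x' z (w, v) i ord0 @[z --> s^'-])).
    apply: (@measurable_fun_cvg _ (Fil s) R setT (fun j v => x' (v_ j) (w, v) i ord0)) => [j|v _]; last exact: lc.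
    by apply: fm_lt => //; have /andP[] := vT j. apply: (fm_ae f1).
  have e1 := lim_sde i s v_ _ st vT (downg_cvg st2) lc (fun j => sde_all (v_ j) i (vT j)).
  by apply: filterS2 e1 (sde_all s i st) => v -> ->.
split => //; first by apply/cadlag_mxP => v i; exact: cx.
exists YI, YJ; split => // s st.
have : {ae P, forall v : Omega, forall i, x' s (w, v) i ord0 = D i s v + M i s v} by apply: filter_forall => i; exact: sde_all.
apply: filterS => v h; apply/matrixP => i j; rewrite (ord1 j) h !mxE /D /M /drift'; ring.
Qed.
End FreezeState.

(** * From a control of cost below [b] to reachability *)

Section Attain.
Variable t : R.
Hypotheses (t0 : 0 <= t) (tT : t < T).
Local Notation Fut s := (sigT_of (futureG P S t s)).
Local Notation Z := (Fil t * Fut T)%type.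
Let tT' : t <= T := ltW tT.

Lemma apprZ (c : R) X : appr P S t T X -> appr P S t T (fun w => c * X w).
Proof.
move=> [LX h]; split; first exact: L2Z.
move=> e e0; have c0 : 0 < c ^+ 2 + 1 :> R by rewrite ltr_pwDr// sqr_ge0.
have [M [sM nM]] := h _ (divr_gt0 e0 c0).
exists (fun w => c * M w); split. by apply: (simpI_scale (Y := cst c) (k := `|c|)) => //; exact: fm_cst.
have LM : L2 P M by have [] := simpI_mart hN t0 tT' (lexx T) sM.
have -> : (fun w => c * X w - Ex P (fun w => c * X w) - c * M w) = (fun w => c * (X w - Ex P X - M w)).
  by apply/funext => w; rewrite ExZ; [ring|exact: L2_L1].
rewrite (nrmZ c (L2B (L2B LX (L2_cst P _)) LM)).
apply: le_trans (ler_wpM2l (sqr_ge0 c) nM) _.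
by rewrite mulrA ler_pdivrMr// mulrC ler_wpM2l ?(ltW e0)// lerDl.
Qed.

(** Staircase functions, finite sums of indicators of upper level sets, lie within [1 / k.+1] of
    [X]; these level sets are events of the future, hence approximable. *)
Lemma appr_future (X : Omega -> R) (K : R) : mfun [set: Fut T] (X : Fut T -> R) ->
  (forall w, 0 <= X w <= K) -> appr P S t T X.
Proof.
move=> mX XK.
have mXO : mfun [set: Omega] X by exact: (mfun_comp mX (future_id_meas hN t0 tT')).
pose M k := (Num.truncn (K * k.+1%:R)).
pose Y k w : R := k.+1%:R^-1 * \sum_(j < M k) (j.+1%:R <= X w * k.+1%:R)%R%:R.
have k0 k : 0 < k.+1%:R :> R by [].
have bnd k w : Y k w <= X w <= Y k w + k.+1%:R^-1. have /andP[X0 XK'] := XK w.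
  have y0 : 0 <= X w * k.+1%:R by rewrite mulr_ge0.
  have [h1 h2 _] := count_below (M k) y0; rewrite /Y; apply/andP; split. by rewrite mulrC ler_pdivrMr.
  move: (k0 k) h2; set N : R := k.+1%:R; set Sm := \sum_(j < _) _ => N0 h2.
  rewrite -(ler_pM2r N0); have -> : (N^-1 * Sm + N^-1) * N = Sm + 1 by field; rewrite gt_eqF. apply: h2; rewrite /N.
  by apply: (@le_lt_trans _ _ (K * k.+1%:R)); [rewrite ler_pM2r|rewrite natr1; exact: truncnS_gt].
have Y0 k w : 0 <= Y k w by rewrite mulr_ge0 ?invr_ge0// sumr_ge0.
apply: (appr_bounded_cvg hN t0 tT' (lexx T) (X := Y) (k := K)) => //.
- move=> k; apply: apprZ. elim: (M k) => [|j IH].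
    rewrite (_ : (fun w => _) = cst 0); last by apply/funext => w; rewrite big_ord0. exact: appr_cst.
  have mG : <<s futureG P S t T >> [set w | j.+1%:R <= X w * (k.+1)%:R].
    apply: (meas_le (T := Fut T)) => //; by apply: mfunM. have [_ aG] := future_appr hN t0 tT' mG.
  have := apprB hN t0 tT' (lexx T) IH (apprZ (-1) aG).
  rewrite (_ : (fun w => _ - _) = (fun w => \sum_(i < j.+1) (i.+1%:R <= X w * k.+1%:R)%R%:R))//.
  apply/funext => w; rewrite big_ord_recr /= mulN1r opprK indicE; congr (_ + _).
  by case: lerP => h; [rewrite mem_set|rewrite memNset//= => h'; move: h; rewrite ltNge h'].
- move=> k w; rewrite ger0_norm//; have /andP[h _] := bnd k w; apply: le_trans h _. by have /andP[] := XK w.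
- by move=> w; have /andP[h1 h2] := XK w; rewrite ger0_norm.
- move=> w; apply/cvgrPdist_le => e e0. have := near_infty_natSinv_lt (PosNum e0); apply: filterS => k /= hk.
  have /andP[h1 h2] := bnd k w; rewrite ger0_norm ?subr_ge0//. by rewrite lerBlDl; apply: le_trans h2 _; rewrite lerD2l ltW.
Qed.

(** The total cost [xi] comes only with a finite mean, while representation is available for bounded
    functionals; it is truncated at [k] first. No optimal target is constructed: targets of
    arbitrarily small auxiliary cost suffice. *)
Lemma future_aux0 (a : 'cV[R]_n) (b : R) u x (xi : Omega -> R) : ctrlU P S C t u -> is_state P S C t a u x ->
  mfun [set: Fut T] (xi : Fut T -> R) -> (forall w, xi w = runint t u x T w + terminal C (x T w)) ->
  (forall w, 0 <= xi w) -> (\int[P]_w (xi w)%:E <= b%:E)%E ->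
  {ae P, forall w, (\int[leb]_(s in `[t, T]) (dist C (x s w))%:E = 0)%E} -> aux_value P S C t a b = 0%E.
Proof.
move=> hu hx mxi xiE xi0 xib hd.
have mxiO : mfun [set: Omega] xi by exact: (mfun_comp mxi (future_id_meas hN t0 tT')).
have Lxi : L1 P xi by apply: ge0_L1P => //; exact: le_lt_trans xib (ltry _).
have Exb : Ex P xi <= b by rewrite -lee_fin ge0_ExE.
pose tr (k : nat) w := Num.min (xi w) k%:R.
have tr0 k w : 0 <= tr k w by rewrite le_min xi0 ler0n.
have trx k w : tr k w <= xi w by rewrite ge_min lexx.
have mtr k : mfun [set: Omega] (tr k) by exact: measurable_minr.
have Ltr k : L1 P (tr k) by apply: (L1_le (mtr k) Lxi) => w; rewrite ger0_norm.
have [_ trcv _] : [/\ P.-integrable setT (EFin \o xi),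
     (\int[P]_w `|(EFin \o tr k) w - (EFin \o xi) w|)%E @[k --> \oo] --> 0%E &
     (\int[P]_w (EFin \o tr k) w)%E @[k --> \oo] --> (\int[P]_w (EFin \o xi) w)%E].
  apply: (@dominated_convergence _ _ _ P setT measurableT (fun k => EFin \o tr k) (EFin \o xi) (EFin \o xi)) => //.
  - by move=> k; exact/measurable_EFinP.
  - exact/measurable_EFinP.
  - apply: aeW => w _; apply: cvg_EFin; first exact: nearW. apply: cvg_near_cst; exists (Num.truncn (xi w)).+1 => // k /= hk.
    rewrite /tr min_l//; apply: le_trans (ltW (truncnS_gt _)) _; by rewrite ler_nat.
  - by apply: aeW => w k _; rewrite /= lee_fin ger0_norm.
apply/eqP; rewrite eq_le aux_value_ge0// andbT; apply/lee_addgt0Pr => e e0; rewrite add0e.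
have e2 : 0 < e / 2 by rewrite divr_gt0.
have e4 : 0 < e / 4 by rewrite divr_gt0.
have /ereal_cvg0P : (\int[P]_w `|(EFin \o tr k) w - (EFin \o xi) w|)%E @[k --> \oo] --> 0%E := trcv.
move=> /(_ (fun k => integral_ge0 _ (fun w _ => abse_ge0 _)) _ e2)[k /(_ k (leqnn k)) hk].
have mtrF : mfun [set: Fut T] (tr k : Fut T -> R) by exact: measurable_minr.
have aK : appr P S t T (tr k). by apply: (appr_future (K := k%:R) mtrF) => w; rewrite tr0 ge_min lexx orbT.
(* The shortfall of the target is [(xi - tr k) + (tr k - Ex (tr k) - M) + (Ex (tr k) - b)]. The last
   term is nonpositive and the first has mean at most [e / 2]; the squared norm [(e / 4) ^+ 2] for
   the middle one gives [e / 2] through [Ex_abs_le]. *)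
have [LK /(_ _ (exprn_gt0 2 e4))[M [sM nM]]] := aK.
have LM : L2 P M by have [] := simpI_mart hN t0 tT' (lexx T) sM.
have [al [be [y [hA hB hy yT]]]] := simpI_target t0 tT' hu hx b sM.
have LG : L2 P (fun w => tr k w - Ex P (tr k) - M w) by apply: L2B => //; apply: L2B => //; exact: L2_cst.
have ExK : Ex P (tr k) <= b by apply: le_trans Exb; exact: Ex_le.
apply: le_trans (_ : _ <= aux_cost P S C t x y)%E _. by apply: ereal_inf_lbound; exists x, y; split => //; exists u, al, be.
have m1 : mfun [set: Omega] (fun w => `|(EFin \o tr k) w - (EFin \o xi) w|)%E.
  by apply: mfun_comp => //; apply: emeasurable_funB; apply/measurable_EFinP.
have m2 : mfun [set: Omega] (fun w => (`|tr k w - Ex P (tr k) - M w|)%:E).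
  by apply/measurable_EFinP; apply: mfun_comp => //; exact: L2_meas LG.
apply: (@le_trans _ _ (\int[P]_w (`|(EFin \o tr k) w - (EFin \o xi) w| + (`|tr k w - Ex P (tr k) - M w|)%:E))%E).
  apply: le_ge0_integral_ae.
  - exact: (aux_meas t0 tT' hu hx hy).
  - move=> w; apply: adde_ge0; first by rewrite lee_fin le_max lexx orbT.
    by apply: integral_ge0 => s _; rewrite lee_fin dist_ge0.
  - by move=> w; apply: adde_ge0 => //; rewrite lee_fin.
  - apply: filterS2 hd yT => w -> hyT; rewrite adde0.
    have -> : `|(EFin \o tr k) w - (EFin \o xi) w|%E = (`|tr k w - xi w|)%:E by []. rewrite -EFinD lee_fin ge_max.
    rewrite addr_ge0// andbT hyT. have h1 := xiE w; have h2 := ler_norm (tr k w - Ex P (tr k) - M w).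
    have h3 : xi w - tr k w <= `|tr k w - xi w| by rewrite distrC ler_norm.
    move: h1 h2 h3 ExK; set A := `|_|; set B := `|_|; set X := runint _ _ _ _ _; set Y := terminal _ _.
    by set Ek := Ex P _; clear; lra.
rewrite ge0_integralD//.
have h2 : (\int[P]_w (`|tr k w - Ex P (tr k) - M w|)%:E <= (e / 2)%:E)%E.
  have LA : L1 P (fun w => `|tr k w - Ex P (tr k) - M w|). by have := integrable_abse (L2_L1 LG).
  rewrite -ge0_ExE// lee_fin; apply: le_trans (Ex_abs_le e4 LG) _.
  have : (e / 4)^-1 * nrm P (fun w => tr k w - Ex P (tr k) - M w) <= e / 4. by rewrite ler_pdivrMl// -expr2.
  have ee : e / 2 = e / 4 + e / 4 by field. by move=> h2; rewrite ee lerD2l.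
by apply: le_trans (leeD (ltW hk) h2) _; rewrite -EFinD lee_fin -splitr.
Qed.

Lemma reach_of_cost (a : 'cV[R]_n) (b : R) u x : aux_attained P S C t a b -> ctrlU P S C t u ->
  is_state P S C t a u x -> in_constraint P S C t x -> (cost P S C t u x < b%:E)%E -> reachable P S C t (a, b).
Proof.
move=> att hu hx ct cb; apply: (aux_reach) => //; first by rewrite t0.
have [pu Uu _] := hu; have [cU _ _ _ _] := hC; have [ax cx _] := hx.
have [u' [uU uM uP uE]] := lift_control hN t0 tT' cU pu Uu.
have [x' [xC xM xE xF]] := lift_path hN t0 tT ax cx.
have TT : t <= T <= T by rewrite tT' lexx.
pose xi (z : Z) : R := \int[leb]_(v in `[t, T]) running C v (x' v z) (u' v z) + terminal C (x' T z).
pose dl (z : Z) : \bar R := (\int[leb]_(s in `[t, T]) (dist C (x' s z))%:E)%E.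
have m0 v : 0 <= terminal C v by have [_ _ _ _] := A2; exact.
have l0 v y c : 0 <= v <= T -> ctrl_set C c -> 0 <= running C v y c by have [_ _ _ + _] := A2; exact.
have xi0 z : 0 <= xi z.
  rewrite addr_ge0// Rintegral_ge0// => v /=; rewrite in_itv /= => /andP[v1 v2]; apply: l0; last exact: uU.
  by rewrite (le_trans t0 v1).
have mxi : mfun [set: Z] xi. apply: mfunD.
    exact: (@lifted_int_meas t t0 u' x' uU uM xC xM (fun v y c => running C v y c) (@run_within) T TT).
  apply: meas_cont_mx; first by have [[]] := A2. by move=> i j; rewrite (ord1 j); exact: xM.
have mdl : mfun [set: Z] dl. have uMs i : mfun ((`[t, T] `*` setT) : set (R * Z)) (fun z => u' z.1 z.2 i ord0).
    exact: mfunTS (uM i). have h := @coef_joint _ _ _ _ _ _ _ S C _ Z t T x' u' t0 tT' (lexx T) xC (fun v i => @xM v i)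
      uMs (fun v w _ => uU v w) (fun v y c => dist C y) (dist_within).
  apply: (@meas_int_fst _ _ _ _ _ leb _ _ (fun z => (dist C (x' z.1 z.2))%:E)) => //.
    by apply/measurable_EFinP; exact: h. by move=> z _; rewrite lee_fin dist_ge0.
have dg := diag_meas hN t0 tT.
have ed := @lifted_int_diag t a u x t0 tT hu hx u' x' uU uM uE xC xM xE
  (fun v y c => running C v y c) _ (@run_within) (@run_bound).
have iD : (\int[P]_w (xi (w, w))%:E <= cost P S C t u x)%E. apply: le_ge0_integral_ae.
  - by apply/measurable_EFinP; exact: (mfun_comp mxi dg).
  - by move=> w; rewrite lee_fin.
  - move=> w; rewrite adde_ge0 ?lee_fin//; apply: integral_ge0 => v /=; rewrite in_itv /= => vt.
    by rewrite lee_fin; apply: l0; [case/andP: vt => v1 ->; rewrite (le_trans t0 v1)|exact: Uu].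
  - apply: filterS2 ed xE => w e1 e2; rewrite (runintE t0 tT' hu hx) -EFinD lee_fin /xi. by rewrite /runint e1// -e2.
have dD : {ae P, forall w : Omega, dl (w, w) = 0%E}.
  apply: filterS2 ct xE => w h1 h2; apply: integral0_eq => s /=; rewrite in_itv /= => st.
  by have [_ _ _ _ [_ dG]] := hC; rewrite -h2//; congr EFin; apply/dG/h1.
have mQ : measurable [set z : Z | dl z = 0%E]. by have := mdl measurableT _ (emeasurable_set1 0%E); rewrite setTI.
have dl2 := indep_ae (past_id_meas hN tT') (future_id_meas hN t0 tT') (past_future_indep hN t0 tT') mQ dD.
have fz := @freeze_state t a u x t0 tT hu hx u' x' uU uM uE xC xM xE xF.
have [w [hs [hd hb]]] : exists w : Omega, is_state P S C t a (fun s v => u' s (w, v)) (fun s v => x' s (w, v)) /\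
    {ae P, forall v : Omega, dl (w, v) = 0%E} /\ (\int[P]_v (xi (w, v))%:E <= b%:E)%E. apply: contrapT => hno.
  have mE2 : mfun [set: Z] (fun z => (xi z)%:E) by exact/measurable_EFinP. have b0 : (0 <= b%:E)%E.
    apply: le_trans (ltW cb); apply: le_trans iD; by apply: integral_ge0 => w _; rewrite lee_fin.
  have : (b%:E <= \int[P]_w (xi (w, w))%:E)%E. rewrite (diag_int hN t0 tT mE2); last by move=> z; rewrite lee_fin.
    have bE : (\int[P]_w b%:E = b%:E)%E. by rewrite -[RHS]mule1 -(probability_setT P) -(integral_cst P measurableT).
    rewrite -[leLHS]bE. apply: le_ge0_integral_ae => //. by move=> w; apply: integral_ge0 => v _; rewrite lee_fin.
    apply: filterS2 fz dl2 => w h1 h2; rewrite leNgt; apply/negP => h3; apply: hno; exists w; split => //.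
    by split => //; exact: ltW. by move=> h; move: (le_lt_trans (le_trans h iD) cb); rewrite ltxx.
have mp : mfun [set: Fut T] (fun v : Fut T => ((w : Fil t), v)). by apply: measurable_fun_pair => //; exact: measurable_cst.
have hm : mfun [set: Fut T] ((fun v => xi (w, v)) : Fut T -> R) := mfun_comp mxi mp.
have hc := freeze_ctrl uU uP w.
exact: (future_aux0 hc hs hm (fun v => erefl) (fun v => xi0 (w, v)) hb hd).
Qed.
End Attain.
End Control.

Theorem theorem3p2 (R : realType) (dO : measure_display)
    (Omega : measurableType dO) (P : probability Omega R)
    (r q n m : nat) (S : noise (R := R) (Omega := Omega) r q)
    (C : problem (R := R) r q n m) :
  noise_axioms P S -> problem_axioms C ->
  assumption1 S C -> assumption2 S C -> assumption3 C ->
  (forall (t : R) (a : 'cV[R]_n) (b : R), 0 <= t <= horizon S -> aux_attained P S C t a b) ->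
  [/\ (forall t : R, 0 <= t < horizon S ->
         reachable P S C t = [set ab | aux_value P S C t ab.1 ab.2 = 0%E]),
      reachable P S C (horizon S) =
        [set ab | Gam C ab.1 /\
                  aux_value P S C (horizon S) ab.1 ab.2 = 0%E]
    & forall (t : R) (a : 'cV[R]_n), 0 <= t <= horizon S ->
        value P S C t a =
          ereal_inf [set b%:E | b in [set b : R |
                       0 <= b /\ reachable P S C t (a, b)]] /\
        (t < horizon S \/ Gam C a ->
         ereal_inf [set b%:E | b in [set b : R |
                      0 <= b /\ reachable P S C t (a, b)]] =
         ereal_inf [set b%:E | b in [set b : R |
                      0 <= b /\ aux_value P S C t a b = 0%E]])].
Proof.
move=> hN hC A1 A2 A3 att.
have T0 := ltW (T_gt0 hN); have TT : 0 <= horizon S <= horizon S by rewrite T0 lexx.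
have R1 t a b : 0 <= t < horizon S -> reachable P S C t (a, b) <-> aux_value P S C t a b = 0%E.
  move=> tT; have tT' : 0 <= t <= horizon S by case/andP: tT => -> /ltW.
  by split; [exact: reach_aux|apply: aux_reach => //; exact: att].
have R2 a b := reach_horizon hN hC A2 A3 (att _ a b TT).
split.
- by move=> t tT; apply/seteqP; split => -[a b] /=; [move/R1; apply|move=> h; apply/R1].
- by apply/seteqP; split => -[a b] /=; [move/R2|move=> h; apply/R2].
move=> t a tT; split; last first.
  move=> h; congr ereal_inf; apply/seteqP; split => _ [b /= [b0 hb] <-]; exists b => //=; split => //.
    exact: (reach_aux hN hC A2 A3 tT hb).
  move: h => [h|Ga]; first by apply/R1 => //; case/andP: tT => ->.
  case/andP: (tT) => t0; rewrite le_eqVlt => /predU1P[e|h]; last by apply/R1 => //; rewrite t0.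
  by move: hb; rewrite e => hb; apply/R2.
apply/eqP; rewrite eq_le; apply/andP; split.
  by apply: le_ereal_inf_tmp => _ [b /= [b0 hb] <-]; exact: (value_le hN A2 tT hb).
apply: le_ereal_inf_tmp => _ [u [x [hu hx ct ->]]]; case/andP: (tT) => t0; rewrite [t <= _]le_eqVlt => /predU1P[e|h].
  (* At the horizon the terminal cost of [a] is itself a reachable level. *)
  subst t; have [-> rc] := cost_horizon hN A2 hu hx ct.
  by apply: ereal_inf_lbound; exists (terminal C a) => //; split => //; have [_ _ _ _] := A2; exact.
have c0 : (0 <= cost P S C t u x)%E.
  have [_ _ _ l0 m0] := A2; have [_ Uu _] := hu.
  apply: integral_ge0 => w _; rewrite adde_ge0 ?lee_fin//; apply: integral_ge0 => v /=; rewrite in_itv /= => vt.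
  by rewrite lee_fin; apply: l0; [case/andP: vt => v1 ->; rewrite (le_trans t0 v1)|exact: Uu].
move: c0; case: (ltP (cost P S C t u x) +oo%E) => [cf c0|]; last by move=> h' _; apply: le_trans h'; rewrite leey.
have cE : cost P S C t u x \is a fin_num by rewrite ge0_fin_numE.
(* The slack [e] provides the strict inequality between cost and level that choosing a past
   requires. *)
apply/lee_addgt0Pr => e e0; rewrite -(fineK cE) -EFinD.
apply: ereal_inf_lbound; exists (fine (cost P S C t u x) + e) => //; split.
  by apply: addr_ge0; [exact: fine_ge0|exact: ltW].
apply: (reach_of_cost hN hC A1 A2 A3 t0 h _ hu hx ct); first exact: att.
by rewrite -[ltLHS](fineK cE) lte_fin ltrDl.
Qed.
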